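(* Let $C$ be a separable residually finite dimensional $C^*$-algebra and let $A_z^C=\lim_{m\to\infty}(A_m,\varphi_m)$ be the $C^*$-algebra constructed from $C$ as described in the context. If $C$ is exact but not nuclear, then $A_z^C$ is exact and not nuclear.
   Context: **Construction of $A_z^C$.** $C$ is a separable residually finite dimensional $C^*$-algebra. Let $B=\mathbb C1_B+C_0((0,1],C)$ be the (adjoined-unit) unitization of $C_0((0,1],C)$. For $t\in[0,1]$ let $\theta_t:B\to B$, $\theta_t(\lambda+h)(x)=\lambda+h((1-t)x)$; so $\theta_0=\mathrm{id}$ and $\theta_1(B)=\mathbb C1_B$. Homomorphisms of $B$ are extended entrywise to matrix algebras under the same name, and $M_L$ is viewed as $M_L(\mathbb C1_B)\subset M_L(B)$ (''scalar'' matrices). For integers $p,q\ge1$ let $$E_{p,q}=\{f\in C([0,1],M_{pq}(B)): f(0)\in M_p(B)\otimes1_q,\ f(1)\in1_p\otimes M_q\},$$ where $M_p(B)\otimes 1_q,\,1_p\otimes M_q\subset M_p(B)\otimes M_q=M_{pq}(B)$. Put $A_m=E_{p_m,q_m}$ with $(p_1,q_1)=(3,5)$. Given $A_m$ (with $p_m,q_m$ relatively prime, $5\nmid p_m$, $3\nmid q_m$) and a finite set $\mathcal F_m\subset A_m\setminus\{0\}$, choose: $d_m$ a power of $3$ with $d_m>3^m$; a unital representation $\gamma_m:B\to M_{d_m-1}$ such that for each $f\in\mathcal F_m$ there is $t\in[0,1]$ with $\|\gamma_m(f(t))\|>(1-\frac1{2m})\|f\|$; distinct primes $k_0>15q_m$,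 $k_1>15k_0d_mp_m$. Put $p_{m+1}=k_0d_mp_m$, $q_{m+1}=5k_1q_m$, $k=k_0k_1$, and let $0<r_0<q_{m+1}$, $0<r_1<p_{m+1}$ be the residues of $k$ modulo $q_{m+1}$ and $p_{m+1}$ (then $r_0+r_1<k$). For $t\in[0,3/4]$ let $\xi_i(t)=2t/3$ if $1\le i\le r_0$, $\xi_i(t)=1/2$ if $r_0<i\le k-r_1$, $\xi_i(t)=1/2+2t/3$ if $k-r_1<i\le k$; for $t\in(3/4,1]$ let $\xi_i(t)=\xi_i(3/4)$. For $f\in A_m$ define $\theta^{(i)}(f)(t)=f(\xi_i(t))$, except that for $i\le k-r_1$ and $t\in(3/4,1]$, $\theta^{(i)}(f)(t)=\theta_{4(t-3/4)}(f(\xi_i(t)))$. Put $$\tilde\psi_{m,i}(f)(t)=\begin{pmatrix}\theta^{(i)}(f)(t)&0\\0&\gamma_m(f(\xi_i(t)))\end{pmatrix}\otimes1_5,$$ $$\varphi_m(f)(t)=v(t)^*\,\mathrm{diag}\big(\tilde\psi_{m,1}(f)(t),\dots,\tilde\psi_{m,k}(f)(t)\big)\,v(t),$$ where $M_{5d_mp_mq_m}(B)$ is identified with $M_{d_mp_m}(B)\otimes M_{5q_m}$ so that $f\mapsto\mathrm{diag}(f,\gamma_m(f))\otimes1_5$ is $\delta_m\otimes s$ with $\delta_m(a)=\mathrm{diag}(a,\gamma_m(a))$ on $M_{p_m}(B)$ and $s(c)=c\otimes1_5$ on $M_{q_m}$, and $v$ is a unitary in $C([0,1],M_{p_{m+1}q_{m+1}})$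 (scalar matrices) such that: for all $g\in E_{d_mp_m,5q_m}$, $v(0)^*\mathrm{diag}(g(\xi_1(0)),\dots,g(\xi_k(0)))v(0)\in M_{p_{m+1}}(B)\otimes1_{q_{m+1}}$ and $v(3/4)^*\mathrm{diag}(g(\xi_1(3/4)),\dots,g(\xi_k(3/4)))v(3/4)\in1_{p_{m+1}}\otimes M_{q_{m+1}}(B)$; and for all $f\in A_m$, $\varphi_m(f)(1)\in1_{p_{m+1}}\otimes M_{q_{m+1}}$. Such choices exist and $\varphi_m:A_m\to A_{m+1}$ is a unital injective homomorphism. The finite sets are chosen as follows: for each $m$ there are finite sets $\mathcal F_{m,1}\subset\mathcal F_{m,2}\subset\cdots\subset A_m$ with dense union, $\varphi_m(\mathcal F_{m,m+n})\subset\mathcal F_{m+1,n}$ for all $m,n\ge1$, and $\mathcal F_m=\mathcal F_{m,1}\setminus\{0\}$. The limit $\lim_m(A_m,\varphi_m)$ is denoted $A_z^C$. *)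

(* Defs.v *)
From mathcomp Require Import all_boot all_order all_algebra.
From mathcomp Require Import complex.
From mathcomp Require Import all_classical all_reals all_analysis.

Set Implicit Arguments.
Unset Strict Implicit.
Unset Printing Implicit Defensive.

Import Order.TTheory GRing.Theory Num.Theory numFieldNormedType.Exports.

Local Open Scope classical_set_scope.
Local Open Scope ring_scope.
Local Open Scope complex_scope.

(** * C*-algebras and Hilbert spaces *)

(* The norm of a normed space over R[i] takes its values in R[i]; [nrm] is the
   same number, in R. *)
Definition nrm (R : realType) (V : normedModType R[i]) (x : V) : R :=
  complex.Re `|x|.

(* Not necessarily unital. *)
Record cstarAlg (R : realType) := CStarAlg {
  cs_car :> completeNormedModType R[i];
  cs_mul : cs_car -> cs_car -> cs_car;
  cs_star : cs_car -> cs_car;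
  _ : associative cs_mul;
  _ : forall a, linear (cs_mul a);
  _ : forall b, linear (cs_mul^~ b);
  _ : forall (l : R[i]) a b, cs_star (l *: a + b) = l^* *: cs_star a + cs_star b;
  _ : involutive cs_star;
  _ : forall a b, cs_star (cs_mul a b) = cs_mul (cs_star b) (cs_star a);
  _ : forall a b, `|cs_mul a b| <= `|a| * `|b|;
  _ : forall a, `|cs_mul (cs_star a) a| = `|a| ^+ 2 }.

Record hilbert (R : realType) := Hilbert {
  hb_car :> completeNormedModType R[i];
  ip : hb_car -> hb_car -> R[i];
  _ : forall y, linear (ip^~ y : hb_car -> (R[i])^o);
  _ : forall x y, ip y x = (ip x y)^*;
  _ : forall x, `|x| ^+ 2 = ip x x }.

(** * *-algebras and their homomorphisms *)

(* Only the operations are recorded. A concrete *-algebra (the unitized cone,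
   the building blocks) is a subset, closed under the operations, of such a
   structure, in the same way as a subgroup is a set in an ambient group. *)
Record starAlg (R : realType) := StarAlg {
  sa_car :> lmodType R[i];
  smul : sa_car -> sa_car -> sa_car;
  star : sa_car -> sa_car }.

Definition cs_starAlg (R : realType) (A : cstarAlg R) : starAlg R :=
  @StarAlg R (cs_car A) (@cs_mul R A) (@cs_star R A).
Coercion cs_starAlg : cstarAlg >-> starAlg.

Section StarAlgebras.
Variable R : realType.
Implicit Types S T : starAlg R.

Definition star_hom_on S T (P : set S) (f : S -> T) : Prop :=
  [/\ forall (l : R[i]) a b, P a -> P b -> f (l *: a + b) = l *: f a + f b,
      forall a b, P a -> P b -> f (smul a b) = smul (f a) (f b) &
      forall a, P a -> f (star a) = star (f a)].

Definition star_hom S T (f : S -> T) : Prop := star_hom_on setT f.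

Definition bounded_op (H : hilbert R) (u : H -> H) : Prop :=
  linear u /\ exists M : R, forall x, nrm (u x) <= M * nrm x.

(* *-homomorphisms from P to the bounded operators on H (possibly degenerate) *)
Definition star_rep_on S (P : set S) (H : hilbert R) (u : S -> H -> H) : Prop :=
  [/\ forall a, P a -> bounded_op (u a),
      forall (l : R[i]) a b x, P a -> P b ->
        u (l *: a + b) x = l *: u a x + u b x,
      forall a b x, P a -> P b -> u (smul a b) x = u a (u b x) &
      forall a x y, P a -> ip (u a x) y = ip x (u (star a) y)].

Definition star_rep S (H : hilbert R) (u : S -> H -> H) : Prop :=
  star_rep_on setT u.

Definition scalars : starAlg R :=
  @StarAlg R (R[i])^o (fun a b => a * b) (fun a => a^*).

(* Matrices with rows and columns indexed by a finite type J; then M_p (x) M_q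
   is indexed by 'I_p * 'I_q and block sums by sum types, without any choice of
   enumeration. *)
Definition mx_starAlg (J : finType) S : starAlg R :=
  @StarAlg R (J -> J -> S) (fun a b i j => \sum_k smul (a i k) (b k j))
    (fun a i j => star (a j i)).

Definition fun_starAlg (X : Type) S : starAlg R :=
  @StarAlg R (X -> S) (fun a b x => smul (a x) (b x)) (fun a x => star (a x)).

(* (l, a) stands for l + a *)
Definition unit_starAlg S : starAlg R :=
  @StarAlg R ((R[i])^o * S)%type
    (fun a b => (a.1 * b.1, a.1 *: b.2 + b.1 *: a.2 + smul a.2 b.2))
    (fun a => (a.1^*, star a.2)).

(* The norm of M_J(P), P a C*-algebra: a matrix over B(H) acts on H^J, and the
   norm is the largest one obtained from a representation of P (all faithful
   representations give this value). *)
Definition mxnorm S (P : set S) (J : finType) (a : mx_starAlg J S) : \bar R :=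
  ereal_sup [set c : \bar R |
    exists (H : hilbert R) (u : S -> H -> H) (x : J -> H),
      [/\ star_rep_on P u, \sum_j nrm (x j) ^+ 2 <= 1 &
          c = (Num.sqrt (\sum_i nrm (\sum_j u (a i j) (x j)) ^+ 2))%:E]].

(** ** Tensor products *)

(* An element of the algebraic tensor product of A and D is given by a list of
   pairs, standing for the sum of the corresponding elementary tensors. *)

Definition tip (H K : hilbert R) (z : seq (H * K)) : R[i] :=
  \sum_(a <- z) \sum_(b <- z) ip a.1 b.1 * ip a.2 b.2.

(* the norm in the Hilbert space tensor product of H and K *)
Definition tvnorm (H K : hilbert R) (z : seq (H * K)) : R :=
  Num.sqrt (complex.Re (tip z)).

(* the minimal (spatial) norm on the algebraic tensor product *)
Definition min_norm (A D : cstarAlg R) (x : seq (A * D)) : \bar R :=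
  ereal_sup [set c : \bar R |
    exists (H K : hilbert R) (u : A -> H -> H) (w : D -> K -> K)
           (z : seq (H * K)),
      [/\ star_rep (S := A) u, star_rep (S := D) w, tvnorm z <= 1 &
          c = (tvnorm [seq (u a.1 b.1, w a.2 b.2) | a <- x, b <- z])%:E]].

(* *-homomorphisms from the algebraic tensor product of A and D to the bounded
   operators on H, [u a d] being the image of the elementary tensor of a and d *)
Definition tensor_rep (A D : cstarAlg R) (H : hilbert R) (u : A -> D -> H -> H)
  : Prop :=
  [/\ forall a d, bounded_op (u a d),
      (forall (l : R[i]) a b d x,
        u (l *: a + b) d x = l *: u a d x + u b d x) /\
      (forall (l : R[i]) a d e x,
        u a (l *: d + e) x = l *: u a d x + u a e x),
      forall a b d e x, u (cs_mul a b) (cs_mul d e) x = u a d (u b e x) &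
      forall a d x y, ip (u a d x) y = ip x (u (cs_star a) (cs_star d) y)].

(* the maximal norm on the algebraic tensor product *)
Definition max_norm (A D : cstarAlg R) (x : seq (A * D)) : \bar R :=
  ereal_sup [set c : \bar R |
    exists (H : hilbert R) (u : A -> D -> H -> H) (xi : H),
      [/\ tensor_rep u, nrm xi <= 1 &
          c = (nrm (\sum_(a <- x) u a.1 a.2 xi))%:E]].

(* The canonical map from the maximal to the minimal tensor product of A and D
   is an isomorphism for every D. *)
Definition cs_nuclear (A : cstarAlg R) : Prop :=
  forall (D : cstarAlg R) (x : seq (A * D)), max_norm x = min_norm x.

Definition tsub (A D : cstarAlg R) (x y : seq (A * D)) : seq (A * D) :=
  x ++ [seq (- a.1, a.2) | a <- y].

(* Exactness of J (x) A -> D (x) A -> D/J (x) A for the minimal tensor products,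
   for every ideal J = ker q (the exactness at the two ends is automatic).
   Elements of the completion D (x) A are represented by sequences x of
   algebraic tensors that are Cauchy for the minimal norm. *)
Definition cs_exact (A : cstarAlg R) : Prop :=
  forall (D E : cstarAlg R) (q : D -> E),
    star_hom (S := D) (T := E) q -> (forall e, exists d, q d = e) ->
  forall x : nat -> seq (D * A),
    (forall e : R, 0 < e -> exists N : nat, forall m n : nat,
       (N <= m)%N -> (N <= n)%N -> (min_norm (tsub (x m) (x n)) < e%:E)%E) ->
    (fun n => min_norm [seq (q a.1, a.2) | a <- x n]) @ \oo --> 0%E ->
  exists y : nat -> seq (D * A),
    (forall n, {in y n, forall a, q a.1 = 0}) /\
    (fun n => min_norm (tsub (x n) (y n))) @ \oo --> 0%E.

Definition cs_separable (A : cstarAlg R) : Prop :=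
  exists u : nat -> A, dense (range u).

Definition cs_residually_fd (A : cstarAlg R) : Prop :=
  forall a : A, a <> 0 ->
    exists (n : nat) (f : A -> mx_starAlg 'I_n scalars), star_hom (S := A) f /\ f a <> 0.

End StarAlgebras.

(** * The building blocks *)

Section Blocks.
Variable R : realType.

Definition I01 : Type := {x : R | 0 <= x <= 1}.

Lemma clip_subproof (x : R) : 0 <= Num.max 0 (Num.min x 1) <= 1.
Proof. by rewrite le_max lexx /= ge_max ler01 ge_min lexx orbT. Qed.

(* The retraction of R onto [0,1]. It turns a real number known to lie in [0,1]
   into a point of [0,1]; a function h on [0,1] is continuous if and only if
   h \o clip is continuous on R. *)
Definition clip (x : R) : I01 := exist (fun y : R => is_true (0 <= y <= 1)) _ (clip_subproof x).

Variable C : cstarAlg R.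

(* (l, h) stands for l + h *)
Definition Bamb : starAlg R := unit_starAlg (fun_starAlg I01 C).

(* B = C 1_B + C_0((0,1], C) *)
Definition B : set Bamb :=
  [set b | continuous (fun x : R => b.2 (clip x) : C) /\ b.2 (clip 0) = 0].

Definition Bscal (l : R[i]) : Bamb := (l, fun=> 0).

Definition theta (t : R) (b : Bamb) : Bamb :=
  (b.1, fun x => b.2 (clip ((1 - t) * sval x))).

Definition MB (J : finType) : starAlg R := mx_starAlg J Bamb.

Definition inMB (J : finType) (a : MB J) : Prop := forall i j, B (a i j).

(* M_P(B) (x) 1_Q *)
Definition left_tensor (P Q : finType) : set (MB (P * Q)%type) :=
  [set a | exists2 b : MB P, inMB b &
     forall x y, a x y = if x.2 == y.2 then b x.1 y.1 else 0].

(* 1_P (x) M_Q(B) *)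
Definition right_tensor (P Q : finType) : set (MB (P * Q)%type) :=
  [set a | exists2 b : MB Q, inMB b &
     forall x y, a x y = if x.1 == y.1 then b x.2 y.2 else 0].

(* 1_P (x) M_Q *)
Definition right_scalar (P Q : finType) : set (MB (P * Q)%type) :=
  [set a | exists c : Q -> Q -> R[i],
     forall x y, a x y = if x.1 == y.1 then Bscal (c x.2 y.2) else 0].

Definition FB (J : finType) : starAlg R := fun_starAlg I01 (MB J).

(* E_{P,Q}, a *-subalgebra of the functions from [0,1] to M_P (x) M_Q (x) Bamb *)
Definition Eblock (P Q : finType) : set (FB (P * Q)%type) :=
  [set f | [/\ forall t, inMB (f t),
     forall (s : I01) (e : R), 0 < e -> exists2 d : R, 0 < d &
       forall t : I01, `|sval t - sval s| < d -> (mxnorm B (f t - f s) < e%:E)%E,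
     left_tensor (f (clip 0)) & right_scalar (f (clip 1))]].

Definition Enorm (J : finType) (f : FB J) : \bar R :=
  ereal_sup (range (fun t => mxnorm B (f t))).

(** ** The connecting maps *)

(* the entrywise extension of gamma : B -> M_n, with values viewed as scalar
   matrices over B *)
Definition gamma_mx (J : finType) (n : nat)
    (gamma : Bamb -> mx_starAlg 'I_n (scalars R)) (a : MB J) :
    MB (J * 'I_n)%type :=
  fun x y => Bscal (gamma (a x.1 y.1) x.2 y.2).

(* the index types of M_{dp} and of M_{5q}, for n = d - 1 *)
Definition dindex (P : finType) (n : nat) : finType := (P + P * 'I_n)%type.
Definition sindex (Q : finType) : finType := (Q * 'I_5)%type.

(* diag(a, gamma(c)) (x) 1_5, with M_{5dpq}(B) identified with
   M_{dp}(B) (x) M_{5q}; for a = c this is (delta (x) s)(a) *)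
Definition delta_s (P Q : finType) (n : nat)
    (gamma : Bamb -> mx_starAlg 'I_n (scalars R)) (a c : MB (P * Q)%type) :
    MB (dindex P n * sindex Q)%type :=
  fun x y =>
    if x.2.2 == y.2.2 then
      match x.1, y.1 with
      | inl i, inl j => a (i, x.2.1) (j, y.2.1)
      | inr i, inr j =>
          gamma_mx gamma c ((i.1, x.2.1), i.2) ((j.1, y.2.1), j.2)
      | _, _ => 0
      end
    else 0.

(* xi_i for 0 <= i < k: index i stands for i+1 in the usual 1-based notation *)
Definition xi (k r0 r1 i : nat) (t : R) : R :=
  let t' := Num.min t (3 / 4) in
  if (i < r0)%N then 2 * t' / 3
  else if (i < k - r1)%N then 1 / 2
  else 1 / 2 + 2 * t' / 3.

Definition theta_i (J : finType) (k r0 r1 i : nat) (f : FB J) (t : R) : MB J :=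
  let a := f (clip (xi k r0 r1 i t)) in
  if (i < k - r1)%N && (3 / 4 < t)
  then fun x y => theta (4 * (t - 3 / 4)) (a x y)
  else a.

Definition diag_blocks (k : nat) (J : finType) (a : 'I_k -> MB J) :
    MB ('I_k * J)%type :=
  fun x y => if x.1 == y.1 then a x.1 x.2 y.2 else 0.

(* v^* a v for a scalar matrix v *)
Definition conj_mx (J K : finType) (v : J -> K -> R[i]) (a : MB J) : MB K :=
  fun x y => \sum_i \sum_j ((v i x)^* * v j y) *: a i j.

(* Unitaries: the index types J and K are two presentations of one dimension. *)
Definition unitary (J K : finType) (v : J -> K -> R[i]) : Prop :=
  (forall x y, \sum_i (v i x)^* * v i y = (x == y)%:R) /\
  (forall i j, \sum_x v i x * (v j x)^* = (i == j)%:R).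

End Blocks.

(** * The construction of A_z^C *)

(* Indices are shifted: index m stands for m+1 in the usual notation. *)
Section Sizes.
Variables d k0 k1 : nat -> nat.

Fixpoint psize (m : nat) : nat :=
  if m is m'.+1 then (k0 m' * d m' * psize m')%N else 3.
Fixpoint qsize (m : nat) : nat :=
  if m is m'.+1 then (5 * k1 m' * qsize m')%N else 5.

Definition knum (m : nat) : nat := (k0 m * k1 m)%N.
Definition r0 (m : nat) : nat := (knum m %% qsize m.+1)%N.
Definition r1 (m : nat) : nat := (knum m %% psize m.+1)%N.

End Sizes.

Record AzC_data (R : realType) (C : cstarAlg R) := AzCData {
  az_d : nat -> nat;
  az_k0 : nat -> nat;
  az_k1 : nat -> nat;
  az_p := psize az_d az_k0;
  az_q := qsize az_k1;
  az_k := knum az_k0 az_k1;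
  az_r0 := r0 az_k0 az_k1;
  az_r1 := r1 az_d az_k0 az_k1;
  (* the index types of A_m and of E_{d_m p_m, 5 q_m} *)
  az_idx m : finType := ('I_(az_p m) * 'I_(az_q m))%type;
  az_blk m : finType :=
    (dindex 'I_(az_p m) (az_d m).-1 * sindex 'I_(az_q m))%type;
  az_gamma : forall m, Bamb C -> mx_starAlg 'I_(az_d m).-1 (scalars R);
  az_v : forall m, I01 R -> 'I_(az_k m) * az_blk m -> az_idx m.+1 -> R[i];
  az_F : forall m, nat -> set (FB C (az_idx m)) }.

Arguments az_gamma {R C} a m _.
Arguments az_v {R C} a m _ _ _.
Arguments az_F {R C} a m _ _.

Section Construction.
Variables (R : realType) (C : cstarAlg R) (S : AzC_data C).

Definition az_amb (m : nat) : starAlg R := FB C (az_idx S m).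

Definition az_A (m : nat) : set (az_amb m) :=
  @Eblock R C 'I_(az_p S m) 'I_(az_q S m).

Definition az_psi (m : nat) (i : 'I_(az_k S m)) (f : az_amb m) (t : R) :
    MB C (az_blk S m) :=
  let k := az_k S m in let r0 := az_r0 S m in let r1 := az_r1 S m in
  delta_s (az_gamma S m) (theta_i k r0 r1 i f t) (f (clip (xi k r0 r1 i t))).

Definition az_phi (m : nat) (f : az_amb m) : az_amb m.+1 :=
  fun t => conj_mx (az_v S m t)
             (diag_blocks (fun i => az_psi i f (sval t))).

Fixpoint az_phin (m n : nat) (f : az_amb m) : az_amb (n + m)%N :=
  if n is n'.+1 return az_amb (n + m)%N then az_phi (az_phin (n := n') f) else f.
Arguments az_phin {m} n f.

(* v(t)^* diag(g(xi_1(t)), ..., g(xi_k(t))) v(t) *)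
Definition az_conj (m : nat) (g : FB C (az_blk S m)) (t : R) :
    MB C (az_idx S m.+1) :=
  conj_mx (az_v S m (clip t))
    (diag_blocks (fun i : 'I_(az_k S m) =>
       g (clip (xi (az_k S m) (az_r0 S m) (az_r1 S m) i t)))).

Record AzC_admissible : Prop := {
  az_dP : forall m, (exists e, az_d S m = (3 ^ e)%N) /\ (3 ^ m.+1 < az_d S m)%N;
  az_k0P : forall m, prime (az_k0 S m) /\ (15 * az_q S m < az_k0 S m)%N;
  az_k1P : forall m, prime (az_k1 S m) /\
    (15 * az_k0 S m * az_d S m * az_p S m < az_k1 S m)%N;
  az_k01 : forall m, az_k0 S m != az_k1 S m;
  az_gamma_hom : forall m, star_hom_on (@B R C) (az_gamma S m);
  az_gamma1 : forall m,
    az_gamma S m (Bscal C 1) = fun i j => (i == j)%:R;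
  az_gammaF : forall m f, az_F S m 0 f -> f <> 0 -> exists t : I01 R,
    ((1 - (2 * m.+1%:R)^-1)%:E * Enorm f
       < mxnorm (@B R C) (gamma_mx (az_gamma S m) (f t)))%E;
  az_v_cont : forall m i j, continuous
    (fun t : R => az_v S m (clip t) i j : (R[i])^o);
  az_v_unitary : forall m (t : I01 R), unitary (az_v S m t);
  az_v0 : forall m (g : FB C (az_blk S m)), Eblock g ->
    left_tensor (az_conj g 0);
  az_v34 : forall m (g : FB C (az_blk S m)), Eblock g ->
    right_tensor (az_conj g (3 / 4));
  az_v1 : forall m (f : az_amb m), az_A f -> right_scalar (az_phi f (clip 1));
  az_F_fin : forall m n, finite_set (az_F S m n);
  az_F_sub : forall m n, az_F S m n `<=` @az_A m;
  az_F_mono : forall m n, az_F S m n `<=` az_F S m n.+1;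
  az_F_dense : forall m (f : az_amb m), az_A f -> forall e : R, 0 < e ->
    exists n, exists2 g, az_F S m n g & (Enorm (f - g)%R < e%:E)%E;
  az_F_phi : forall m n (f : az_amb m), az_F S m (m + n).+1 f ->
    az_F S m.+1 n (az_phi f) }.

(* A, with the maps mu_m : A_m -> A, is the inductive limit of (A_m, phi_m):
   the completion of the algebraic limit for the norm
   lim_n ||phi_{m+n-1} o ... o phi_m (f)||. *)
Definition is_limit (A : cstarAlg R) (mu : forall m, az_amb m -> A) : Prop :=
  [/\ forall m, star_hom_on (@az_A m) (mu m : az_amb m -> cs_starAlg A),
      forall m (f : az_amb m), az_A f -> mu m.+1 (az_phi f) = mu m f,
      forall m (f : az_amb m), az_A f ->
        (fun n => Enorm (az_phin n f)) @ \oo --> (nrm (mu m f))%:E &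
      dense (\bigcup_m (mu m @` @az_A m) : set A)].

End Construction.

(* Main.v *)
(* Both properties are compared through representations only, so no faithful
   representation of an abstract C*-algebra is ever needed.

   Each point evaluation on A_m is a compression of a point evaluation on
   A_(m+1) by a scalar isometry (xi_i takes every value in [0,1] before the
   contraction theta sets in), so f |-> f(s) in M_(p q)(B) extends along the
   whole system to a completely positive map tau_s on A. Compressions are used
   only through their positive matrix coefficients, which are dilated to
   representations of A by a kernel construction.

   Not nuclear: the map c |-> mu_1(h(t) x c 1), with h(0) = h(1) = 0 and
   h(1/2) = 1, embeds C in A without increasing minimal norms, and tau_(1/2)
   followed by evaluation at x = 1 is a left inverse of it, which turns a
   representation of C (x) D into one of A (x) D. Hence C would be nuclear if A
   were.

   Exact: interpolating with partitions of unity in t and in the cone variable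
   x, the identity of A is a point-norm limit of uniformly completely bounded
   finite sums of maps A -> C -> A. Near t = 0 and t = 1 the interpolating
   matrices are spread out so that they stay in M_p (x) 1 and 1 (x) M_q, and
   the part h = b - lambda of b = lambda + h in B is compressed by an approximate
   unit e of C, as e b(x) e - lambda e^2, a difference of two completely positive
   maps. The exactness of C is then applied to each of the finitely many
   factors. *)
From HB Require Import structures.
Require Import Defs.
From mathcomp Require Import all_boot all_order all_algebra.
From mathcomp Require Import complex ring lra.
From mathcomp Require Import all_classical all_reals all_analysis.

Set Implicit Arguments.
Unset Strict Implicit.
Unset Printing Implicit Defensive.

Import Order.TTheory GRing.Theory Num.Theory numFieldNormedType.Exports.

Local Open Scope classical_set_scope.
Local Open Scope ring_scope.
Local Open Scope complex_scope.

Local Notation cj := (@conjc _).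

(** * Norms and Hilbert spaces *)

(** The only functional calculus used is the solution of 2 y - y^2 = x for small x; it bounds
    representations by twice the norm instead of once. Such losses are harmless for exactness but
    not for nuclearity, where two norms are compared with constant 1: there the estimates go through
    dilations, whose bound is sharp. Functionals on matrices over B extend to A, but tau_s itself is
    not extended as a map; maps out of A are therefore defined on a set of lifts with dense image in
    A. For exactness the bound of the sum of all factors must be uniform. The coefficient data of
    all patches are added before dilating, so the bound is the norm of the sum of the images of the
    unit, whatever the mesh; the individual factors A -> C -> A may have bounds that grow with the
    mesh. For the same reason the mesh is fixed before the approximate unit of C, whose error is
    multiplied by those bounds. Residual finite-dimensionality supplies a matrix coefficient of C
    that is nonzero at some c0. The scalar part lambda of lambda + h is sent to lambda c0 in C and
    read off again by this coefficient. *)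

Definition cmod (R : realType) (z : R[i]) : R := complex.Re `|z|.

Section Moduli.
Variable R : realType.
Implicit Types (z w : R[i]) (V : normedModType R[i]).

Lemma cge0E z : 0 <= z -> z = (complex.Re z)%:C.
Proof. by move=> z0; rewrite RRe_real// ger0_real. Qed.

Lemma nrmE V (x : V) : `|x| = (nrm x)%:C.
Proof. by rewrite [LHS]cge0E. Qed.

Lemma cmodE z : `|z| = (cmod z)%:C.
Proof. by rewrite [LHS]cge0E. Qed.

Lemma nrm_ge0 V (x : V) : 0 <= nrm x.
Proof. by rewrite -ler0c -nrmE. Qed.

Lemma cmod_ge0 z : 0 <= cmod z.
Proof. by rewrite -ler0c -cmodE. Qed.

Lemma cmodM z w : cmod (z * w) = cmod z * cmod w.
Proof. by apply: complexI; rewrite rmorphM/= -!cmodE normrM. Qed.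

Lemma cmodD z w : cmod (z + w) <= cmod z + cmod w.
Proof. by rewrite -lecR rmorphD/= -!cmodE ler_normD. Qed.

Lemma cmodJ z : cmod (cj z) = cmod z.
Proof. by rewrite /cmod normcJ. Qed.

Lemma cmodN z : cmod (- z) = cmod z.
Proof. by rewrite /cmod normrN. Qed.

Lemma cmodB z w : cmod (z - w) = cmod (w - z).
Proof. by rewrite /cmod distrC. Qed.

Lemma cmod0 : cmod (0 : R[i]) = 0.
Proof. by rewrite /cmod normr0. Qed.

Lemma cmod1 : cmod (1 : R[i]) = 1.
Proof. by rewrite /cmod normr1. Qed.

Lemma cmod_eq0 z : cmod z = 0 -> z = 0.
Proof. by move=> z0; apply/eqP; rewrite -normr_eq0 cmodE z0. Qed.

Lemma cmodR (r : R) : cmod r%:C = `|r|.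
Proof. by rewrite /cmod normc_def/= expr0n/= addr0 sqrtr_sqr. Qed.

Lemma Re_le_cmod z : complex.Re z <= cmod z.
Proof.
have := normc_ge_Re z; rewrite cmodE lecR; apply: le_trans; exact: ler_norm.
Qed.

Lemma RCM (a b : R) : (a * b)%:C = a%:C * b%:C.
Proof. exact: rmorphM. Qed.

Lemma RCD (a b : R) : (a + b)%:C = a%:C + b%:C.
Proof. exact: rmorphD. Qed.

Lemma conjM z w : cj (z * w) = cj z * cj w.
Proof. exact: rmorphM. Qed.

Lemma conjD z w : cj (z + w) = cj z + cj w.
Proof. exact: rmorphD. Qed.

Lemma conjN z : cj (- z) = - cj z.
Proof. exact: rmorphN. Qed.

Lemma conj_sum I (s : seq I) (F : I -> R[i]) :
  cj (\sum_(i <- s) F i) = \sum_(i <- s) cj (F i).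
Proof. exact: rmorph_sum. Qed.

Lemma mulcJ z : z * cj z = (cmod z ^+ 2)%:C.
Proof. by rewrite -sqr_normc cmodE rmorphXn. Qed.

Lemma cmod_le z : cmod z <= `|complex.Re z| + `|complex.Im z|.
Proof.
case: z => a b; rewrite /cmod normc_def/= -[leRHS]ger0_norm ?addr_ge0//.
by rewrite -sqrtr_sqr ler_wsqrtr// sqrrD !real_normK ?num_real// lerD2r lerDl mulrn_wge0// mulr_ge0.
Qed.

Lemma Re_cmod z : `|complex.Re z| <= cmod z.
Proof. by have := normc_ge_Re z; rewrite cmodE lecR. Qed.

Lemma Im_cmod z : `|complex.Im z| <= cmod z.
Proof.
case: z => a b /=; rewrite /cmod normc_def/= -[`|b|]sqrtr_sqr ler_wsqrtr//.
by rewrite lerDr sqr_ge0.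
Qed.

Lemma nrmD V (x y : V) : nrm (x + y) <= nrm x + nrm y.
Proof. by rewrite -lecR rmorphD/= -!nrmE ler_normD. Qed.

Lemma nrmN V (x : V) : nrm (- x) = nrm x.
Proof. by rewrite /nrm normrN. Qed.

Lemma nrmB V (x y : V) : nrm (x - y) = nrm (y - x).
Proof. by rewrite /nrm distrC. Qed.

Lemma nrmZ V z (x : V) : nrm (z *: x) = cmod z * nrm x.
Proof. by apply: complexI; rewrite rmorphM/= -nrmE -cmodE -nrmE normrZ. Qed.

Lemma nrm0 V : nrm (0 : V) = 0.
Proof. by rewrite /nrm normr0. Qed.

Lemma nrm_eq0 V (x : V) : nrm x = 0 -> x = 0.
Proof. by move=> x0; apply/eqP; rewrite -normr_eq0 nrmE x0. Qed.

Lemma nrm_sum V I (s : seq I) (F : I -> V) :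
  nrm (\sum_(i <- s) F i) <= \sum_(i <- s) nrm (F i).
Proof.
elim: s => [|a s IH]; first by rewrite !big_nil nrm0.
by rewrite !big_cons (le_trans (nrmD _ _))// lerD2l.
Qed.

Lemma nrm_triangle V (x y z : V) : nrm (x - z) <= nrm (x - y) + nrm (y - z).
Proof. by rewrite (le_trans _ (nrmD _ _))// addrA subrK. Qed.

Lemma nrm_sub V (x y : V) : nrm x <= nrm (x - y) + nrm y.
Proof. by rewrite (le_trans _ (nrmD _ _))// subrK. Qed.

Lemma cpos_ex (e : R[i]) : 0 < e -> exists2 r : R, 0 < r & e = r%:C.
Proof.
move=> e0; have eE := cge0E (ltW e0).
by exists (complex.Re e) => //; rewrite -(@ltcR R 0) -eE.
Qed.

Lemma ltC_nrm V (x : V) (r : R) : (`|x| < r%:C) = (nrm x < r).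
Proof. by rewrite nrmE ltcR. Qed.

Lemma inv_small (e : R) : 0 < e -> exists N : nat, forall n, (N <= n)%N -> n.+1%:R^-1 < e.
Proof.
move=> e0; have ei : 0 < e^-1 by rewrite invr_gt0.
exists (Num.truncn e^-1) => n Nn.
rewrite -[e]invrK ltf_pV2 ?posrE// (lt_le_trans (truncnS_gt _))//.
by rewrite ler_nat ltnS.
Qed.

Lemma invr_gt0_nat (n : nat) : 0 < n.+1%:R^-1 :> R.
Proof. by rewrite invr_gt0. Qed.

Lemma nrm_le_of_sq_real (x M : R) : x ^+ 2 <= M * x -> 0 <= x -> 0 <= M -> x <= M.
Proof.
move=> h x0 M0; have [->//|xn0] := eqVneq x 0.
by move: h; rewrite expr2 ler_pM2r// lt0r xn0.
Qed.

Lemma eps_eq0 (x : R) : 0 <= x -> (forall e, 0 < e -> x <= e) -> x = 0.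
Proof.
move=> x0 h; apply/le_anti; rewrite x0 andbT.
by apply/ler_addgt0Pr => e e0; rewrite add0r h.
Qed.

Lemma nrm_cvg (V : completeNormedModType R[i]) (u : nat -> V) :
  (forall e : R, 0 < e -> exists N, forall m n, (N <= m)%N -> (N <= n)%N -> nrm (u m - u n) < e) ->
  exists l, forall e : R, 0 < e -> exists N, forall n, (N <= n)%N -> nrm (u n - l) < e.
Proof.
move=> uC.
have /cauchy_cvgP/cvg_ex[l ul] : cauchy (u @ \oo).
  apply/cauchy_exP => _ /cpos_ex[r r0 ->].
  have [N NP] := uC _ r0; exists (u N).
  exists N => // n /= Nn; rewrite -ball_normE /ball_/= ltC_nrm; exact: NP.
exists l => e e0; have e0' : 0 < e%:C by rewrite ltcR.
move/cvgrPdist_lt: ul => /(_ _ e0')[N _ NP].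
by exists N => n Nn; rewrite nrmB -ltC_nrm; exact: NP.
Qed.

Lemma dense_nrm V (D : set V) : dense D -> forall (a : V) (e : R), 0 < e ->
  exists2 b, D b & nrm (a - b) < e.
Proof.
move=> dD a e e0; have e0' : 0 < e%:C by rewrite ltcR.
have oB : open (ball a e%:C) by exact: ball_open.
have [|b [ab Db]] := dD (ball a e%:C) _ oB.
  by exists a; exact: ballxx.
by exists b => //; move: ab; rewrite -ball_normE /ball_/= ltC_nrm.
Qed.

Lemma cplx_cvg (u : nat -> R[i]) :
  (forall e : R, 0 < e -> exists N, forall m n, (N <= m)%N -> (N <= n)%N -> cmod (u m - u n) < e) ->
  exists l, forall e : R, 0 < e -> exists N, forall n, (N <= n)%N -> cmod (u n - l) < e.
Proof.
move=> uC.
have rc (v : nat -> R) : (forall m n, `|v m - v n| <= cmod (u m - u n)) ->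
  exists l, forall e : R, 0 < e -> exists N, forall n, (N <= n)%N -> `|v n - l| < e.
  move=> vu.
  have /cauchy_cvgP/cvg_ex[l ul] : cauchy (v @ \oo).
    apply/cauchy_exP => r r0; have [N NP] := uC _ r0; exists (v N).
    exists N => // n /= Nn; rewrite /ball/=; apply: le_lt_trans (vu _ _) _; exact: NP.
  exists l => e e0; move/cvgrPdist_lt: ul => /(_ _ e0)[N _ NP].
  by exists N => n Nn; rewrite distrC; exact: NP.
have [|a aP] := rc (fun n => complex.Re (u n)).
  by move=> m n; have := Re_cmod (u m - u n); case: (u m) (u n) => [? ?] [].
have [|b bP] := rc (fun n => complex.Im (u n)).
  by move=> m n; have := Im_cmod (u m - u n); case: (u m) (u n) => [? ?] [].
exists (a +i* b) => e e0; have e20 : 0 < e / 2 by lra.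
have [N1 h1] := aP _ e20; have [N2 h2] := bP _ e20.
exists (maxn N1 N2) => n; rewrite geq_max => /andP[n1 n2].
apply: le_lt_trans (cmod_le _) _.
move: (h1 _ n1) (h2 _ n2); case: (u n) => c d /=; lra.
Qed.

End Moduli.

Section Hilbert.
Variable R : realType.
Implicit Types (H : hilbert R) (z : R[i]).

Lemma ip_linear H (l : R[i]) (x y z : H) : ip (l *: x + y) z = l * ip x z + ip y z.
Proof. by case: H x y z => T i lin h n x y z /=; rewrite lin. Qed.

Lemma ipJ H (x y : H) : ip y x = cj (ip x y).
Proof. by case: H x y => T i lin h n x y /=; rewrite h. Qed.

Lemma ip_nrm H (x : H) : ip x x = (nrm x ^+ 2)%:C.
Proof. by rewrite rmorphXn/= -nrmE; case: H x => T i lin h n x /=; rewrite n. Qed.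

Lemma ipDl H (x y z : H) : ip (x + y) z = ip x z + ip y z.
Proof. by have := ip_linear 1 x y z; rewrite scale1r mul1r. Qed.

Lemma ip0l H (z : H) : ip 0 z = 0.
Proof. by apply: (addrI (ip 0 z)); rewrite -ipDl !addr0. Qed.

Lemma ipZl H l (x z : H) : ip (l *: x) z = l * ip x z.
Proof. by have := ip_linear l x 0 z; rewrite ip0l !addr0. Qed.

Lemma ipNl H (x z : H) : ip (- x) z = - ip x z.
Proof. by rewrite -scaleN1r ipZl mulN1r. Qed.

Lemma ipBl H (x y z : H) : ip (x - y) z = ip x z - ip y z.
Proof. by rewrite ipDl ipNl. Qed.

Lemma ipDr H (x y z : H) : ip z (x + y) = ip z x + ip z y.
Proof. by rewrite ipJ ipDl conjD -!ipJ. Qed.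

Lemma ip0r H (z : H) : ip z 0 = 0.
Proof. by rewrite ipJ ip0l conjc0. Qed.

Lemma ipZr H l (x z : H) : ip z (l *: x) = cj l * ip z x.
Proof. by rewrite ipJ ipZl conjM -!ipJ. Qed.

Lemma ipNr H (x z : H) : ip z (- x) = - ip z x.
Proof. by rewrite ipJ ipNl conjN -!ipJ. Qed.

Lemma ipBr H (x y z : H) : ip z (x - y) = ip z x - ip z y.
Proof. by rewrite ipDr ipNr. Qed.

Lemma ip_suml H I (s : seq I) (F : I -> H) (z : H) :
  ip (\sum_(i <- s) F i) z = \sum_(i <- s) ip (F i) z.
Proof.
elim: s => [|a s IH]; first by rewrite !big_nil ip0l.
by rewrite !big_cons ipDl IH.
Qed.

Lemma ip_sumr H I (s : seq I) (F : I -> H) (z : H) :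
  ip z (\sum_(i <- s) F i) = \sum_(i <- s) ip z (F i).
Proof.
elim: s => [|a s IH]; first by rewrite !big_nil ip0r.
by rewrite !big_cons ipDr IH.
Qed.

Lemma ip_ge0 H (x : H) : 0 <= ip x x.
Proof. by rewrite ip_nrm ler0c sqr_ge0. Qed.

(** Only multiples c = - t z are tried, which leaves a real quadratic in t; for b > 0 its value at
    the minimum t = 1/b is the claim. *)
Lemma quad_CS (a b : R) z : 0 <= a -> 0 <= b ->
  (forall c : R[i], 0 <= a + 2 * complex.Re (cj c * z) + cmod c ^+ 2 * b) ->
  cmod z ^+ 2 <= a * b.
Proof.
move=> a0 b0 h.
have hr (t : R) : 0 <= a - 2 * t * cmod z ^+ 2 + t ^+ 2 * cmod z ^+ 2 * b.
  have := h (- t%:C * z); rewrite conjM conjN conjc_real -mulrA [cj _ * _]mulrC mulcJ.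
  rewrite !mulNr cmodN cmodM cmodR -rmorphM -rmorphN/= exprMn real_normK ?num_real//.
  by move=> hh; lra.
move: (cmod z ^+ 2) (sqr_ge0 (cmod z)) hr => w w0 hr.
have [->|z0] := eqVneq w 0; first by rewrite mulr_ge0.
have [bz|bz] := eqVneq b 0.
  (* For b = 0 the expression is affine in t and equals -1 at this t. *)
  have := hr ((a + 1) / (2 * w)).
  rewrite bz mulr0 addr0.
  suff -> : 2 * ((a + 1) / (2 * w)) * w = a + 1 by lra.
  by field.
have := hr b^-1.
have -> : a - 2 * b^-1 * w + b^-1 ^+ 2 * w * b = (a * b - w) / b by field.
by rewrite pmulr_lge0 ?invr_gt0 ?lt0r ?bz// subr_ge0.
Qed.

(** Stated for a bare function [B] and two points, so that one argument serves the inner product of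
    a Hilbert space, the form on formal sums and the form on its completion. *)
Lemma psd_CS (T : Type) (B : T -> T -> R[i]) (x y : T) :
  (forall x, 0 <= B x x) -> (B y x = cj (B x y)) ->
  (forall c, 0 <= B x x + (cj c * B x y + c * B y x) + c * cj c * B y y) ->
  cmod (B x y) <= Num.sqrt (complex.Re (B x x)) * Num.sqrt (complex.Re (B y y)).
Proof.
move=> B0 Bh h; have B0' (z : T) : 0 <= complex.Re (B z z) by rewrite -ler0c -cge0E.
rewrite -(ler_pXn2r (ltn0Sn 1)) ?nnegrE ?cmod_ge0 ?mulr_ge0 ?sqrtr_ge0//.
rewrite exprMn !sqr_sqrtr//; apply: quad_CS => // c.
have := h c; rewrite (cge0E (B0 x)) (cge0E (B0 y)) mulcJ Bh.
have -> : c * cj (B x y) = cj (cj c * B x y) by rewrite conjM conjcK.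
rewrite addcJ -(rmorph_nat (real_complex R)) -!rmorphM -!rmorphD/= ler0c.
exact.
Qed.

Lemma cauchy_schwarz H (x y : H) : cmod (ip x y) <= nrm x * nrm y.
Proof.
have := @psd_CS H (@ip R H) x y (@ip_ge0 H) (ipJ x y).
rewrite !ip_nrm/= !sqrtr_sqr !ger0_norm ?nrm_ge0//; apply => c.
have := ip_ge0 (x + c *: y).
by rewrite ipDl !ipDr !ipZl !ipZr !ip_nrm; congr (_ <= _); ring.
Qed.

(* self-duality of a Hilbert space, with the functional tested at the vector itself *)
Lemma nrm_le_ip H (x : H) (M : R) : 0 <= M ->
  cmod (ip x x) <= M * nrm x -> nrm x <= M.
Proof.
move=> M0; rewrite ip_nrm cmodR ger0_norm ?sqr_ge0// => h.
by apply: nrm_le_of_sq_real; rewrite ?nrm_ge0.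
Qed.

Lemma ip_ext H (D : set H) (x y : H) :
  (forall h (e : R), 0 < e -> exists2 b, D b & nrm (h - b) < e) ->
  (forall b, D b -> ip x b = ip y b) -> x = y.
Proof.
move=> dD h; apply/eqP; rewrite -subr_eq0; apply/eqP/nrm_eq0.
apply: eps_eq0 => [|e e0]; first exact: nrm_ge0.
have [b Db xb] := dD (x - y) _ e0.
apply: nrm_le_ip; first exact: ltW.
have -> : ip (x - y) (x - y) = ip (x - y) (x - y - b).
  by rewrite [in RHS]ipBr [ip _ b]ipBl h// subrr subr0.
rewrite (le_trans (cauchy_schwarz _ _))// mulrC ler_wpM2r ?nrm_ge0//; exact: ltW.
Qed.

End Hilbert.

(** * Positive semidefinite kernels and their forms on formal sums *)

Record psdker (R : realType) (X : Type) := Psdker {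
  kf :> X -> X -> R[i];
  kf_psd : forall s : seq (R[i] * X),
    0 <= \sum_(a <- s) \sum_(b <- s) a.1 * cj b.1 * kf a.2 b.2 }.

Section KernelForm.
Variables (R : realType) (X : Type) (k : psdker R X).
Implicit Types (s t u : seq (R[i] * X)).

Definition form s t := \sum_(a <- s) \sum_(b <- t) a.1 * cj b.1 * k a.2 b.2.
Definition scl (c : R[i]) s : seq (R[i] * X) := [seq (c * a.1, a.2) | a <- s].
Definition nn s : R := Num.sqrt (complex.Re (form s s)).

Lemma form_catl s s' t : form (s ++ s') t = form s t + form s' t.
Proof. by rewrite /form big_cat. Qed.

Lemma form_catr s t t' : form s (t ++ t') = form s t + form s t'.
Proof. by rewrite /form -big_split; apply: eq_bigr => a _; rewrite big_cat. Qed.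

Lemma form_scll c s t : form (scl c s) t = c * form s t.
Proof.
rewrite /form big_map mulr_sumr; apply: eq_bigr => a _ /=.
by rewrite mulr_sumr; apply: eq_bigr => b _; rewrite !mulrA.
Qed.

Lemma form_sclr c s t : form s (scl c t) = cj c * form s t.
Proof.
rewrite /form mulr_sumr; apply: eq_bigr => a _ /=.
rewrite big_map mulr_sumr; apply: eq_bigr => b _ /=.
by rewrite conjM !mulrA [a.1 * _]mulrC.
Qed.

Lemma form_ge0 s : 0 <= form s s.
Proof. exact: kf_psd. Qed.

(** Hermitian symmetry is not a field of [psdker]: it follows from positivity by polarisation, with
    c = 1 and c = i. *)
Lemma form_herm s t : form t s = cj (form s t).
Proof.
have h c : complex.Im (cj c * form s t + c * form t s) = 0.
  have := ger0_Im (form_ge0 (s ++ scl c t)).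
  rewrite form_catl !form_catr !form_scll !form_sclr.
  rewrite [c * (cj c * _)]mulrA mulcJ (cge0E (form_ge0 s)) (cge0E (form_ge0 t)).
  case: (form s t) (form t s) (c) => [a b] [a' b'] [e f] /=; lra.
move: (h 1) (h 'i); case: (form s t) (form t s) => [a b] [a' b'] /= h1 h2.
by apply/eqP; rewrite eq_complex/=; apply/andP; split; apply/eqP; lra.
Qed.

Lemma form_nn s : form s s = (nn s ^+ 2)%:C.
Proof.
rewrite /nn sqr_sqrtr; first exact/cge0E/form_ge0.
by rewrite -ler0c -cge0E// form_ge0.
Qed.

Lemma nn_ge0 s : 0 <= nn s. Proof. exact: sqrtr_ge0. Qed.

Lemma form_CS s t : cmod (form s t) <= nn s * nn t.
Proof.
apply: psd_CS => [||c]; [exact: form_ge0|exact: form_herm|].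
have := form_ge0 (s ++ scl c t).
by rewrite form_catl !form_catr !form_scll !form_sclr; congr (_ <= _); ring.
Qed.

End KernelForm.

(** * Completion with respect to a positive kernel *)

Section Completion.
Variables (R : realType) (X : Type) (k : psdker R X).
Implicit Types (s t u : seq (R[i] * X)) (F G : X -> R[i]).

(** The completion is realised as a reproducing kernel space: an element f is stored as the function
    x |-> <f, x>, so neither a quotient by null vectors nor classes of Cauchy sequences are needed.
    [ev] extends this pairing to formal sums, and [hk_pred] keeps the functions that are
    approximated by formal sums in the dual norm. *)
Definition lst s : X -> R[i] := fun x => \sum_(a <- s) a.1 * k a.2 x.
Definition ev F t : R[i] := \sum_(b <- t) cj b.1 * F b.2.

(* [F] lies within distance [e] of the element represented by [s] *)
Definition near_form F s (e : R) := forall t, cmod (ev F t - form k s t) <= e * nn k t.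

Definition hk_pred : {pred (X -> (R[i])^o)} :=
  fun F => `[< forall e : R, 0 < e -> exists s, near_form F s e >].

Lemma ev_lst s t : ev (lst s) t = form k s t.
Proof.
rewrite /ev /form exchange_big; apply: eq_bigr => b _.
rewrite mulr_sumr; apply: eq_bigr => a _; rewrite mulrA; congr (_ * _); exact: mulrC.
Qed.

Lemma ev_lin (c : R[i]) F G t : ev (c *: (F : X -> (R[i])^o) + G) t = c * ev F t + ev G t.
Proof.
rewrite /ev mulr_sumr -big_split; apply: eq_bigr => b _ /=.
by rewrite mulrDr mulrCA.
Qed.

Lemma ev_cat F s t : ev F (s ++ t) = ev F s + ev F t.
Proof. by rewrite /ev big_cat. Qed.

Lemma ev_scl F c t : ev F (scl c t) = cj c * ev F t.
Proof.
rewrite /ev big_map mulr_sumr; apply: eq_bigr => b _ /=.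
by rewrite conjM mulrA.
Qed.

Lemma near_lst s e : 0 <= e -> near_form (lst s) s e.
Proof. by move=> e0 t; rewrite ev_lst subrr cmod0 mulr_ge0 ?nn_ge0. Qed.

Lemma hk_submod : submod_closed hk_pred.
Proof.
split.
  apply/asboolP => e e0; exists [::] => t.
  rewrite /form big_nil subr0 /ev big1 ?cmod0 ?mulr_ge0 ?nn_ge0 ?ltW// => b _.
  by rewrite mulr0.
move=> c F G /asboolP hF /asboolP hG; apply/asboolP => e e0.
have c0 := cmod_ge0 c; have c1 : cmod c + 1 != 0 by rewrite gt_eqF//; lra.
have d0 : 0 < e / (cmod c + 1) by rewrite divr_gt0//; lra.
have [s sF] := hF _ d0; have [s' sG] := hG _ d0.
exists (scl c s ++ s') => t; rewrite ev_lin form_catl form_scll.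
rewrite opprD addrACA -mulrBr (le_trans (cmodD _ _))// cmodM.
have h1 := ler_wpM2l c0 (sF t); have h2 := sG t.
suff -> : e = cmod c * (e / (cmod c + 1)) + e / (cmod c + 1).
  by rewrite mulrDl -mulrA lerD.
by field.
Qed.

HB.instance Definition _ := GRing.isSubmodClosed.Build R[i] (X -> (R[i])^o) hk_pred hk_submod.

Record hk := Hk { hkf :> X -> (R[i])^o; _ : hkf \in hk_pred }.
HB.instance Definition _ := [isSub for hkf].
HB.instance Definition _ := [Choice of hk by <:].
HB.instance Definition _ := [SubChoice_isSubLmodule of hk by <:].

Implicit Types (f g h : hk).

Lemma hk_near f (e : R) : 0 < e -> exists s, near_form f s e.
Proof. by case: f => F /= /asboolP h; exact: h. Qed.

Lemma emb_subproof s : (lst s : X -> (R[i])^o) \in hk_pred.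
Proof. by apply/asboolP => e e0; exists s; exact/near_lst/ltW. Qed.
Definition emb s : hk := Hk (emb_subproof s).

Lemma near_bound F s e t : near_form F s e -> cmod (ev F t) <= (nn k s + e) * nn k t.
Proof.
move=> /(_ t) h; have := cmodD (ev F t - form k s t) (form k s t); rewrite subrK.
have := form_CS k s t; rewrite mulrDl; lra.
Qed.

(** The difference [u] is paired with itself: both forms are compared with [ev F u], so the square
    of [nn k u] is at most (d + e) times [nn k u]. *)
Lemma near_near F s t d e : 0 <= d -> 0 <= e -> near_form F s d -> near_form F t e ->
  nn k (s ++ scl (- 1) t) <= d + e.
Proof.
set u := s ++ _ => d0 e0 hs ht.
have h : nn k u ^+ 2 <= (d + e) * nn k u.
  have -> : nn k u ^+ 2 = cmod (form k s u - form k t u).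
    rewrite -[LHS]ger0_norm ?sqr_ge0// -cmodR -form_nn {1}/u form_catl form_scll.
    by rewrite mulN1r.
  have -> : form k s u - form k t u = (ev F u - form k t u) - (ev F u - form k s u) by ring.
  rewrite (le_trans (cmodD _ _))// cmodN mulrDl addrC lerD//.
have [->|u0] := eqVneq (nn k u) 0; first by rewrite addr_ge0.
by move: h; rewrite expr2 ler_pM2r// lt0r u0 nn_ge0.
Qed.

Lemma nn_sub s t : nn k s <= nn k t + nn k (s ++ scl (- 1) t).
Proof.
rewrite addrC; apply: nrm_le_of_sq_real; rewrite ?addr_ge0 ?nn_ge0//.
have -> : nn k s ^+ 2 = cmod (form k s s).
  by rewrite form_nn cmodR ger0_norm ?sqr_ge0.
have -> : form k s s = form k (s ++ scl (- 1) t) s + form k t s.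
  by rewrite form_catl form_scll; ring.
by rewrite (le_trans (cmodD _ _))// mulrDl lerD// form_CS.
Qed.

Lemma near_nn f : exists2 B : R, 0 <= B &
  forall s e, 0 <= e -> e <= 1 -> near_form f s e -> nn k s <= B.
Proof.
have [s0 h0] := hk_near f ltr01; exists (nn k s0 + 2).
  by rewrite addr_ge0 ?nn_ge0.
move=> s e e0 e1 hs; rewrite (le_trans (nn_sub s s0))// lerD2l.
rewrite (le_trans (near_near _ _ hs h0))//; lra.
Qed.

Lemma near_ev F s t u e : 0 <= e -> near_form F s e ->
  cmod (ev F t - ev F u) <= (nn k s + e) * nn k (t ++ scl (- 1) u).
Proof.
move=> e0 h; have -> : ev F t - ev F u = ev F (t ++ scl (- 1) u).
  by rewrite ev_cat ev_scl conjN conjc1 mulN1r.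
exact: near_bound h.
Qed.

Definition app f (n : nat) : seq (R[i] * X) := sval (cid (hk_near f (invr_gt0_nat R n))).

Lemma appP f n : near_form f (app f n) n.+1%:R^-1.
Proof. exact: (svalP (cid (hk_near f (invr_gt0_nat R n)))). Qed.

(** The inner product of f and g is the limit of f along approximants of g; by [near_ev], f is
    Lipschitz for the seminorm, so the values form a Cauchy sequence. *)
Lemma hkip_ex f g : exists l : R[i], forall e : R, 0 < e ->
  exists N, forall n, (N <= n)%N -> cmod (ev f (app g n) - l) < e.
Proof.
apply: cplx_cvg => e e0.
have [s fs] := hk_near f ltr01; set M := nn k s + 1.
have M0 : 0 < M by rewrite ltr_wpDl ?nn_ge0.
have q0 : 0 < e / (2 * M) by rewrite divr_gt0// mulr_gt0.
have [N NP] := inv_small q0.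
exists N => m n /NP hm /NP hn.
rewrite (le_lt_trans (near_ev _ _ ler01 fs))//.
have := near_near _ _ (appP g m) (appP g n).
rewrite !invr_ge0 !ler0n => /(_ isT isT) h.
rewrite -/M -ltr_pdivlMl//; apply: le_lt_trans h _.
have -> : M^-1 * e = e / (2 * M) + e / (2 * M) by field; lra.
exact: ltrD.
Qed.

Definition hkip f g : R[i] := sval (cid (hkip_ex f g)).

Lemma hkip_near f g s t d e : 0 <= d -> 0 <= e -> near_form f s d -> near_form g t e ->
  cmod (hkip f g - form k s t) <= (nn k s + d) * e + d * nn k t.
Proof.
move=> d0 e0 hf hg.
suff key (r : R) : 0 < r -> cmod (hkip f g - form k s t) <= (nn k s + d) * e + d * nn k t + r.
  by apply/ler_addgt0Pr => r; exact: key.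
move=> r0.
have hl := svalP (cid (hkip_ex f g)); rewrite -/(hkip f g) in hl.
set M := nn k s + d; have M0 : 0 <= M by rewrite addr_ge0 ?nn_ge0.
have r20 : 0 < r / 2 by rewrite divr_gt0.
have [N1 h1] := hl _ r20.
have q0 : 0 < r / (2 * (M + 1)) by rewrite divr_gt0// mulr_gt0//; lra.
have [N2 h2] := inv_small q0.
pose n := maxn N1 N2.
have {}h1 := h1 n (leq_maxl _ _); have {}h2 := h2 n (leq_maxr _ _).
have -> : hkip f g - form k s t = (hkip f g - ev f (app g n)) + (ev f (app g n) - ev f t)
   + (ev f t - form k s t) by ring.
rewrite cmodB in h1; have h6 := hf t.
apply: le_trans (cmodD _ _) _; apply: le_trans (lerD (cmodD _ _) h6) _.
have h3 := near_ev (app g n) t d0 hf; rewrite -/M in h3.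
have h4 : M * nn k (app g n ++ scl (- 1) t) <= M * (n.+1%:R^-1 + e).
  by apply: ler_wpM2l => //; apply: (near_near _ e0 (appP g n) hg); rewrite invr_ge0.
have h5 : M * n.+1%:R^-1 <= r / 2.
  rewrite (le_trans (ler_wpM2l M0 (ltW h2)))//.
  have -> : M * (r / (2 * (M + 1))) = (r / 2) * (M / (M + 1)) by field; lra.
  apply: ler_piMr; first exact: ltW.
  by rewrite ler_pdivrMr; lra.
rewrite mulrDr in h4.
move: (M * _) (M / _) (M * e) (d * _) h3 h4 h5 h6 h1 => x1 x2 x3 x4.
move: (cmod _) (cmod _) (cmod _) => y1 y2 y3; lra.
Qed.

Lemma hkip_lim f g (r : R) : 0 < r -> exists2 d : R, 0 < d <= 1 &
  forall e s t, 0 < e <= d -> near_form f s e -> near_form g t e -> cmod (hkip f g - form k s t) <= r.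
Proof.
move=> r0; have [B B0 hB] := near_nn f; have [B' B'0 hB'] := near_nn g.
pose K := B + 1 + B'; have K0 : 0 < K by rewrite /K; lra.
have d0 : 0 < Num.min 1 (r / K) by rewrite lt_min ltr01 divr_gt0.
exists (Num.min 1 (r / K)); first by rewrite d0 ge_min lexx.
move=> e s t; rewrite le_min => /andP[e0 /andP[e1 eK]] fs gt.
have e0' := ltW e0.
rewrite (le_trans (hkip_near e0' e0' fs gt))//.
have {}hB := hB _ _ e0' e1 fs; have {}hB' := hB' _ _ e0' e1 gt.
rewrite ler_pdivlMr// in eK; apply: le_trans eK.
rewrite [e * K]mulrC [e * nn _ _]mulrC -mulrDl ler_wpM2r// /K; lra.
Qed.

End Completion.

Section CompletionHilbert.
Variables (R : realType) (X : Type) (k : psdker R X).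
Implicit Types (s t u : seq (R[i] * X)) (f g h : hk k).

Lemma ceq (z w : R[i]) : (forall e : R, 0 < e -> cmod (z - w) <= e) -> z = w.
Proof.
move=> h; apply/eqP; rewrite -subr_eq0; apply/eqP/cmod_eq0/eps_eq0 => //.
exact: cmod_ge0.
Qed.

Lemma hkip_linear (c : R[i]) f g h : hkip (c *: f + g) h = c * hkip f h + hkip g h.
Proof.
apply: ceq => e e0; have c0 := cmod_ge0 c.
pose d := e / (cmod c + 2); have d0 : 0 < d by rewrite divr_gt0//; lra.
have [N1 h1] := svalP (cid (hkip_ex (c *: f + g) h)) _ d0.
have [N2 h2] := svalP (cid (hkip_ex f h)) _ d0.
have [N3 h3] := svalP (cid (hkip_ex g h)) _ d0.
pose n := maxn N1 (maxn N2 N3).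
have {}h1 := h1 n (leq_maxl _ _).
have {}h2 := h2 n (leq_trans (leq_maxl _ _) (leq_maxr _ _)).
have {}h3 := h3 n (leq_trans (leq_maxr _ _) (leq_maxr _ _)).
rewrite -!/(hkip _ _) in h1 h2 h3.
rewrite (_ : ev _ _ = c * ev f (app h n) + ev g (app h n)) in h1; last exact: ev_lin.
have -> : hkip (c *: f + g) h - (c * hkip f h + hkip g h) =
   (c * (ev f (app h n) - hkip f h) + (ev g (app h n) - hkip g h)) -
   (c * ev f (app h n) + ev g (app h n) - hkip (c *: f + g) h) by ring.
apply: le_trans (cmodD _ _) _; rewrite cmodN; apply: le_trans (lerD (cmodD _ _) (lexx _)) _.
rewrite cmodM; have h4 := ler_wpM2l c0 (ltW h2).
have -> : e = cmod c * d + d + d by rewrite /d; field; rewrite gt_eqF//; lra.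
apply: lerD; [apply: lerD => //|]; exact: ltW.
Qed.

Lemma hkip_conj f g : hkip g f = cj (hkip f g).
Proof.
apply: ceq => e e0; have e20 : 0 < e / 2 by rewrite divr_gt0.
have [d /andP[d0 d1] hd] := hkip_lim f g e20.
have [d' /andP[d'0 d'1] hd'] := hkip_lim g f e20.
pose r := Num.min d d'; have r0 : 0 < r by rewrite lt_min d0.
have [s hs] := hk_near f r0; have [t ht] := hk_near g r0.
have {hd}h1 := hd r s t; have {hd'}h2 := hd' r t s.
move: h1 h2; rewrite r0 !ge_min !lexx orbT => /(_ isT hs ht) h1 /(_ isT ht hs) h2.
have -> : hkip g f - cj (hkip f g) = (hkip g f - form k t s) - cj (hkip f g - form k s t).
  by rewrite conjD conjN (form_herm k s t); ring.
rewrite (le_trans (cmodD _ _))// cmodN cmodJ; lra.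
Qed.

Lemma hkip_ge0 f : 0 <= hkip f f.
Proof.
have h (e : R) : 0 < e -> - e <= complex.Re (hkip f f) /\ `|complex.Im (hkip f f)| <= e.
  move=> e0; have [d /andP[d0 d1] hd] := hkip_lim f f e0.
  have [s hs] := hk_near f d0.
  have {hd} := hd d s s; rewrite d0 lexx => /(_ isT hs hs) h1.
  have := le_trans (Re_cmod _) h1; have := le_trans (Im_cmod _) h1.
  have /cge0E -> := form_ge0 k s; have := form_ge0 k s.
  rewrite lecE => /andP[_ /=]; case: (hkip f f) => a b /= h2.
  rewrite subr0 => h3; rewrite ler_norml => /andP[h4 _]; split=> //; lra.
rewrite lecE/=; apply/andP; split.
  rewrite eq_sym; apply/eqP; apply/eqP; rewrite eq_sym -normr_eq0; apply/eqP.
  by rewrite -[LHS]/(`|complex.Im (hkip f f)|); apply: eps_eq0 => // e /h[].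
by apply/ler_addgt0Pr => e /h[]; rewrite -lerBlDr sub0r.
Qed.

Lemma hkip_emb f t : hkip f (emb k t) = ev f t.
Proof.
apply: ceq => e e0; have n0 := nn_ge0 k t.
pose d := e / (2 * (nn k t + 1)); have d0 : 0 < d by rewrite divr_gt0// mulr_gt0//; lra.
have [s hs] := hk_near f d0.
have ht : near_form k (emb k t) t 0 by exact: near_lst.
have := hkip_near (ltW d0) (lexx 0) hs ht; rewrite mulr0 add0r => h1.
have -> : hkip f (emb k t) - ev f t = (hkip f (emb k t) - form k s t) - (ev f t - form k s t).
  by ring.
rewrite (le_trans (cmodD _ _))// cmodN.
have h2 := hs t; have -> : e = d * nn k t + d * nn k t + 2 * d.
  by rewrite /d; field; rewrite gt_eqF//; lra.
by rewrite -[leLHS]addr0 lerD// ?lerD// mulr_ge0// ltW.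
Qed.

Definition hn f : R := Num.sqrt (complex.Re (hkip f f)).

Lemma hn_ge0 f : 0 <= hn f. Proof. exact: sqrtr_ge0. Qed.

Lemma hn_sq f : hkip f f = (hn f ^+ 2)%:C.
Proof.
rewrite /hn sqr_sqrtr; first exact/cge0E/hkip_ge0.
by rewrite -ler0c -cge0E// hkip_ge0.
Qed.

Lemma hkipDl f g h : hkip (f + g) h = hkip f h + hkip g h.
Proof. by have := hkip_linear 1 f g h; rewrite scale1r mul1r. Qed.

Lemma hkip0l h : hkip 0 h = 0.
Proof. by apply: (addrI (hkip 0 h)); rewrite -hkipDl !addr0. Qed.

Lemma hkipZl c f h : hkip (c *: f) h = c * hkip f h.
Proof. by have := hkip_linear c f 0 h; rewrite hkip0l !addr0. Qed.

Lemma hkipDr f g h : hkip h (f + g) = hkip h f + hkip h g.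
Proof. by rewrite hkip_conj hkipDl conjD -!hkip_conj. Qed.

Lemma hkipZr c f h : hkip h (c *: f) = cj c * hkip h f.
Proof. by rewrite hkip_conj hkipZl conjM -!hkip_conj. Qed.

Lemma hk_CS f g : cmod (hkip f g) <= hn f * hn g.
Proof.
apply: psd_CS => [||c]; [exact: hkip_ge0|exact: hkip_conj|].
have := hkip_ge0 (f + c *: g).
by rewrite hkipDl !hkipDr !hkipZl !hkipZr; congr (_ <= _); ring.
Qed.

Lemma hnD f g : hn (f + g) <= hn f + hn g.
Proof.
rewrite -(ler_pXn2r (ltn0Sn 1)) ?nnegrE ?addr_ge0 ?hn_ge0//.
rewrite -lecR -hn_sq hkipDl !hkipDr (hkip_conj f g) !hn_sq.
rewrite -[leLHS]addrA [X in _ + X]addrA addcJ -(rmorph_nat (real_complex R)).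
rewrite -!rmorphM -!rmorphD/= lecR sqrrD -mulr_natl.
by have := le_trans (Re_le_cmod _) (hk_CS f g); lra.
Qed.

Lemma hnZ c f : hn (c *: f) = cmod c * hn f.
Proof.
rewrite [LHS]/hn hkipZl hkipZr mulrA mulcJ hn_sq -rmorphM/=.
by rewrite -exprMn sqrtr_sqr ger0_norm ?mulr_ge0 ?cmod_ge0 ?hn_ge0.
Qed.

Lemma hn_emb s : hn (emb k s) = nn k s.
Proof. by rewrite /hn hkip_emb (ev_lst k s s). Qed.

Lemma ev_hn f t : cmod (ev f t) <= hn f * nn k t.
Proof. by rewrite -hkip_emb -hn_emb hk_CS. Qed.

Lemma ev1 f x : ev f [:: (1, x)] = f x.
Proof. by rewrite /ev big_seq1 (conjc1 R) mul1r. Qed.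

Lemma hn_eq0 f : hn f = 0 -> f = 0.
Proof.
move=> f0; apply/val_inj/funext => x.
apply: cmod_eq0; have := ev_hn f [:: (1, x)]; rewrite f0 mul0r ev1 => h.
by apply/le_anti; rewrite h cmod_ge0.
Qed.

Definition hknorm f : R[i] := (hn f)%:C.

Lemma hknormD f g : hknorm (f + g) <= hknorm f + hknorm g.
Proof. by rewrite -rmorphD/= lecR hnD. Qed.

Lemma hknormZ (c : R[i]) f : hknorm (c *: f) = `|c| * hknorm f.
Proof. by rewrite /hknorm hnZ rmorphM/= -cmodE. Qed.

Lemma hknorm_eq0 f : hknorm f = 0 -> f = 0.
Proof. by move=> /complexI/hn_eq0. Qed.

HB.instance Definition _ := Lmodule_isNormed.Build R[i] (hk k) hknormD hknormZ hknorm_eq0.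

Lemma nrm_hk f : nrm f = hn f. Proof. by []. Qed.

Lemma hk_dense f (e : R) : 0 < e -> exists s, nrm (f - emb k s) < e.
Proof.
move=> e0; have [B B0 hB] := near_nn f.
have q0 : 0 < e ^+ 2 / 2 by rewrite divr_gt0// exprn_gt0.
have [d /andP[d0 d1] hd] := hkip_lim f f q0.
(* The square of |f - s| is <f, f> - <s, s> minus twice the real part of [ev f s - form k s s]. The
   choice of [d] bounds the first difference by e^2 / 2; the second bound on r, with [nn k s <= B],
   keeps the rest below e^2 / 2. *)
pose r := Num.min d (e ^+ 2 / (4 * (B + 1))).
have r0 : 0 < r by rewrite lt_min d0 divr_gt0 ?exprn_gt0 ?mulr_gt0//; lra.
have [s hs] := hk_near f r0; exists s.
have rd : r <= d by rewrite ge_min lexx.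
have {hd} := hd r s s; rewrite r0 rd => /(_ isT hs hs) h1.
have h2 := hs s; have h3 := hB _ _ (ltW r0) (le_trans rd d1) hs.
rewrite nrm_hk -(ltr_pXn2r (ltn0Sn 1)) ?nnegrE ?hn_ge0 ?ltW//.
rewrite -ltcR -hn_sq.
have eqD : hkip (f - emb k s) (f - emb k s) = (hkip f f - form k s s)
   - ((ev f s - form k s s) + cj (ev f s - form k s s)).
  rewrite -scaleN1r hkipDl !hkipDr !hkipZl !hkipZr (hkip_conj f (emb k s)) !hkip_emb.
  rewrite (ev_lst k s s) conjD !conjN conjc1 -(form_herm k s s); ring.
rewrite [ltLHS]cge0E ?hkip_ge0// ltcR; apply: le_lt_trans (Re_le_cmod _) _.
rewrite eqD; apply: le_lt_trans (cmodD _ _) _; rewrite cmodN.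
apply: le_lt_trans (lerD (lexx _) (cmodD _ _)) _; rewrite cmodJ.
have h4 : r * nn k s <= e ^+ 2 / (4 * (B + 1)) * B.
  by apply: ler_pM; rewrite ?nn_ge0 ?(ltW r0)// ge_min lexx orbT.
have h5 : e ^+ 2 / (4 * (B + 1)) * B < e ^+ 2 / 4.
  have -> : e ^+ 2 / (4 * (B + 1)) * B = e ^+ 2 / 4 * (B / (B + 1)).
    by field; rewrite gt_eqF//; lra.
  by rewrite gtr_pMr ?divr_gt0 ?exprn_gt0// ltr_pdivrMr; lra.
move: (e ^+ 2) (_ * B) (r * _) h1 h2 h4 h5 => x1 x2 x3; lra.
Qed.

(** The norm is the dual norm on formal sums: f is paired with an approximant of itself. This
    converts estimates of [ev] into norm estimates in the proof of completeness. *)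
Lemma hn_le_ev f (e : R) : 0 <= e -> (forall t, cmod (ev f t) <= e * nn k t) -> hn f <= e.
Proof.
move=> e0 h; apply: nrm_le_of_sq_real; rewrite ?hn_ge0//.
suff key (r : R) : 0 < r -> hn f ^+ 2 <= e * hn f + r.
  by apply/ler_addgt0Pr => r; exact: key.
move=> r0; pose d := r / (hn f + e + 1).
have n0 := hn_ge0 f; have K0 : 0 < hn f + e + 1 by lra.
have [s hs] := hk_dense f (divr_gt0 r0 K0); rewrite -/d nrm_hk in hs.
have -> : hn f ^+ 2 = cmod (hkip f (f - emb k s) + ev f s).
  rewrite -hkip_emb -hkipDr subrK hn_sq cmodR ger0_norm//; exact: sqr_ge0.
apply: le_trans (cmodD _ _) _; apply: le_trans (lerD (hk_CS _ _) (h s)) _.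
have h1 : nn k s <= hn f + d.
  have e1 : -1 *: (f - emb k s) + f = emb k s by rewrite scaleN1r opprB subrK.
  have := hnD (-1 *: (f - emb k s)) f.
  by rewrite e1 hnZ cmodN cmod1 mul1r hn_emb; lra.
have h2 : hn f * hn (f - emb k s) <= hn f * d by rewrite ler_wpM2l// ltW.
have h3 : e * nn k s <= e * hn f + e * d by rewrite -mulrDr ler_wpM2l.
have h4 : r = hn f * d + e * d + d by rewrite /d; field; rewrite gt_eqF.
have d0 : 0 < d by rewrite divr_gt0.
by move: (hn f * _) (e * nn k s) (e * d) (e * hn f) (hn f * d) h2 h3 h4 => x1 x2 x3 x4 x5; lra.
Qed.

Lemma hkB f g x : (f - g : hk k) x = f x - g x.
Proof. by []. Qed.

Lemma evB f g t : ev (f - g : hk k) t = ev f t - ev g t.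
Proof.
rewrite /ev -sumrB; apply: eq_bigr => b _.
by rewrite hkB mulrBr.
Qed.

(** Evaluation at a label is bounded, so a Cauchy sequence converges pointwise; the rate is then
    recovered on every formal sum by comparing [G] with a far term of the sequence. *)
Lemma hk_seq_complete (a : nat -> hk k) :
  (forall m n, nrm (a m - a n) <= m.+1%:R^-1 + n.+1%:R^-1) ->
  exists g, forall n, nrm (g - a n) <= n.+1%:R^-1.
Proof.
move=> ac.
have aev m n t : cmod (ev (a m) t - ev (a n) t) <= (m.+1%:R^-1 + n.+1%:R^-1) * nn k t.
  rewrite -evB; apply: le_trans (ev_hn _ _) _.
  by apply: ler_wpM2r; rewrite ?nn_ge0// -nrm_hk.
have exG x : exists l : R[i], forall e : R, 0 < e ->
    exists N, forall n, (N <= n)%N -> cmod (a n x - l) < e.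
  apply: cplx_cvg => e e0; pose c := nn k [:: (1, x)].
  have c0 : 0 <= c := nn_ge0 _ _.
  have q0 : 0 < e / (2 * (c + 1)) by rewrite divr_gt0// mulr_gt0//; lra.
  have [N NP] := inv_small q0; exists N => m n /NP hm /NP hn.
  have := aev m n [:: (1, x)]; rewrite !ev1 -/c => h; apply: le_lt_trans h _.
  have -> : e = (e / (2 * (c + 1)) + e / (2 * (c + 1))) * (c + 1).
    by field; rewrite gt_eqF//; lra.
  apply: le_lt_trans (_ : _ <= (m.+1%:R^-1 + n.+1%:R^-1) * (c + 1)) _.
    by apply: ler_wpM2l; rewrite ?addr_ge0 ?invr_ge0//; lra.
  by rewrite ltr_pM2r ?ltrD//; lra.
pose G x := sval (cid (exG x)).
have GP x := svalP (cid (exG x)); rewrite -/(G _) in GP.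
have Gev t (e : R) : 0 < e -> exists N, forall n, (N <= n)%N -> cmod (ev G t - ev (a n) t) <= e.
  elim: t e => [|b t IH] e e0; first by exists 0%N => n _; rewrite /ev !big_nil subrr cmod0 ltW.
  have c0 := cmod_ge0 b.1.
  have q0 : 0 < e / (2 * (cmod b.1 + 1)) by rewrite divr_gt0// mulr_gt0//; lra.
  have e20 : 0 < e / 2 by rewrite divr_gt0.
  have [N1 h1] := GP b.2 _ q0; have [N2 h2] := IH _ e20.
  exists (maxn N1 N2) => n; rewrite geq_max => /andP[/h1 {}h1 /h2 {}h2].
  rewrite /ev !big_cons -/(ev G t) -/(ev (a n) t) opprD addrACA -mulrBr.
  apply: le_trans (cmodD _ _) _; rewrite cmodM cmodJ cmodB.
  have : cmod b.1 * cmod (a n b.2 - G b.2) <= e / 2.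
    apply: le_trans (ler_wpM2l c0 (ltW h1)) _.
    have -> : cmod b.1 * (e / (2 * (cmod b.1 + 1))) = e / 2 * (cmod b.1 / (cmod b.1 + 1)).
      by field; rewrite gt_eqF//; lra.
    by apply: ler_piMr; [exact: ltW|rewrite ler_pdivrMr; lra].
  lra.
have Gn n t : cmod (ev G t - ev (a n) t) <= n.+1%:R^-1 * nn k t.
  suff key (e : R) : 0 < e -> cmod (ev G t - ev (a n) t) <= n.+1%:R^-1 * nn k t + e.
    by apply/ler_addgt0Pr => e; exact: key.
  move=> e0; have t0 := nn_ge0 k t.
  have e20 : 0 < e / 2 by rewrite divr_gt0.
  have q0 : 0 < e / (2 * (nn k t + 1)) by rewrite divr_gt0// mulr_gt0//; lra.
  have [N1 h1] := Gev t _ e20; have [N2 h2] := inv_small q0.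
  pose m := maxn N1 N2; have {}h1 := h1 m (leq_maxl _ _); have {}h2 := h2 m (leq_maxr _ _).
  have -> : ev G t - ev (a n) t = (ev G t - ev (a m) t) + (ev (a m) t - ev (a n) t) by ring.
  apply: le_trans (cmodD _ _) _; apply: le_trans (lerD h1 (aev m n t)) _.
  have h5 : m.+1%:R^-1 * nn k t <= e / 2.
    apply: le_trans (ler_wpM2r t0 (ltW h2)) _.
    have -> : (e / (2 * (nn k t + 1))) * nn k t = e / 2 * (nn k t / (nn k t + 1)).
      by field; rewrite gt_eqF//; lra.
    by apply: ler_piMr; [exact: ltW|rewrite ler_pdivrMr; lra].
  rewrite mulrDl; move: (n.+1%:R^-1 * _) (m.+1%:R^-1 * _) h5 => x y; lra.
(* A late term approximates [G], and an approximant of that term approximates [G] as well. *)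
have Gin : (G : X -> (R[i])^o) \in hk_pred k.
  apply/asboolP => e e0; have e20 : 0 < e / 2 by rewrite divr_gt0.
  have [N NP] := inv_small e20; have {}NP := NP N (leqnn _).
  exists (app (a N) N) => t.
  have -> : ev G t - form k (app (a N) N) t =
    (ev G t - ev (a N) t) + (ev (a N) t - form k (app (a N) N) t) by ring.
  apply: le_trans (cmodD _ _) _; apply: le_trans (lerD (Gn _ _) (appP _ _ _)) _.
  by rewrite -mulrDl; apply: ler_wpM2r; rewrite ?nn_ge0// [leRHS]splitr lerD// ltW.
exists (Hk Gin) => n; rewrite nrm_hk; apply: hn_le_ev => [|t]; first by rewrite invr_ge0.
by rewrite evB; exact: Gn.
Qed.

Lemma hk_complete (F : set_system (hk k)) : ProperFilter F -> cauchy F -> cvg F.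
Proof.
move=> FF /cauchyP Fc.
(* Centres of balls belonging to the filter form a sequence with an explicit Cauchy rate, because
   any two members of a proper filter meet. *)
have r n : exists f, F (ball f (n.+1%:R^-1 : R)%:C).
  by apply: Fc; rewrite ltcR invr_gt0.
pose a n := sval (cid (r n)); have aP n : F (ball (a n) (n.+1%:R^-1 : R)%:C) := svalP (cid (r n)).
have ballE f g (e : R) : ball f e%:C g = (nrm (f - g) < e).
  by rewrite -ball_normE /ball_/= ltC_nrm.
have [|G hG] := @hk_seq_complete a.
  move=> m n; have [g [h1 h2]] := filter_ex (filterI (aP m) (aP n)).
  rewrite /= !ballE in h1 h2.
  apply: le_trans (nrm_triangle (a m) g (a n)) _.
  by rewrite (nrmB g) lerD ?ltW.
apply/cvg_ex; exists G; apply/cvg_ballP => _ /cpos_ex[e e0 ->].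
have e20 : 0 < e / 2 by rewrite divr_gt0.
have [N NP] := inv_small e20; have {}NP := NP N (leqnn _).
apply: filterS (aP N) => g; rewrite !ballE => h.
apply: le_lt_trans (nrm_triangle G (a N) g) _.
by rewrite [e]splitr ler_ltD ?(lt_trans h)// (le_trans (hG N))// ltW.
Qed.

HB.instance Definition _ := Uniform_isComplete.Build (hk k) hk_complete.

Lemma hkip_lin g : linear ((fun f => hkip f g) : hk k -> (R[i])^o).
Proof. by move=> c f h; exact: hkip_linear. Qed.

Lemma hknorm_sq f : `|f| ^+ 2 = hkip f f.
Proof. by rewrite hn_sq rmorphXn. Qed.

(** The Kolmogorov decomposition of [k]. The tensor products, finite powers, dilation spaces and
    essential subspaces used below are all of this form for suitable label sets. *)
Definition kolm : hilbert R := @Hilbert R (hk k) (@hkip R X k) hkip_lin hkip_conj hknorm_sq.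

Definition pt (x : X) : kolm := emb k [:: (1, x)].

Lemma ip_pt x y : ip (pt x) (pt y) = k x y.
Proof.
rewrite [LHS]hkip_emb (ev_lst k [:: (1, x)] [:: (1, y)]) /form !big_seq1.
by rewrite (conjc1 R) !mul1r.
Qed.

Lemma kolm_dense (f : kolm) (e : R) : 0 < e ->
  exists s : seq (R[i] * X), nrm (f - \sum_(a <- s) a.1 *: pt a.2) < e.
Proof.
move=> e0; have [s hs] := hk_dense f e0; exists s.
suff -> : \sum_(a <- s) a.1 *: pt a.2 = emb k s by [].
elim: s {hs} => [|a s IH].
  by rewrite big_nil; apply/val_inj/funext => x; rewrite /= /lst big_nil.
rewrite big_cons IH; apply/val_inj/funext => x.
transitivity (a.1 * lst k [:: (1, a.2)] x + lst k s x) => //.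
by rewrite /lst [RHS]big_cons big_seq1 mul1r.
Qed.

End CompletionHilbert.

(** * Extension of Lipschitz maps from dense families *)

Section DenseExtension.
Variables (R : realType) (V W : normedModType R[i]).
Hypothesis W_complete : forall u : nat -> W,
  (forall e : R, 0 < e -> exists N, forall m n, (N <= m)%N -> (N <= n)%N -> nrm (u m - u n) < e) ->
  exists l, forall e : R, 0 < e -> exists N, forall n, (N <= n)%N -> nrm (u n - l) < e.
Variables (Y : Type) (p : Y -> V) (q : Y -> W) (M : R).
Hypothesis M0 : 0 <= M.
Hypothesis p_dense : forall f (e : R), 0 < e -> exists y, nrm (f - p y) < e.
Hypothesis pq : forall y y', nrm (q y - q y') <= M * nrm (p y - p y').

(** [p] and [q] live on a bare index set, so several indices may name the same point; the Lipschitz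
    hypothesis alone makes [U] well defined. Completeness of the target is a sequential hypothesis,
    so that Hilbert spaces and the complex numbers can both be used. *)
Lemma dense_ext : exists U : V -> W, forall f y, nrm (U f - q y) <= M * nrm (f - p y).
Proof.
suff ex f : exists l, forall y, nrm (l - q y) <= M * nrm (f - p y).
  by exists (fun f => sval (cid (ex f))) => f y; exact: svalP (cid (ex f)) y.
have M1 : 0 < M + 1 by rewrite ltr_wpDl.
pose a n := sval (cid (p_dense f (invr_gt0_nat R n))).
have aP n : nrm (f - p (a n)) < n.+1%:R^-1 := svalP (cid (p_dense f (invr_gt0_nat R n))).
have [e e0|l hl] := W_complete (u := q \o a).
  have q0 : 0 < e / (2 * (M + 1)) by rewrite divr_gt0// mulr_gt0.
  have [N NP] := inv_small q0; exists N => m n /NP hm /NP hn.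
  apply: le_lt_trans (pq _ _) _; apply: le_lt_trans (ler_wpM2l M0 (nrm_triangle _ f _)) _.
  rewrite (nrmB _ f).
  have h1 := lt_trans (aP m) hm; have h2 := lt_trans (aP n) hn.
  apply: le_lt_trans (ler_wpM2l M0 (ltW (ltrD h1 h2))) _.
  have -> : M * (e / (2 * (M + 1)) + e / (2 * (M + 1))) = e * (M / (M + 1)).
    by field; rewrite gt_eqF.
  by rewrite gtr_pMr// ltr_pdivrMr// mul1r ltrDl.
exists l => y.
suff key (e : R) : 0 < e -> nrm (l - q y) <= M * nrm (f - p y) + e.
  by apply/ler_addgt0Pr => e; exact: key.
move=> e0; have e20 : 0 < e / 2 by rewrite divr_gt0.
have q0 : 0 < e / (2 * (M + 1)) by rewrite divr_gt0// mulr_gt0.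
have [N1 h1] := hl _ e20; have [N2 h2] := inv_small q0.
pose n := maxn N1 N2; have {}h1 := h1 n (leq_maxl _ _); have {}h2 := h2 n (leq_maxr _ _).
apply: le_trans (nrm_triangle _ (q (a n)) _) _; rewrite nrmB.
have h3 := le_trans (pq (a n) y) (ler_wpM2l M0 (nrm_triangle _ f _)).
rewrite (nrmB _ f) in h3.
have h4 := ler_wpM2l M0 (ltW (lt_trans (aP n) h2)).
have h5 : M * (e / (2 * (M + 1))) <= e / 2.
  have -> : M * (e / (2 * (M + 1))) = e / 2 * (M / (M + 1)) by field; rewrite gt_eqF.
  by apply: ler_piMr; [exact: ltW|rewrite ler_pdivrMr ?mul1r ?lerDl//].
rewrite mulrDr in h3; apply: le_trans (lerD (ltW h1) h3) _.
move: (M * nrm (f - p y)) (M * nrm (f - p (a n))) (M * _) h4 h5 => x1 x2 x3; lra.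
Qed.

End DenseExtension.

Section Linear.
Variable R : realType.

Lemma linDZ (V W : lmodType R[i]) (u : V -> W) : linear u ->
  [/\ u 0 = 0, forall x y, u (x + y) = u x + u y & forall c x, u (c *: x) = c *: u x].
Proof.
move=> ul; have uD x y : u (x + y) = u x + u y by have := ul 1 x y; rewrite !scale1r.
have u0 : u 0 = 0 by apply: (addrI (u 0)); rewrite -uD !addr0.
by split=> // c x; have := ul c x 0; rewrite u0 !addr0.
Qed.

Lemma lin_sum (V W : lmodType R[i]) (u : V -> W) : linear u -> forall I (s : seq I) (F : I -> V),
  u (\sum_(i <- s) F i) = \sum_(i <- s) u (F i).
Proof.
move=> /linDZ[u0 uD _] I s F; elim: s => [|i s IH]; first by rewrite !big_nil.
by rewrite !big_cons uD IH.
Qed.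

Lemma linB (V W : lmodType R[i]) (u : V -> W) : linear u ->
  forall x y, u (x - y) = u x - u y.
Proof. by move=> /linDZ[_ uD uZ] x y; rewrite uD -scaleN1r uZ scaleN1r. Qed.

Lemma bounded_opM (H : hilbert R) (u : H -> H) : bounded_op u ->
  exists2 M : R, 0 <= M & forall x, nrm (u x) <= M * nrm x.
Proof.
move=> [_ [M hM]]; exists `|M| => // x; apply: le_trans (hM x) _.
by rewrite ler_wpM2r ?nrm_ge0// ler_norm.
Qed.

End Linear.

Section KolmOperators.
Variables (R : realType) (X : Type) (k : psdker R X).

Definition span (s : seq (R[i] * X)) : kolm k := \sum_(a <- s) a.1 *: pt k a.2.

Lemma span_dense (f : kolm k) (e : R) : 0 < e -> exists s, nrm (f - span s) < e.
Proof. exact: kolm_dense. Qed.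

Lemma span_cat s t : span (s ++ t) = span s + span t.
Proof. by rewrite /span big_cat. Qed.

Lemma span_scl c s : span (scl c s) = c *: span s.
Proof.
by rewrite /span big_map scaler_sumr; apply: eq_bigr => a _; rewrite scalerA.
Qed.

Lemma lift_op (H : hilbert R) (T : X -> H) (M : R) : 0 <= M ->
  (forall s, nrm (\sum_(a <- s) a.1 *: T a.2) <= M * nrm (span s)) ->
  exists U : kolm k -> H, [/\ linear U, forall f, nrm (U f) <= M * nrm f &
    forall x, U (pt k x) = T x].
Proof.
move=> M0 hT; pose TT (s : seq (R[i] * X)) := \sum_(a <- s) a.1 *: T a.2.
have TTcat s t : TT (s ++ t) = TT s + TT t by rewrite /TT big_cat.
have TTscl c s : TT (scl c s) = c *: TT s.
  by rewrite /TT big_map scaler_sumr; apply: eq_bigr => a _; rewrite scalerA.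
have hTT s t : nrm (TT s - TT t) <= M * nrm (span s - span t).
  have := hT (s ++ scl (-1) t); rewrite -/(TT _) TTcat TTscl span_cat span_scl.
  by rewrite !scaleN1r.
have [U UP] := dense_ext (@nrm_cvg R H) M0 span_dense hTT.
have Us s : U (span s) = TT s.
  apply/eqP; rewrite -subr_eq0; apply/eqP/nrm_eq0/le_anti; rewrite nrm_ge0 andbT.
  by apply: le_trans (UP _ s) _; rewrite subrr nrm0 mulr0.
exists U; split.
- move=> c f g; apply/eqP; rewrite -subr_eq0; apply/eqP/nrm_eq0/eps_eq0 => [|e e0].
    exact: nrm_ge0.
  have c0 := cmod_ge0 c; pose d := e / (2 * (M + 1) * (cmod c + 1)).
  have M1 : 0 < M + 1 by rewrite ltr_wpDl.
  have c1 : 0 < cmod c + 1 by lra.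
  have d0 : 0 < d by rewrite divr_gt0// !mulr_gt0.
  have [s hs] := span_dense f d0; have [t ht] := span_dense g d0.
  have h1 := UP (c *: f + g) (scl c s ++ t).
  have e1 : c *: f + g - (c *: span s + span t) = c *: (f - span s) + (g - span t).
    by rewrite scalerBr opprD addrACA.
  rewrite TTcat TTscl span_cat span_scl e1 in h1.
  have h2 := UP f s; have h3 := UP g t.
  have -> : U (c *: f + g) - (c *: U f + U g) = (U (c *: f + g) - (c *: TT s + TT t))
     - (c *: (U f - TT s) + (U g - TT t)).
    have -> : c *: (U f - TT s) + (U g - TT t) = c *: U f + U g - (c *: TT s + TT t).
      by rewrite scalerBr addrACA opprD.
    by rewrite opprB addrA subrK.
  apply: le_trans (nrmD _ _) _; rewrite nrmN.
  apply: le_trans (lerD h1 (nrmD _ _)) _; rewrite nrmZ.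
  have h4 : nrm (c *: (f - span s) + (g - span t)) <= cmod c * d + d.
    apply: le_trans (nrmD _ _) _; rewrite nrmZ; apply: lerD; last exact: ltW.
    by apply: ler_wpM2l => //; exact: ltW.
  have h5 := ler_wpM2l M0 h4.
  have h6 := ler_wpM2l c0 (le_trans h2 (ler_wpM2l M0 (ltW hs))).
  have h7 := le_trans h3 (ler_wpM2l M0 (ltW ht)).
  apply: le_trans (lerD h5 (lerD h6 h7)) _.
  have -> : M * (cmod c * d + d) + (cmod c * (M * d) + M * d) = M * (2 * (cmod c + 1) * d) by ring.
  have -> : M * (2 * (cmod c + 1) * d) = e * (M / (M + 1)).
    by rewrite /d; field; rewrite !gt_eqF.
  by apply: ler_piMr; [exact: ltW|rewrite ler_pdivrMr ?mul1r ?lerDl//].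
- by move=> f; have := UP f [::]; rewrite /TT /span !big_nil !subr0.
- by move=> x; have := Us [:: (1, x)]; rewrite /span /TT !big_seq1 !scale1r.
Qed.

Lemma kolm_op_ext (H : hilbert R) (U U' : kolm k -> H) (M M' : R) :
  linear U -> linear U' -> (forall f, nrm (U f) <= M * nrm f) ->
  (forall f, nrm (U' f) <= M' * nrm f) ->
  (forall x, U (pt k x) = U' (pt k x)) -> forall f, U f = U' f.
Proof.
move=> Ul U'l hM hM' UU' f.
have sp s : U (span s) = U' (span s).
  rewrite /span (lin_sum Ul) (lin_sum U'l); apply: eq_bigr => a _.
  by have [_ _ ->] := linDZ Ul; have [_ _ ->] := linDZ U'l; rewrite UU'.
apply/eqP; rewrite -subr_eq0; apply/eqP/nrm_eq0/eps_eq0 => [|e e0]; first exact: nrm_ge0.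
pose K := `|M| + `|M'| + 1; have K0 : 0 < K by rewrite ltr_wpDl ?addr_ge0.
have [s hs] := span_dense f (divr_gt0 e0 K0).
have -> : U f - U' f = U (f - span s) - U' (f - span s).
  by rewrite (linB Ul) (linB U'l) sp opprB addrA subrK.
apply: le_trans (nrmD _ _) _; rewrite nrmN; apply: le_trans (lerD (hM _) (hM' _)) _.
rewrite -mulrDl; apply: le_trans (_ : K * nrm (f - span s) <= _).
  rewrite ler_wpM2r ?nrm_ge0// /K; have := ler_norm M; have := ler_norm M'; lra.
by rewrite -ler_pdivlMl// mulrC ltW.
Qed.

Lemma ip_span_ext (x y : kolm k) : (forall z, ip x (pt k z) = ip y (pt k z)) -> x = y.
Proof.
move=> h; apply: (@ip_ext R _ (range span)) => [f e e0|_ [s _ <-]].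
  by have [s hs] := span_dense f e0; exists (span s) => //; exists s.
by rewrite !ip_sumr; apply: eq_bigr => a _; rewrite !ipZr h.
Qed.

Lemma kolm_adj (U U' : kolm k -> kolm k) (M M' : R) :
  linear U -> linear U' -> (forall f, nrm (U f) <= M * nrm f) ->
  (forall f, nrm (U' f) <= M' * nrm f) ->
  (forall x y, ip (U (pt k x)) (pt k y) = ip (pt k x) (U' (pt k y))) ->
  forall f g, ip (U f) g = ip f (U' g).
Proof.
move=> Ul U'l hM hM' UU' f g.
have sp s t : ip (U (span s)) (span t) = ip (span s) (U' (span t)).
  rewrite /span (lin_sum Ul) (lin_sum U'l) !ip_suml; apply: eq_bigr => a _.
  rewrite !ip_sumr; apply: eq_bigr => b _.
  have [_ _ ->] := linDZ Ul; have [_ _ ->] := linDZ U'l.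
  by rewrite !ipZl !ipZr UU'.
pose L := `|M| + `|M'| + 1; have L0 : 0 < L by rewrite ltr_wpDl ?addr_ge0.
have UL h : nrm (U h) <= L * nrm h.
  apply: le_trans (hM h) _; rewrite ler_wpM2r ?nrm_ge0// /L; have := ler_norm M.
  by have := normr_ge0 M'; lra.
have U'L h : nrm (U' h) <= L * nrm h.
  apply: le_trans (hM' h) _; rewrite ler_wpM2r ?nrm_ge0// /L; have := ler_norm M'.
  by have := normr_ge0 M; lra.
apply: ceq => e e0.
pose K := 2 * L * (nrm f + nrm g + 1); have f0 := nrm_ge0 f; have g0 := nrm_ge0 g.
have K0 : 0 < K by rewrite !mulr_gt0//; lra.
(* The bound d <= 1 keeps the norm of [span s] below nrm f + 1, which is built into [K]. *)
pose d := Num.min 1 (e / K); have d0 : 0 < d by rewrite lt_min ltr01 divr_gt0.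
have d1 : d <= 1 by rewrite ge_min lexx.
have dK : d * K <= e by rewrite -ler_pdivlMr// ge_min lexx orbT.
have [s hs] := span_dense f d0; have [t ht] := span_dense g d0.
have -> : ip (U f) g - ip f (U' g) = ip (U (f - span s)) g + ip (U (span s)) (g - span t)
  - ip (f - span s) (U' g) - ip (span s) (U' (g - span t)).
  by rewrite (linB Ul) (linB U'l) !ipBl !ipBr sp; ring.
have ns : nrm (span s) <= nrm f + 1.
  apply: le_trans (nrm_sub _ f) _; rewrite nrmB; lra.
have a1 : cmod (ip (U (f - span s)) g) <= d * L * nrm g.
  apply: le_trans (cauchy_schwarz _ _) _; rewrite ler_wpM2r//.
  by apply: le_trans (UL _) _; rewrite mulrC ler_wpM2r ?ltW.
have a2 : cmod (ip (U (span s)) (g - span t)) <= L * (nrm f + 1) * d.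
  apply: le_trans (cauchy_schwarz _ _) _; apply: ler_pM; rewrite ?nrm_ge0 ?(ltW ht)//.
  by apply: le_trans (UL _) _; rewrite ler_wpM2l// ltW.
have a3 : cmod (ip (f - span s) (U' g)) <= d * (L * nrm g).
  by apply: le_trans (cauchy_schwarz _ _) _; apply: ler_pM; rewrite ?nrm_ge0 ?(ltW hs).
have a4 : cmod (ip (span s) (U' (g - span t))) <= (nrm f + 1) * (L * d).
  apply: le_trans (cauchy_schwarz _ _) _; apply: ler_pM; rewrite ?nrm_ge0//.
  by apply: le_trans (U'L _) _; rewrite ler_wpM2l// ltW.
apply: le_trans dK.
have -> : d * K = d * L * nrm g + L * (nrm f + 1) * d + d * (L * nrm g) + (nrm f + 1) * (L * d).
  by rewrite /K; ring.
do 3 (apply: le_trans (cmodD _ _) _; rewrite ?cmodN; apply: lerD => //).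
Qed.

End KolmOperators.

(** * C*-algebras and their representations *)

Section CstarBasics.
Variables (R : realType) (A : cstarAlg R).
Implicit Types (a b c : A) (l : R[i]).

Lemma csA a b c : cs_mul a (cs_mul b c) = cs_mul (cs_mul a b) c.
Proof. by case: A a b c. Qed.

Lemma cs_linr a : linear (cs_mul a).
Proof. by case: A a. Qed.

Lemma cs_linl b : linear ((cs_mul (c:=A))^~ b).
Proof. by case: A b. Qed.

Lemma cs_star_lin l a b : cs_star (l *: a + b) = cj l *: cs_star a + cs_star b.
Proof. by case: A l a b. Qed.

Lemma csK a : cs_star (cs_star a) = a.
Proof. by case: A a. Qed.

Lemma cs_starM a b : cs_star (cs_mul a b) = cs_mul (cs_star b) (cs_star a).
Proof. by case: A a b. Qed.

Lemma cs_nrmM a b : nrm (cs_mul a b) <= nrm a * nrm b.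
Proof. by rewrite -lecR rmorphM/= -!nrmE; case: A a b. Qed.

Lemma cs_nrmC a : nrm (cs_mul (cs_star a) a) = nrm a ^+ 2.
Proof. by apply: complexI; rewrite rmorphXn/= -!nrmE; case: A a. Qed.

Lemma csDr a b c : cs_mul a (b + c) = cs_mul a b + cs_mul a c.
Proof. by have [_ h _] := linDZ (cs_linr a). Qed.

Lemma csDl a b c : cs_mul (a + b) c = cs_mul a c + cs_mul b c.
Proof. by have [_ h _] := linDZ (cs_linl c); exact: h. Qed.

Lemma csBr a b c : cs_mul a (b - c) = cs_mul a b - cs_mul a c.
Proof. exact: (linB (cs_linr a)). Qed.

Lemma csBl a b c : cs_mul (a - b) c = cs_mul a c - cs_mul b c.
Proof. exact: (linB (cs_linl c)). Qed.

Lemma csZr l a b : cs_mul a (l *: b) = l *: cs_mul a b.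
Proof. by have [_ _ h] := linDZ (cs_linr a). Qed.

Lemma csZl l a b : cs_mul (l *: a) b = l *: cs_mul a b.
Proof. by have [_ _ h] := linDZ (cs_linl b); exact: h. Qed.

Lemma cs0l a : cs_mul 0 a = 0.
Proof. by have [h _ _] := linDZ (cs_linl a); exact: h. Qed.

Lemma cs0r a : cs_mul a 0 = 0.
Proof. by have [h _ _] := linDZ (cs_linr a). Qed.

Lemma cs_starD a b : cs_star (a + b) = cs_star a + cs_star b.
Proof. by have := cs_star_lin 1 a b; rewrite (conjc1 R) !scale1r. Qed.

Lemma cs_star0 : cs_star (0 : A) = 0.
Proof. by apply: (addrI (cs_star 0)); rewrite -cs_starD !addr0. Qed.

Lemma cs_starZ l a : cs_star (l *: a) = cj l *: cs_star a.
Proof. by have := cs_star_lin l a 0; rewrite cs_star0 !addr0. Qed.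

Lemma cs_starN a : cs_star (- a) = - cs_star a.
Proof. by rewrite -scaleN1r cs_starZ conjN (conjc1 R) scaleN1r. Qed.

Lemma cs_starB a b : cs_star (a - b) = cs_star a - cs_star b.
Proof. by rewrite cs_starD cs_starN. Qed.

Lemma cs_star_sum I (s : seq I) (F : I -> A) :
  cs_star (\sum_(i <- s) F i) = \sum_(i <- s) cs_star (F i).
Proof.
elim: s => [|i s IH]; first by rewrite !big_nil cs_star0.
by rewrite !big_cons cs_starD IH.
Qed.

Lemma cs_nrm_star a : nrm (cs_star a) = nrm a.
Proof.
have le b : nrm b <= nrm (cs_star b).
  apply: nrm_le_of_sq_real; rewrite ?nrm_ge0// -cs_nrmC; exact: cs_nrmM.
by apply/le_anti; rewrite le andbT -{2}[a]csK le.
Qed.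

(** y = 1 - sqrt (1 - x) written without a unit: (1 - y)^2 = 1 - x. The bound 1/4 selects the small
    root, which makes it unique and the iteration a contraction. *)
Definition sqrt_solves (x y : A) := 2 *: y - cs_mul y y = x /\ nrm y <= 1 / 4.

Lemma nrm_scale2 a : nrm ((2 : R[i]) *: a) = 2 * nrm a.
Proof. by rewrite nrmZ -(rmorph_nat (real_complex R)) cmodR ger0_norm. Qed.

(** With delta = y - y' one has 2 delta = (x - x') + y delta + delta y', and the last two terms have
    norm at most |delta| / 4 each. The estimate gives uniqueness of the root, and later the
    continuity of roots taken pointwise in the cone. *)
Lemma sqrt_lip x y x' y' : sqrt_solves x y -> sqrt_solves x' y' ->
  nrm (y - y') <= nrm (x - x').
Proof.
move=> [<- hy] [<- hy'].
have e : 2 *: (y - y') = (2 *: y - cs_mul y y - (2 *: y' - cs_mul y' y'))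
   + (cs_mul y (y - y') + cs_mul (y - y') y').
  have -> : cs_mul y (y - y') + cs_mul (y - y') y' = cs_mul y y - cs_mul y' y'.
    by rewrite csBr csBl addrA subrK.
  have zm (a b c d : A) : a - c = a - b - (c - d) + (b - d).
    by rewrite addrAC addrA subrK opprB addrA subrK.
  by rewrite scalerBr -zm.
have := nrm_scale2 (y - y'); rewrite {1}e => h.
have h1 := nrmD (2 *: y - cs_mul y y - (2 *: y' - cs_mul y' y')) (cs_mul y (y - y') + cs_mul (y - y') y').
have h2 := nrmD (cs_mul y (y - y')) (cs_mul (y - y') y').
have h3 := cs_nrmM y (y - y'); have h4 := cs_nrmM (y - y') y'.
have n0 := nrm_ge0 (y - y').
have h5 := ler_wpM2r n0 hy; have h6 := ler_wpM2l n0 hy'.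
move: (nrm (y - y')) (_ * nrm y') (nrm y * _) h h1 h2 h3 h4 n0 h5 h6 => x1 x2 x3.
by move: (nrm _) (nrm _) (nrm _) (nrm _) => x4 x5 x6 x7; lra.
Qed.

(* fixed point of y |-> (x + y^2) / 2 *)
Lemma sqrt_ex x : nrm x <= 1 / 4 -> exists y, sqrt_solves x y.
Proof.
move=> x4; pose f y : A := (2^-1 : R[i]) *: (x + cs_mul y y).
have nh a : nrm ((2^-1 : R[i]) *: a) = 2^-1 * nrm a.
  rewrite nrmZ; congr (_ * _).
  by rewrite -(rmorph_nat (real_complex R)) -fmorphV cmodR ger0_norm.
have f4 y : nrm y <= 1 / 4 -> nrm (f y) <= 1 / 4.
  move=> y4; rewrite nh; have y0 := nrm_ge0 y.
  have := nrmD x (cs_mul y y); have := cs_nrmM y y; have := ler_pM y0 y0 y4 y4.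
  by move: (nrm (x + _)) (nrm (cs_mul y y)) (nrm y * _) => x1 x2 x3; lra.
have fl y y' : nrm y <= 1 / 4 -> nrm y' <= 1 / 4 -> nrm (f y - f y') <= 1 / 4 * nrm (y - y').
  move=> hy hy'; rewrite /f -scalerBr nh opprD addrACA subrr add0r.
  have -> : cs_mul y y - cs_mul y' y' = cs_mul y (y - y') + cs_mul (y - y') y'.
    by rewrite csBr csBl addrA subrK.
  have h2 := nrmD (cs_mul y (y - y')) (cs_mul (y - y') y').
  have h3 := cs_nrmM y (y - y'); have h4 := cs_nrmM (y - y') y'.
  have n0 := nrm_ge0 (y - y').
  have h5 := ler_wpM2r n0 hy; have h6 := ler_wpM2l n0 hy'.
  move: (nrm (y - y')) (_ * nrm y') (nrm y * _) h2 h3 h4 n0 h5 h6 => x1 x2 x3.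
  by move: (nrm _) (nrm _) (nrm _) => x4' x5 x6; lra.
pose u n := iter n f 0.
have u4 n : nrm (u n) <= 1 / 4.
  by elim: n => [|n IH] /=; [rewrite nrm0; lra|exact: f4].
have un m n : nrm (u (m + n)%N - u n) <= n.+1%:R^-1.
  have : nrm (u (m + n)%N - u n) <= (1 / 4) ^+ n.+1.
    elim: n => [|n IH]; first by rewrite addn0 subr0 expr1.
    rewrite addnS exprS /=; apply: le_trans (fl _ _ (u4 _) (u4 _)) _.
    by rewrite ler_wpM2l//; lra.
  move=> h; apply: le_trans h _.
  have -> : (1 / 4 : R) ^+ n.+1 = (4 ^+ n.+1)^-1 by rewrite div1r exprVn.
  rewrite lef_pV2 ?posrE ?exprn_gt0// -natrX ler_nat.
  by apply: ltnW; apply: ltn_expl.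
have [e e0|y hy] := @nrm_cvg R A u.
  have e20 : 0 < e / 2 by rewrite divr_gt0.
  have [N NP] := inv_small e20; have {}NP := NP N (leqnn _).
  exists N => m n Nm Nn; rewrite [e]splitr.
  apply: le_lt_trans (nrm_triangle _ (u N) _) _; rewrite (nrmB (u N)).
  by rewrite -(subnK Nm) -(subnK Nn) ltrD// (le_lt_trans (un _ _)).
have y4 : nrm y <= 1 / 4.
  apply/ler_addgt0Pr => e /hy[N /(_ N (leqnn _))] h.
  have := nrm_sub y (u N); rewrite nrmB => h'; apply: le_trans h' _.
  by rewrite addrC lerD// ltW.
exists y; split => //.
suff e : y = f y.
  rewrite {1}e /f scalerA mulfV ?scale1r ?addrK//.
apply/eqP; rewrite -subr_eq0; apply/eqP/nrm_eq0/eps_eq0 => [|e e0]; first exact: nrm_ge0.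
have e20 : 0 < e / 2 by rewrite divr_gt0.
have [N NP] := hy _ e20.
have h1 := NP N.+1 (leqnSn _); have h2 := NP N (leqnn _).
apply: le_trans (nrm_triangle _ (u N.+1) _) _; rewrite nrmB.
have := fl _ _ (u4 N) y4; rewrite -[f (u N)]/(u N.+1); lra.
Qed.

Lemma sqrt_sa x y : cs_star x = x -> sqrt_solves x y -> cs_star y = y.
Proof.
move=> xs hy; have [hy1 hy2] := hy.
have hs : sqrt_solves x (cs_star y).
  split; last by rewrite cs_nrm_star.
  by rewrite -[RHS]xs -hy1 cs_starB cs_starZ (conjc_nat R 2) cs_starM.
apply/eqP; rewrite -subr_eq0; apply/eqP/nrm_eq0/le_anti; rewrite nrm_ge0 andbT.
by apply: le_trans (sqrt_lip hs hy) _; rewrite subrr nrm0.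
Qed.

(** 2 |a| <= M puts the norm of x = a* a / M^2 below 1/4, where the root exists; the identity then
    says that M^2 - a* a is the square M^2 (1 - y)^2. The factor 2 in the later bounds for
    representations has its origin here. *)
Lemma cs_sqrt a (M : R) : 0 < M -> 2 * nrm a <= M -> exists y : A, cs_star y = y /\
  cs_mul (cs_star a) a = (M ^+ 2)%:C *: (2 *: y - cs_mul y y).
Proof.
move=> M0 aM; pose x := ((M ^+ 2)^-1)%:C *: cs_mul (cs_star a) a.
have M20 : 0 < M ^+ 2 by rewrite exprn_gt0.
have x4 : nrm x <= 1 / 4.
  rewrite nrmZ cmodR ger0_norm ?invr_ge0 ?(ltW M20)// cs_nrmC.
  rewrite ler_pdivrMl// mulrC div1r ler_pdivlMl//.
  have -> : 4 * nrm a ^+ 2 = (2 * nrm a) ^+ 2 by ring.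
  by rewrite ler_pXn2r ?nnegrE ?mulr_ge0 ?nrm_ge0 ?(ltW M0).
have xs : cs_star x = x by rewrite /x cs_starZ conjc_real cs_starM csK.
have [y hy] := sqrt_ex x4; exists y; split; first exact: sqrt_sa xs hy.
case: hy => -> _; rewrite /x scalerA -rmorphM/= mulfV ?gt_eqF//.
by rewrite scale1r.
Qed.

End CstarBasics.

Section Representations.
Variable R : realType.

(* if [h] is [a x] and [hy] is [y x] with a* a = M^2 (2 y - y^2), then
   |x|^2 - |h|^2 / M^2 = |x - y x|^2 *)
Lemma sqrt_dom (H : hilbert R) (x h hy : H) (M : R) : 0 < M ->
  ip h h = (M ^+ 2)%:C * (2 * ip hy x - ip hy hy) -> ip hy x = ip x hy ->
  nrm h <= M * nrm x.
Proof.
move=> M0 e1 e2.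
rewrite -(ler_pXn2r (ltn0Sn 1)) ?nnegrE ?mulr_ge0 ?nrm_ge0 ?(ltW M0)//.
rewrite -lecR -(ip_nrm h) e1 exprMn (RCM (M ^+ 2)) -(ip_nrm x).
rewrite ler_wpM2l ?ler0c ?sqr_ge0// -subr_ge0.
have -> : ip x x - (2 * ip hy x - ip hy hy) = ip (x - hy) (x - hy).
  by rewrite !ipBl !ipBr -e2; ring.
exact: ip_ge0.
Qed.

Section RepLin.
Variables (S : starAlg R) (P : set S) (H : hilbert R) (u : S -> H -> H).
Hypothesis hu : star_rep_on P u.

Lemma rep_lin a : P a -> linear (u a).
Proof. by case: hu => h _ _ _ /h[]. Qed.

Lemma rep_bd a : P a -> exists2 M : R, 0 <= M & forall x, nrm (u a x) <= M * nrm x.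
Proof. by case: hu => h _ _ _ /h/bounded_opM. Qed.

Lemma rep_add (l : R[i]) a b x : P a -> P b -> u (l *: a + b) x = l *: u a x + u b x.
Proof. by case: hu => _ h _ _; exact: h. Qed.

Lemma rep_mul a b x : P a -> P b -> u (smul a b) x = u a (u b x).
Proof. by case: hu => _ _ h _; exact: h. Qed.

Lemma rep_star a x y : P a -> ip (u a x) y = ip x (u (star a) y).
Proof. by case: hu => _ _ _ h; exact: h. Qed.

Lemma repD a b x : P a -> P b -> u (a + b) x = u a x + u b x.
Proof. by move=> Pa Pb; have := rep_add 1 x Pa Pb; rewrite !scale1r. Qed.

Lemma rep0 x : P 0 -> u 0 x = 0.
Proof. by move=> P0; apply: (addrI (u 0 x)); rewrite -repD// !addr0. Qed.

Lemma repZ l a x : P 0 -> P a -> u (l *: a) x = l *: u a x.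
Proof. by move=> P0 Pa; have := rep_add l x Pa P0; rewrite rep0// !addr0. Qed.

Lemma repB a b x : P 0 -> P a -> P b -> u (a - b) x = u a x - u b x.
Proof.
by move=> P0 Pa Pb; rewrite addrC -scaleN1r rep_add// scaleN1r addrC.
Qed.

Lemma rep_sum I (s : seq I) (F : I -> S) x : P 0 -> (forall a b, P a -> P b -> P (a + b)) ->
  (forall i, P (F i)) -> u (\sum_(i <- s) F i) x = \sum_(i <- s) u (F i) x.
Proof.
move=> P0 PD PF; suff [] : P (\sum_(i <- s) F i) /\ u (\sum_(i <- s) F i) x = \sum_(i <- s) u (F i) x by [].
elim: s => [|i s [IH1 IH2]]; first by rewrite !big_nil rep0.
by rewrite !big_cons repD// IH2; split=> //; apply: PD.
Qed.

End RepLin.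

(* the same computation bounds a *-representation and a symbol action on a dense subspace *)
Lemma alg_bd (A : cstarAlg R) (H : hilbert R) (x : H) (v : A -> H) :
  (forall (l : R[i]) a b, v (l *: a + b) = l *: v a + v b) ->
  (forall a b, ip (v (cs_mul a b)) x = ip (v b) (v (cs_star a))) ->
  (forall a b, ip x (v (cs_mul a b)) = ip (v (cs_star a)) (v b)) ->
  (forall a, ip (v a) x = ip x (v (cs_star a))) ->
  forall a, nrm (v a) <= 2 * nrm a * nrm x.
Proof.
move=> vl vm vm' vs a; have x0 := nrm_ge0 x; have a0 := nrm_ge0 a.
suff key (e : R) : 0 < e -> nrm (v a) <= 2 * nrm a * nrm x + e.
  by apply/ler_addgt0Pr => e; exact: key.
move=> e0; have x1 : 0 < nrm x + 1 by lra.
have q0 : 0 < e / (nrm x + 1) by rewrite divr_gt0.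
pose M := 2 * nrm a + e / (nrm x + 1).
have M0 : 0 < M by rewrite ltr_wpDl// mulr_ge0.
have aM : 2 * nrm a <= M by rewrite lerDl ltW.
have [y [ys ey]] := cs_sqrt M0 aM.
have v0 : v 0 = 0.
  by have := vl 1 0 0; rewrite !scale1r addr0 => ev0; apply: (addrI (v 0)); rewrite -ev0 addr0.
have vZ (l : R[i]) b : v (l *: b) = l *: v b by have := vl l b 0; rewrite v0 !addr0.
have vB b c : v (b - c) = v b - v c.
  by rewrite addrC -scaleN1r vl scaleN1r addrC.
have h : nrm (v a) <= M * nrm x.
  apply: (@sqrt_dom _ _ _ (v y)) => //.
    have -> : ip (v a) (v a) = ip (v (cs_mul (cs_star a) a)) x by rewrite vm csK.
    rewrite ey vZ vB vZ ipZl ipBl ipZl vm ys; congr (_ * (_ - _)).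
  by rewrite vs ys.
apply: le_trans h _; rewrite /M mulrDl lerD2l -mulrA ler_piMr ?(ltW e0)//.
by rewrite mulrC ler_pdivrMr// mul1r lerDl.
Qed.

(** The sharp constant is 1; the 2 is inherited from [cs_sqrt]. *)
Lemma rep_cs_bd (A : cstarAlg R) (H : hilbert R) (u : A -> H -> H) :
  star_rep (S := A) u -> forall a x, nrm (u a x) <= 2 * nrm a * nrm x.
Proof.
move=> hu a x; apply: (alg_bd (v := u^~ x)) => [l b c|b c|b c|b] /=.
- exact: (rep_add hu).
- by rewrite (rep_mul hu)// (rep_star hu).
- by rewrite (rep_mul hu)// -[in LHS](csK b) -(rep_star hu).
- exact: (rep_star hu).
Qed.

End Representations.

(** * Representations from actions on labels *)

Section Action.
Variables (R : realType) (X : Type) (k : psdker R X) (S : starAlg R) (P : set S).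
Variable act : S -> X -> X.
Hypothesis P_star : forall a, P a -> P (star a).
Hypothesis P_lin : forall (l : R[i]) a b, P a -> P b -> P (l *: a + b).
Hypothesis P_mul : forall a b, P a -> P b -> P (smul a b).
Hypothesis act_bd : forall a, P a -> exists2 M : R, 0 <= M & forall s : seq (R[i] * X),
  nrm (\sum_(c <- s) c.1 *: pt k (act a c.2)) <= M * nrm (span k s).
Hypothesis act_lin : forall (l : R[i]) a b x, P a -> P b ->
  pt k (act (l *: a + b) x) = l *: pt k (act a x) + pt k (act b x).
Hypothesis act_mul : forall a b x, P a -> P b -> pt k (act (smul a b) x) = pt k (act a (act b x)).
Hypothesis act_star : forall a x y, P a -> k (act a x) y = k x (act (star a) y).

(** Labels carry no linear structure, so [act] is linear and multiplicative only after passage to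
    the vectors [pt k x]. Each identity is checked on these vectors and spreads by density and
    boundedness. *)
Lemma action_rep : exists u : S -> kolm k -> kolm k,
  star_rep_on P u /\ forall a x, P a -> u a (pt k x) = pt k (act a x).
Proof.
have ex a : exists U : kolm k -> kolm k, P a -> [/\ linear U,
    exists2 M : R, 0 <= M & forall f, nrm (U f) <= M * nrm f & forall x, U (pt k x) = pt k (act a x)].
  (* Outside [P] nothing is required of the operator, and the identity is a default. *)
  have [Pa|nPa] := pselect (P a); last by exists id.
  have [M M0 hM] := act_bd Pa.
  have [U [U1 U2 U3]] := lift_op (T := fun x => pt k (act a x)) M0 hM.
  by exists U => _; split=> //; exists M.
have [u uP] := choice ex.
have u3 a x : P a -> u a (pt k x) = pt k (act a x) by move=> /uP[_ _ h]; exact: h.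
exists u; split=> //; split.
- by move=> a /uP[ul [M _ hM] _]; split=> //; exists M.
- move=> l a b x Pa Pb.
  have [l1 [M1 M10 h1] _] := uP _ (P_lin l Pa Pb).
  have [l2 [M2 M20 h2] _] := uP _ Pa; have [l3 [M3 M30 h3] _] := uP _ Pb.
  apply: (@kolm_op_ext _ _ k _ (u (l *: a + b)) (fun x => l *: u a x + u b x) M1 (cmod l * M2 + M3)) => //.
  + by move=> c f g /=; rewrite l2 l3 !scalerDr !scalerA [l * c]mulrC addrACA.
  + move=> f; apply: le_trans (nrmD _ _) _; rewrite nrmZ mulrDl -mulrA.
    by rewrite lerD// ler_wpM2l ?cmod_ge0.
  + by move=> y; rewrite !u3//; [rewrite act_lin|exact: P_lin].
- move=> a b x Pa Pb.
  have [l1 [M1 M10 h1] _] := uP _ (P_mul Pa Pb).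
  have [l2 [M2 M20 h2] _] := uP _ Pa; have [l3 [M3 M30 h3] _] := uP _ Pb.
  apply: (@kolm_op_ext _ _ k _ (u (smul a b)) (fun x => u a (u b x)) M1 (M2 * M3)) => //.
  + by move=> c f g /=; rewrite l3 l2.
  + by move=> f; apply: le_trans (h2 _) _; rewrite -mulrA ler_wpM2l.
  + by move=> y; rewrite !u3//; [rewrite act_mul|exact: P_mul].
- move=> a x y Pa.
  have [l2 [M2 M20 h2] _] := uP _ Pa; have [l3 [M3 M30 h3] _] := uP _ (P_star Pa).
  apply: (kolm_adj l2 l3 h2 h3) => x' y'.
  by rewrite !u3 ?ip_pt ?act_star//; exact: P_star.
Qed.

End Action.

(* for a C*-algebra the boundedness of the action is automatic *)
Lemma cs_action_rep (R : realType) (X : Type) (k : psdker R X) (A : cstarAlg R)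
    (act : A -> X -> X) :
  (forall (l : R[i]) a b x, pt k (act (l *: a + b) x) = l *: pt k (act a x) + pt k (act b x)) ->
  (forall a b x, pt k (act (cs_mul a b) x) = pt k (act a (act b x))) ->
  (forall a x y, k (act a x) y = k x (act (cs_star a) y)) ->
  exists u : A -> kolm k -> kolm k,
    star_rep (S := A) u /\ forall a x, u a (pt k x) = pt k (act a x).
Proof.
move=> al am as_.
suff [u [hu uE]] : exists u : A -> kolm k -> kolm k,
    star_rep_on (S := A) setT u /\ forall a x, setT a -> u a (pt k x) = pt k (act a x).
  by exists u; split=> // a x; rewrite uE.
apply: (@action_rep R X k A setT act (fun _ _ => I) (fun _ _ _ _ _ => I) (fun _ _ _ _ => I) _
  (fun l a b x _ _ => al l a b x) (fun a b x _ _ => am a b x) (fun a x y _ => as_ a x y)).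
move=> a _; exists (2 * nrm a) => [|s]; first by rewrite mulr_ge0 ?nrm_ge0.
(* For a fixed formal sum [s] the vectors b s satisfy the hypotheses of [alg_bd], with [span k s] as
   base vector, although the operators are not yet defined. *)
pose v (b : A) : kolm k := \sum_(c <- s) c.1 *: pt k (act b c.2).
apply: (alg_bd (v := v)) => [l b c|b c|b c|b]; rewrite /v /span.
- rewrite scaler_sumr -big_split; apply: eq_bigr => i _ /=.
  by rewrite al scalerDr !scalerA mulrC.
- rewrite !ip_suml; apply: eq_bigr => i _; rewrite !ip_sumr; apply: eq_bigr => j _.
  by rewrite !ipZl !ipZr am !ip_pt as_.
- rewrite !ip_suml; apply: eq_bigr => i _; rewrite !ip_sumr; apply: eq_bigr => j _.
  by rewrite !ipZl !ipZr am !ip_pt -[b in LHS]csK -as_.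
- rewrite !ip_suml; apply: eq_bigr => i _; rewrite !ip_sumr; apply: eq_bigr => j _.
  by rewrite !ipZl !ipZr !ip_pt as_.
Qed.

(** * The minimal tensor norm *)

Section TensorProduct.
Variables (R : realType) (H K : hilbert R).
Implicit Types z : seq (H * K).

Lemma big_cons2 (T : Type) (F : T -> T -> R[i]) a (s : seq T) :
  \sum_(x <- a :: s) \sum_(y <- a :: s) F x y =
  F a a + \sum_(y <- s) F a y + \sum_(x <- s) F x a + \sum_(x <- s) \sum_(y <- s) F x y.
Proof.
rewrite !big_cons -[RHS]addrA -big_split/=; congr (_ + _).
by apply: eq_bigr => x _; rewrite big_cons.
Qed.

(* Gram-Schmidt: the second components are made orthogonal to the first one *)
Lemma tip_ge0 z : 0 <= tip z.
Proof.
elim: {z}(size z) {-2}z (erefl (size z)) => [[]// _|n IH [//|[h k] z] [zn]].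
  by rewrite /tip big_nil.
have [k0|k0] := eqVneq (ip k k) 0.
  have {}k0 : k = 0.
    by apply/nrm_eq0/eqP; move: k0; rewrite ip_nrm => /complexI/eqP; rewrite expf_eq0.
  have e1 : \sum_(b <- z) ip h b.1 * ip 0 b.2 = 0 by apply: big1 => b _; rewrite ip0l mulr0.
  have e2 : \sum_(b <- z) ip b.1 h * ip b.2 0 = 0 by apply: big1 => b _; rewrite ip0r mulr0.
  by rewrite /tip big_cons2/= k0 e1 e2 ip0l mulr0 !add0r; exact: IH.
(* Splitting off the component along k rewrites the tensor as h' (x) k plus [z'], whose second
   components are orthogonal to k; the two parts do not interact. *)
pose c (b : H * K) : R[i] := ip b.2 k / ip k k.
pose z' := [seq (b.1, b.2 - c b *: k) | b <- z].
pose h' := h + \sum_(b <- z) c b *: b.1.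
suff -> : tip ((h, k) :: z) = ip h' h' * ip k k + tip z'.
  by rewrite addr_ge0 ?mulr_ge0 ?ip_ge0// IH// size_map.
have kr : cj (ip k k) = ip k k by rewrite -ipJ.
have ck b : c b * ip k k = ip b.2 k by rewrite /c divfK.
have ck' b : cj (c b) * ip k k = ip k b.2.
  by rewrite -{1}kr -conjM ck -ipJ.
rewrite /tip [LHS]big_cons2/= /h' ipDl !ipDr !ip_suml !ip_sumr.
rewrite big_map !mulrDl -!addrA; congr (_ + _); congr (_ + _).
  by rewrite mulr_suml; apply: eq_bigr => b _; rewrite ipZr mulrAC ck' mulrC.
congr (_ + _).
  by rewrite mulr_suml; apply: eq_bigr => b _; rewrite ipZl mulrAC ck mulrC.
rewrite mulr_suml -big_split; apply: eq_bigr => a _ /=.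
rewrite ip_sumr mulr_suml big_map -big_split; apply: eq_bigr => b _ /=.
rewrite ipBl !ipBr !ipZl !ipZr -(ck' b) -(ck a); ring.
Qed.

Lemma tker_psd (s : seq (R[i] * (H * K))) :
  0 <= \sum_(a <- s) \sum_(b <- s) a.1 * cj b.1 * (ip a.2.1 b.2.1 * ip a.2.2 b.2.2).
Proof.
have := tip_ge0 [seq (a.1 *: a.2.1, a.2.2) | a <- s]; rewrite /tip big_map.
congr (_ <= _); apply: eq_bigr => a _; rewrite big_map; apply: eq_bigr => b _ /=.
by rewrite ipZl ipZr !mulrA.
Qed.

Definition tker : psdker R (H * K) :=
  @Psdker R _ (fun a b => ip a.1 b.1 * ip a.2 b.2) tker_psd.
Definition HT : hilbert R := kolm tker.
Definition tns (h : H) (k : K) : HT := pt tker (h, k).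
Definition tvec z : HT := \sum_(a <- z) tns a.1 a.2.

Lemma ip_tns h k h' k' : ip (tns h k) (tns h' k') = ip h h' * ip k k'.
Proof. exact: ip_pt. Qed.

Lemma tns_lin1 l h h' k : tns (l *: h + h') k = l *: tns h k + tns h' k.
Proof.
apply: ip_span_ext => -[h1 k1]; rewrite ip_linear !ip_tns ip_linear; ring.
Qed.

Lemma tns_lin2 l h k k' : tns h (l *: k + k') = l *: tns h k + tns h k'.
Proof.
apply: ip_span_ext => -[h1 k1]; rewrite ip_linear !ip_tns ip_linear; ring.
Qed.

Lemma ip_tvec z z' : ip (tvec z) (tvec z') = \sum_(a <- z) \sum_(b <- z') ip a.1 b.1 * ip a.2 b.2.
Proof.
rewrite /tvec ip_suml; apply: eq_bigr => a _.
by rewrite ip_sumr; apply: eq_bigr => b _; rewrite ip_tns.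
Qed.

Lemma tvnormE z : tvnorm z = nrm (tvec z).
Proof.
by rewrite /tvnorm /tip -ip_tvec ip_nrm/= sqrtr_sqr ger0_norm ?nrm_ge0.
Qed.

Lemma tvnorm_ge0 z : 0 <= tvnorm z. Proof. exact: sqrtr_ge0. Qed.

Lemma tns_span s : span tker s = tvec [seq (a.1 *: a.2.1, a.2.2) | a <- s].
Proof.
rewrite /span /tvec big_map; apply: eq_bigr => -[l [h k]] _ /=.
have := tns_lin1 l h 0 k; rewrite addr0 => ->.
suff -> : tns 0 k = 0 by rewrite addr0.
by have := tns_lin1 (-1) 0 0 k; rewrite scaler0 addr0 scaleN1r addNr.
Qed.

Lemma left_rep (A : cstarAlg R) (u : A -> H -> H) : star_rep (S := A) u ->
  exists U : A -> HT -> HT, star_rep (S := A) U /\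
    forall a h k, U a (tns h k) = tns (u a h) k.
Proof.
move=> hu; have [|||U [hU UE]] := @cs_action_rep R _ tker A (fun a x => (u a x.1, x.2)).
- by move=> l a b [h k] /=; rewrite (rep_add hu)//; exact: tns_lin1.
- by move=> a b [h k] /=; rewrite (rep_mul hu).
- by move=> a [h k] [h' k'] /=; rewrite (rep_star hu).
- by exists U; split=> // a h k; rewrite /tns UE.
Qed.

Lemma right_rep (A : cstarAlg R) (u : A -> K -> K) : star_rep (S := A) u ->
  exists U : A -> HT -> HT, star_rep (S := A) U /\
    forall a h k, U a (tns h k) = tns h (u a k).
Proof.
move=> hu; have [|||U [hU UE]] := @cs_action_rep R _ tker A (fun a x => (x.1, u a x.2)).
- by move=> l a b [h k] /=; rewrite (rep_add hu)//; exact: tns_lin2.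
- by move=> a b [h k] /=; rewrite (rep_mul hu).
- by move=> a [h k] [h' k'] /=; rewrite (rep_star hu).
- by exists U; split=> // a h k; rewrite /tns UE.
Qed.

End TensorProduct.

Section TensorNorm.
Variable R : realType.

(** [X] and [Y] are bare types and [u], [w] arbitrary families, since the same expression is used
    for representations and for compressions of representations. *)
Definition tact (X Y : Type) (H K : hilbert R) (u : X -> H -> H) (w : Y -> K -> K)
    (x : seq (X * Y)) (z : seq (H * K)) : seq (H * K) :=
  [seq (u a.1 b.1, w a.2 b.2) | a <- x, b <- z].

Lemma tvec_tact (X Y : Type) (H K : hilbert R) (u : X -> H -> H) (w : Y -> K -> K)
    (x : seq (X * Y)) (z : seq (H * K)) :
  tvec (tact u w x z) = \sum_(a <- x) \sum_(b <- z) tns (u a.1 b.1) (w a.2 b.2).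
Proof.
rewrite /tact /tvec big_flatten big_map; apply: eq_bigr => a _; by rewrite big_map.
Qed.

Lemma commuting_reps (A D : cstarAlg R) (H K : hilbert R) (u : A -> H -> H) (w : D -> K -> K) :
  star_rep (S := A) u -> star_rep (S := D) w ->
  exists (U : A -> HT H K -> HT H K) (W : D -> HT H K -> HT H K),
  [/\ star_rep (S := A) U, star_rep (S := D) W,
      forall a d f, U a (W d f) = W d (U a f) &
      forall x z, tvec (tact u w x z) = \sum_(a <- x) U a.1 (W a.2 (tvec z))].
Proof.
move=> hu hw; have [U [hU UE]] := left_rep K hu; have [W [hW WE]] := right_rep H hw.
exists U, W; split=> //.
  move=> a d f.
  have [M M0 hM] := rep_bd hU (I : setT a); have [N N0 hN] := rep_bd hW (I : setT d).
  have Ul := rep_lin hU (I : setT a); have Wl := rep_lin hW (I : setT d).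
  apply: (@kolm_op_ext _ _ _ _ (fun f => U a (W d f)) (fun f => W d (U a f)) (M * N) (N * M)).
  - by move=> l x y; rewrite Wl Ul.
  - by move=> l x y; rewrite Ul Wl.
  - by move=> x; apply: le_trans (hM _) _; rewrite -mulrA ler_wpM2l.
  - by move=> x; apply: le_trans (hN _) _; rewrite -mulrA ler_wpM2l.
  - by move=> [h k]; rewrite -/(tns h k) WE UE UE WE.
move=> x z; rewrite tvec_tact; apply: eq_bigr => a _.
rewrite (lin_sum (rep_lin hW (I : setT a.2))) (lin_sum (rep_lin hU (I : setT a.1))).
by apply: eq_bigr => b _; rewrite WE UE.
Qed.

(** The bound [min_norm x <= M] in homogeneous form: vectors are not normalised and no supremum
    appears, so that such bounds can be added and composed. *)
Definition minle (A D : cstarAlg R) (x : seq (A * D)) (M : R) : Prop :=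
  forall (H K : hilbert R) (u : A -> H -> H) (w : D -> K -> K) (z : seq (H * K)),
    star_rep (S := A) u -> star_rep (S := D) w -> tvnorm (tact u w x z) <= M * tvnorm z.

Lemma minleP (A D : cstarAlg R) (x : seq (A * D)) (M : R) : 0 <= M ->
  (min_norm x <= M%:E)%E <-> minle x M.
Proof.
move=> M0; split=> [h H K u w z hu hw|h]; last first.
  apply: ge_ereal_sup => _ [H [K [u [w [z [hu hw z1 ->]]]]]].
  rewrite lee_fin; apply: le_trans (h H K u w z hu hw) _.
  by rewrite ler_piMr.
have [U [W [hU hW _ UW]]] := commuting_reps hu hw.
have key (t : R) : 0 < t -> t * tvnorm z <= 1 -> t * tvnorm (tact u w x z) <= M.
  move=> t0 tz; pose z' := [seq (t%:C *: b.1, b.2) | b <- z].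
  have ez' : tvec z' = t%:C *: tvec z.
    rewrite /tvec big_map scaler_sumr; apply: eq_bigr => -[b1 b2] _ /=.
    have := tns_span [:: (t%:C, (b1, b2))].
    by rewrite /tvec /span !big_seq1.
  have cz : cmod t%:C = t by rewrite cmodR gtr0_norm.
  rewrite -lee_fin; apply: le_trans h; apply: ereal_sup_ubound.
  exists H, K, u, w, z'; split => //.
    by rewrite tvnormE ez' nrmZ cz -tvnormE.
  rewrite -/(tact u w x z') !tvnormE !UW ez'; congr EFin.
  have -> : \sum_(a <- x) U a.1 (W a.2 (t%:C *: tvec z)) = t%:C *: \sum_(a <- x) U a.1 (W a.2 (tvec z)).
    rewrite [RHS]scaler_sumr; apply: eq_bigr => a _.
    have [_ _ ->] := linDZ (rep_lin hW (I : setT a.2)).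
    by have [_ _ ->] := linDZ (rep_lin hU (I : setT a.1)).
  by rewrite nrmZ cz.
have [z0|z0] := eqVneq (tvnorm z) 0.
  rewrite z0 mulr0; have X0 := tvnorm_ge0 (tact u w x z).
  rewrite leNgt; apply/negP => Xp.
  (* A null vector stays admissible under every scaling, and this one would produce norm M + 1. *)
  have tp : 0 < (M + 1) / tvnorm (tact u w x z) by rewrite divr_gt0// ltr_wpDl.
  by have := key _ tp; rewrite z0 mulr0 ler01 divfK ?gt_eqF// => /(_ isT); lra.
have zp : 0 < tvnorm z by rewrite lt0r z0 tvnorm_ge0.
have := key (tvnorm z)^-1; rewrite invr_gt0 zp mulVf// => /(_ isT (lexx _)).
by rewrite ler_pdivrMl// mulrC.
Qed.

(** The zero space, used to see that the suprema defining the norms are over nonempty sets. *)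
Definition hilbert0 : hilbert R :=
  kolm (@Psdker R void (fun=> fun=> 0) (fun s => eq_ind_r (fun x => 0 <= x) (lexx 0)
     (big1 _ _ _ (fun a _ => big1 _ _ _ (fun b _ => mulr0 _))))).

Lemma zero_rep (S : starAlg R) (P : set S) (H : hilbert R) : star_rep_on P (fun (_ : S) (_ : H) => 0 : H).
Proof.
split=> [a _|l a b x _ _|//|a x y _].
- split; first by move=> l x y; rewrite scaler0 addr0.
  by exists 0 => x; rewrite nrm0 mul0r.
- by rewrite scaler0 addr0.
- by rewrite ip0l ip0r.
Qed.

Lemma min_norm_ge0 (A D : cstarAlg R) (x : seq (A * D)) : (0 <= min_norm x)%E.
Proof.
apply: ereal_sup_ubound; exists hilbert0, hilbert0, (fun=> fun=> 0), (fun=> fun=> 0), [::].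
have t0 : tvnorm (Nil (hilbert0 * hilbert0)) = 0 by rewrite tvnormE /tvec big_nil nrm0.
split; [exact: zero_rep|exact: zero_rep|by rewrite t0|].
suff -> : [seq ((0 : hilbert0), (0 : hilbert0)) | a <- x, b <- Nil (hilbert0 * hilbert0)] = [::] by rewrite t0.
by elim: x => //= a x ->.
Qed.

Lemma minle_ge (A D : cstarAlg R) (x : seq (A * D)) (M N : R) : minle x M -> M <= N -> minle x N.
Proof.
by move=> h MN H K u w z hu hw; apply: le_trans (h _ _ _ _ z hu hw) _; rewrite ler_wpM2r ?tvnorm_ge0.
Qed.

Lemma minle_cat (A D : cstarAlg R) (x y : seq (A * D)) (M N : R) :
  minle x M -> minle y N -> minle (x ++ y) (M + N).
Proof.
move=> hx hy H K u w z hu hw.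
have [U [W [hU hW _ UW]]] := commuting_reps hu hw.
rewrite tvnormE UW big_cat/= -!UW mulrDl; apply: le_trans (nrmD _ _) _.
by rewrite -!tvnormE lerD ?hx ?hy.
Qed.

(* two lists representing the same element of the algebraic tensor product *)
Definition tequiv (A D : cstarAlg R) (x y : seq (A * D)) : Prop :=
  forall (H : hilbert R) (U : A -> H -> H) (W : D -> H -> H) (f : H),
    star_rep (S := A) U -> star_rep (S := D) W ->
    \sum_(a <- x) U a.1 (W a.2 f) = \sum_(a <- y) U a.1 (W a.2 f).

Lemma minle_equiv (A D : cstarAlg R) (x y : seq (A * D)) (M : R) :
  tequiv x y -> minle x M -> minle y M.
Proof.
move=> xy hx H K u w z hu hw.
have [U [W [hU hW _ UW]]] := commuting_reps hu hw.
by rewrite tvnormE UW -(xy _ U W)// -UW -tvnormE; exact: hx.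
Qed.

Lemma minle_el (A D : cstarAlg R) (a : A) (d : D) : minle [:: (a, d)] (4 * nrm a * nrm d).
Proof.
move=> H K u w z hu hw.
have [U [W [hU hW _ UW]]] := commuting_reps hu hw.
rewrite !tvnormE UW big_seq1/=; apply: le_trans (rep_cs_bd hU _ _) _.
apply: le_trans (ler_wpM2l _ (rep_cs_bd hW _ _)) _; first by rewrite mulr_ge0 ?nrm_ge0.
by rewrite le_eqVlt; apply/orP; left; apply/eqP; ring.
Qed.

Lemma minle_swap (A D : cstarAlg R) (x : seq (A * D)) (M : R) :
  minle x M -> minle [seq (a.2, a.1) | a <- x] M.
Proof.
have tsw (H K : hilbert R) (z : seq (H * K)) : tvnorm [seq (b.2, b.1) | b <- z] = tvnorm z.
  rewrite /tvnorm /tip big_map; do 2 f_equal; apply: eq_bigr => a _.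
  by rewrite big_map; apply: eq_bigr => b _; rewrite mulrC.
move=> hx K H w u z hw hu.
have := hx H K u w [seq (b.2, b.1) | b <- z] hu hw; rewrite !tsw; apply: le_trans.
rewrite -[leRHS]tsw le_eqVlt; apply/orP; left; apply/eqP; congr tvnorm.
rewrite /tact map_flatten -!map_comp; congr flatten; apply: eq_map => a /=.
by rewrite -!map_comp; apply: eq_map.
Qed.

(* Schur product argument: 1 (x) S is bounded by the norm of S *)
Lemma amp_bd (H K H' : hilbert R) (S : H -> H') (M : R) (z : seq (K * H)) : 0 <= M ->
  linear S -> (forall f, nrm (S f) <= M * nrm f) ->
  tvnorm [seq (b.1, S b.2) | b <- z] <= M * tvnorm z.
Proof.
move=> M0 Sl hS.
pose k (f g : H) : R[i] := (M ^+ 2)%:C * ip f g - ip (S f) (S g).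
have k_psd (s : seq (R[i] * H)) : 0 <= \sum_(a <- s) \sum_(b <- s) a.1 * cj b.1 * k a.2 b.2.
  pose f := \sum_(a <- s) a.1 *: a.2.
  have Sf : S f = \sum_(a <- s) a.1 *: S a.2.
    rewrite /f (lin_sum Sl); apply: eq_bigr => a _.
    by have [_ _ ->] := linDZ Sl.
  suff -> : \sum_(a <- s) \sum_(b <- s) a.1 * cj b.1 * k a.2 b.2 = (M ^+ 2)%:C * ip f f - ip (S f) (S f).
    rewrite subr_ge0 !ip_nrm -(RCM (M ^+ 2)) lecR -exprMn ler_pXn2r ?nnegrE ?mulr_ge0 ?nrm_ge0//.
  rewrite Sf /f !ip_suml mulr_sumr -sumrB; apply: eq_bigr => a _.
  rewrite !ip_sumr mulr_sumr -sumrB; apply: eq_bigr => b _.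
  by rewrite !ipZl !ipZr /k; ring.
pose kk : psdker R H := @Psdker R _ k k_psd.
have tp := tip_ge0 [seq (b.1, pt kk b.2) | b <- z].
rewrite -(ler_pXn2r (ltn0Sn 1)) ?nnegrE ?mulr_ge0 ?tvnorm_ge0//.
rewrite !tvnormE exprMn -lecR (RCM (M ^+ 2)) -(ip_nrm (tvec z)) -(ip_nrm (tvec [seq _ | b <- z])) !ip_tvec.
rewrite -subr_ge0; move: tp; congr (_ <= _).
rewrite /tip !big_map mulr_sumr -sumrB; apply: eq_bigr => a _.
rewrite !big_map mulr_sumr -sumrB; apply: eq_bigr => b _.
by rewrite (ip_pt kk) /= /k; ring.
Qed.

(** The vector [Y] is paired with itself: |Y|^2 = <(w (x) U)(1 (x) S1) z, (1 (x) S2) Y>. The minimal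
    norm controls the middle factor and [amp_bd] the two outer ones, so [beta] needs to be given by
    matrix coefficients only. *)
Lemma dilation_bd (D P : cstarAlg R) (G : Type) (m : G -> P) (x : seq (D * G)) (N : R)
   (K H HH : hilbert R) (w : D -> K -> K) (U : P -> HH -> HH) (beta : G -> H -> H)
   (S1 S2 : H -> HH) (M1 M2 : R) (z : seq (K * H)) :
  0 <= N -> 0 <= M1 -> 0 <= M2 ->
  minle [seq (a.1, m a.2) | a <- x] N -> star_rep (S := D) w -> star_rep (S := P) U ->
  linear S1 -> linear S2 ->
  (forall f, nrm (S1 f) <= M1 * nrm f) -> (forall f, nrm (S2 f) <= M2 * nrm f) ->
  (forall g f f', ip (beta g f) f' = ip (U (m g) (S1 f)) (S2 f')) ->
  tvnorm (tact w beta x z) <= N * M1 * M2 * tvnorm z.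
Proof.
move=> N0 M10 M20 hx hw hU l1 l2 b1 b2 hb.
move YE : (tact w beta x z) => Y; pose SY := [seq (b.1, S2 b.2) | b <- Y].
pose Sz := [seq (b.1, S1 b.2) | b <- z].
have z0 := tvnorm_ge0 z; have Y0 := tvnorm_ge0 Y.
apply: nrm_le_of_sq_real; rewrite ?mulr_ge0//.
have e : ip (tvec Y) (tvec Y) = ip (tvec (tact w U [seq (a.1, m a.2) | a <- x] Sz)) (tvec SY).
  rewrite -{1}YE !tvec_tact big_map !ip_suml; apply: eq_bigr => a _.
  rewrite big_map !ip_suml; apply: eq_bigr => b _.
  rewrite /tvec big_map !ip_sumr; apply: eq_bigr => c _.
  by rewrite !ip_tns hb.
have -> : tvnorm Y ^+ 2 = cmod (ip (tvec Y) (tvec Y)).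
  by rewrite ip_nrm cmodR ger0_norm ?sqr_ge0// tvnormE.
rewrite e; apply: le_trans (cauchy_schwarz _ _) _; rewrite -!tvnormE.
have h1 := hx _ _ _ _ Sz hw hU.
have h2 : tvnorm Sz <= M1 * tvnorm z := amp_bd _ M10 l1 b1.
have h3 : tvnorm SY <= M2 * tvnorm Y := amp_bd _ M20 l2 b2.
have h4 := le_trans h1 (ler_wpM2l N0 h2).
apply: le_trans (ler_pM (tvnorm_ge0 _) (tvnorm_ge0 _) h4 h3) _.
by rewrite le_eqVlt; apply/orP; left; apply/eqP; ring.
Qed.

End TensorNorm.

(** * Dilations *)

(* coefficient data of a dilation: [om] is to be p |-> <U p (S x), S y> and [ka]
   the Gram matrix of S; positivity is that of the unital extension to C 1 + P *)
Record cpdata (R : realType) (P : cstarAlg R) (X : Type) := CPData {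
  ka : X -> X -> R[i];
  om : P -> X -> X -> R[i];
  om_lin : forall (l : R[i]) p q x y, om (l *: p + q) x y = l * om p x y + om q x y;
  om_psd : forall s : seq (R[i] * P * X), 0 <= \sum_(a <- s) \sum_(b <- s)
    (a.1.1 * cj b.1.1 * ka a.2 b.2 + cj b.1.1 * om a.1.2 a.2 b.2
     + a.1.1 * om (cs_star b.1.2) a.2 b.2 + om (cs_mul (cs_star b.1.2) a.1.2) a.2 b.2) }.

Section Dilation.
Variables (R : realType) (P : cstarAlg R) (X : Type) (d : cpdata P X).

Lemma omZ l p x y : om d (l *: p) x y = l * om d p x y.
Proof.
have h0 : om d 0 x y = 0.
  by have := om_lin d 1 0 0 x y; rewrite scale1r addr0 mul1r => e; apply: (addrI (om d 0 x y)); rewrite -e addr0.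
by have := om_lin d l p 0 x y; rewrite h0 !addr0.
Qed.

Lemma omD p q x y : om d (p + q) x y = om d p x y + om d q x y.
Proof. by have := om_lin d 1 p q x y; rewrite scale1r mul1r. Qed.

(** The label (l, p, x) stands for (l + U p) S x, and the kernel is the inner product of two such
    vectors. Accordingly q acts in [dact] by q (l + p) = l q + q p, with no scalar part left. *)
Definition dkf (a b : R[i] * P * X) : R[i] :=
  a.1.1 * cj b.1.1 * ka d a.2 b.2 + cj b.1.1 * om d a.1.2 a.2 b.2
     + a.1.1 * om d (cs_star b.1.2) a.2 b.2 + om d (cs_mul (cs_star b.1.2) a.1.2) a.2 b.2.

Lemma dkf_psd (s : seq (R[i] * (R[i] * P * X))) :
  0 <= \sum_(a <- s) \sum_(b <- s) a.1 * cj b.1 * dkf a.2 b.2.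
Proof.
have := om_psd d [seq (a.1 * a.2.1.1, a.1 *: a.2.1.2, a.2.2) | a <- s].
rewrite big_map; congr (_ <= _); apply: eq_bigr => a _; rewrite big_map.
apply: eq_bigr => b _ /=.
by rewrite /dkf !conjM cs_starZ csZl csZr !omZ; ring.
Qed.

Definition dker : psdker R (R[i] * P * X) := @Psdker R _ dkf dkf_psd.

Definition dact (p : P) (a : R[i] * P * X) : R[i] * P * X :=
  (0, a.1.1 *: p + cs_mul p a.1.2, a.2).

Lemma dkE l p x l' p' x' : dker (l, p, x) (l', p', x') =
  l * cj l' * ka d x x' + cj l' * om d p x x' + l * om d (cs_star p') x x'
  + om d (cs_mul (cs_star p') p) x x'.
Proof. by []. Qed.

Lemma dactE q l p x : dact q (l, p, x) = (0, l *: q + cs_mul q p, x).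
Proof. by []. Qed.

Lemma dker_rep : exists U : P -> kolm dker -> kolm dker,
  star_rep (S := P) U /\ forall p a, U p (pt dker a) = pt dker (dact p a).
Proof.
apply: cs_action_rep => [l p q [[m r] x]|p q [[m r] x]|p [[m r] x] [[m' r'] x']].
- apply: ip_span_ext => -[[m' r'] x']; rewrite ip_linear !ip_pt !dactE !dkE.
  rewrite csDl csZl !csDr !csZr scalerDr !scalerA !omD !omZ csDr csZr !omD !omZ.
  by rewrite !mul0r !add0r; ring.
- apply: ip_span_ext => -[[m' r'] x']; rewrite !ip_pt !dactE !dkE.
  by rewrite scale0r add0r !csDr !csZr !csA !mul0r.
- rewrite !dactE !dkE (conjc0 R) !mul0r !mulr0 !mul0r !add0r !addr0.
  rewrite cs_starD cs_starZ cs_starM csK !csDr !csDl !csZl !csZr !omD !omZ csA; ring.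
Qed.

Definition dS (x : X) : kolm dker := pt dker (1, 0, x).

Lemma om0 x y : om d 0 x y = 0.
Proof. by have := omZ 0 0 x y; rewrite scale0r mul0r. Qed.

Lemma ip_dS x y : ip (dS x) (dS y) = ka d x y.
Proof.
by rewrite ip_pt !dkE (conjc1 R) cs_star0 cs0l om0 !mulr0 !addr0 !mul1r.
Qed.

Lemma dS_om U : (forall p a, U p (pt dker a) = pt dker (dact p a)) ->
  forall p x y, ip (U p (dS x)) (dS y) = om d p x y.
Proof.
move=> hU p x y; rewrite hU ip_pt dactE dkE (conjc1 R) cs_star0 cs0l cs0r scale1r addr0.
by rewrite om0 !mul0r !addr0 add0r mul1r.
Qed.

Lemma dS_lin l x y z : (forall t, ka d x t = l * ka d y t + ka d z t) ->
  (forall p t, om d p x t = l * om d p y t + om d p z t) -> dS x = l *: dS y + dS z.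
Proof.
move=> h1 h2; apply: ip_span_ext => -[[m' r'] x']; rewrite ip_linear !ip_pt !dkE.
by rewrite h1 !h2; ring.
Qed.

End Dilation.

(* the operators [be g] are the compressions S2^* U(m g) S1 of a *-representation of P *)
Definition dilates (R : realType) (P : cstarAlg R) (G : Type) (m : G -> P) (H : hilbert R)
    (be : G -> H -> H) (M : R) : Prop :=
  exists (HH : hilbert R) (U : P -> HH -> HH) (S1 S2 : H -> HH) (M1 M2 : R),
  [/\ star_rep (S := P) U, linear S1 /\ linear S2, [/\ 0 <= M1, 0 <= M2 & M1 * M2 <= M],
      (forall f, nrm (S1 f) <= M1 * nrm f) /\ (forall f, nrm (S2 f) <= M2 * nrm f) &
      forall g f f', ip (be g f) f' = ip (U (m g) (S1 f)) (S2 f')].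

Section Dilates.
Variable R : realType.

Lemma dilates_bd (D P : cstarAlg R) (G : Type) (m : G -> P) (x : seq (D * G)) (N M : R)
   (K H : hilbert R) (w : D -> K -> K) (be : G -> H -> H) (z : seq (K * H)) :
  dilates m be M -> 0 <= N -> minle [seq (a.1, m a.2) | a <- x] N -> star_rep (S := D) w ->
  tvnorm (tact w be x z) <= M * N * tvnorm z.
Proof.
move=> [HH [U [S1 [S2 [M1 [M2 [hU [l1 l2] [h1 h2 hM] [b1 b2] hb]]]]]]] N0 hx hw.
apply: le_trans (dilation_bd _ N0 h1 h2 hx hw hU l1 l2 b1 b2 hb) _.
rewrite ler_wpM2r ?tvnorm_ge0//; have -> : N * M1 * M2 = (M1 * M2) * N by ring.
by rewrite ler_wpM2r.
Qed.

(** The norm as seen by representations. Such a bound passes through [dilates_nrm] without loss,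
    whereas each use of [rep_cs_bd] costs a factor 2. *)
Definition repn (P : cstarAlg R) (c : P) (N : R) : Prop :=
  forall (H : hilbert R) (u : P -> H -> H) f, star_rep (S := P) u -> nrm (u c f) <= N * nrm f.

Lemma dilates_nrm (P : cstarAlg R) (G : Type) (m : G -> P) (H : hilbert R)
    (be : G -> H -> H) (M N : R) g f :
  dilates m be M -> 0 <= N -> repn (m g) N -> nrm (be g f) <= M * N * nrm f.
Proof.
move=> [HH [U [S1 [S2 [M1 [M2 [hU _ [h1 h2 hM] [b1 b2] hb]]]]]]] N0 hN.
have M0 : 0 <= M by apply: le_trans hM; rewrite mulr_ge0.
have f0 := nrm_ge0 f.
apply: nrm_le_ip; first by rewrite !mulr_ge0.
rewrite hb; apply: le_trans (cauchy_schwarz _ _) _.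
apply: le_trans (ler_pM (nrm_ge0 _) (nrm_ge0 _) (hN _ _ (S1 f) hU) (b2 _)) _.
rewrite mulrA ler_wpM2r ?nrm_ge0//.
apply: le_trans (ler_wpM2r h2 (ler_wpM2l N0 (b1 f))) _.
have -> : N * (M1 * nrm f) * M2 = M1 * M2 * (N * nrm f) by ring.
by rewrite -[M * N * _]mulrA ler_wpM2r// mulr_ge0.
Qed.

(* the operators R2 c = T (R1 c), with T a contraction commuting with everything,
   R1 c^* R1 c' = R2 (c^* c') *)
Lemma cone_dilates (C : cstarAlg R) (H : hilbert R) (R1 R2 : C -> H -> H) :
  (forall (l : R[i]) c c' f, R2 (l *: c + c') f = l *: R2 c f + R2 c' f) ->
  (forall c, linear (R2 c)) ->
  (forall c c' f f', ip (R1 c f) (R1 c' f') = ip (R2 (cs_mul (cs_star c') c) f) f') ->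
  (forall c f f', ip (R2 c f) f' = ip f (R2 (cs_star c) f')) ->
  (forall s : seq (C * H), nrm (\sum_(a <- s) R2 a.1 a.2) <= nrm (\sum_(a <- s) R1 a.1 a.2)) ->
  dilates id R2 1.
Proof.
move=> lc lf h12 hs hle.
have ol (l : R[i]) p q x y : ip (R2 (l *: p + q) x) y = l * ip (R2 p x) y + ip (R2 q x) y.
  by rewrite lc ip_linear.
have op (s : seq (R[i] * C * H)) : 0 <= \sum_(a <- s) \sum_(b <- s)
    (a.1.1 * cj b.1.1 * ip a.2 b.2 + cj b.1.1 * ip (R2 a.1.2 a.2) b.2
     + a.1.1 * ip (R2 (cs_star b.1.2) a.2) b.2 + ip (R2 (cs_mul (cs_star b.1.2) a.1.2) a.2) b.2).
  pose f := \sum_(a <- s) a.1.1 *: a.2; pose g := \sum_(a <- s) R1 a.1.2 a.2.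
  pose h := \sum_(a <- s) R2 a.1.2 a.2.
  have gh : nrm h <= nrm g.
    by have := hle [seq (a.1.2, a.2) | a <- s]; rewrite !big_map.
  (* With f, g, h the sums of scalar, [R1] and [R2] terms, the form is |f + h|^2 + (|g|^2 - |h|^2),
     and the last bracket is nonnegative by the contraction hypothesis. *)
  suff -> : \sum_(a <- s) \sum_(b <- s)
    (a.1.1 * cj b.1.1 * ip a.2 b.2 + cj b.1.1 * ip (R2 a.1.2 a.2) b.2
     + a.1.1 * ip (R2 (cs_star b.1.2) a.2) b.2 + ip (R2 (cs_mul (cs_star b.1.2) a.1.2) a.2) b.2)
     = ip (f + h) (f + h) + (ip g g - ip h h).
    rewrite addr_ge0 ?ip_ge0// subr_ge0 !ip_nrm lecR.
    by rewrite ler_pXn2r ?nnegrE ?nrm_ge0.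
  have -> : ip (f + h) (f + h) + (ip g g - ip h h) = ip f f + ip h f + ip f h + ip g g.
    by rewrite ipDl !ipDr; ring.
  rewrite /f /g /h !ip_suml -!big_split; apply: eq_bigr => a _ /=.
  rewrite !ip_sumr -!big_split; apply: eq_bigr => b _ /=.
  have e3 : ip (R2 (cs_star b.1.2) a.2) b.2 = ip a.2 (R2 b.1.2 b.2) by rewrite hs csK.
  by rewrite e3 !ipZl !ipZr h12; ring.
pose d : cpdata C H := @CPData R C H (@ip R H) (fun c x y => ip (R2 c x) y) ol op.
have [U [hU UE]] := dker_rep d.
have Sl : linear (dS d).
  move=> l x y; apply: dS_lin => [t|p t] /=; first by rewrite ip_linear.
  by rewrite lf ip_linear.
have Sn f : nrm (dS d f) <= 1 * nrm f.
  rewrite mul1r -(ler_pXn2r (ltn0Sn 1)) ?nnegrE ?nrm_ge0//.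
  by rewrite -lecR -(ip_nrm (dS d f)) -(ip_nrm f) ip_dS.
exists (kolm (dker d)), U, (dS d), (dS d), 1, 1; split=> //.
by move=> c f f'; rewrite (dS_om UE).
Qed.

End Dilates.

(** * Approximate units by averaged powers *)

Section ApproximateUnit.
Variables (R : realType) (C : cstarAlg R).

(* p = sum of c^* c; 1 - e is the average of the powers (1 - p)^k, k < n *)
Lemma approx_unit1 (L : seq C) (eta : R) : 0 < eta -> \sum_(c <- L) 2 * nrm c <= 1 ->
  exists e : C, [/\ cs_star e = e, repn e 2 &
   forall c, c \in L -> forall (H : hilbert R) (u : C -> H -> H) f, star_rep (S := C) u ->
     nrm (u c (f - u e f)) <= eta * nrm f].
Proof.
move=> eta0 hL; pose p := \sum_(c <- L) cs_mul (cs_star c) c.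
have ps : cs_star p = p.
  by rewrite /p cs_star_sum; apply: eq_bigr => c _; rewrite cs_starM csK.
(* [ek k] is 1 - (1 - p)^k, by a recursion that avoids the unit. *)
pose ek := fix ek k := if k is k'.+1 then ek k' + p - cs_mul p (ek k') else 0.
have ekp k : cs_mul (ek k) p = cs_mul p (ek k).
  elim: k => [|k IH] /=; first by rewrite cs0l cs0r.
  by rewrite csBl csDl csBr csDr IH -csA IH.
have eks k : cs_star (ek k) = ek k.
  elim: k => [|k IH] /=; first by rewrite cs_star0.
  by rewrite cs_starB cs_starD IH ps cs_starM IH ps ekp.
have [N hN] := inv_small (exprn_gt0 2 (divr_gt0 eta0 (ltr0Sn R 1))).
pose n := N.+1; have {hN}hN : n%:R^-1 < (eta / 2) ^+ 2 := hN N (leqnn _).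
have n0 : 0 < n%:R :> R by rewrite ltr0n.
pose e := (n%:R^-1 : R)%:C *: \sum_(0 <= k < n) ek k.
have cn : cmod (n%:R^-1 : R)%:C = n%:R^-1 by rewrite cmodR ger0_norm// invr_ge0 ltW.
have core (H : hilbert R) (u : C -> H -> H) f : star_rep (S := C) u ->
    exists v : nat -> H, [/\ f - u e f = (n%:R^-1 : R)%:C *: \sum_(0 <= k < n) v k,
      forall k, nrm (v k) <= nrm f &
      forall c, c \in L -> \sum_(0 <= k < n) nrm (u c (v k)) ^+ 2 <= nrm f ^+ 2].
  move=> hu; have ul a := rep_lin hu (I : setT a).
  (* [v k] is (1 - p)^k f, and [Q g] will be <p g, g>. *)
  pose v k := f - u (ek k) f; pose Q g : R := \sum_(c <- L) nrm (u c g) ^+ 2.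
  have Q0 g : 0 <= Q g by apply: sumr_ge0 => c _; rewrite sqr_ge0.
  have Qc c g : c \in L -> nrm (u c g) ^+ 2 <= Q g.
    move=> cL; rewrite /Q (big_rem c)//= lerDl; apply: sumr_ge0 => c' _; exact: sqr_ge0.
  have pQ g : ip (u p g) g = (Q g)%:C.
    rewrite /p (rep_sum hu)// ip_suml /Q rmorph_sum/=; apply: eq_bigr => c _.
    rewrite (rep_mul hu)// -[X in _ = X]ip_nrm (rep_star hu)//.
    by rewrite [star _]csK.
  (* The normalisation of [L] enters here and yields p^2 <= p in every representation. *)
  have pn g : nrm (u p g) <= Num.sqrt (Q g).
    rewrite /p (rep_sum hu)//; apply: le_trans (nrm_sum _ _) _.
    rewrite -[leRHS]mul1r; apply: le_trans (ler_wpM2r (sqrtr_ge0 _) hL).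
    rewrite mulr_suml big_seq [leRHS]big_seq; apply: ler_sum => c cL.
    rewrite (rep_mul hu)//; apply: le_trans (rep_cs_bd hu _ _) _.
    rewrite cs_nrm_star ler_wpM2l ?mulr_ge0 ?nrm_ge0//.
    by rewrite -[leLHS]ger0_norm ?nrm_ge0// -sqrtr_sqr ler_wsqrtr// Qc.
  have vS k : v k.+1 = v k - u p (v k).
    rewrite /v /= (repB hu)// (repD hu)// (rep_mul hu)// (linB (ul p)).
    by rewrite !opprD !opprK !addrA.
  (* Applying 1 - p costs at least [Q g] of the squared norm. Summed along the powers this
     telescopes below |f|^2, so that the values Q (v k), and with them u c (v k), are small on
     average. *)
  have step g : nrm (g - u p g) ^+ 2 <= nrm g ^+ 2 - Q g.
    have pg : nrm (u p g) ^+ 2 <= Q g.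
      by rewrite -(sqr_sqrtr (Q0 g)) ler_pXn2r ?nnegrE ?nrm_ge0 ?sqrtr_ge0.
    have := ip_nrm (g - u p g); rewrite ipBl !ipBr pQ !ip_nrm (ipJ (u p g) g) pQ conjc_real.
    by rewrite -!rmorphB/= => /complexI => <-; lra.
  have tele m : \sum_(0 <= k < m) Q (v k) <= nrm f ^+ 2 - nrm (v m) ^+ 2.
    elim: m => [|m IH].
      by rewrite big_geq// /v /= (rep0 hu)// subr0 subrr.
    rewrite big_nat_recr//= vS; have := step (v m); lra.
  have vf k : nrm (v k) <= nrm f.
    rewrite -(ler_pXn2r (ltn0Sn 1)) ?nnegrE ?nrm_ge0//.
    have := tele k; have : 0 <= \sum_(0 <= j < k) Q (v j) by apply: sumr_ge0.
    lra.
  exists v; split=> //.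
    rewrite /e (repZ hu)// (rep_sum hu)// /v sumrB scalerBr; congr (_ - _).
    rewrite sumr_const_nat subn0 -(scaler_nat n f) scalerA -(rmorph_nat (real_complex R)).
    by rewrite -rmorphM/= mulVf ?scale1r// gt_eqF.
  move=> c cL; apply: le_trans (_ : _ <= nrm f ^+ 2 - nrm (v n) ^+ 2) _; last first.
    by rewrite lerBlDr lerDl sqr_ge0.
  by apply: le_trans (tele n); apply: ler_sum => k _; exact: Qc.
exists e; split.
- rewrite /e cs_starZ conjc_real cs_star_sum; congr (_ *: _).
  by apply: eq_bigr => k _.
- move=> H u f hu; have [v [h1 h2 _]] := core H u f hu.
  have -> : u e f = f - (f - u e f) by rewrite opprB addrCA subrr addr0.
  rewrite h1; apply: le_trans (nrmD _ _) _; rewrite nrmN nrmZ cn.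
  suff : n%:R^-1 * nrm (\sum_(0 <= k < n) v k) <= nrm f.
    by move: (_ * _) => y; lra.
  rewrite ler_pdivrMl//; apply: le_trans (nrm_sum _ _) _.
  apply: le_trans (ler_sum _ (fun k _ => h2 k)) _.
  by rewrite sumr_const_nat subn0 mulr_natl.
- move=> c cL H u f hu; have [v [h1 _ h2]] := core H u f hu.
  have {}h2 := h2 c cL.
  have [f0|fn0] := eqVneq (nrm f) 0.
    have -> : f - u e f = 0.
      have f00 : f = 0 := nrm_eq0 f0.
      by have [z _ _] := linDZ (rep_lin hu (I : setT e)); rewrite f00 z subrr.
    by have [z _ _] := linDZ (rep_lin hu (I : setT c)); rewrite z nrm0 mulr_ge0 ?nrm_ge0 ?ltW.
  have fp : 0 < nrm f by rewrite lt0r fn0 nrm_ge0.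
  rewrite h1; have [_ _ ->] := linDZ (rep_lin hu (I : setT c)).
  rewrite (lin_sum (rep_lin hu (I : setT c))) nrmZ cn.
  rewrite ler_pdivrMl//; apply: le_trans (nrm_sum _ _) _.
  (* t b <= b^2 + t^2 replaces the sum of norms by the sum of squares. Since 1/n < (eta / 2)^2, the
     latter is at most |f|^2 <= n t^2, and the total 2 n t^2 is t n eta |f|. *)
  pose t := eta / 2 * nrm f; have t0 : 0 < t by rewrite !mulr_gt0.
  rewrite -(ler_pM2l t0) mulr_sumr.
  apply: le_trans (_ : _ <= \sum_(0 <= k < n) (nrm (u c (v k)) ^+ 2 + t ^+ 2)) _.
    apply: ler_sum => k _; move: (nrm (u c (v k))) => b.
    have := sqr_ge0 (t - b / 2); have := sqr_ge0 b.
    rewrite !expr2; nra.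
  rewrite big_split/= sumr_const_nat subn0 -[X in _ + X]mulr_natl.
  have h3 : nrm f ^+ 2 <= n%:R * t ^+ 2.
    rewrite /t exprMn mulrA -[leLHS]mul1r ler_wpM2r ?sqr_ge0//.
    by rewrite mulrC -ler_pdivrMr// div1r ltW.
  apply: le_trans (lerD (le_trans h2 h3) (lexx _)) _.
  by rewrite /t le_eqVlt; apply/orP; left; apply/eqP; field.
Qed.

Lemma approx_unit (cs : seq C) (eps : R) : 0 < eps ->
  exists e : C, [/\ cs_star e = e, repn e 2 &
    forall c, c \in cs -> repn (c - cs_mul (cs_mul e c) e) eps].
Proof.
(* Adjoints are included because (1 - e) c is controlled through c* (1 - e). The scaling by 1/K
   meets the normalisation of [approx_unit1], and eps / 3 suffices since c - e c e = c (1 - e) + (1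
   - e) c e with e bounded by 2. *)
move=> eps0; pose L0 := cs ++ map (@cs_star R C) cs.
pose K := \sum_(c <- L0) 2 * nrm c + 1.
have s0 : 0 <= \sum_(c <- L0) 2 * nrm c by apply: sumr_ge0 => c _; rewrite mulr_ge0 ?nrm_ge0.
have K0 : 0 < K by rewrite ltr_wpDl.
pose L := [seq (K^-1)%:C *: c | c <- L0].
have cK : cmod (K^-1)%:C = K^-1 by rewrite cmodR gtr0_norm ?invr_gt0.
have hL : \sum_(c <- L) 2 * nrm c <= 1.
  rewrite big_map (eq_bigr (fun c => K^-1 * (2 * nrm c))) => [|c _].
    by rewrite -mulr_sumr ler_pdivrMl// mulr1 lerDl.
  by rewrite nrmZ cK mulrCA.
have q0 : 0 < eps / 3 / K by rewrite !divr_gt0.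
have [e [es e2 he]] := approx_unit1 q0 hL.
have he' c (H : hilbert R) (u : C -> H -> H) f : c \in L0 -> star_rep (S := C) u ->
    nrm (u c (f - u e f)) <= eps / 3 * nrm f.
  move=> cL hu; have := he _ (map_f _ cL) _ u f hu.
  rewrite (repZ hu)// nrmZ cK ler_pdivrMl//.
  by have -> : K * (eps / 3 / K * nrm f) = eps / 3 * nrm f by field; rewrite gt_eqF.
exists e; split=> // c cc H u f hu.
have cL : c \in L0 by rewrite mem_cat cc.
have cL' : cs_star c \in L0 by rewrite mem_cat map_f ?orbT.
have fe := e2 _ u f hu.
pose g := u c (u e f).
have hg : nrm (g - u e g) <= eps / 3 * nrm (u e f).
  apply: nrm_le_ip; first by rewrite mulr_ge0 ?nrm_ge0// divr_ge0 ?ltW.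
  have -> : ip (g - u e g) (g - u e g) = ip (u e f) (u (cs_star c) ((g - u e g) - u e (g - u e g))).
    set h := g - u e g.
    rewrite -[cs_star c]/(star (s := C) c) -(rep_star hu)// -/g ipBr.
    by rewrite /h {1}ipBl (rep_star hu)// [star _]es.
  apply: le_trans (cauchy_schwarz _ _) _.
  have := he' _ _ u (g - u e g) cL' hu => h.
  apply: le_trans (ler_wpM2l (nrm_ge0 _) h) _.
  by rewrite le_eqVlt; apply/orP; left; apply/eqP; ring.
have -> : u (c - cs_mul (cs_mul e c) e) f = u c (f - u e f) + (g - u e g).
  rewrite (repB hu)// !(rep_mul hu)// (linB (rep_lin hu (I : setT c))).
  by rewrite /g addrA subrK.
apply: le_trans (nrmD _ _) _; apply: le_trans (lerD (he' _ _ u f cL hu) hg) _.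
have h3 : 0 < eps / 3 by rewrite divr_gt0.
have := ler_wpM2l (ltW h3) fe.
have -> : eps * nrm f = eps / 3 * nrm f + eps / 3 * (2 * nrm f) by field.
by rewrite lerD2l.
Qed.

End ApproximateUnit.

(** * The unitized cone *)

Section UnitInterval.
Variable R : realType.
Implicit Types (s t : I01 R) (x y : R).

Lemma clip_val x : 0 <= x <= 1 -> sval (clip x) = x.
Proof. by move=> /andP[x0 x1] /=; rewrite min_l// max_r. Qed.

Lemma I01_ge0 s : 0 <= sval s. Proof. by case: s => x /= /andP[]. Qed.
Lemma I01_le1 s : sval s <= 1. Proof. by case: s => x /= /andP[]. Qed.

Lemma clip_sval s : clip (sval s) = s.
Proof. by apply: val_inj; apply: clip_val; rewrite I01_ge0 I01_le1. Qed.

Lemma clip_lip x y : `|sval (clip x) - sval (clip y)| <= `|x - y|.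
Proof.
have key (a b : R) : a <= b -> `|sval (clip a) - sval (clip b)| <= `|a - b|.
  move=> ab; rewrite distrC [leRHS]distrC ger0_norm ?ger0_norm ?subr_ge0//=.
    by rewrite /Num.max /Num.min; repeat case: ifPn; rewrite -?leNgt; move=> *; lra.
  by rewrite /Num.max /Num.min; repeat case: ifPn; rewrite -?leNgt; move=> *; lra.
have [/key//|/ltW/key] := leP x y; by rewrite distrC [leRHS]distrC.
Qed.

Definition ucont (V : normedModType R[i]) (h : I01 R -> V) : Prop :=
  forall s (e : R), 0 < e -> exists2 d : R, 0 < d &
    forall t, `|sval t - sval s| < d -> nrm (h t - h s) < e.

Lemma ucontP (V : normedModType R[i]) (h : I01 R -> V) :
  continuous (fun x : R => h (clip x)) <-> ucont h.
Proof.
split=> [hc s e e0|hc x].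
  have e0' : 0 < e%:C by rewrite ltcR.
  have := hc (sval s); move=> /cvgrPdist_lt /(_ _ e0')[d /= d0 hd].
  exists d => // t st; have := hd (sval t); rewrite /ball_/= distrC => /(_ st).
  by rewrite !clip_sval ltC_nrm nrmB.
apply/cvgrPdist_lt => _ /cpos_ex[e e0 ->].
have [d d0 hd] := hc (clip x) _ e0; exists d => //= y; rewrite /ball_/= => xy.
rewrite ltC_nrm nrmB; apply: hd; apply: le_lt_trans (clip_lip _ _) _; by rewrite distrC.
Qed.

Lemma ucont_const (V : normedModType R[i]) (v : V) : ucont (fun=> v).
Proof. by move=> s e e0; exists 1 => // t _; rewrite subrr nrm0. Qed.

Lemma ucont_le (V W : normedModType R[i]) (h : I01 R -> V) (g : I01 R -> W) (M : R) :
  ucont h -> 0 < M -> (forall s t, nrm (g t - g s) <= M * nrm (h t - h s)) -> ucont g.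
Proof.
move=> hc M0 gh s e e0; have [d d0 hd] := hc s _ (divr_gt0 e0 M0); exists d => // t /hd ht.
by apply: le_lt_trans (gh _ _) _; rewrite -ltr_pdivlMl// mulrC.
Qed.

Lemma ucont_lin (V : normedModType R[i]) (l : R[i]) (h g : I01 R -> V) :
  ucont h -> ucont g -> ucont (fun s => l *: h s + g s).
Proof.
move=> hc gc s e e0; have c0 := cmod_ge0 l; have c1 : 0 < cmod l + 1 by lra.
have q0 : 0 < e / 2 / (cmod l + 1) by rewrite !divr_gt0.
have e20 : 0 < e / 2 by rewrite divr_gt0.
have [d d0 hd] := hc s _ q0; have [d' d'0 hd'] := gc s _ e20.
exists (Num.min d d') => [|t]; first by rewrite lt_min d0.
rewrite lt_min => /andP[/hd h1 /hd' h2].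
rewrite opprD addrACA -scalerBr; apply: le_lt_trans (nrmD _ _) _; rewrite nrmZ.
rewrite [e]splitr; apply: ler_ltD => //.
apply: le_trans (ler_wpM2l c0 (ltW h1)) _.
have -> : cmod l * (e / 2 / (cmod l + 1)) = e / 2 * (cmod l / (cmod l + 1)).
  by field; rewrite gt_eqF.
by apply: ler_piMr; [exact: ltW|rewrite ler_pdivrMr// mul1r lerDl].
Qed.

Lemma ucont_mul (C : cstarAlg R) (h g : I01 R -> C) :
  ucont h -> ucont g -> ucont (fun s => cs_mul (h s) (g s)).
Proof.
move=> hc gc s e e0.
have h0 := nrm_ge0 (h s); have g0 := nrm_ge0 (g s).
have K0 : 0 < nrm (g s) + 1 + nrm (h s) by lra.
have q0 : 0 < e / (nrm (g s) + 1 + nrm (h s)) by rewrite divr_gt0.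
have [d d0 hd] := hc s _ q0; have [d' d'0 hd'] := gc s _ q0; have [d2 d20 hd2] := gc s _ ltr01.
exists (Num.min d (Num.min d' d2)) => [|t]; first by rewrite !lt_min d0 d'0.
rewrite !lt_min => /and3P[/hd h1 /hd' h2 /hd2 h3].
have -> : cs_mul (h t) (g t) - cs_mul (h s) (g s) =
   cs_mul (h t - h s) (g t) + cs_mul (h s) (g t - g s).
  by rewrite csBl csBr addrA subrK.
have gt1 : nrm (g t) <= nrm (g s) + 1.
  by apply: le_trans (nrm_sub _ (g s)) _; rewrite addrC lerD2l ltW.
apply: le_lt_trans (nrmD _ _) _; apply: le_lt_trans (lerD (cs_nrmM _ _) (cs_nrmM _ _)) _.
set q := e / _ in q0 h1 h2; have -> : e = q * (nrm (g s) + 1) + nrm (h s) * q.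
  by rewrite /q; field; rewrite gt_eqF.
apply: ltr_leD; last by rewrite ler_wpM2l// ltW.
apply: le_lt_trans (ler_wpM2l (nrm_ge0 _) gt1) _.
by rewrite ltr_pM2r//; lra.
Qed.

(* a Lebesgue number for a continuous family of pseudometrics *)
Lemma unif_cont (D : I01 R -> I01 R -> R -> Prop) (e : R) :
  (forall s t a, D s t a -> D t s a) ->
  (forall s t u a b, D s t a -> D t u b -> D s u (a + b)) ->
  (forall s (e : R), 0 < e -> exists2 d : R, 0 < d & forall t, `|sval t - sval s| < d -> D t s e) ->
  0 < e -> exists N : nat, forall s t, `|sval t - sval s| <= N.+1%:R^-1 -> D s t e.
Proof.
move=> Dsym Dtr hD e0; have e20 : 0 < e / 2 by rewrite divr_gt0.
have cpt := @segment_compact R 0 1.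
move: cpt; rewrite compact_near_coveringP => /(_ nat \oo
  (fun N x => forall t, `|sval t - sval (clip x)| <= N.+1%:R^-1 -> D (clip x) t e)).
case=> [x _|N _ hN].
  have [d d0 hd] := hD (clip x) _ e20; have d20 : 0 < d / 2 by rewrite divr_gt0.
  have [N hN] := inv_small d20.
  exists (ball x (d / 2), [set n | (N <= n)%N]) => /=.
    by split; [exact: nbhsx_ballx|exists N].
  move=> [y n] /= [xy Nn] t ty; rewrite /ball/= in xy.
  have xy' : `|sval (clip y) - sval (clip x)| < d / 2.
    by apply: le_lt_trans (clip_lip _ _) _; rewrite distrC.
  rewrite [e]splitr; apply: Dtr (_ : D (clip y) (clip x) _) _.
    by apply: hd; apply: lt_trans xy' _; rewrite ltr_pdivrMr// ltr_pMr// ltr1n.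
  apply/Dsym/hd; rewrite [d]splitr; apply: le_lt_trans (ler_distD (sval (clip y)) _ _) _.
  by apply: ltrD => //; apply: le_lt_trans ty _; exact: hN.
exists N => s t st; have := hN N (leqnn N) (sval s).
rewrite clip_sval => h; apply: h => //=.
by rewrite in_itv/= I01_ge0 I01_le1.
Qed.

End UnitInterval.

(** * The algebra B and its representations *)

Section BAlgebra.
Variables (R : realType) (C : cstarAlg R).
Implicit Types (a b c : Bamb C) (s : I01 R) (l : R[i]).

Lemma Bext a b : a.1 = b.1 -> (forall s, a.2 s = b.2 s) -> a = b.
Proof. by case: a b => [a1 a2] [b1 b2] /= -> h; congr (_, _); apply/funext. Qed.

Lemma smul2 a b s : (smul a b).2 s = a.1 *: b.2 s + b.1 *: a.2 s + cs_mul (a.2 s) (b.2 s).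
Proof. by []. Qed.

Lemma B1lin l a b : (l *: a + b).1 = l * a.1 + b.1. Proof. by []. Qed.
Lemma B2lin l a b s : (l *: a + b).2 s = l *: a.2 s + b.2 s. Proof. by []. Qed.
Lemma B2D a b s : (a + b).2 s = a.2 s + b.2 s. Proof. by []. Qed.
Lemma B1D a b : (a + b).1 = a.1 + b.1. Proof. by []. Qed.
Lemma B2Z l a s : (l *: a).2 s = l *: a.2 s. Proof. by []. Qed.
Lemma B1Z l a : (l *: a).1 = l * a.1. Proof. by []. Qed.
Lemma B2N a s : (- a).2 s = - a.2 s. Proof. by []. Qed.

Lemma add33 (V : zmodType) (x1 x2 y1 y2 z1 z2 : V) :
  x1 + x2 + (y1 + y2) + (z1 + z2) = x1 + y1 + z1 + (x2 + y2 + z2).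
Proof. by rewrite (addrACA x1) (addrACA (x1 + y1)). Qed.

Lemma BsmulDl a b c : smul (a + b) c = smul a c + smul b c.
Proof.
apply: Bext => [|s]; first exact: mulrDl.
by rewrite B2D !smul2 B1D !B2D csDl scalerDl scalerDr add33.
Qed.

Lemma BsmulZl l a b : smul (l *: a) b = l *: smul a b.
Proof.
apply: Bext => [|s]; first exact/esym/mulrA.
rewrite B2Z !smul2 B1Z !B2Z csZl !scalerDr !scalerA; congr (_ + _ + _).
by rewrite mulrC.
Qed.

Lemma BsmulDr a b c : smul c (a + b) = smul c a + smul c b.
Proof.
apply: Bext => [|s]; first exact: mulrDr.
by rewrite B2D !smul2 B1D !B2D csDr scalerDl scalerDr add33.
Qed.

Lemma BsmulZr l a b : smul a (l *: b) = l *: smul a b.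
Proof.
apply: Bext => [|s]; first exact: mulrCA.
rewrite B2Z !smul2 B1Z !B2Z csZr !scalerDr !scalerA; congr (_ + _ + _).
by rewrite mulrC.
Qed.

Lemma Bsmul0l a : smul 0 a = 0.
Proof. by have := BsmulZl 0 0 a; rewrite !scale0r. Qed.

Lemma Bsmul0r a : smul a 0 = 0.
Proof. by have := BsmulZr 0 a 0; rewrite !scale0r. Qed.

Lemma Bsmul_suml a I (r : seq I) (F : I -> Bamb C) :
  smul (\sum_(i <- r) F i) a = \sum_(i <- r) smul (F i) a.
Proof.
elim: r => [|i r IH]; first by rewrite !big_nil Bsmul0l.
by rewrite !big_cons BsmulDl IH.
Qed.

Lemma Bsmul_sumr a I (r : seq I) (F : I -> Bamb C) :
  smul a (\sum_(i <- r) F i) = \sum_(i <- r) smul a (F i).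
Proof.
elim: r => [|i r IH]; first by rewrite !big_nil Bsmul0r.
by rewrite !big_cons BsmulDr IH.
Qed.

Lemma BstarD a b : star (a + b) = star a + star b.
Proof. by apply: Bext => [|s]; [exact: conjD|exact: cs_starD]. Qed.

Lemma BstarZ l a : star (l *: a) = cj l *: star a.
Proof. by apply: Bext => [|s]; [exact: conjM|exact: cs_starZ]. Qed.

Lemma Bstar0 : star (0 : Bamb C) = 0.
Proof. by apply: Bext => [|s]; [exact: conjc0|exact: cs_star0]. Qed.

Lemma BstarK a : star (star a) = a.
Proof. by apply: Bext => [|s]; [exact: conjcK|exact: csK]. Qed.

Lemma Bstar_sum I (r : seq I) (F : I -> Bamb C) :
  star (\sum_(i <- r) F i) = \sum_(i <- r) star (F i).
Proof.
elim: r => [|i r IH]; first by rewrite !big_nil Bstar0.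
by rewrite !big_cons BstarD IH.
Qed.

Lemma BP a : B a <-> ucont a.2 /\ a.2 (clip 0) = 0.
Proof. by split=> -[h1 h2]; split=> //; apply/ucontP. Qed.

Lemma B_lin l a b : B a -> B b -> B (l *: a + b).
Proof.
move=> /BP[a1 a2] /BP[b1 b2]; apply/BP; split; first exact: ucont_lin.
by rewrite B2lin a2 b2 scaler0 addr0.
Qed.

Lemma B0 : B (0 : Bamb C).
Proof. by apply/BP; split=> //; exact: ucont_const. Qed.

Lemma Bscal_B l : B (Bscal C l).
Proof. by apply/BP; split=> //; exact: ucont_const. Qed.

Lemma B_D a b : B a -> B b -> B (a + b).
Proof. by move=> ha hb; rewrite -[a]scale1r; exact: B_lin. Qed.

Lemma B_Z l a : B a -> B (l *: a).
Proof. by move=> ha; rewrite -[_ *: _]addr0; apply: B_lin => //; exact: B0. Qed.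

Lemma B_sub a b : B a -> B b -> B (a - b).
Proof. by move=> ha hb; rewrite addrC -scaleN1r; exact: B_lin. Qed.

Lemma B_sum I (r : seq I) (F : I -> Bamb C) : (forall i, B (F i)) -> B (\sum_(i <- r) F i).
Proof.
move=> h; elim: r => [|i r IH]; first by rewrite big_nil; exact: B0.
by rewrite big_cons; exact: B_D.
Qed.

Lemma B_mul a b : B a -> B b -> B (smul a b).
Proof.
move=> /BP[a1 a2] /BP[b1 b2]; apply/BP; split; last first.
  by rewrite smul2 a2 b2 cs0l !scaler0 !addr0.
have h1 : ucont (fun s => b.1 *: a.2 s + cs_mul (a.2 s) (b.2 s)).
  by apply: ucont_lin => //; exact: ucont_mul.
have := ucont_lin a.1 b1 h1; congr ucont; apply/funext => s.
by rewrite [RHS]smul2 addrA.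
Qed.

Lemma B_star a : B a -> B (star a).
Proof.
move=> /BP[a1 a2]; apply/BP; split; last first.
  by rewrite -[LHS]/(cs_star (a.2 (clip 0))) a2 cs_star0.
apply: (ucont_le a1 ltr01) => s t; rewrite mul1r.
by rewrite -[X in nrm X <= _]/(cs_star (a.2 t) - cs_star (a.2 s)) -cs_starB cs_nrm_star.
Qed.

(** Evaluation of the cone at [s] followed by [u]. The unit of B acts as the identity even if [u] is
    degenerate. *)
Definition Bev (H : hilbert R) (u : C -> H -> H) (s : I01 R) (b : Bamb C) (f : H) : H :=
  b.1 *: f + u (b.2 s) f.

Lemma Bev_rep (H : hilbert R) (u : C -> H -> H) s : star_rep (S := C) u ->
  star_rep_on (@B R C) (Bev u s).
Proof.
move=> hu; split=> [a _|l a b x _ _|a b x _ _|a x y _]; rewrite /Bev.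
- have ul := rep_lin hu (I : setT (a.2 s)).
  have [M M0 hM] := rep_bd hu (I : setT (a.2 s)); split.
    move=> l x y; rewrite ul scalerDr !scalerDr !scalerA [l * _]mulrC -!addrA; congr (_ + _).
    by rewrite addrCA.
  exists (cmod a.1 + M) => x; apply: le_trans (nrmD _ _) _.
  by rewrite nrmZ mulrDl lerD.
- rewrite B2lin (rep_add hu)// B1lin scalerDl scalerDr scalerA -!addrA; congr (_ + _).
  by rewrite addrCA.
- rewrite smul2 (repD hu)// (repD hu)// !(repZ hu)// (rep_mul hu)//.
  have [_ uD uZ] := linDZ (rep_lin hu (I : setT (a.2 s))).
  by rewrite uD uZ -[(smul a b).1]/(a.1 * b.1) scalerDr scalerA -!addrA.
- rewrite ipDl ipDr ipZl ipZr (rep_star hu)//; congr (_ * _ + _).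
  by rewrite -[(star a).1]/(cj a.1) conjcK.
Qed.

Definition Bchar (H : hilbert R) (b : Bamb C) (f : H) : H := b.1 *: f.

Lemma Bchar_rep (H : hilbert R) : star_rep_on (@B R C) (@Bchar H).
Proof.
have := Bev_rep (clip 0) (zero_rep (S := C) setT H); congr star_rep_on.
by apply/funext => b; apply/funext => f; rewrite /Bev addr0.
Qed.

Section BBounds.
Variables (H : hilbert R) (v : Bamb C -> H -> H).
Hypothesis hv : star_rep_on (@B R C) v.

Lemma B_unit_bd f : nrm (v (Bscal C 1) f) <= nrm f.
Proof.
apply: nrm_le_ip; first exact: nrm_ge0.
have B1 := Bscal_B 1.
have s1 : star (Bscal C 1) = Bscal C 1.
  by apply: Bext => [|s]; [exact: conjc1|exact: cs_star0].
have m1 : smul (Bscal C 1) (Bscal C 1) = Bscal C 1.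
  apply: Bext => [|s]; first exact: mul1r.
  by rewrite smul2 /= cs0l !scaler0 !addr0.
rewrite (rep_star hv)// s1 -(rep_mul hv)// m1.
exact: cauchy_schwarz.
Qed.

Lemma B_scal_bd l f : nrm (v (Bscal C l) f) <= cmod l * nrm f.
Proof.
have -> : Bscal C l = l *: Bscal C 1.
  by apply: Bext => [|s]; [rewrite B1Z; exact/esym/mulr1|rewrite B2Z; exact/esym/scaler0].
rewrite (repZ hv) ?nrmZ; [|exact: B0|exact: Bscal_B].
by rewrite ler_wpM2l ?cmod_ge0// B_unit_bd.
Qed.

(* the square root used in [cs_sqrt] is taken pointwise; it depends
   Lipschitz-continuously on its argument, so it stays in the cone *)
Lemma B_cone_bd (h : I01 R -> C) (K : R) f : B (0, h) -> (forall s, nrm (h s) <= K) ->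
  nrm (v (0, h) f) <= 2 * K * nrm f.
Proof.
move=> Bh hK; have [hc h0'] := (BP (0, h)).1 Bh; have h0 : h (clip 0) = 0 := h0'.
have K0 : 0 <= K := le_trans (nrm_ge0 _) (hK (clip 0)).
have f0 := nrm_ge0 f; have f1 : 0 < nrm f + 1 by lra.
suff key (e : R) : 0 < e -> nrm (v (0, h) f) <= 2 * K * nrm f + e.
  by apply/ler_addgt0Pr => e; exact: key.
move=> e0; have q0 : 0 < e / (nrm f + 1) by rewrite divr_gt0.
pose M := 2 * K + e / (nrm f + 1); have M0 : 0 < M by rewrite ltr_wpDl// mulr_ge0.
have M20 : 0 < M ^+ 2 by rewrite exprn_gt0.
pose x s := ((M ^+ 2)^-1)%:C *: cs_mul (cs_star (h s)) (h s).
have cM : cmod ((M ^+ 2)^-1)%:C = (M ^+ 2)^-1 by rewrite cmodR gtr0_norm ?invr_gt0.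
have x4 s : nrm (x s) <= 1 / 4.
  rewrite nrmZ cM cs_nrmC ler_pdivrMl// mulrC div1r ler_pdivlMl//.
  have -> : 4 * nrm (h s) ^+ 2 = (2 * nrm (h s)) ^+ 2 by ring.
  rewrite ler_pXn2r ?nnegrE ?mulr_ge0 ?nrm_ge0 ?(ltW M0)//.
  by rewrite /M -[leLHS]addr0 lerD ?(ltW q0)// ler_wpM2l.
have [y hy] := choice (fun s => sqrt_ex (x4 s)).
have xs s : cs_star (x s) = x s by rewrite /x cs_starZ conjc_real cs_starM csK.
have hyx s : (M ^+ 2)%:C *: (2 *: y s - cs_mul (y s) (y s)) = cs_mul (cs_star (h s)) (h s).
  by case: (hy s) => -> _; rewrite /x scalerA -rmorphM/= mulfV ?gt_eqF// scale1r.
have xc : ucont x.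
  have hsc : ucont (fun s => cs_star (h s)).
    by apply: (ucont_le hc ltr01) => s t; rewrite mul1r -cs_starB cs_nrm_star.
  apply: (ucont_le (ucont_mul hsc hc) (_ : 0 < (M ^+ 2)^-1)); first by rewrite invr_gt0.
  by move=> s t; rewrite /x -scalerBr nrmZ cM.
have By : B (0, y).
  apply/BP; split.
    by apply: (ucont_le xc ltr01) => s t; rewrite mul1r; exact: sqrt_lip.
  have := sqrt_lip (hy (clip 0)) (y' := 0) (x' := 0).
  rewrite /x h0 cs0r !scaler0 subrr nrm0 subr0 => /(_ _) h1.
  apply/nrm_eq0/le_anti; rewrite nrm_ge0 andbT; apply: h1.
  by split; [rewrite cs0l scaler0 subrr|rewrite nrm0 div1r invr_ge0].
have sy : star ((0, y) : Bamb C) = (0, y).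
  by apply: Bext => [|s]; [exact: conjc0|exact: (sqrt_sa (xs s) (hy s))].
have hh : smul (star ((0, h) : Bamb C)) (0, h) =
    (M ^+ 2)%:C *: (2 *: ((0, y) : Bamb C) - smul ((0, y) : Bamb C) (0, y)).
  apply: Bext => [|s].
    rewrite -[LHS]/(cj 0 * 0 : R[i]) -[RHS]/((M ^+ 2)%:C * (2 * 0 - 0 * 0) : R[i]).
    by rewrite !mulr0 subrr mulr0.
  transitivity (cs_mul (cs_star (h s)) (h s)).
    have s0 : (star ((0, h) : Bamb C)).1 = 0 by exact: conjc0.
    by rewrite smul2 s0 /= !scale0r !add0r.
  rewrite -hyx B2Z B2D B2N B2Z; congr (_ *: (_ - _)).
  by rewrite smul2 /= !scale0r !add0r.
have yf g g' : ip (v (0, y) g) g' = ip g (v (0, y) g') by rewrite (rep_star hv)// sy.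
have {}hM : nrm (v (0, h) f) <= M * nrm f.
  apply: (sqrt_dom (hy := v (0, y) f)) => //.
  rewrite (rep_star hv)// -(rep_mul hv)//; last exact: B_star.
  rewrite hh; have Byy := B_mul By By; have B2y : B (2 *: ((0, y) : Bamb C)) by exact: B_Z.
  rewrite (repZ hv); [|exact: B0|exact: B_sub].
  rewrite (repB hv)//; last exact: B0.
  rewrite (repZ hv)//; last exact: B0.
  by rewrite (rep_mul hv)// ipZr ipBr ipZr conjc_real (conjc_nat R 2) -!yf.
apply: le_trans hM _; rewrite /M mulrDl lerD2l -mulrA ler_piMr ?(ltW e0)//.
by rewrite mulrC ler_pdivrMr// mul1r lerDl.
Qed.

End BBounds.

Lemma B_bounded a : B a -> exists2 K : R, 0 <= K & forall s, nrm (a.2 s) <= K.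
Proof.
move=> /BP[ac _].
have [|||N hN] := unif_cont (D := fun s t e => nrm (a.2 s - a.2 t) < e) _ _ _ ltr01.
- by move=> s t e; rewrite nrmB.
- by move=> s t u e e' h1 h2; exact: le_lt_trans (nrm_triangle _ _ _) (ltrD h1 h2).
- by move=> s e; exact: ac.
have step k : (k <= N.+1)%N -> exists2 K : R, 0 <= K &
    forall s, sval s <= k%:R / N.+1%:R -> nrm (a.2 s) <= K.
  elim: k => [_|k IH kN].
    exists (nrm (a.2 (clip 0))) => [|s]; first exact: nrm_ge0.
    rewrite mul0r => s0; suff -> : s = clip 0 by [].
    by rewrite -[s]clip_sval; congr clip; apply/le_anti; rewrite s0 I01_ge0.
  have [K K0 hK] := IH (ltnW kN); exists (K + 1) => [|s sk]; first by rewrite addr_ge0.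
  have n0 : 0 < N.+1%:R :> R by [].
  have kN1 : 0 <= (k%:R / N.+1%:R : R) <= 1.
    by rewrite divr_ge0//= ler_pdivrMr// mul1r ler_nat ltnW.
  have [sk'|ks] := leP (sval s) (k%:R / N.+1%:R); first by have := hK s sk'; lra.
  pose t : I01 R := clip (k%:R / N.+1%:R).
  have := hK t; rewrite clip_val// => /(_ (lexx _)) h1.
  have := hN s t; rewrite clip_val// ler0_norm ?subr_le0 ?(ltW ks)// opprB lerBlDr.
  have -> : N.+1%:R^-1 + k%:R / N.+1%:R = k.+1%:R / N.+1%:R :> R.
    by rewrite -(natr1 k) mulrDl mul1r addrC.
  move=> /(_ sk) h2; apply: le_trans (nrm_sub _ (a.2 t)) _.
  by rewrite addrC lerD// ltW.
have [K K0 hK] := step N.+1 (leqnn _); exists K => // s; apply: hK.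
by rewrite divff ?I01_le1.
Qed.

Lemma B_rep_bd a : B a -> exists2 K : R, 0 <= K &
  forall (H : hilbert R) (v : Bamb C -> H -> H) f, star_rep_on (@B R C) v ->
    nrm (v a f) <= K * nrm f.
Proof.
move=> Ba; have [K K0 hK] := B_bounded Ba.
exists (cmod a.1 + 2 * K) => [|H v f hv]; first by rewrite addr_ge0 ?cmod_ge0 ?mulr_ge0.
have Bh : B ((0, a.2) : Bamb C) by move/BP: Ba => [h1 h2]; apply/BP.
have e : a = Bscal C a.1 + (0, a.2).
  by apply: Bext => [|s]; [exact/esym/addr0|exact/esym/add0r].
rewrite {1}e (repD hv)//; last exact: Bscal_B.
apply: le_trans (nrmD _ _) _; rewrite mulrDl lerD//; first exact: (B_scal_bd hv).
exact: (B_cone_bd hv).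
Qed.

End BAlgebra.

(** * Matrices over B *)

Section HilbertPower.
Variables (R : realType) (J : finType) (H : hilbert R).
Implicit Types x y : J -> H.

Lemma pk_psd (s : seq (R[i] * (J -> H))) :
  0 <= \sum_(a <- s) \sum_(b <- s) a.1 * cj b.1 * \sum_j ip (a.2 j) (b.2 j).
Proof.
have -> : \sum_(a <- s) \sum_(b <- s) a.1 * cj b.1 * \sum_j ip (a.2 j) (b.2 j) =
   \sum_j ip (\sum_(a <- s) a.1 *: a.2 j) (\sum_(a <- s) a.1 *: a.2 j).
  transitivity (\sum_j \sum_(a <- s) \sum_(b <- s) a.1 * cj b.1 * ip (a.2 j) (b.2 j)).
    rewrite [RHS]exchange_big; apply: eq_bigr => a _; rewrite [RHS]exchange_big.
    by apply: eq_bigr => b _; rewrite mulr_sumr.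
  apply: eq_bigr => j _; rewrite ip_suml; apply: eq_bigr => a _.
  rewrite ip_sumr; apply: eq_bigr => b _.
  by rewrite ipZl ipZr mulrA.
by apply: sumr_ge0 => j _; exact: ip_ge0.
Qed.

Definition pk : psdker R (J -> H) := @Psdker R _ (fun x y => \sum_j ip (x j) (y j)) pk_psd.
Definition hpow : hilbert R := kolm pk.
Definition vec x : hpow := pt pk x.
Definition vn x : R := nrm (vec x).

Lemma ip_vec x y : ip (vec x) (vec y) = \sum_j ip (x j) (y j).
Proof. exact: ip_pt. Qed.

Lemma vec_lin (l : R[i]) x y : vec (fun j => l *: x j + y j) = l *: vec x + vec y.
Proof.
apply: ip_span_ext => z; rewrite ip_linear !ip_pt /= mulr_sumr -big_split.
by apply: eq_bigr => j _; rewrite ip_linear.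
Qed.

Lemma vec0 : vec (fun=> 0) = 0.
Proof.
by apply/nrm_eq0/eqP; rewrite -sqrf_eq0 -(inj_eq (@complexI R)) -(ip_nrm (vec _)) ip_vec big1 ?eqxx// => j _; rewrite ip0l.
Qed.

Lemma vn_ge0 x : 0 <= vn x. Proof. exact: nrm_ge0. Qed.

Lemma vn_sq x : vn x ^+ 2 = \sum_j nrm (x j) ^+ 2.
Proof.
apply: complexI; rewrite -(ip_nrm (vec x)) ip_vec rmorph_sum/=; apply: eq_bigr => j _.
exact: ip_nrm.
Qed.

Lemma vnE x : Num.sqrt (\sum_j nrm (x j) ^+ 2) = vn x.
Proof. by rewrite -vn_sq sqrtr_sqr ger0_norm ?vn_ge0. Qed.

Lemma vn_entry x j : nrm (x j) <= vn x.
Proof.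
rewrite -(ler_pXn2r (ltn0Sn 1)) ?nnegrE ?vn_ge0 ?nrm_ge0// vn_sq (bigD1 j)//= lerDl.
by apply: sumr_ge0 => i _; exact: sqr_ge0.
Qed.

Lemma vn_le_sum x : vn x <= \sum_j nrm (x j).
Proof.
have s0 : 0 <= \sum_j nrm (x j) by apply: sumr_ge0 => j _; exact: nrm_ge0.
rewrite -(ler_pXn2r (ltn0Sn 1)) ?nnegrE ?vn_ge0// vn_sq [leRHS]expr2 mulr_suml.
apply: ler_sum => j _; rewrite expr2 ler_wpM2l ?nrm_ge0// (bigD1 j)//= lerDl.
by apply: sumr_ge0 => i _; exact: nrm_ge0.
Qed.

Lemma vnD x y : vn (fun j => x j + y j) <= vn x + vn y.
Proof.
have := vec_lin 1 x y; rewrite scale1r => e; apply: le_trans (nrmD _ _).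
rewrite -e /vn; under eq_fun do rewrite -[x _]scale1r.
exact: lexx.
Qed.

Lemma vnZ (l : R[i]) x : vn (fun j => l *: x j) = cmod l * vn x.
Proof.
have := vec_lin l x (fun=> 0); rewrite vec0 addr0 => e; rewrite /vn -nrmZ -e.
by congr (nrm (vec _)); apply/funext => j; rewrite addr0.
Qed.

Lemma vn_CS x y : cmod (\sum_j ip (x j) (y j)) <= vn x * vn y.
Proof. by rewrite -ip_vec cauchy_schwarz. Qed.

Lemma ip_vn x : \sum_j ip (x j) (x j) = (vn x ^+ 2)%:C.
Proof. by rewrite -ip_vec ip_nrm. Qed.

End HilbertPower.

Section MatrixNorm.
Variables (R : realType) (C : cstarAlg R).
Implicit Types (J K : finType).

Definition mop J (H : hilbert R) (v : Bamb C -> H -> H) (a : MB C J) (x : J -> H) : J -> H :=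
  fun i => \sum_j v (a i j) (x j).

Definition mxle J (a : MB C J) (M : R) : Prop :=
  forall (H : hilbert R) (v : Bamb C -> H -> H) (x : J -> H),
    star_rep_on (@B R C) v -> vn (mop v a x) <= M * vn x.

Lemma mxnormP J (a : MB C J) (M : R) : inMB a -> 0 <= M ->
  (mxnorm (@B R C) a <= M%:E)%E <-> mxle a M.
Proof.
move=> aB M0; split=> [h H v x hv|h]; last first.
  apply: ge_ereal_sup => _ [H [v [x [hv x1 ->]]]].
  rewrite lee_fin vnE; apply: le_trans (h H v x hv) _.
  by rewrite ler_piMr// -(ler_pXn2r (ltn0Sn 1)) ?nnegrE ?vn_ge0// vn_sq expr1n.
have key (t : R) : 0 < t -> t * vn x <= 1 -> t * vn (mop v a x) <= M.
  move=> t0 tx; have ct : cmod t%:C = t by rewrite cmodR gtr0_norm.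
  rewrite -lee_fin; apply: le_trans h; apply: ereal_sup_ubound.
  exists H, v, (fun j => t%:C *: x j); split => //.
    by rewrite -vn_sq vnZ ct expr_le1// mulr_ge0 ?vn_ge0// ltW.
  rewrite vnE; congr EFin; rewrite -[X in X * _]ct -vnZ; congr vn; apply/funext => i.
  rewrite /mop scaler_sumr; apply: eq_bigr => j _.
  by have [_ _ ->] := linDZ (rep_lin hv (aB i j)).
have x0 := vn_ge0 x; have [z0|z0] := eqVneq (vn x) 0.
  rewrite z0 mulr0 leNgt; apply/negP => Xp.
  have tp : 0 < (M + 1) / vn (mop v a x) by rewrite divr_gt0// ltr_wpDl.
  by have := key _ tp; rewrite z0 mulr0 ler01 divfK ?gt_eqF// => /(_ isT); lra.
have zp : 0 < vn x by rewrite lt0r z0 x0.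
have := key (vn x)^-1; rewrite invr_gt0 zp mulVf// => /(_ isT (lexx _)).
by rewrite ler_pdivrMl// mulrC.
Qed.

Lemma mxle_ge J (a : MB C J) (M N : R) : mxle a M -> M <= N -> mxle a N.
Proof.
by move=> h MN H v x hv; apply: le_trans (h _ _ x hv) _; rewrite ler_wpM2r ?vn_ge0.
Qed.

Lemma mxle_lin J (l : R[i]) (a b : MB C J) (M N : R) : inMB a -> inMB b ->
  mxle a M -> mxle b N -> mxle (l *: a + b) (cmod l * M + N).
Proof.
move=> aB bB ha hb H v x hv.
have -> : mop v (l *: a + b) x = fun i => l *: mop v a x i + mop v b x i.
  apply/funext => i; rewrite /mop scaler_sumr -big_split; apply: eq_bigr => j _.
  by rewrite -[(l *: a + b) i j]/(l *: a i j + b i j) (rep_add hv).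
apply: le_trans (vnD _ _) _; rewrite vnZ mulrDl -mulrA lerD ?hb// ler_wpM2l ?cmod_ge0//.
exact: ha.
Qed.

Lemma mop_mul J (H : hilbert R) (v : Bamb C -> H -> H) (a b : MB C J) x :
  star_rep_on (@B R C) v -> inMB a -> inMB b -> mop v (smul a b) x = mop v a (mop v b x).
Proof.
move=> hv aB bB; apply/funext => i; rewrite /mop.
transitivity (\sum_j \sum_k v (smul (a i k) (b k j)) (x j)).
  apply: eq_bigr => j _; rewrite (rep_sum hv)//; [exact: B0|exact: B_D|].
  by move=> k; exact: B_mul.
rewrite exchange_big; apply: eq_bigr => k _.
rewrite (lin_sum (rep_lin hv (aB i k))); apply: eq_bigr => j _.
by rewrite (rep_mul hv).
Qed.

Lemma inMB_lin J (l : R[i]) (a b : MB C J) : inMB a -> inMB b -> inMB (l *: a + b).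
Proof. by move=> aB bB i j; exact: B_lin. Qed.

Lemma inMB_mul J (a b : MB C J) : inMB a -> inMB b -> inMB (smul a b).
Proof. by move=> aB bB i j; apply: B_sum => k; exact: B_mul. Qed.

Lemma inMB_star J (a : MB C J) : inMB a -> inMB (star a).
Proof. by move=> aB i j; exact: B_star. Qed.

Lemma mxle_mul J (a b : MB C J) (M N : R) : 0 <= M -> inMB a -> inMB b ->
  mxle a M -> mxle b N -> mxle (smul a b) (M * N).
Proof.
move=> M0 aB bB ha hb H v x hv; rewrite mop_mul//.
by apply: le_trans (ha _ _ _ hv) _; rewrite -mulrA ler_wpM2l// hb.
Qed.

Lemma mop_adj J (H : hilbert R) (v : Bamb C -> H -> H) (a : MB C J) x y :
  star_rep_on (@B R C) v -> inMB a ->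
  \sum_i ip (mop v a x i) (y i) = \sum_i ip (x i) (mop v (star a) y i).
Proof.
move=> hv aB; rewrite /mop.
transitivity (\sum_i \sum_j ip (v (a i j) (x j)) (y i)).
  by apply: eq_bigr => i _; rewrite ip_suml.
rewrite exchange_big; apply: eq_bigr => j _.
by rewrite ip_sumr; apply: eq_bigr => i _; rewrite (rep_star hv).
Qed.

Lemma mxle_star J (a : MB C J) (M : R) : 0 <= M -> inMB a -> mxle a M -> mxle (star a) M.
Proof.
move=> M0 aB ha H v x hv; apply: nrm_le_of_sq_real; rewrite ?vn_ge0 ?mulr_ge0 ?vn_ge0//.
set y := mop v (star a) x.
have -> : vn y ^+ 2 = cmod (\sum_i ip (mop v a y i) (x i)).
  by rewrite mop_adj// -/y ip_vn cmodR ger0_norm// sqr_ge0.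
apply: le_trans (vn_CS _ _) _.
by rewrite -mulrA [vn x * _]mulrC mulrA ler_wpM2r ?vn_ge0// ha.
Qed.

Lemma mxle_entries J (a : MB C J) (m : J -> J -> R) :
  (forall i j (H : hilbert R) (v : Bamb C -> H -> H) f, star_rep_on (@B R C) v ->
     nrm (v (a i j) f) <= m i j * nrm f) ->
  mxle a (\sum_i \sum_j Num.max 0 (m i j)).
Proof.
move=> h H v x hv; apply: le_trans (vn_le_sum _) _; rewrite mulr_suml; apply: ler_sum => i _.
apply: le_trans (nrm_sum _ _) _; rewrite mulr_suml; apply: ler_sum => j _.
apply: le_trans (h i j H v (x j) hv) _.
apply: le_trans (ler_wpM2r (nrm_ge0 _) (_ : m i j <= Num.max 0 (m i j))) _.
  by rewrite le_max lexx orbT.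
by rewrite ler_wpM2l ?vn_entry// le_max lexx.
Qed.

Lemma mxle_ex J (a : MB C J) : inMB a -> exists2 M : R, 0 <= M & mxle a M.
Proof.
move=> aB; have h i j : exists K : R, forall (H : hilbert R) (v : Bamb C -> H -> H) f,
    star_rep_on (@B R C) v -> nrm (v (a i j) f) <= K * nrm f.
  by have [K _ hK] := B_rep_bd (aB i j); exists K.
pose m i j := sval (cid (h i j)); have hm i j := svalP (cid (h i j)).
exists (\sum_i \sum_j Num.max 0 (m i j)); last exact: mxle_entries.
by apply: sumr_ge0 => i _; apply: sumr_ge0 => j _; rewrite le_max lexx.
Qed.

Lemma mxle_entry J (a : MB C J) (M : R) i j (H : hilbert R) (v : Bamb C -> H -> H) f :
  inMB a -> star_rep_on (@B R C) v -> mxle a M -> nrm (v (a i j) f) <= M * nrm f.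
Proof.
move=> aB hv ha; pose x (j' : J) := if j' == j then f else 0.
have xn : vn x = nrm f.
  apply/eqP; rewrite -(@eqrXn2 _ 2)// ?vn_ge0 ?nrm_ge0//; rewrite vn_sq (bigD1 j)//= big1 => [|k kj].
    by rewrite /x eqxx addr0.
  by rewrite /x (negPf kj) nrm0 expr0n.
rewrite -xn; apply: le_trans (ha H v x hv); apply: le_trans (vn_entry _ i).
rewrite /mop (bigD1 j)//= big1 => [|k kj]; first by rewrite /x eqxx addr0.
have [z _ _] := linDZ (rep_lin hv (aB i k)).
by rewrite /x (negPf kj) z.
Qed.

Lemma sum_prod (V : nmodType) (L K : finType) (F : L * K -> V) :
  \sum_p F p = \sum_c \sum_k F (c, k).
Proof. by rewrite pair_bigA; apply: eq_bigr => -[]. Qed.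

Lemma vn_sq_le (J K : finType) (H : hilbert R) (y : J -> H) (z : K -> H) (M : R) : 0 <= M ->
  vn y <= M * vn z -> \sum_j nrm (y j) ^+ 2 <= M ^+ 2 * \sum_k nrm (z k) ^+ 2.
Proof.
by move=> M0 h; rewrite -!vn_sq -exprMn ler_pXn2r ?nnegrE ?mulr_ge0 ?vn_ge0.
Qed.

Lemma mxle_blocks (L K J : finType) (e : L * K -> J) (a : MB C J) (b : L -> MB C K) (M : R) :
  0 <= M -> bijective e -> (forall c k k', a (e (c, k)) (e (c, k')) = b c k k') ->
  (forall c c' k k', c != c' -> a (e (c, k)) (e (c', k')) = 0) ->
  (forall c, mxle (b c) M) -> mxle a M.
Proof.
move=> M0 be ab a0 hb H v x hv.
rewrite -(ler_pXn2r (ltn0Sn 1)) ?nnegrE ?vn_ge0 ?mulr_ge0 ?vn_ge0//.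
rewrite exprMn !vn_sq [in leLHS](reindex e) ?[in leRHS](reindex e); try exact: onW_bij.
rewrite !sum_prod mulr_sumr.
apply: ler_sum => c _.
apply: le_trans (vn_sq_le M0 (hb c H v (fun k => x (e (c, k))) hv)); rewrite le_eqVlt; apply/orP; left; apply/eqP; apply: eq_bigr => k _.
congr (nrm _ ^+ 2); rewrite /mop (reindex e); last exact: onW_bij.
rewrite sum_prod.
rewrite (bigD1 c)//= [X in _ + X]big1 ?addr0 => [|c' cc'].
  by apply: eq_bigr => k' _; rewrite ab.
by apply: big1 => k' _; rewrite a0 1?eq_sym// (rep0 hv)//; exact: B0.
Qed.

Lemma mxle_sum (K1 K2 J : finType) (e : K1 + K2 -> J) (a : MB C J) (b1 : MB C K1) (b2 : MB C K2) (M : R) :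
  0 <= M -> bijective e -> (forall k k', a (e (inl k)) (e (inl k')) = b1 k k') ->
  (forall k k', a (e (inr k)) (e (inr k')) = b2 k k') ->
  (forall k k', a (e (inl k)) (e (inr k')) = 0) -> (forall k k', a (e (inr k)) (e (inl k')) = 0) ->
  mxle b1 M -> mxle b2 M -> mxle a M.
Proof.
move=> M0 be a1 a2 a12 a21 h1 h2 H v x hv.
rewrite -(ler_pXn2r (ltn0Sn 1)) ?nnegrE ?vn_ge0 ?mulr_ge0 ?vn_ge0//.
rewrite exprMn !vn_sq [in leLHS](reindex e) ?[in leRHS](reindex e); try exact: onW_bij.
rewrite !big_sumType/= mulrDr.
have v0 f : v 0 f = 0 by rewrite (rep0 hv)//; exact: B0.
have g1 := vn_sq_le M0 (h1 H v (fun k => x (e (inl k))) hv).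
have g2 := vn_sq_le M0 (h2 H v (fun k => x (e (inr k))) hv).
apply: le_trans (lerD g1 g2); rewrite le_eqVlt; apply/orP; left; apply/eqP.
congr (_ + _); apply: eq_bigr => k _; congr (nrm _ ^+ 2);
  rewrite /mop (reindex e) ?big_sumType; try exact: onW_bij; rewrite /=.
  by rewrite [X in _ + X]big1 ?addr0 => [|k' _]; [apply: eq_bigr => k' _; rewrite a1|rewrite a12 v0].
by rewrite big1 ?add0r => [|k' _]; [apply: eq_bigr => k' _; rewrite a2|rewrite a21 v0].
Qed.

Lemma mxle_conj J K (W : J -> K -> R[i]) (a : MB C J) (M : R) : 0 <= M -> inMB a ->
  (forall x y, \sum_i cj (W i x) * W i y = (x == y)%:R) -> mxle a M -> mxle (conj_mx W a) M.
Proof.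
move=> M0 aB Wi ha H v x hv.
pose Wx (z : K -> H) : J -> H := fun i => \sum_y W i y *: z y.
pose Ws (z : J -> H) : K -> H := fun k => \sum_i cj (W i k) *: z i.
have -> : mop v (conj_mx W a) x = Ws (mop v a (Wx x)).
  apply/funext => k; rewrite /mop /Ws /conj_mx.
  transitivity (\sum_y \sum_i \sum_j (cj (W i k) * W j y) *: v (a i j) (x y)).
    apply: eq_bigr => y _; rewrite (rep_sum hv); [|exact: B0|exact: B_D|].
      apply: eq_bigr => i _; rewrite (rep_sum hv); [|exact: B0|exact: B_D|].
        by apply: eq_bigr => j _; rewrite (repZ hv)//; exact: B0.
      by move=> j; exact: B_Z.
    by move=> i; apply: B_sum => j; exact: B_Z.
  rewrite exchange_big; apply: eq_bigr => i _.
  rewrite [LHS]exchange_big scaler_sumr; apply: eq_bigr => j _.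
  rewrite (lin_sum (rep_lin hv (aB i j))) scaler_sumr; apply: eq_bigr => y _.
  by have [_ _ ->] := linDZ (rep_lin hv (aB i j)); rewrite scalerA.
have adj (z : K -> H) (y : J -> H) : \sum_i ip (Wx z i) (y i) = \sum_k ip (z k) (Ws y k).
  transitivity (\sum_i \sum_k W i k * ip (z k) (y i)).
    by apply: eq_bigr => i _; rewrite ip_suml; apply: eq_bigr => k _; rewrite ipZl.
  rewrite exchange_big; apply: eq_bigr => k _; rewrite ip_sumr.
  by apply: eq_bigr => i _; rewrite ipZr conjcK.
have WW z : Ws (Wx z) = z.
  apply/funext => k; rewrite /Ws /Wx.
  transitivity (\sum_y (\sum_i cj (W i k) * W i y) *: z y).
    transitivity (\sum_i \sum_y (cj (W i k) * W i y) *: z y).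
      by apply: eq_bigr => i _; rewrite scaler_sumr; apply: eq_bigr => y _; rewrite scalerA.
    by rewrite exchange_big; apply: eq_bigr => y _; rewrite scaler_suml.
  rewrite (bigD1 k)//= Wi eqxx scale1r big1 ?addr0// => y yk.
  by rewrite Wi eq_sym (negPf yk) scale0r.
have Wn z : vn (Wx z) = vn z.
  apply/eqP; rewrite -(@eqrXn2 _ 2)// ?vn_ge0//.
  by rewrite -(inj_eq (@complexI R)) -!ip_vn adj WW.
have Wsn y : vn (Ws y) <= vn y.
  apply: nrm_le_of_sq_real; rewrite ?vn_ge0//.
  have -> : vn (Ws y) ^+ 2 = cmod (\sum_i ip (Wx (Ws y) i) (y i)).
    by rewrite adj ip_vn cmodR ger0_norm// sqr_ge0.
  by apply: le_trans (vn_CS _ _) _; rewrite Wn mulrC.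
by apply: le_trans (Wsn _) _; apply: le_trans (ha _ _ _ hv) _; rewrite Wn.
Qed.

Lemma inMB_conj J K (W : J -> K -> R[i]) (a : MB C J) : inMB a -> inMB (conj_mx W a).
Proof. by move=> aB i j; apply: B_sum => k; apply: B_sum => l; exact: B_Z. Qed.

End MatrixNorm.

(** * The connecting maps *)

Section ConnectingMapNorm.
Variables (R : realType) (C : cstarAlg R).

Lemma theta_B t (b : Bamb C) : B b -> B (theta t b).
Proof.
move=> /BP[bc b0]; apply/BP; split=> /=.
  move=> s e e0; have [d d0 hd] := bc (clip ((1 - t) * sval s)) e e0.
  have c0 : 0 < `|1 - t| + 1 by rewrite ltr_wpDl.
  exists (d / (`|1 - t| + 1)) => [|s' hs]; first by rewrite divr_gt0.
  apply: hd; apply: le_lt_trans (clip_lip _ _) _; rewrite -mulrBr normrM.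
  rewrite ltr_pdivlMr// in hs; apply: le_lt_trans hs; rewrite mulrC ler_wpM2l//; lra.
have -> : clip ((1 - t) * sval (clip (0 : R))) = clip 0 :> I01 R.
  by rewrite [sval (clip 0)]clip_val ?mulr0// lexx ler01.
exact: b0.
Qed.

Lemma theta_rep t (H : hilbert R) (v : Bamb C -> H -> H) :
  star_rep_on (@B R C) v -> star_rep_on (@B R C) (fun b => v (theta t b)).
Proof.
move=> hv; split=> [a Ba|l a b x Ba Bb|a b x Ba Bb|a x y Ba].
- split; first exact: (rep_lin hv (theta_B t Ba)).
  by have [M _ hM] := rep_bd hv (theta_B t Ba); exists M.
- by rewrite -(rep_add hv)//; exact: theta_B.
- by rewrite -(rep_mul hv)//; exact: theta_B.
- by rewrite (rep_star hv)//; exact: theta_B.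
Qed.

Lemma mxle_theta (J : finType) t (a : MB C J) M :
  mxle a M -> mxle (fun x y => theta t (a x y)) M.
Proof. by move=> ha H v x hv; exact: (ha _ _ x (theta_rep t hv)). Qed.

Section Gamma.
Variables (n : nat) (gamma : Bamb C -> mx_starAlg 'I_n (scalars R)).
Hypothesis hg : star_hom_on (@B R C) gamma.

Definition gact (H : hilbert R) (b : Bamb C) (x : 'I_n -> H) : 'I_n -> H :=
  fun i => \sum_j (gamma b i j : R[i]) *: x j.

(** Composing with [gamma] lets B act on H^n. Boundedness has to be supplied, since B is not a
    [cstarAlg]; the sum of the moduli of the entries is enough, because only its existence
    matters. *)
Lemma gamma_rep (H : hilbert R) : exists u : Bamb C -> hpow 'I_n H -> hpow 'I_n H,
  star_rep_on (@B R C) u /\ forall b x, B b -> u b (vec x) = vec (gact b x).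
Proof.
have [glin gmul gstar] := hg.
have vsum (s : seq (R[i] * ('I_n -> H))) : \sum_(c <- s) c.1 *: vec c.2 = vec (fun i => \sum_(c <- s) c.1 *: c.2 i).
  elim: s => [|c s IH].
    by rewrite big_nil -[LHS](vec0 'I_n H); congr vec; apply/funext => i; rewrite big_nil.
  rewrite big_cons IH -vec_lin; congr vec; apply/funext => i; by rewrite big_cons.
apply: (@action_rep R _ (pk 'I_n H) (Bamb C) (@B R C) (@gact H)).
- exact: B_star.
- exact: B_lin.
- exact: B_mul.
- move=> b Bb; exists (\sum_i \sum_j cmod (gamma b i j : R[i])) => [|s].
    by apply: sumr_ge0 => i _; apply: sumr_ge0 => j _; exact: cmod_ge0.
  have -> : \sum_(c <- s) c.1 *: pt (pk 'I_n H) (gact b c.2) =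
     vec (gact b (fun i => \sum_(c <- s) c.1 *: c.2 i)).
    have := vsum [seq (c.1, gact b c.2) | c <- s]; rewrite big_map => ->; congr vec.
    apply/funext => i; rewrite big_map /gact.
    transitivity (\sum_(c <- s) \sum_j (gamma b i j : R[i]) *: (c.1 *: c.2 j)).
      by apply: eq_bigr => c _; rewrite scaler_sumr; apply: eq_bigr => j _; rewrite !scalerA mulrC.
    by rewrite exchange_big; apply: eq_bigr => j _; rewrite scaler_sumr.
  rewrite /span vsum; set x := fun i => _.
  apply: le_trans (vn_le_sum _) _; rewrite mulr_suml; apply: ler_sum => i _.
  apply: le_trans (nrm_sum _ _) _; rewrite mulr_suml; apply: ler_sum => j _.
  by rewrite nrmZ ler_wpM2l ?cmod_ge0// vn_entry.
- move=> l a b x Ba Bb; rewrite -vec_lin; congr vec; apply/funext => i.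
  rewrite /gact glin// scaler_sumr -big_split; apply: eq_bigr => j _ /=.
  by rewrite scalerA -scalerDl.
- move=> a b x Ba Bb; congr pt; apply/funext => i; rewrite /gact gmul//=.
  transitivity (\sum_j \sum_k ((gamma a i k : R[i]) * (gamma b k j : R[i])) *: x j).
    by apply: eq_bigr => j _; rewrite -scaler_suml.
  rewrite exchange_big; apply: eq_bigr => k _; rewrite scaler_sumr.
  by apply: eq_bigr => j _; rewrite scalerA.
- move=> a x y Ba /=; rewrite /gact gstar//.
  transitivity (\sum_i \sum_j (gamma a i j : R[i]) * ip (x j) (y i)).
    by apply: eq_bigr => i _; rewrite ip_suml; apply: eq_bigr => j _; rewrite ipZl.
  rewrite exchange_big; apply: eq_bigr => j _; rewrite ip_sumr; apply: eq_bigr => i _.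
  by rewrite ipZr; congr (_ * _); exact/esym/conjcK.
Qed.

(** A representation [v] of B may send the unit to a proper projection p, and then v (l 1) f = l p
    f. The vectors are therefore first cut down by p, after which the norm is that of c in the
    representation through [gamma] on H^n. *)
Lemma mxle_gamma (J : finType) (c : MB C J) M : 0 <= M -> inMB c ->
  mxle c M -> mxle (gamma_mx gamma c) M.
Proof.
move=> M0 cB hc H v x hv; have [u [hu uE]] := gamma_rep H.
pose p := v (Bscal C 1).
have vscal l f : v (Bscal C l) f = l *: p f.
  have -> : Bscal C l = l *: Bscal C 1.
    by apply: Bext => [|s]; [rewrite B1Z; exact/esym/mulr1|rewrite B2Z; exact/esym/scaler0].
  by rewrite (repZ hv)//; [exact: B0|exact: Bscal_B].
pose x' j : hpow 'I_n H := vec (fun al => p (x (j, al))).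
have h := vn_sq_le M0 (hc _ _ x' hu).
rewrite -(ler_pXn2r (ltn0Sn 1)) ?nnegrE ?vn_ge0 ?mulr_ge0 ?vn_ge0//.
rewrite exprMn !vn_sq !sum_prod.
have e1 j : nrm (mop u c x' j) ^+ 2 = \sum_al nrm (mop v (gamma_mx gamma c) x (j, al)) ^+ 2.
  rewrite -vn_sq; congr (_ ^+ 2); congr nrm; rewrite /mop.
  have -> : \sum_j' u (c j j') (x' j') = \sum_(j' <- enum J) 1 *: vec (gact (c j j') (fun al => p (x (j', al)))).
    by rewrite big_enum; apply: eq_bigr => j' _; rewrite scale1r /x' uE.
  have vs (s : seq J) : \sum_(j' <- s) 1 *: vec (gact (c j j') (fun al => p (x (j', al)))) =
     vec (fun al => \sum_(j' <- s) gact (c j j') (fun al => p (x (j', al))) al).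
    elim: s => [|j' s IH].
      by rewrite big_nil -[LHS](vec0 'I_n H); congr vec; apply/funext => i; rewrite big_nil.
    rewrite big_cons IH -vec_lin; congr vec; apply/funext => i; by rewrite big_cons scale1r.
  rewrite vs; congr vec; apply/funext => al; rewrite big_enum sum_prod.
  apply: eq_bigr => j' _; apply: eq_bigr => be _.
  by rewrite /gamma_mx/= vscal.
rewrite -(eq_bigr _ (fun j _ => e1 j)); apply: le_trans h _.
rewrite ler_wpM2l ?sqr_ge0//; apply: ler_sum => j _; rewrite -[nrm _]/(vn _) vn_sq.
apply: ler_sum => al _; rewrite ler_pXn2r ?nnegrE ?nrm_ge0//.
exact: (B_unit_bd hv).
Qed.

Lemma mxle_delta (P Q : finType) (a c : MB C (P * Q)%type) M : 0 <= M -> inMB c ->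
  mxle a M -> mxle c M -> mxle (delta_s gamma a c) M.
Proof.
move=> M0 cB ha hc.
(* Up to the order of the indices, [delta_s] consists of five diagonal copies of a (+) gamma(c). *)
pose b : MB C ((P + P * 'I_n) * Q)%type := fun x y =>
  match x.1, y.1 with
  | inl i, inl j => a (i, x.2) (j, y.2)
  | inr i, inr j => gamma_mx gamma c ((i.1, x.2), i.2) ((j.1, y.2), j.2)
  | _, _ => 0
  end.
have hb : mxle b M.
  pose e (k : (P * Q) + (P * Q) * 'I_n) : (P + P * 'I_n) * Q :=
    match k with inl k => (inl k.1, k.2) | inr k => (inr (k.1.1, k.2), k.1.2) end.
  apply: (@mxle_sum R C _ _ _ e b a (gamma_mx gamma c)) => //.
  - exists (fun k => match k.1 with inl i => inl (i, k.2) | inr i => inr ((i.1, k.2), i.2) end).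
      by move=> [[i j]|[[i j] l]].
    by move=> [[i|[i l]] j].
  - by move=> [i j] [i' j'].
  - by move=> [[i j] l] [[i' j'] l'].
  - exact: mxle_gamma.
pose e (k : 'I_5 * ((P + P * 'I_n) * Q)) : (P + P * 'I_n) * (Q * 'I_5) := (k.2.1, (k.2.2, k.1)).
apply: (@mxle_blocks R C _ _ _ e _ (fun=> b)) => //.
- by exists (fun k => (k.2.2, (k.1, k.2.1))) => [[c' [i j]]|[i [j c']]].
- by move=> c' [i j] [i' j']; rewrite /delta_s/= eqxx.
- by move=> c1 c2 [i j] [i' j'] cc; rewrite /delta_s/= (negPf cc).
Qed.

Lemma delta_B (P Q : finType) (a c : MB C (P * Q)%type) : inMB a -> inMB (delta_s gamma a c).
Proof.
move=> aB x y; rewrite /delta_s; case: ifP => _; last exact: B0.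
by case: (x.1) (y.1) => [i|i] [j|j]; [exact: aB|exact: B0|exact: B0|exact: Bscal_B].
Qed.

End Gamma.

Lemma mxle_diag (k : nat) (J : finType) (a : 'I_k -> MB C J) M : 0 <= M ->
  (forall i, mxle (a i) M) -> mxle (diag_blocks a) M.
Proof.
move=> M0 ha; apply: (@mxle_blocks R C _ _ _ id _ a) => //.
- by exists id.
- by move=> c i j; rewrite /diag_blocks/= eqxx.
- by move=> c c' i j cc; rewrite /diag_blocks/= (negPf cc).
Qed.

Lemma diag_B (k : nat) (J : finType) (a : 'I_k -> MB C J) :
  (forall i, inMB (a i)) -> inMB (diag_blocks a).
Proof. by move=> aB x y; rewrite /diag_blocks; case: ifP => _; [exact: aB|exact: B0]. Qed.

Lemma conj_conj (J K L : finType) (V : J -> K -> R[i]) (W : K -> L -> R[i]) (a : MB C J) :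
  conj_mx W (conj_mx V a) = conj_mx (fun i y => \sum_x V i x * W x y) a.
Proof.
apply/funext => y; apply/funext => y'; rewrite /conj_mx.
transitivity (\sum_x \sum_x' \sum_i \sum_j (cj (W x y) * W x' y' * (cj (V i x) * V j x')) *: a i j).
  apply: eq_bigr => x _; apply: eq_bigr => x' _; rewrite scaler_sumr; apply: eq_bigr => i _.
  by rewrite scaler_sumr; apply: eq_bigr => j _; rewrite scalerA.
under eq_bigr do rewrite exchange_big.
rewrite exchange_big; apply: eq_bigr => i _.
under eq_bigr do rewrite exchange_big.
rewrite exchange_big; apply: eq_bigr => j _.
transitivity ((\sum_x \sum_x' (cj (W x y) * W x' y' * (cj (V i x) * V j x'))) *: a i j).
  by rewrite scaler_suml; apply: eq_bigr => x _; rewrite scaler_suml.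
congr (_ *: _); rewrite -[Num.conj _]/(cj _) conj_sum mulr_suml; apply: eq_bigr => x _.
by rewrite mulr_sumr; apply: eq_bigr => x' _; rewrite conjM; ring.
Qed.

Lemma conj_sel (J K : finType) (e : K -> J) (a : MB C J) :
  conj_mx (fun i y => (i == e y)%:R) a = fun y y' => a (e y) (e y').
Proof.
apply/funext => y; apply/funext => y'; rewrite /conj_mx (bigD1 (e y))//= (bigD1 (e y'))//=.
rewrite !eqxx -[Num.conj _]/(cj 1) (conjc1 R) mulr1 scale1r.
rewrite big1 ?addr0 => [|j je]; last by rewrite (negPf je) mulr0 scale0r.
rewrite big1 ?addr0// => i ie; apply: big1 => j _.
by rewrite (negPf ie) -[Num.conj _]/(cj 0) (conjc0 R) mul0r scale0r.
Qed.

End ConnectingMapNorm.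

Section ConnectingMaps.
Variables (R : realType) (C : cstarAlg R) (S : AzC_data C).
Hypothesis adm : AzC_admissible S.

Lemma psize_gt0 m : (0 < az_p S m)%N.
Proof.
rewrite /az_p; elim: m => // m IH /=.
rewrite !muln_gt0 IH andbT; have [/prime_gt0 -> _] := az_k0P adm m.
by have [[e ->] _] := az_dP adm m; rewrite expn_gt0.
Qed.

Lemma qsize_gt0 m : (0 < az_q S m)%N.
Proof.
rewrite /az_q; elim: m => // m IH /=.
by rewrite !muln_gt0 IH andbT; have [/prime_gt0 -> _] := az_k1P adm m.
Qed.

(** If the residue vanished, 5 q would divide the prime k0 after cancelling k1, hence equal it,
    against 15 q < k0. Positivity guarantees a path of [xi] that sweeps [0, 1/2]. *)
Lemma r0_gt0 m : (0 < az_r0 S m)%N.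
Proof.
have [k0p k0q] := az_k0P adm m; have [/prime_gt0 k10 _] := az_k1P adm m.
have q0 := qsize_gt0 m; rewrite lt0n; apply/negP => /eqP r00.
have : (5 * az_k1 S m * az_q S m %| az_k0 S m * az_k1 S m)%N by apply/eqP; exact: r00.
rewrite mulnAC dvdn_pmul2r// => d.
have := primeP k0p => -[_ /(_ _ d)] /orP[|/eqP e]; first by rewrite muln_eq1 => /andP[].
by move: k0q; rewrite -e ltnNge leq_mul2r orbT.
Qed.

(** If the residue vanished, d p would divide the prime k1 after cancelling k0; as d > 1 they would
    be equal, against 15 k0 d p < k1. Positivity guarantees a path of [xi] that sweeps [1/2, 1]. *)
Lemma r1_gt0 m : (0 < az_r1 S m)%N.
Proof.
have [/prime_gt0 k00 _] := az_k0P adm m; have [k1p k1q] := az_k1P adm m.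
have p0 := psize_gt0 m; have [_ d3] := az_dP adm m.
rewrite lt0n; apply/negP => /eqP r10.
have : (az_k0 S m * az_d S m * az_p S m %| az_k0 S m * az_k1 S m)%N by apply/eqP; exact: r10.
rewrite -mulnA dvdn_pmul2l// => d.
have d1 : (1 < az_d S m)%N by apply: leq_trans d3; rewrite ltnS expn_gt0.
have := primeP k1p => -[_ /(_ _ d)] /orP[|/eqP e].
  by rewrite muln_eq1 => /andP[/eqP e _]; rewrite e in d1.
by move: k1q; rewrite -e -mulnA ltnNge leq_pmull// muln_gt0 k00.
Qed.

Lemma r0_lt_k m : (az_r0 S m < az_k S m)%N.
Proof.
have [_ k0q] := az_k0P adm m; have [/prime_gt0 k10 _] := az_k1P adm m.
have q0 := qsize_gt0 m.
apply: (@leq_trans (az_q S m.+1)).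
  by rewrite ltn_mod; exact: (qsize_gt0 m.+1).
rewrite -[az_q S m.+1]/(5 * az_k1 S m * az_q S m)%N -[az_k S m]/(az_k0 S m * az_k1 S m)%N.
rewrite mulnAC leq_mul2r; apply/orP; right; apply: leq_trans (ltnW k0q).
by rewrite leq_mul2r orbT.
Qed.

(** The first path is 2 t / 3 and the last one 1/2 + 2 t / 3 on [0, 3/4]; together they cover
    [0, 1]. The restriction t <= 3/4 keeps the contraction [theta] out of the formula. *)
Lemma xi_surj m (s : I01 R) : exists (i : 'I_(az_k S m)) (t : I01 R),
  sval t <= 3 / 4 /\ xi (az_k S m) (az_r0 S m) (az_r1 S m) i (sval t) = sval s.
Proof.
have k0 : (0 < az_k S m)%N := leq_ltn_trans (leq0n _) (r0_lt_k m).
have s0 := I01_ge0 s; have s1 := I01_le1 s.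
have [s2|s2] := leP (sval s) (1 / 2).
  exists (Ordinal k0), (clip (3 / 2 * sval s)).
  rewrite clip_val; last by apply/andP; split; lra.
  have h : 3 / 2 * sval s <= 3 / 4 by lra.
  by split=> //; rewrite /xi /= r0_gt0 min_l//; field.
have km : ((az_k S m).-1 < az_k S m)%N by rewrite prednK.
exists (Ordinal km), (clip (3 / 2 * (sval s - 1 / 2))).
rewrite clip_val; last by apply/andP; split; lra.
have h : 3 / 2 * (sval s - 1 / 2) <= 3 / 4 by lra.
split=> //; rewrite /xi /= min_l//.
have -> : ((az_k S m).-1 < az_r0 S m)%N = false.
  by apply/negbTE; rewrite -leqNgt -ltnS prednK// r0_lt_k.
have -> : ((az_k S m).-1 < az_k S m - az_r1 S m)%N = false.
  apply/negbTE; rewrite -leqNgt -subn1; apply: leq_sub2l; exact: r1_gt0.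
by field.
Qed.

Definition isom (J K : finType) (W : J -> K -> R[i]) : Prop :=
  forall x y, \sum_i cj (W i x) * W i y = (x == y)%:R.

(* f(s) is a corner of phi_m(f)(t), cut out by an isometry independent of f *)
Lemma tower_step m (K : finType) (s : I01 R) (W : az_idx S m -> K -> R[i]) : isom W ->
  exists (t : I01 R) (W' : az_idx S m.+1 -> K -> R[i]), isom W' /\
    forall g : az_amb S m, conj_mx W' (az_phi g t) = conj_mx W (g s).
Proof.
move=> iW; have [i [t [t34 xit]]] := xi_surj m s.
(* Block i, the summand f rather than gamma(f), and the first of the five copies. [V] is the adjoint
   of [v(t)] restricted to these coordinates, so that conjugating by it cancels [v(t)] and leaves a
   selection of entries. *)
pose e (y : az_idx S m) : 'I_(az_k S m) * az_blk S m := (i, (inl y.1, (y.2, ord0))).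
pose V x y := cj (az_v S m t (e y) x).
have [v1 v2] := az_v_unitary adm m t.
pose W' x y := \sum_z V x z * W z y.
have Vi : isom V.
  move=> y y'; rewrite /V.
  transitivity ((e y == e y')%:R : R[i]).
    by rewrite -v2; apply: eq_bigr => z _; rewrite conjcK.
  by congr (_%:R); case: y y' => [y1 y2] [y1' y2']; rewrite /e /= !xpair_eqE eqxx /= eqxx andbT.
exists t, W'; split.
  move=> x y; rewrite /W'.
  transitivity (\sum_z \sum_z' cj (W z x) * W z' y * \sum_i0 (cj (V i0 z) * V i0 z')).
    transitivity (\sum_i0 \sum_z \sum_z' cj (W z x) * W z' y * (cj (V i0 z) * V i0 z')).
      apply: eq_bigr => i0 _; rewrite conj_sum mulr_suml; apply: eq_bigr => z _.
      by rewrite mulr_sumr; apply: eq_bigr => z' _; rewrite conjM; ring.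
    rewrite exchange_big; apply: eq_bigr => z _; rewrite exchange_big; apply: eq_bigr => z' _.
    by rewrite mulr_sumr.
  rewrite -iW; apply: eq_bigr => z _; rewrite (bigD1 z)//= Vi eqxx mulr1 big1 ?addr0// => z' zz.
  by rewrite Vi eq_sym (negPf zz) mulr0.
move=> g; rewrite /W' -conj_conj; congr conj_mx.
rewrite /az_phi conj_conj.
have -> : (fun (i0 : 'I_(az_k S m) * az_blk S m) y => \sum_x az_v S m t i0 x * V x y) =
   (fun i0 y => (i0 == e y)%:R).
  by apply/funext => i0; apply/funext => y; rewrite -v2.
rewrite conj_sel; apply/funext => y; apply/funext => y'.
rewrite /diag_blocks /e /= ?eqxx /az_psi /delta_s /= ?eqxx /theta_i xit clip_sval.
rewrite -!surjective_pairing.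
by rewrite [3 / 4 < _]ltNge t34 andbF.
Qed.

Lemma phi_le m (f : az_amb S m) (M : R) : 0 <= M -> (forall t, inMB (f t)) ->
  (forall t, mxle (f t) M) -> forall t, inMB (az_phi f t) /\ mxle (az_phi f t) M.
Proof.
move=> M0 fB hf t.
have tB i s : inMB (theta_i (az_k S m) (az_r0 S m) (az_r1 S m) i f s).
  by rewrite /theta_i; case: ifP => _ x y; [apply: theta_B|]; exact: fB.
have DB : inMB (diag_blocks (fun i => az_psi i f (sval t))).
  by apply: diag_B => i; apply: delta_B; exact: tB.
split; first exact: inMB_conj.
apply: mxle_conj => //.
  by have [v1 _] := az_v_unitary adm m t; exact: v1.
apply: mxle_diag => // i; apply: mxle_delta => //; first exact: az_gamma_hom.
rewrite /theta_i; case: ifP => _; [apply: mxle_theta|]; exact: hf.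
Qed.

End ConnectingMaps.

(** * Building blocks and the inductive limit *)

Lemma BsmulBl (R : realType) (C : cstarAlg R) (a b c : Bamb C) :
  smul (a - b) c = smul a c - smul b c.
Proof. by rewrite -[- b]scaleN1r BsmulDl BsmulZl scaleN1r. Qed.

Lemma BsmulBr (R : realType) (C : cstarAlg R) (a b c : Bamb C) :
  smul c (a - b) = smul c a - smul c b.
Proof. by rewrite -[- b]scaleN1r BsmulDr BsmulZr scaleN1r. Qed.

Section BuildingBlocks.
Variables (R : realType) (C : cstarAlg R) (P Q : finType).

Definition ampl (b : MB C P) : MB C (P * Q)%type :=
  fun x y => if x.2 == y.2 then b x.1 y.1 else 0.
Definition ampr (b : MB C Q) : MB C (P * Q)%type :=
  fun x y => if x.1 == y.1 then b x.2 y.2 else 0.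

Lemma left_tensorP (a : MB C (P * Q)%type) : left_tensor a <-> exists2 b, inMB b & a = ampl b.
Proof.
split=> -[b bB h]; exists b => //; last by rewrite h.
by apply/funext => x; apply/funext => y; exact: h.
Qed.

Lemma right_scalarP (a : MB C (P * Q)%type) :
  right_scalar a <-> exists c : Q -> Q -> R[i], a = ampr (fun x y => Bscal C (c x y)).
Proof.
split=> -[c h]; exists c; last by rewrite h.
by apply/funext => x; apply/funext => y; exact: h.
Qed.

Lemma ampl_lin (l : R[i]) b b' : ampl (l *: b + b') = l *: ampl b + ampl b'.
Proof.
apply/funext => x; apply/funext => y; rewrite /ampl -[RHS]/(l *: (if _ then _ else _) + (if _ then _ else _)).
by case: ifP => _ //; rewrite scaler0 addr0.
Qed.

Lemma ampr_lin (l : R[i]) b b' : ampr (l *: b + b') = l *: ampr b + ampr b'.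
Proof.
apply/funext => x; apply/funext => y; rewrite /ampr -[RHS]/(l *: (if _ then _ else _) + (if _ then _ else _)).
by case: ifP => _ //; rewrite scaler0 addr0.
Qed.

Lemma ampl_mul b b' : smul (ampl b) (ampl b') = ampl (smul b b').
Proof.
apply/funext => x; apply/funext => y.
rewrite -[LHS]/(\sum_k smul (ampl b x k) (ampl b' k y)) sum_prod.
rewrite -[RHS]/(if x.2 == y.2 then \sum_k smul (b x.1 k) (b' k y.1) else 0).
transitivity (\sum_k (if x.2 == y.2 then smul (b x.1 k) (b' k y.1) else 0)); last first.
  by case: ifP => // _; rewrite big1.
apply: eq_bigr => k _; rewrite (bigD1 x.2)// big1 ?Monoid.mulm1 => [|j jx].
  have -> : ampl b x (k, x.2) = b x.1 k by rewrite /ampl eqxx.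
  have -> : ampl b' (k, x.2) y = if x.2 == y.2 then b' k y.1 else 0 by [].
  by case: ifP => // _; rewrite Bsmul0r.
by have -> : ampl b x (k, j) = 0; [rewrite /ampl eq_sym (negPf jx)|rewrite Bsmul0l].
Qed.

Lemma ampr_mul b b' : smul (ampr b) (ampr b') = ampr (smul b b').
Proof.
apply/funext => x; apply/funext => y.
rewrite -[LHS]/(\sum_k smul (ampr b x k) (ampr b' k y)) sum_prod.
rewrite -[RHS]/(if x.1 == y.1 then \sum_k smul (b x.2 k) (b' k y.2) else 0).
have h j k : smul (ampr b x (j, k)) (ampr b' (j, k) y) =
    if j == x.1 then smul (b x.2 k) (if x.1 == y.1 then b' k y.2 else 0) else 0.
  rewrite -[LHS]/(smul (if x.1 == j then b x.2 k else 0) (if j == y.1 then b' k y.2 else 0)).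
  by rewrite [j == x.1]eq_sym; case: eqVneq => [<-//|_]; rewrite Bsmul0l.
transitivity (\sum_k smul (b x.2 k) (if x.1 == y.1 then b' k y.2 else 0)).
  rewrite exchange_big; apply: eq_bigr => k _.
  rewrite (bigD1 x.1)// big1 ?Monoid.mulm1 => [|j jx]; first by rewrite h eqxx.
  by rewrite h (negPf jx).
by case: ifP => // _; apply: big1 => k _; rewrite Bsmul0r.
Qed.

Lemma ampl_star b : star (ampl b) = ampl (star b).
Proof.
apply/funext => x; apply/funext => y; rewrite /ampl /= eq_sym.
by case: ifP => // _; exact: Bstar0.
Qed.

Lemma ampr_star b : star (ampr b) = ampr (star b).
Proof.
apply/funext => x; apply/funext => y; rewrite /ampr /= eq_sym.
by case: ifP => // _; exact: Bstar0.
Qed.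

Lemma Bscal_lin (l c d : R[i]) : Bscal C (l * c + d) = l *: Bscal C c + Bscal C d.
Proof. by apply: Bext => // s; rewrite B2D B2Z /= scaler0 addr0. Qed.

Lemma Bscal_mul (c d : R[i]) : smul (Bscal C c) (Bscal C d) = Bscal C (c * d).
Proof. by apply: Bext => // s; rewrite smul2 /= cs0l !scaler0 !addr0. Qed.

Lemma Bscal_star (c : R[i]) : star (Bscal C c) = Bscal C (cj c).
Proof. by apply: Bext => // s; exact: cs_star0. Qed.

Lemma Bscal_sum I (r : seq I) (F : I -> R[i]) :
  \sum_(i <- r) Bscal C (F i) = Bscal C (\sum_(i <- r) F i).
Proof.
elim: r => [|i r IH]; first by rewrite !big_nil; exact: Bext.
rewrite !big_cons IH; have := Bscal_lin 1 (F i) (\sum_(i <- r) F i).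
by rewrite mul1r scale1r.
Qed.

Notation E := (@Eblock R C P Q).

Lemma EblockP (f : FB C (P * Q)%type) : E f <->
  [/\ forall t, inMB (f t), forall s (e : R), 0 < e -> exists2 d : R, 0 < d &
      forall t : I01 R, `|sval t - sval s| < d -> mxle (f t - f s) e,
     left_tensor (f (clip 0)) & right_scalar (f (clip 1))].
Proof.
have sB f' t s : (forall t, inMB (f' t)) -> inMB ((f' : FB C (P * Q)%type) t - f' s).
  by move=> fB i j; apply: B_sub; exact: fB.
split=> -[h1 h2 h3 h4]; split=> // s e e0.
  have [d d0 hd] := h2 s e e0; exists d => // t /hd h.
  by apply/mxnormP; [exact: sB|exact: ltW|exact: ltW].
have e20 : 0 < e / 2 by rewrite divr_gt0.
have [d d0 hd] := h2 s _ e20; exists d => // t /hd h.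
apply: (@le_lt_trans _ _ (e / 2)%:E); first by apply/mxnormP; [exact: sB|exact: ltW|].
by rewrite lte_fin ltr_pdivrMr// ltr_pMr// ltr1n.
Qed.

Lemma E_B f t : E f -> inMB (f t). Proof. by move=> /EblockP[]. Qed.

Lemma E_cont f s (e : R) : E f -> 0 < e -> exists2 d : R, 0 < d &
  forall t : I01 R, `|sval t - sval s| < d -> mxle (f t - f s) e.
Proof. by move=> /EblockP[_ h _ _]; exact: h. Qed.

Lemma E_lin (l : R[i]) f g : E f -> E g -> E (l *: f + g).
Proof.
move=> hf hg; apply/EblockP; split.
- by move=> t; apply: inMB_lin; exact: E_B.
- move=> s e e0; have c0 : 0 < cmod l + 1 by rewrite ltr_wpDl ?cmod_ge0.
  have q0 : 0 < e / (cmod l + 1) by rewrite divr_gt0.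
  have [d d0 hd] := E_cont s hf q0; have [d' d'0 hd'] := E_cont s hg q0.
  exists (Num.min d d') => [|t]; first by rewrite lt_min d0.
  rewrite lt_min => /andP[/hd h1 /hd' h2].
  have -> : (l *: f + g) t - (l *: f + g) s = l *: (f t - f s) + (g t - g s).
    rewrite -[(l *: f + g) t]/(l *: f t + g t) -[(l *: f + g) s]/(l *: f s + g s).
    by rewrite opprD addrACA -scalerBr.
  have -> : e = cmod l * (e / (cmod l + 1)) + e / (cmod l + 1) by field; rewrite gt_eqF.
  by apply: mxle_lin => // i j; apply: B_sub; exact: E_B.
- move: hf hg => /EblockP[_ _ /left_tensorP[b bB fb] _] /EblockP[_ _ /left_tensorP[b' b'B gb] _].
  apply/left_tensorP; exists (l *: b + b'); first exact: inMB_lin.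
  by rewrite ampl_lin -fb -gb.
- move: hf hg => /EblockP[_ _ _ /right_scalarP[c fc]] /EblockP[_ _ _ /right_scalarP[c' gc]].
  apply/right_scalarP; exists (fun x y => l * c x y + c' x y).
  rewrite -[LHS]/(l *: f _ + g _) fc gc -ampr_lin; congr ampr.
  by apply/funext => x; apply/funext => y; rewrite Bscal_lin.
Qed.

Lemma E0 : E 0.
Proof.
apply/EblockP; split.
- by move=> t i j; exact: B0.
- move=> s e e0; exists 1 => // t _ H v x hv.
  have -> : mop v (0 - 0) x = fun=> 0.
    apply/funext => i; apply: big1 => j _; rewrite -[(0 - 0) i j]/(0 - 0 : Bamb C) subr0.
    by rewrite (rep0 hv)//; exact: B0.
  by rewrite {1}/vn vec0 nrm0 mulr_ge0 ?vn_ge0// ltW.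
- apply/left_tensorP; exists 0 => [i j|]; first exact: B0.
  by apply/funext => x; apply/funext => y; rewrite /ampl; case: ifP.
- apply/right_scalarP; exists (fun _ _ => 0).
  by apply/funext => x; apply/funext => y; rewrite /ampr; case: ifP => // _; exact: Bext.
Qed.

Lemma E_D f g : E f -> E g -> E (f + g).
Proof. by move=> hf hg; rewrite -[f]scale1r; exact: E_lin. Qed.

Lemma E_sub f g : E f -> E g -> E (f - g).
Proof. by move=> hf hg; rewrite addrC -scaleN1r; exact: E_lin. Qed.

Lemma E_sum I (r : seq I) (F : I -> FB C (P * Q)%type) : (forall i, E (F i)) -> E (\sum_(i <- r) F i).
Proof.
move=> h; elim: r => [|i r IH]; first by rewrite big_nil; exact: E0.
by rewrite big_cons; exact: E_D.
Qed.

Lemma E_star f : E f -> E (star f).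
Proof.
move=> hf; apply/EblockP; split.
- by move=> t; apply: inMB_star; exact: E_B.
- move=> s e e0; have [d d0 hd] := E_cont s hf e0; exists d => // t /hd h.
  have -> : star f t - star f s = star (f t - f s).
    apply/funext => i; apply/funext => j; rewrite -[RHS]/(star (f t j i - f s j i)).
    by rewrite -[X in _ = star (_ + X)]scaleN1r BstarD BstarZ conjN (conjc1 R) scaleN1r.
  by apply: mxle_star => //; [exact: ltW|move=> i j; apply: B_sub; exact: E_B].
- move: hf => /EblockP[_ _ /left_tensorP[b bB fb] _].
  apply/left_tensorP; exists (star b); first exact: inMB_star.
  by rewrite -ampl_star -fb.
- move: hf => /EblockP[_ _ _ /right_scalarP[c fc]].
  apply/right_scalarP; exists (fun x y => cj (c y x)).
  rewrite -[LHS]/(star (f _)) fc ampr_star; congr ampr.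
  by apply/funext => x; apply/funext => y; exact: Bscal_star.
Qed.

Lemma E_mul f g : E f -> E g -> E (smul f g).
Proof.
move=> hf hg; apply/EblockP; split.
- by move=> t; apply: inMB_mul; exact: E_B.
- move=> s e e0; have [M M0 hM] := mxle_ex (E_B s hf); have [N N0 hN] := mxle_ex (E_B s hg).
  have K0 : 0 < N + 1 + M by lra.
  have q0 : 0 < e / (N + 1 + M) by rewrite divr_gt0.
  have [d d0 hd] := E_cont s hf q0; have [d' d'0 hd'] := E_cont s hg q0.
  have [d2 d20 hd2] := E_cont s hg ltr01.
  exists (Num.min d (Num.min d' d2)) => [|t]; first by rewrite !lt_min d0 d'0.
  rewrite !lt_min => /and3P[/hd h1 /hd' h2 /hd2 h3].
  have sB h : E h -> inMB (h t - h s) by move=> hh i j; apply: B_sub; exact: E_B.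
  have -> : smul f g t - smul f g s = 1 *: smul (f t - f s) (g t) + smul (f s) (g t - g s).
    rewrite scale1r; apply/funext => i; apply/funext => j.
    rewrite -[LHS]/(\sum_k smul (f t i k) (g t k j) - \sum_k smul (f s i k) (g s k j)).
    rewrite -[RHS]/(\sum_k smul (f t i k - f s i k) (g t k j) + \sum_k smul (f s i k) (g t k j - g s k j)).
    rewrite -sumrB -big_split; apply: eq_bigr => k _.
    rewrite -[RHS]/(smul (f t i k - f s i k) (g t k j) + smul (f s i k) (g t k j - g s k j)).
    by rewrite BsmulBl BsmulBr addrA subrK.
  have -> : e = cmod (1 : R[i]) * (e / (N + 1 + M) * (N + 1)) + M * (e / (N + 1 + M)).
    by rewrite cmod1; field; rewrite gt_eqF.
  have gt1 : mxle (g t) (N + 1).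
    have := mxle_lin 1 (sB g hg) (E_B s hg) h3 hN.
    by rewrite scale1r subrK cmod1 mulr1 addrC.
  apply: mxle_lin.
  + by apply: inMB_mul; [exact: sB|exact: E_B].
  + by apply: inMB_mul; [exact: E_B|exact: sB].
  + by apply: mxle_mul => //; [exact: ltW|exact: sB|exact: E_B].
  + by apply: mxle_mul => //; [exact: E_B|exact: sB].
- move: hf hg => /EblockP[_ _ /left_tensorP[b bB fb] _] /EblockP[_ _ /left_tensorP[b' b'B gb] _].
  apply/left_tensorP; exists (smul b b'); first exact: inMB_mul.
  by rewrite -ampl_mul -fb -gb.
- move: hf hg => /EblockP[_ _ _ /right_scalarP[c fc]] /EblockP[_ _ _ /right_scalarP[c' gc]].
  apply/right_scalarP; exists (fun x y => \sum_k c x k * c' k y).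
  rewrite -[LHS]/(smul (f _) (g _)) fc gc ampr_mul; congr ampr.
  apply/funext => x; apply/funext => y; rewrite -Bscal_sum; apply: eq_bigr => k _.
  by rewrite Bscal_mul.
Qed.

Lemma mxle0 (J : finType) : mxle (0 : MB C J) 0.
Proof.
move=> H v x hv; have -> : mop v 0 x = fun=> 0.
  by apply/funext => i; apply: big1 => j _; rewrite (rep0 hv)//; exact: B0.
by rewrite {1}/vn vec0 nrm0 mul0r.
Qed.

Lemma E_ucont f (e : R) : E f -> 0 < e -> exists N : nat, forall s t : I01 R,
  `|sval t - sval s| <= N.+1%:R^-1 -> mxle (f s - f t) e.
Proof.
move=> hf e0; have sB t s : inMB (f t - f s) by move=> i j; apply: B_sub; exact: E_B.
have zB : inMB (0 : MB C (P * Q)%type) by move=> i j; exact: B0.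
pose D s t a := mxle (f s - f t) a.
apply: (@unif_cont R D e) (e0); rewrite /D.
- move=> s t a h; have := mxle_lin (-1) (sB s t) zB h (@mxle0 _).
  by rewrite scaleN1r opprB !addr0 cmodN cmod1 mul1r.
- move=> s t u a b h h'; have := mxle_lin 1 (sB s t) (sB t u) h h'.
  by rewrite scale1r cmod1 mul1r addrA subrK.
- by move=> s e' e'0; have := E_cont s hf e'0.
Qed.

Lemma E_bounded f : E f -> exists2 M : R, 0 <= M & forall t, mxle (f t) M.
Proof.
move=> hf; have [N hN] := E_ucont hf ltr01.
have [M M0 hM] := mxle_ex (E_B (clip 0) hf).
have sB t s : inMB (f t - f s) by move=> i j; apply: B_sub; exact: E_B.
have N0 : 0 < N.+1%:R :> R by rewrite ltr0n.
have h k : forall t : I01 R, sval t <= k%:R / N.+1%:R -> mxle (f t) (M + k%:R).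
  elim: k => [|k IH] t ht.
    have -> : t = clip 0.
      rewrite -[t]clip_sval; congr clip; apply/eqP; rewrite eq_le I01_ge0 andbT.
      by move: ht; rewrite mul0r.
    by rewrite addr0.
  pose r := clip (sval t - N.+1%:R^-1).
  have t0 := I01_ge0 t; have t1 := I01_le1 t.
  have V0 : 0 < N.+1%:R^-1 :> R by rewrite invr_gt0.
  have rv : sval r = Num.max 0 (sval t - N.+1%:R^-1).
    rewrite /r /clip /=; congr Num.max; apply/min_idPl; by rewrite lerBlDr (le_trans t1)// lerDl (ltW V0).
  have hr : sval r <= k%:R / N.+1%:R.
    rewrite rv ge_max divr_ge0 ?ler0n//= lerBlDr (le_trans ht)// -natr1 mulrDl mul1r.
    by [].
  have hd : `|sval r - sval t| <= N.+1%:R^-1.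
    rewrite distrC rv; case: (lerP 0 (sval t - N.+1%:R^-1)); move: V0 t0; set V := _^-1 => V0 t0 h; rewrite ?subr0 ?ger0_norm//; lra.
  have := mxle_lin 1 (sB t r) (E_B r hf) (hN _ _ hd) (IH _ hr).
  by rewrite scale1r subrK cmod1 mul1r addrCA nat1r.
exists (M + N.+1%:R) => [|t]; first by rewrite addr_ge0 ?ler0n.
by apply: h; rewrite divff ?I01_le1// gt_eqF.
Qed.

End BuildingBlocks.

Lemma EnormP (R : realType) (C : cstarAlg R) (J : finType) (f : FB C J) (M : R) :
  (forall t, inMB (f t)) -> 0 <= M -> (Enorm f <= M%:E)%E <-> forall t, mxle (f t) M.
Proof.
move=> fB M0; split=> [h t|h].
  apply/mxnormP => //; apply: le_trans h; apply: ereal_sup_ubound; by exists t.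
by apply: ge_ereal_sup => _ [t _ <-]; apply/mxnormP.
Qed.

(** * The inductive limit and its compatible corners *)

Section Limit.
Variables (R : realType) (C : cstarAlg R) (S : AzC_data C).
Variables (A : cstarAlg R) (mu : forall m, az_amb S m -> A).
Hypothesis adm : AzC_admissible S.
Hypothesis lim : is_limit mu.

Lemma mu_lin m (l : R[i]) (f g : az_amb S m) : az_A f -> az_A g ->
  mu (l *: f + g) = l *: mu f + mu g.
Proof. by have [/(_ m)[h _ _] _ _ _] := lim; exact: h. Qed.

Lemma mu_mul m (f g : az_amb S m) : az_A f -> az_A g -> mu (smul f g) = cs_mul (mu f) (mu g).
Proof. by have [/(_ m)[_ h _] _ _ _] := lim; exact: h. Qed.

Lemma mu_star m (f : az_amb S m) : az_A f -> mu (star f) = cs_star (mu f).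
Proof. by have [/(_ m)[_ _ h] _ _ _] := lim; exact: h. Qed.

Lemma mu_phi m (f : az_amb S m) : az_A f -> mu (az_phi f) = mu f.
Proof. by have [_ h _ _] := lim; exact: h. Qed.

Lemma mu_D m (f g : az_amb S m) : az_A f -> az_A g -> mu (f + g) = mu f + mu g.
Proof. by move=> hf hg; have := mu_lin 1 hf hg; rewrite !scale1r. Qed.

Lemma mu_0 m : mu (0 : az_amb S m) = 0.
Proof.
have z := @E0 R C 'I_(az_p S m) 'I_(az_q S m).
by have := mu_D (m := m) z z; rewrite addr0 => e; apply: (addrI (mu (0 : az_amb S m))); rewrite addr0 -e.
Qed.

Lemma mu_Z m (l : R[i]) (f : az_amb S m) : az_A f -> mu (l *: f) = l *: mu f.
Proof. by move=> hf; have := mu_lin l hf (E0 C _ _); rewrite mu_0 !addr0. Qed.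

Lemma mu_B m (f g : az_amb S m) : az_A f -> az_A g -> mu (f - g) = mu f - mu g.
Proof. by move=> hf hg; rewrite addrC -scaleN1r mu_lin// scaleN1r addrC. Qed.

Lemma mu_sum m I (r : seq I) (F : I -> az_amb S m) : (forall i, az_A (F i)) ->
  mu (\sum_(i <- r) F i) = \sum_(i <- r) mu (F i).
Proof.
move=> h; elim: r => [|i r IH]; first by rewrite !big_nil mu_0.
by rewrite !big_cons mu_D// ?IH//; exact: E_sum.
Qed.

Lemma phin_le m n (f : az_amb S m) (M : R) : 0 <= M -> (forall t, inMB (f t)) ->
  (forall t, mxle (f t) M) -> forall t, inMB (@az_phin R C S _ n f t) /\ mxle (@az_phin R C S _ n f t) M.
Proof.
move=> M0 fB hf; elim: n => [|n IH] t; first by split; [exact: fB|exact: hf].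
have h s := (IH s).1; have h' s := (IH s).2.
exact: (phi_le adm M0 h h').
Qed.

Lemma mu_le m (f : az_amb S m) (M : R) : az_A f -> 0 <= M -> (forall t, mxle (f t) M) ->
  nrm (mu f) <= M.
Proof.
move=> hf M0 h; have [_ _ /(_ m f hf) c _] := lim.
rewrite -lee_fin; apply: (cvge_to_le c); apply: nearW => n.
have fB t : inMB (f t) by exact: E_B.
by apply/EnormP => // t; have [] := phin_le n M0 fB h t.
Qed.

(** Points and isometries at all later stages for which g |-> W_n* g(t_n) W_n is compatible with the
    connecting maps; this family is tau_s before its extension to A. *)
Record tower m (s : I01 R) := Tower {
  tw_t : nat -> I01 R;
  tw_W : forall n, az_idx S (n + m) -> az_idx S m -> R[i];
  tw_isom : forall n, isom (@tw_W n);
  tw_t0 : tw_t 0%N = s;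
  tw_W0 : @tw_W 0%N = fun i y => (i == y)%:R;
  tw_step : forall n (g : az_amb S (n + m)),
    conj_mx (@tw_W n.+1) (az_phi g (tw_t n.+1)) = conj_mx (@tw_W n) (g (tw_t n)) }.
Arguments tw_t {m s} t n.
Arguments tw_W {m s} t n _ _.

Lemma tower_ex m s : exists T : tower m s, True.
Proof.
pose X n := {p : I01 R * (az_idx S (n + m) -> az_idx S m -> R[i]) | isom p.2}.
have st n (x : X n) : {y : X n.+1 | forall g : az_amb S (n + m),
    conj_mx (sval y).2 (az_phi g (sval y).1) = conj_mx (sval x).2 (g (sval x).1)}.
  case: x => -[t W] hW; apply: cid.
  have [t' [W' [hW' h]]] := @tower_step R C S adm (n + m) _ t W hW.
  by exists (exist _ (t', W') hW').
have h0 : isom (fun i y : az_idx S m => (i == y)%:R : R[i]).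
  move=> x y; rewrite (bigD1 x)//= eqxx big1 ?addr0 ?(conjc1 R) ?mul1r// => i ix.
  by rewrite (negPf ix) (conjc0 R) mul0r.
pose x0 : X 0%N := exist _ (s, fun i y : az_idx S m => (i == y)%:R) h0.
pose q n : X n := nat_rect X x0 (fun n x => sval (st n x)) n.
exists (@Tower m s (fun n => (sval (q n)).1) (fun n => (sval (q n)).2)
  (fun n => svalP (q n)) erefl erefl (fun n => svalP (st n (q n)))) => //.
Qed.

Section Tau.
Variables (m : nat) (s : I01 R) (T : tower m s).

Definition tau n (g : az_amb S (n + m)) : MB C (az_idx S m) := conj_mx (tw_W T n) (g (tw_t T n)).

Lemma tau_phi n (g : az_amb S (n + m)) : @tau n.+1 (az_phi g) = tau g.
Proof. exact: tw_step. Qed.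

Lemma tau0 (f : az_amb S m) : @tau 0%N f = f s.
Proof.
rewrite /tau tw_W0 tw_t0; have := conj_sel (fun x : az_idx S m => x) (f s).
by move=> ->.
Qed.

Lemma tau_phin n (f : az_amb S m) : tau (@az_phin R C S _ n f) = f s.
Proof. by elim: n => [|n IH]; [exact: tau0|exact: etrans (tau_phi _) IH]. Qed.

Lemma tau_B n (g : az_amb S (n + m)) : az_A g -> inMB (tau g).
Proof. by move=> hg; apply: inMB_conj; exact: E_B. Qed.

Lemma tau_le n (g : az_amb S (n + m)) (M : R) : az_A g -> 0 <= M -> (forall t, mxle (g t) M) ->
  mxle (tau g) M.
Proof.
by move=> hg M0 h; exact: mxle_conj M0 (E_B _ hg) (tw_isom T _) (h _).
Qed.

Lemma tau_lin n (l : R[i]) (g h : az_amb S (n + m)) : tau (l *: g + h) = l *: tau g + tau h.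
Proof.
apply/funext => x; apply/funext => y.
rewrite -[RHS]/(l *: tau g x y + tau h x y) /tau /conj_mx scaler_sumr -big_split.
apply: eq_bigr => i _; rewrite scaler_sumr -big_split; apply: eq_bigr => j _.
rewrite -[(l *: g + h) _ i j]/(l *: g (tw_t T n) i j + h (tw_t T n) i j).
by rewrite scalerDr !scalerA [l * _]mulrC.
Qed.

End Tau.

(** f(t) is a corner of the image of f at every later stage, so it is dominated by each term of the
    sequence that converges to the norm of [mu f]. Together with [mu_le] this makes the connecting
    maps isometric. *)
Lemma mu_ge m (f : az_amb S m) t : az_A f -> mxle (f t) (nrm (mu f)).
Proof.
move=> hf; have fB t' : inMB (f t') by exact: E_B.
have [T _] := tower_ex m t.
have [_ _ /(_ m f hf) c _] := lim.
apply/mxnormP => //; first exact: nrm_ge0.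
apply: (cvge_to_ge c); apply: nearW => n.
case E : (Enorm _) => [M| |]; rewrite ?leey//; last first.
  have : (0 <= Enorm (@az_phin R C S _ n f))%E.
    apply: (@le_trans _ _ (mxnorm (@B R C) (@az_phin R C S _ n f t))); last by apply: ereal_sup_ubound; exists t.
    apply: ereal_sup_ubound; exists (hilbert0 R), (fun _ _ => 0), (fun=> 0).
    split; [exact: zero_rep|by rewrite big1 ?ler01// => j _; rewrite nrm0 expr0n|].
    by rewrite big1 ?sqrtr0// => i _; rewrite big1 ?nrm0 ?expr0n.
  by rewrite E.
have pB t' : inMB (@az_phin R C S _ n f t').
  by have [N N0 hN] := E_bounded hf; have [] := phin_le n N0 fB hN t'.
have M0 : 0 <= M.
  rewrite -lee_fin -E; apply: le_trans (ereal_sup_ubound _); last by exists t.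
  apply: ereal_sup_ubound; exists (hilbert0 R), (fun _ _ => 0), (fun=> 0).
  split; [exact: zero_rep|by rewrite big1 ?ler01// => j _; rewrite nrm0 expr0n|].
  by rewrite big1 ?sqrtr0// => i _; rewrite big1 ?nrm0 ?expr0n.
have /EnormP-/(_ pB M0) h : (Enorm (@az_phin R C S _ n f) <= M%:E)%E by rewrite E.
apply/mxnormP => //; rewrite -(tau_phin T n).
exact: mxle_conj M0 (pB _) (tw_isom T _) (h _).
Qed.

(** The union of the finite sets is dense in A_m and, by [az_F_phi] and [az_F_sub], its images stay
    in the later blocks. Lifts can thus be moved to later stages without a separate verification of
    the boundary conditions for phi_m(f). *)
Definition Fset m (f : az_amb S m) := exists j, az_F S m j f.

Lemma FsetA m (f : az_amb S m) : Fset f -> az_A f.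
Proof. by case=> j; exact: az_F_sub. Qed.

Lemma F_mono m j j' (f : az_amb S m) : (j <= j')%N -> az_F S m j f -> az_F S m j' f.
Proof.
move=> /subnK <-; elim: (j' - j)%N => // k IH /IH; exact: (az_F_mono adm).
Qed.

Lemma Fset_phi m (f : az_amb S m) : Fset f -> Fset (az_phi f).
Proof.
case=> j hj; exists j; apply: (az_F_phi adm); apply: F_mono hj; exact: leq_trans (leq_addl _ _) (leqnSn _).
Qed.

Lemma Fset_raise m k (f : az_amb S m) : (m <= k)%N -> Fset f ->
  exists2 f' : az_amb S k, Fset f' & mu f' = mu f.
Proof.
move=> + hf; elim: k => [|k IH]; first by rewrite leqn0 => /eqP m0; subst m; exists f.
rewrite leq_eqVlt => /orP[/eqP e|/IH[f' f'F e]]; first by subst m; exists f.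
by exists (az_phi f'); [exact: Fset_phi|rewrite mu_phi//; exact: FsetA].
Qed.

Lemma Fset_tau m n n' (g : az_amb S (n + m)) : (n <= n')%N -> Fset g ->
  exists g' : az_amb S (n' + m), [/\ Fset g', mu g' = mu g &
    forall s (T : tower m s), tau T g' = tau T g].
Proof.
move=> + hf; elim: n' => [|k IH]; first by rewrite leqn0 => /eqP m0; subst n; exists g.
rewrite leq_eqVlt => /orP[/eqP e|/IH[f' [f'F e h]]]; first by subst n; exists g.
exists (az_phi f'); split; [exact: Fset_phi|rewrite -e; apply: mu_phi; exact: FsetA|].
by move=> s T; rewrite -h; exact: tau_phi.
Qed.

End Limit.

(** * Extension of functionals from matrices over B to A *)

Lemma cge0_lim (R : realType) (z : R[i]) :
  (forall e : R, 0 < e -> exists2 w : R[i], 0 <= w & cmod (z - w) <= e) -> 0 <= z.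
Proof.
move=> h.
have hI : complex.Im z = 0.
  apply/eqP; rewrite -normr_le0; apply/ler_addgt0Pr => e e0; rewrite add0r.
  have [w w0 zw] := h e e0; apply: le_trans zw.
  by have := Im_cmod (z - w); rewrite (cge0E w0); case: z {h} => a b /=; rewrite subr0.
have hR : 0 <= complex.Re z.
  apply/ler_addgt0Pr => e e0; have [w w0 zw] := h e e0.
  have := le_trans (Re_cmod (z - w)) zw; rewrite (cge0E w0).
  have r0 : 0 <= complex.Re w by rewrite -lecR -(cge0E w0).
  by case: z {h hI zw} => a b /=; rewrite ler_norml => /andP[h1 _]; lra.
by case: z {h} hI hR => a b /= -> ha; rewrite lecR.
Qed.

Section MatrixUnit.
Variables (R : realType) (C : cstarAlg R) (J : finType).
Implicit Types (a b c : MB C J).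

Definition mx1 : MB C J := fun i j => if i == j then Bscal C 1 else 0.

Lemma Bmul1l (b : Bamb C) : smul (Bscal C 1) b = b.
Proof.
apply: Bext => [|s]; first exact: mul1r.
by rewrite smul2 /= cs0l scaler0 !addr0 scale1r.
Qed.

Lemma Bmul1r (b : Bamb C) : smul b (Bscal C 1) = b.
Proof.
apply: Bext => [|s]; first exact: mulr1.
by rewrite smul2 /= cs0r scaler0 add0r addr0 scale1r.
Qed.

Lemma mx1_B : inMB mx1.
Proof. by move=> i j; rewrite /mx1; case: ifP => _; [exact: Bscal_B|exact: B0]. Qed.

Lemma mxmul1l a : smul mx1 a = a.
Proof.
apply/funext => i; apply/funext => j; rewrite -[LHS]/(\sum_k smul (mx1 i k) (a k j)).
rewrite (bigD1 i)// big1 ?Monoid.mulm1 => [|k ki]; first by rewrite /mx1 eqxx Bmul1l.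
by rewrite /mx1 eq_sym (negPf ki) Bsmul0l.
Qed.

Lemma mxmul1r a : smul a mx1 = a.
Proof.
apply/funext => i; apply/funext => j; rewrite -[LHS]/(\sum_k smul (a i k) (mx1 k j)).
rewrite (bigD1 j)// big1 ?Monoid.mulm1 => [|k ki]; first by rewrite /mx1 eqxx Bmul1r.
by rewrite /mx1 (negPf ki) Bsmul0r.
Qed.

Lemma mx1_star : star mx1 = mx1.
Proof.
apply/funext => i; apply/funext => j; rewrite -[LHS]/(star (mx1 j i)) /mx1 eq_sym.
by case: ifP => _; rewrite ?Bstar0// Bscal_star (conjc1 R).
Qed.

Lemma mxmulDl a b c : smul (a + b) c = smul a c + smul b c.
Proof.
apply/funext => i; apply/funext => j.
rewrite -[RHS]/(\sum_k smul (a i k) (c k j) + \sum_k smul (b i k) (c k j)) -big_split.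
by apply: eq_bigr => k _; exact: BsmulDl.
Qed.

Lemma mxmulDr a b c : smul c (a + b) = smul c a + smul c b.
Proof.
apply/funext => i; apply/funext => j.
rewrite -[RHS]/(\sum_k smul (c i k) (a k j) + \sum_k smul (c i k) (b k j)) -big_split.
by apply: eq_bigr => k _; exact: BsmulDr.
Qed.

Lemma mxmulZl l a b : smul (l *: a) b = l *: smul a b.
Proof.
apply/funext => i; apply/funext => j.
rewrite -[RHS]/(l *: \sum_k smul (a i k) (b k j)) scaler_sumr.
by apply: eq_bigr => k _; exact: BsmulZl.
Qed.

Lemma mxmulZr l a b : smul a (l *: b) = l *: smul a b.
Proof.
apply/funext => i; apply/funext => j.
rewrite -[RHS]/(l *: \sum_k smul (a i k) (b k j)) scaler_sumr.
by apply: eq_bigr => k _; exact: BsmulZr.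
Qed.

Lemma mxstar_lin l a b : star (l *: a + b) = cj l *: star a + star b.
Proof.
apply/funext => i; apply/funext => j.
rewrite -[LHS]/(star (l *: a j i + b j i)) -[RHS]/(cj l *: star (a j i) + star (b j i)).
by rewrite BstarD BstarZ.
Qed.

Variable K : finType.

Lemma conj_lin (W : J -> K -> R[i]) l a b :
  conj_mx W (l *: a + b) = l *: conj_mx W a + conj_mx W b.
Proof.
apply/funext => x; apply/funext => y.
rewrite -[RHS]/(l *: conj_mx W a x y + conj_mx W b x y) /conj_mx scaler_sumr -big_split.
apply: eq_bigr => i _; rewrite scaler_sumr -big_split; apply: eq_bigr => j _.
rewrite -[(l *: a + b) i j]/(l *: a i j + b i j).
by rewrite scalerDr !scalerA [l * _]mulrC.
Qed.

Definition outer (L : finType) (r r' : L -> Bamb C) : MB C L := fun y y' => smul (star (r' y)) (r y').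

Lemma outer_B (L : finType) (r r' : L -> Bamb C) : (forall y, B (r y)) -> (forall y, B (r' y)) ->
  inMB (outer r r').
Proof. by move=> h h' y y'; apply: B_mul => //; exact: B_star. Qed.

Definition crow (W : J -> K -> R[i]) a (k : J) : K -> Bamb C := fun y => \sum_i W i y *: a k i.

Lemma crow_B (W : J -> K -> R[i]) a k : inMB a -> forall y, B (crow W a k y).
Proof. by move=> ha y; apply: B_sum => i; exact: B_Z. Qed.

(** Reduces positivity on compressed products to rank one: W* b* a W is the sum, over the rows k, of
    the products of the k-th rows of b W and a W. *)
Lemma conj_outer (W : J -> K -> R[i]) a b :
  conj_mx W (smul (star b) a) = \sum_k outer (crow W a k) (crow W b k).
Proof.
apply/funext => x; apply/funext => y.
have -> : (\sum_k outer (crow W a k) (crow W b k)) x y = \sum_k outer (crow W a k) (crow W b k) x y.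
  by rewrite fct_sumE fct_sumE.
transitivity (\sum_i \sum_j \sum_k smul (star (W i x *: b k i)) (W j y *: a k j)).
  apply: eq_bigr => i _; apply: eq_bigr => j _.
  rewrite -[smul (star b) a i j]/(\sum_k smul (star (b k i)) (a k j)) scaler_sumr.
  by apply: eq_bigr => k _; rewrite BstarZ BsmulZl BsmulZr scalerA.
rewrite (eq_bigr _ (fun i _ => exchange_big _ _ _ _ _ _)) exchange_big; apply: eq_bigr => k _.
rewrite /outer /crow Bstar_sum Bsmul_suml; apply: eq_bigr => i _.
by rewrite Bsmul_sumr.
Qed.

End MatrixUnit.

Lemma conj_mx1 (R : realType) (C : cstarAlg R) (J K : finType) (W : J -> K -> R[i]) : isom W ->
  conj_mx W (@mx1 R C J) = @mx1 R C K.
Proof.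
move=> h; apply/funext => x; apply/funext => y; rewrite /conj_mx.
transitivity (\sum_i (cj (W i x) * W i y) *: Bscal C 1).
  apply: eq_bigr => i _; rewrite (bigD1 i)// big1 ?Monoid.mulm1 => [|j ji].
    by rewrite /mx1 eqxx.
  by rewrite /mx1 eq_sym (negPf ji) scaler0.
rewrite -scaler_suml h /mx1; case: ifP => _; last by rewrite scale0r.
by rewrite scale1r.
Qed.

Section Extension.
Variables (R : realType) (C : cstarAlg R) (S : AzC_data C).
Variables (A : cstarAlg R) (mu : forall m, az_amb S m -> A).
Hypothesis adm : AzC_admissible S.
Hypothesis lim : is_limit mu.

Lemma mu_Enorm m (f g : az_amb S m) (e : R) : az_A f -> az_A g -> 0 < e ->
  (Enorm (f - g) < e%:E)%E -> nrm (mu f - mu g) <= e.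
Proof.
move=> hf hg e0 h; have fg : az_A (f - g) by exact: E_sub.
rewrite -(mu_B lim hf hg); apply: (mu_le adm lim) => //; first exact: ltW.
by apply/EnormP => [t||]; [exact: E_B|exact: ltW|exact: ltW].
Qed.

Lemma dense_F (a : A) (e : R) : 0 < e ->
  exists m (f : az_amb S m), Fset f /\ nrm (a - mu f) < e.
Proof.
move=> e0; have e20 : 0 < e / 2 by rewrite divr_gt0.
have [_ _ _ dn] := lim.
have [_ [m _ [f hf <-]] h] := dense_nrm dn a e20.
have [n [g gF gn]] := az_F_dense adm hf e20.
exists m, g; split; first by exists n.
have gA : az_A g by exact: (az_F_sub adm gF).
apply: le_lt_trans (nrm_triangle _ (mu f) _) _.
by rewrite (splitr e) ltr_leD//; exact: mu_Enorm.
Qed.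

Lemma dense_lift m (l : seq A) (e : R) : 0 < e -> exists n, forall a, a \in l ->
  exists g : az_amb S (n + m), Fset g /\ nrm (a - mu g) < e.
Proof.
move=> e0; elim: l => [|a l [n IH]]; first by exists 0%N.
have [m' [f [fF hf]]] := dense_F a e0.
exists (maxn n m') => b; rewrite in_cons => /orP[/eqP ->|/IH[g [gF hg]]].
  have le : (m' <= maxn n m' + m)%N by rewrite (leq_trans (leq_maxr n m'))// leq_addr.
  by have [f' f'F e'] := Fset_raise adm lim le fF; exists f'; rewrite e'.
have le : (n <= maxn n m')%N by exact: leq_maxl.
by have [g' [g'F e' _]] := Fset_tau adm lim le gF; exists g'; rewrite e'.
Qed.

Lemma dense_lift1 m (a : A) (e : R) : 0 < e -> exists n (g : az_amb S (n + m)),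
  Fset g /\ nrm (a - mu g) < e.
Proof.
by move=> /(dense_lift m [:: a])[n h]; exists n; apply: h; rewrite inE.
Qed.

Lemma mu_dense_ext m (F G : A -> R[i]) (K K' : R) : 0 <= K -> 0 <= K' ->
  (forall a b, cmod (F a - F b) <= K * nrm (a - b)) ->
  (forall a b, cmod (G a - G b) <= K' * nrm (a - b)) ->
  (forall n (g : az_amb S (n + m)), az_A g -> F (mu g) = G (mu g)) ->
  forall a, F a = G a.
Proof.
move=> K0 K'0 hF hG h a; apply: ceq => e e0.
have d0 : 0 < e / (K + K' + 1) by rewrite divr_gt0// ltr_wpDl// addr_ge0.
have [n [g [gF hg]]] := dense_lift1 m a d0.
have -> : F a - G a = F a - F (mu g) + (G (mu g) - G a).
  by rewrite (h _ _ (FsetA adm gF)) addrA subrK.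
apply: le_trans (cmodD _ _) _; have h1 := hF a (mu g); have := hG (mu g) a.
rewrite nrmB => h2; have K1 : 0 < K + K' + 1 by rewrite ltr_wpDl// addr_ge0.
have : (K + K' + 1) * nrm (a - mu g) <= e.
  by rewrite mulrC -ler_pdivlMr// ltW.
have := nrm_ge0 (a - mu g); move: h1 h2; move: (nrm _) (cmod (G _ - _)) (cmod _) => x y z.
by move: K0 K'0; nra.
Qed.

Section Functional.
Variables (m : nat) (s : I01 R) (T : tower S m s).
Variables (l : MB C (az_idx S m) -> R[i]) (K : R).
Hypothesis K0 : 0 <= K.
Hypothesis l_lin : forall c a b, inMB a -> inMB b -> l (c *: a + b) = c * l a + l b.
Hypothesis l_bd : forall b (M : R), inMB b -> 0 <= M -> mxle b M -> cmod (l b) <= K * M.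

Lemma lB a b : inMB a -> inMB b -> l (a - b) = l a - l b.
Proof. by move=> ha hb; rewrite addrC -scaleN1r l_lin// mulN1r addrC. Qed.

Lemma tau_bd n (g h : az_amb S (n + m)) : az_A g -> az_A h ->
  cmod (l (tau T g) - l (tau T h)) <= K * nrm (mu g - mu h).
Proof.
move=> hg hh; have gh : az_A (g - h) by exact: E_sub.
rewrite -lB; [|exact: tau_B..].
have -> : tau T g - tau T h = tau T (g - h).
  by have := tau_lin T (-1) h g; rewrite !scaleN1r addrC => ->; rewrite addrC.
rewrite -(mu_B lim hg hh); apply: l_bd; [exact: tau_B|exact: nrm_ge0|].
apply: tau_le => // [|t]; [exact: nrm_ge0|exact: (mu_ge adm lim)].
Qed.

(** By [mu_ge] the functional l o tau is bounded by the norm of A, independently of the stage. The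
    index set [Y] collects lifts from all stages, and two of them are compared after being raised to
    a common one. *)
Lemma functional_ext : exists L : A -> R[i],
  [/\ forall c a b, L (c *: a + b) = c * L a + L b,
      forall a b, cmod (L a - L b) <= K * nrm (a - b) &
      forall n (g : az_amb S (n + m)), az_A g -> L (mu g) = l (tau T g)].
Proof.
pose Y := {n : nat & {g : az_amb S (n + m) | Fset g}}.
pose p (y : Y) : A := mu (sval (tagged y)).
pose q (y : Y) : (R[i])^o := l (tau T (sval (tagged y))).
have pd f (e : R) : 0 < e -> exists y, nrm (f - p y) < e.
  move=> /(dense_lift1 m f)[n [g [gF hg]]].
  by exists (existT _ n (exist _ g gF)).
have pq y y' : nrm (q y - q y') <= K * nrm (p y - p y').
  case: y y' => [n [g gF]] [n' [g' g'F]]; rewrite /p /q /=.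
  have [h [hF eh th]] := Fset_tau adm lim (leq_maxl n n') gF.
  have [h' [h'F eh' th']] := Fset_tau adm lim (leq_maxr n n') g'F.
  rewrite -eh -eh' -th -th'; apply: tau_bd; exact: FsetA.
have [L hL] := @dense_ext R A (R[i])^o (@cplx_cvg R) Y p q K K0 pd pq.
(* [Y] consists of members of the finite sets; their density in each block extends the estimate to
   all of its elements. *)
have hl f n (g : az_amb S (n + m)) : az_A g -> cmod (L f - l (tau T g)) <= K * nrm (f - mu g).
  move=> gA; apply/ler_addgt0Pr => e e0.
  have d0 : 0 < e / (2 * (K + 1)) by rewrite divr_gt0// mulr_gt0// ltr_wpDl.
  have [j [g' g'F hg']] := az_F_dense adm gA d0.
  have g'A : az_A g' by exact: (az_F_sub adm g'F).
  have hd : nrm (mu g - mu g') <= e / (2 * (K + 1)).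
    exact: mu_Enorm.
  have h1 := hL f (existT _ n (exist _ g' (ex_intro _ j g'F))).
  rewrite /p /q /= in h1.
  have h2 := tau_bd g'A gA.
  have h3 := nrm_triangle f (mu g) (mu g').
  have : cmod (L f - l (tau T g)) <= cmod (L f - l (tau T g')) + cmod (l (tau T g') - l (tau T g)).
    by apply: le_trans (cmodD _ _); rewrite addrA subrK.
  rewrite nrmB in h2.
  have h1' : cmod (L f - l (tau T g')) <= K * nrm (f - mu g') := h1.
  have K1 : 0 < 2 * (K + 1) by rewrite mulr_gt0// ltr_wpDl.
  have : 2 * (K + 1) * nrm (mu g - mu g') <= e by rewrite mulrC -ler_pdivlMr.
  move: h1' h2 h3; have := nrm_ge0 (mu g - mu g').
  move: (nrm (f - mu g')) (nrm (f - mu g)) (nrm (mu g - mu g')) (cmod (L f - l (tau T g'))).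
  move: (cmod (L f - l (tau T g))) (cmod (l _ - _)) => x y z1 z2 z3 z4 z30 h1' h2 h3 h4 h5.
  have : K * z1 <= K * (z2 + z3) by rewrite ler_wpM2l.
  by lra.
have hv n (g : az_amb S (n + m)) : az_A g -> L (mu g) = l (tau T g).
  move=> gA; apply: ceq => e e0; apply: le_trans (hl (mu g) _ _ gA) _.
  by rewrite subrr nrm0 mulr0 ltW.
have hL2 a b : cmod (L a - L b) <= K * nrm (a - b).
  apply/ler_addgt0Pr => e e0.
  have d0 : 0 < e / (2 * (K + 1)) by rewrite divr_gt0// mulr_gt0// ltr_wpDl.
  have [n [g [gF hg]]] := dense_lift1 m b d0.
  have := hl a _ _ (FsetA adm gF); have := hl b _ _ (FsetA adm gF).
  have : cmod (L a - L b) <= cmod (L a - l (tau T g)) + cmod (L b - l (tau T g)).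
    by rewrite [X in _ <= _ + X]cmodB; apply: le_trans (cmodD _ _); rewrite addrA subrK.
  have K1 : 0 < 2 * (K + 1) by rewrite mulr_gt0// ltr_wpDl.
  have : 2 * (K + 1) * nrm (b - mu g) <= e by rewrite mulrC -ler_pdivlMr// ltW.
  have := nrm_triangle a b (mu g); have := nrm_ge0 (b - mu g).
  move: (nrm (a - mu g)) (nrm (b - mu g)) (nrm (a - b)) (cmod (L a - L b)) (cmod (L a - _)) (cmod _).
  move=> x y z x' y' z' y0 h1 h2 h3 h4 h5.
  have : K * x <= K * (z + y) by rewrite ler_wpM2l.
  by lra.
exists L; split=> // c a b; apply: ceq => e e0.
have c1 : 0 < cmod c + 1 by rewrite ltr_wpDl ?cmod_ge0.
have d0 : 0 < e / (2 * (K + 1) * (cmod c + 1)) by rewrite divr_gt0// !mulr_gt0// ltr_wpDl.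
(* Linearity of tau is available inside one stage, so both elements are approximated there. *)
have [n hn] := dense_lift m [:: a; b] d0.
have [g [gF hg]] := hn a (mem_head _ _).
have [h [hF hh]] : exists h : az_amb S (n + m), Fset h /\ nrm (b - mu h) < e / (2 * (K + 1) * (cmod c + 1)).
  by apply: hn; rewrite !inE eqxx orbT.
have gA := FsetA adm gF; have hA := FsetA adm hF.
have e1 := mu_lin lim c gA hA.
have e2 : L (mu (c *: g + h)) = c * L (mu g) + L (mu h).
  rewrite !hv//; last exact: E_lin.
  by rewrite tau_lin l_lin//; exact: tau_B.
have -> : L (c *: a + b) - (c * L a + L b) = (L (c *: a + b) - L (mu (c *: g + h)))
    - (c * (L a - L (mu g)) + (L b - L (mu h))).
  rewrite e2; ring.
have h1 := hL2 (c *: a + b) (mu (c *: g + h)).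
have h2 := hL2 a (mu g); have h3 := hL2 b (mu h).
have h4 : nrm (c *: a + b - mu (c *: g + h)) <= cmod c * nrm (a - mu g) + nrm (b - mu h).
  rewrite e1 opprD addrACA -scalerBr -nrmZ; exact: nrmD.
apply: le_trans (cmodD _ _) _; rewrite cmodN.
have h5 : cmod (c * (L a - L (mu g)) + (L b - L (mu h))) <= cmod c * (K * nrm (a - mu g)) + K * nrm (b - mu h).
  apply: le_trans (cmodD _ _) _; rewrite cmodM; apply: lerD => //.
  by apply: ler_wpM2l => //; exact: cmod_ge0.
apply: le_trans (lerD h1 h5) _.
have K1 : 0 < 2 * (K + 1) * (cmod c + 1) by rewrite !mulr_gt0// ltr_wpDl.
set d := e / _ in d0 hg hh.
have ed : e = 2 * (K + 1) * (cmod c + 1) * d by rewrite mulrC /d divfK ?gt_eqF.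
have s1 : cmod c * nrm (a - mu g) + nrm (b - mu h) <= (cmod c + 1) * d.
  rewrite mulrDl mul1r; apply: lerD; [apply: ler_wpM2l; [exact: cmod_ge0|exact: ltW]|exact: ltW].
have s2 := le_trans h4 s1.
have s3 := ler_wpM2l K0 s2; have s4 := ler_wpM2l K0 s1.
have s5 : 0 <= (cmod c + 1) * d by rewrite mulr_ge0// ltW.
rewrite mulrDr [K * (cmod c * _)]mulrCA in s4.
have -> : e = 2 * (K * ((cmod c + 1) * d)) + 2 * ((cmod c + 1) * d) by rewrite ed; ring.
move: s3 s4 s5; move: (K * ((cmod c + 1) * d)) ((cmod c + 1) * d).
by move=> x y s3 s4 s5; lra.
Qed.

End Functional.

End Extension.

Arguments tw_t {R C S m s} t n.
Arguments tw_W {R C S m s} t n _ _.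

Lemma cmod_sum_le (R : realType) (I : Type) (P : pred I) (r : seq I) (F G : I -> R[i]) (B : I -> R) :
  all P r -> (forall i, P i -> cmod (F i - G i) <= B i) ->
  cmod (\sum_(i <- r) F i - \sum_(i <- r) G i) <= \sum_(i <- r) B i.
Proof.
move=> + h; elim: r => [_|i r IH /= /andP[Pi /IH hr]]; first by rewrite !big_nil subrr cmod0.
rewrite !big_cons opprD addrACA; apply: le_trans (cmodD _ _) _.
by apply: lerD => //; exact: h.
Qed.

Section Positive.
Variables (R : realType) (C : cstarAlg R) (S : AzC_data C).
Variables (A : cstarAlg R) (mu : forall m, az_amb S m -> A).
Hypothesis adm : AzC_admissible S.
Hypothesis lim : is_limit mu.
Variables (m : nat) (s : I01 R) (T : tower S m s).
Notation J := (az_idx S m).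
Variables (X : Type) (l : X -> X -> MB C J -> R[i]) (K : X -> X -> R).
Hypothesis K0 : forall x y, 0 <= K x y.
Hypothesis l_lin : forall x y c a b, inMB a -> inMB b -> l x y (c *: a + b) = c * l x y a + l x y b.
Hypothesis l_bd : forall x y b (M : R), inMB b -> 0 <= M -> mxle b M -> cmod (l x y b) <= K x y * M.
Hypothesis l_psd : forall (I : Type) (r : seq I) (rho : I -> J -> Bamb C) (x : I -> X),
  (forall i y, B (rho i y)) ->
  0 <= \sum_(i <- r) \sum_(j <- r) l (x i) (x j) (outer (rho i) (rho j)).

Lemma l_sum x y I (r : seq I) (F : I -> MB C J) : (forall i, inMB (F i)) ->
  l x y (\sum_(i <- r) F i) = \sum_(i <- r) l x y (F i).
Proof.
have z : inMB (0 : MB C J) by move=> i j; exact: B0.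
have l0 : l x y 0 = 0.
  have := l_lin x y (-1) z z; rewrite scaleN1r oppr0 addr0 mulN1r => h.
  by rewrite {1}h addNr.
move=> h; elim: r => [|i r IH]; first by rewrite !big_nil.
have hs : inMB (\sum_(i <- r) F i).
  elim: r {IH} => [|j r IH]; first by rewrite big_nil.
  by rewrite big_cons -[F j]scale1r; exact: inMB_lin.
rewrite !big_cons -[F i in LHS]scale1r l_lin//.
by rewrite mul1r IH.
Qed.

(* the unit of C 1 + A is sent to 1, so that symbols l + p become l 1 + g *)
Lemma gen_cp : exists d : cpdata A X,
  [/\ forall x y, ka d x y = l x y (@mx1 R C J),
      forall x y a b, cmod (om d a x y - om d b x y) <= K x y * nrm (a - b) &
      forall n (g : az_amb S (n + m)) x y, az_A g -> om d (mu g) x y = l x y (tau T g)].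
Proof.
have hex (xy : X * X) := functional_ext adm lim T (K0 xy.1 xy.2) (@l_lin xy.1 xy.2) (@l_bd xy.1 xy.2).
have [L hL] := choice hex.
have L_lin x y c a b : L (x, y) (c *: a + b) = c * L (x, y) a + L (x, y) b.
  by have [h _ _] := hL (x, y); exact: h.
have L_bd x y a b : cmod (L (x, y) a - L (x, y) b) <= K x y * nrm (a - b).
  by have [_ h _] := hL (x, y); exact: h.
have L_v n (g : az_amb S (n + m)) x y : az_A g -> L (x, y) (mu g) = l x y (tau T g).
  by have [_ _ h] := hL (x, y); exact: h.
pose kk (a b : R[i] * A * X) := a.1.1 * cj b.1.1 * l a.2 b.2 (@mx1 R C J)
   + cj b.1.1 * L (a.2, b.2) a.1.2 + a.1.1 * L (a.2, b.2) (cs_star b.1.2)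
   + L (a.2, b.2) (cs_mul (cs_star b.1.2) a.1.2).
have psd (r : seq (R[i] * A * X)) : 0 <= \sum_(a <- r) \sum_(b <- r) kk a b.
  (* Coefficient of [dl] in the error when each component in A is replaced by a lift within [dl].
     The summand 1 absorbs the excess in |mu h| <= |p| + dl, as dl <= 1. *)
  pose cst (a b : R[i] * A * X) :=
    K a.2 b.2 * (cmod a.1.1 + cmod b.1.1 + nrm a.1.2 + nrm b.1.2 + 1).
  have cst0 a b : 0 <= cst a b.
    by rewrite /cst mulr_ge0// !addr_ge0 ?cmod_ge0 ?nrm_ge0.
  pose tot := \sum_(a <- r) \sum_(b <- r) cst a b.
  have tot0 : 0 <= tot by apply: sumr_ge0 => a _; exact: sumr_ge0.
  apply: cge0_lim => e e0.
  pose dl := Num.min 1 (e / (tot + 1)).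
  have dl0 : 0 < dl by rewrite lt_min ltr01 divr_gt0// ltr_wpDl.
  have dl1 : dl <= 1 by rewrite ge_min lexx.
  have dle : tot * dl <= e.
    have h : dl <= e / (tot + 1) by rewrite ge_min lexx orbT.
    have t1 : 0 < tot + 1 by rewrite ltr_wpDl.
    move: h; rewrite ler_pdivlMr// => h; apply: le_trans h.
    by rewrite mulrC ler_wpM2l ?(ltW dl0)// lerDl.
  have [n hn] := dense_lift adm lim m [seq a.1.2 | a <- r] dl0.
  have hn' (a : A) : exists g : az_amb S (n + m), az_A g /\ (a \in [seq a.1.2 | a <- r] -> nrm (a - mu g) < dl).
    case: (boolP (a \in [seq a.1.2 | a <- r])) => [/hn[g [gF hg]]|_]; last first.
      by exists 0; split=> //; exact: E0.
    by exists g; split=> //; exact: FsetA.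
  have [G hG] := choice hn'.
  have GA a : az_A (G a) by have [] := hG a.
  pose W := tw_W T n; pose t := tw_t T n.
  pose q (a : R[i] * A * X) : MB C (az_idx S (n + m)) := a.1.1 *: @mx1 R C _ + G a.1.2 t.
  have GB a : inMB (G a t) by exact: (E_B _ (GA a)).
  have qB a : inMB (q a) by apply: inMB_lin; [exact: mx1_B|exact: GB].
  (* The approximating value is nonnegative: by [conj_outer] it is a sum over rows, and [l_psd]
     applies to each row. *)
  exists (\sum_(a <- r) \sum_(b <- r) l a.2 b.2 (conj_mx W (smul (star (q b)) (q a)))).
    have -> : \sum_(a <- r) \sum_(b <- r) l a.2 b.2 (conj_mx W (smul (star (q b)) (q a))) =
        \sum_k \sum_(a <- r) \sum_(b <- r) l a.2 b.2 (outer (crow W (q a) k) (crow W (q b) k)).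
      rewrite [RHS]exchange_big; apply: eq_bigr => a _.
      rewrite [RHS]exchange_big; apply: eq_bigr => b _.
      by rewrite conj_outer l_sum// => k; apply: outer_B => y; exact: crow_B.
    apply: sumr_ge0 => k _.
    apply: (l_psd r (rho := fun a => crow W (q a) k) (fun a => a.2)) => a y; exact: crow_B.
  apply: (@le_trans _ _ (tot * dl)) => //.
  have rP : all (fun a : R[i] * A * X => a.1.2 \in [seq a.1.2 | a <- r]) r.
    by have := allss [seq a.1.2 | a <- r]; rewrite all_map.
  rewrite /tot mulr_suml; apply: (cmod_sum_le rP) => a ar.
  rewrite mulr_suml; apply: (cmod_sum_le rP) => b br.
  have ha := (hG a.1.2).2 ar; have hb := (hG b.1.2).2 br.
  move: a b ha hb {ar br} => [[la pa] xa] [[lb pb] xb] /= ha hb.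
  set g := G pa in ha; set h := G pb in hb.
  have gA : az_A g := GA pa; have hA : az_A h := GA pb.
  have -> : conj_mx W (smul (star (q (lb, pb, xb))) (q (la, pa, xa))) =
     (la * cj lb) *: @mx1 R C J + (cj lb *: tau T g + (la *: tau T (star h) + tau T (smul (star h) g))).
    have -> : q (la, pa, xa) = la *: @mx1 R C _ + g t by [].
    have -> : q (lb, pb, xb) = lb *: @mx1 R C _ + h t by [].
    rewrite mxstar_lin mx1_star mxmulDl mxmulZl mxmul1l mxmulDr mxmulZr mxmul1r.
    rewrite scalerDr scalerA mulrC -addrA conj_lin (conj_mx1 C (tw_isom T n)).
    by rewrite conj_lin conj_lin.
  have gB : inMB (tau T g) by exact: tau_B.
  have shA : az_A (star h) by exact: E_star.
  have shgA : az_A (smul (star h) g) by exact: E_mul.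
  have shB : inMB (tau T (star h)) by exact: tau_B.
  have shgB : inMB (tau T (smul (star h) g)) by exact: tau_B.
  have lB1 : inMB (la *: tau T (star h) + tau T (smul (star h) g)) by exact: inMB_lin.
  have lB2 : inMB (cj lb *: tau T g + (la *: tau T (star h) + tau T (smul (star h) g))) by exact: inMB_lin.
  rewrite !l_lin//; last exact: mx1_B.
  rewrite -!L_v// (mu_star lim hA) (mu_mul lim shA gA) (mu_star lim hA) /kk /cst /=.
  set e1 := L (xa, xb) pa; set e2 := L (xa, xb) (cs_star pb); set e3 := L (xa, xb) (cs_mul _ _).
  set f1 := L (xa, xb) (mu g); set f2 := L (xa, xb) (cs_star _); set f3 := L (xa, xb) (cs_mul _ _).
  set k1 := l _ _ _.
  have -> : la * cj lb * k1 + cj lb * e1 + la * e2 + e3 - (la * cj lb * k1 + (cj lb * f1 + (la * f2 + f3)))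
    = cj lb * (e1 - f1) + la * (e2 - f2) + (e3 - f3) by ring.
  have b1 : cmod (e1 - f1) <= K xa xb * dl.
    by apply: le_trans (L_bd _ _ _ _) _; apply: ler_wpM2l => //; exact: ltW.
  have b2 : cmod (e2 - f2) <= K xa xb * dl.
    apply: le_trans (L_bd _ _ _ _) _; apply: ler_wpM2l => //.
    by rewrite -cs_starB cs_nrm_star ltW.
  have b3 : cmod (e3 - f3) <= K xa xb * (dl * (nrm pa + nrm pb + 1)).
    apply: le_trans (L_bd _ _ _ _) _; apply: ler_wpM2l => //.
    have -> : cs_mul (cs_star pb) pa - cs_mul (cs_star (mu h)) (mu g) =
       cs_mul (cs_star pb - cs_star (mu h)) pa + cs_mul (cs_star (mu h)) (pa - mu g).
      by rewrite csBl csBr addrA subrK.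
    apply: le_trans (nrmD _ _) _.
    have := cs_nrmM (cs_star pb - cs_star (mu h)) pa; have := cs_nrmM (cs_star (mu h)) (pa - mu g).
    rewrite -cs_starB !cs_nrm_star => i1 i2.
    have i3 : nrm (mu h) <= nrm pb + dl.
      have := nrm_sub (mu h) pb; rewrite nrmB => i3; apply: le_trans i3 _.
      by rewrite addrC lerD2l ltW.
    have j1 := ler_pM (nrm_ge0 _) (nrm_ge0 _) i3 (ltW ha).
    have j2 := ler_wpM2r (nrm_ge0 pa) (ltW hb).
    apply: le_trans (lerD i2 i1) _; apply: le_trans (lerD j2 j1) _.
    have -> : dl * nrm pa + (nrm pb + dl) * dl = dl * (nrm pa + nrm pb + dl) by ring.
    by apply: ler_wpM2l; [exact: ltW|rewrite lerD2l].
  apply: le_trans (cmodD _ _) _; apply: le_trans (lerD (cmodD _ _) b3) _.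
  rewrite !cmodM cmodJ.
  have j1 := ler_wpM2l (cmod_ge0 lb) b1; have j2 := ler_wpM2l (cmod_ge0 la) b2.
  apply: le_trans (lerD (lerD j1 j2) (lexx _)) _.
  by rewrite le_eqVlt; apply/orP; left; apply/eqP; ring.
exists (@CPData R A X (fun x y => l x y (@mx1 R C J)) (fun a x y => L (x, y) a)
  (fun c a b x y => L_lin x y c a b) psd); split=> //=.
Qed.

End Positive.

Section SumData.
Variables (R : realType) (P : cstarAlg R) (X : Type) (I : Type) (r : seq I) (d : I -> cpdata P X).

Lemma cp_sum : exists d' : cpdata P X,
  (forall x y, ka d' x y = \sum_(i <- r) ka (d i) x y) /\
  forall p x y, om d' p x y = \sum_(i <- r) om (d i) p x y.
Proof.
pose k x y := \sum_(i <- r) ka (d i) x y.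
pose o p x y := \sum_(i <- r) om (d i) p x y.
have o_lin (l : R[i]) p q x y : o (l *: p + q) x y = l * o p x y + o q x y.
  by rewrite /o mulr_sumr -big_split; apply: eq_bigr => i _; exact: om_lin.
have o_psd (s : seq (R[i] * P * X)) : 0 <= \sum_(a <- s) \sum_(b <- s)
    (a.1.1 * cj b.1.1 * k a.2 b.2 + cj b.1.1 * o a.1.2 a.2 b.2
     + a.1.1 * o (cs_star b.1.2) a.2 b.2 + o (cs_mul (cs_star b.1.2) a.1.2) a.2 b.2).
  have -> : \sum_(a <- s) \sum_(b <- s)
    (a.1.1 * cj b.1.1 * k a.2 b.2 + cj b.1.1 * o a.1.2 a.2 b.2
     + a.1.1 * o (cs_star b.1.2) a.2 b.2 + o (cs_mul (cs_star b.1.2) a.1.2) a.2 b.2) =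
    \sum_(i <- r) \sum_(a <- s) \sum_(b <- s)
    (a.1.1 * cj b.1.1 * ka (d i) a.2 b.2 + cj b.1.1 * om (d i) a.1.2 a.2 b.2
     + a.1.1 * om (d i) (cs_star b.1.2) a.2 b.2 + om (d i) (cs_mul (cs_star b.1.2) a.1.2) a.2 b.2).
    rewrite [RHS]exchange_big; apply: eq_bigr => a _; rewrite [RHS]exchange_big; apply: eq_bigr => b _.
    by rewrite !big_split -!mulr_sumr.
  by apply: sumr_ge0 => i _; exact: om_psd.
by exists (@CPData R P X k o o_lin o_psd).
Qed.

End SumData.

(** * Compressions of tau by representations of B *)

Section Coefficients.
Variables (R : realType) (C : cstarAlg R) (S : AzC_data C).
Variables (A : cstarAlg R) (mu : forall m, az_amb S m -> A).
Hypothesis adm : AzC_admissible S.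
Hypothesis lim : is_limit mu.
Variables (m : nat) (s : I01 R) (T : tower S m s).
Notation J := (az_idx S m).

(** Elements of A with a chosen representative at some stage. On these tau is a map into matrices
    over B, while on A it is available only through extended functionals. *)
Definition lifts : Type := {n : nat & {g : az_amb S (n + m) | az_A g}}.
Definition lmu (x : lifts) : A := mu (sval (tagged x)).
Definition ltau (x : lifts) : MB C J := tau T (sval (tagged x)).

(** Relations between coefficients hold at each stage and pass to A by density; this is how the
    extended coefficients become linear in the vectors that label them. *)
Lemma om_rel (X : Type) (l : X -> X -> MB C J -> R[i]) (K : X -> X -> R) (d : cpdata A X) :
  (forall x y, 0 <= K x y) ->
  (forall x y a b, cmod (om d a x y - om d b x y) <= K x y * nrm (a - b)) ->
  (forall n (g : az_amb S (n + m)) x y, az_A g -> om d (mu g) x y = l x y (tau T g)) ->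
  forall (c : R[i]) x1 y1 x2 y2 x3 y3,
  (forall b, inMB b -> l x1 y1 b = c * l x2 y2 b + l x3 y3 b) ->
  forall p, om d p x1 y1 = c * om d p x2 y2 + om d p x3 y3.
Proof.
move=> K0 hK hv c x1 y1 x2 y2 x3 y3 h.
apply: (mu_dense_ext adm lim (m := m) (K := K x1 y1) (K' := cmod c * K x2 y2 + K x3 y3)) => //.
- by rewrite addr_ge0// mulr_ge0// cmod_ge0.
- move=> a b; have -> : c * om d a x2 y2 + om d a x3 y3 - (c * om d b x2 y2 + om d b x3 y3)
    = c * (om d a x2 y2 - om d b x2 y2) + (om d a x3 y3 - om d b x3 y3) by ring.
  apply: le_trans (cmodD _ _) _; rewrite cmodM mulrDl -mulrA; apply: lerD => //.
  by apply: ler_wpM2l => //; exact: cmod_ge0.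
- by move=> n g gA; cbv beta; rewrite (hv n g x1 y1 gA) (hv n g x2 y2 gA) (hv n g x3 y3 gA) h//; exact: tau_B.
Qed.

Section Alpha.
Variables (H : hilbert R) (v : Bamb C -> H -> H).
Hypothesis hv : star_rep_on (@B R C) v.

(* the label (y, f) stands for f in the y-th coordinate of H^J *)
Definition avec (x y : J * H) (b : MB C J) : R[i] := ip (v (b y.1 x.1) x.2) y.2.

Lemma alpha_cp : exists d : cpdata A (J * H),
  [/\ forall x y, ka d x y = if x.1 == y.1 then ip (v (Bscal C 1) x.2) y.2 else 0,
      forall n (g : az_amb S (n + m)) x y, az_A g -> om d (mu g) x y = avec x y (tau T g) &
      forall (c : R[i]) x1 y1 x2 y2 x3 y3,
        (forall b, inMB b -> avec x1 y1 b = c * avec x2 y2 b + avec x3 y3 b) ->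
        forall p, om d p x1 y1 = c * om d p x2 y2 + om d p x3 y3].
Proof.
pose K (x y : J * H) := nrm x.2 * nrm y.2.
have K0 x y : 0 <= K x y by rewrite mulr_ge0 ?nrm_ge0.
have l_lin x y c a b : inMB a -> inMB b -> avec x y (c *: a + b) = c * avec x y a + avec x y b.
  move=> ha hb; rewrite /avec -[(c *: a + b) _ _]/(c *: a y.1 x.1 + b y.1 x.1).
  by rewrite (rep_add hv)// ip_linear.
have l_bd x y b (M : R) : inMB b -> 0 <= M -> mxle b M -> cmod (avec x y b) <= K x y * M.
  move=> hb M0 hM; apply: le_trans (cauchy_schwarz _ _) _.
  rewrite /K mulrC mulrAC mulrC ler_wpM2r ?nrm_ge0// mulrC; apply: mxle_entry hM => //.
have l_psd (I : Type) (r : seq I) (rho : I -> J -> Bamb C) (x : I -> J * H) :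
  (forall i y, B (rho i y)) ->
  0 <= \sum_(i <- r) \sum_(j <- r) avec (x i) (x j) (outer (rho i) (rho j)).
  move=> hB; have := ip_ge0 (\sum_(i <- r) v (rho i (x i).1) (x i).2).
  rewrite ip_suml; congr (_ <= _); apply: eq_bigr => i _.
  rewrite ip_sumr; apply: eq_bigr => j _.
  rewrite /avec /outer (rep_mul hv)//; last exact: B_star.
  by rewrite [RHS](rep_star hv) ?BstarK//; exact: B_star.
have [d [h1 h2 h3]] := gen_cp adm lim T K0 l_lin l_bd l_psd.
exists d; split=> //; last exact: (om_rel K0 h2 h3).
move=> x y; rewrite h1 /avec /mx1 eq_sym; case: ifP => // _.
by rewrite (rep0 hv) ?ip0l//; exact: B0.
Qed.

(** An off-diagonal entry is the compression between the coordinates y and y' of one dilation. The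
    constant is 1 because the Gram form of a coordinate is <v(1) f, f>. *)
Lemma alpha_dilates (y y' : J) : dilates lmu (fun x f => v (ltau x y' y) f) 1.
Proof.
have [d [h1 h2 h3]] := alpha_cp.
have [U [hU U_pt]] := dker_rep d.
have ld z : linear (fun f => dS d (z, f)).
  move=> c f f'; apply: dS_lin => [t|p t].
    rewrite !h1 /=; case: ifP => _; last by rewrite mulr0 addr0.
    by rewrite (rep_lin hv)//; [rewrite ip_linear|exact: Bscal_B].
  apply: h3 => b hb; rewrite /avec /= (rep_lin hv)//; exact: ip_linear.
have nd z f : nrm (dS d (z, f)) <= 1 * nrm f.
  rewrite mul1r; rewrite -(ler_pXn2r (ltn0Sn 1)) ?nnegrE ?nrm_ge0//.
  have e : (nrm (dS d (z, f)) ^+ 2)%:C = ip (v (Bscal C 1) f) f by rewrite -ip_nrm ip_dS h1 /= eqxx.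
  have := cauchy_schwarz (v (Bscal C 1) f) f; rewrite -e cmodR ger0_norm ?sqr_ge0// => h.
  by apply: le_trans h _; rewrite expr2 ler_wpM2r ?nrm_ge0//; exact: B_unit_bd.
exists (kolm (dker d)), U, (fun f => dS d (y, f)), (fun f => dS d (y', f)), 1, 1.
split; [done|by split; exact: ld|by rewrite mulr1; split; rewrite ?ler01|by split; exact: nd|].
move=> [n [g gA]] f f'; rewrite (dS_om U_pt) -[lmu _]/(mu g) h2//.
Qed.

End Alpha.

End Coefficients.

(** * Elements supported on patches of [0,1] x (0,1] *)

Section RealFunctions.
Variable R : realType.
Implicit Types (h g : I01 R -> R).

Definition rcont h := forall s (e : R), 0 < e -> exists2 d : R, 0 < d &
  forall t, `|sval t - sval s| < d -> `|h t - h s| < e.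

Lemma rcont_lip h (K : R) : 0 <= K -> (forall s t, `|h t - h s| <= K * `|sval t - sval s|) -> rcont h.
Proof.
move=> K0 hK s e e0; have K1 : 0 < K + 1 by rewrite ltr_wpDl.
exists (e / (K + 1)) => [|t]; first by rewrite divr_gt0.
rewrite ltr_pdivlMr// => ht; apply: le_lt_trans (hK _ _) _; apply: le_lt_trans ht.
by rewrite mulrDr mulr1 mulrC lerDl.
Qed.

Lemma rcontB h g : rcont h -> rcont g -> rcont (fun t => h t - g t).
Proof.
move=> ch cg s e e0; have e20 : 0 < e / 2 by rewrite divr_gt0.
have [d d0 hd] := ch s _ e20; have [d' d'0 hd'] := cg s _ e20.
exists (Num.min d d') => [|t]; first by rewrite lt_min d0.
rewrite lt_min => /andP[/hd h1 /hd' h2].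
have -> : h t - g t - (h s - g s) = (h t - h s) - (g t - g s) by ring.
by apply: le_lt_trans (ler_normB _ _) _; rewrite (splitr e) ltrD.
Qed.

Lemma rcont_sqrt h : (forall t, 0 <= h t) -> rcont h -> rcont (fun t => Num.sqrt (h t)).
Proof.
move=> h0 ch s e e0; have e20 : 0 < e ^+ 2 by rewrite exprn_gt0.
have [d d0 hd] := ch s _ e20; exists d => // t /hd.
have := sqrtr_ge0 (h t); have := sqrtr_ge0 (h s).
rewrite -{2}(sqr_sqrtr (h0 t)) -{2}(sqr_sqrtr (h0 s)).
move: (Num.sqrt (h t)) (Num.sqrt (h s)) => x y y0 x0; rewrite ltr_norml => /andP[h1 h2].
rewrite ltr_norml; apply/andP; split.
  by rewrite ltNge; apply/negP => hn; nra.
by rewrite ltNge; apply/negP => hn; nra.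
Qed.

Lemma rcont_mul h g : (forall t, 0 <= h t <= 1) -> (forall t, 0 <= g t <= 1) ->
  rcont h -> rcont g -> rcont (fun t => h t * g t).
Proof.
move=> h1 g1 ch cg s e e0; have e20 : 0 < e / 2 by rewrite divr_gt0.
have [d d0 hd] := ch s _ e20; have [d' d'0 hd'] := cg s _ e20.
exists (Num.min d d') => [|t]; first by rewrite lt_min d0.
rewrite lt_min => /andP[/hd k1 /hd' k2].
have -> : h t * g t - h s * g s = (h t - h s) * g t + h s * (g t - g s) by ring.
apply: le_lt_trans (ler_normD _ _) _; rewrite (splitr e) !normrM.
have /andP[a1 a2] := g1 t; have /andP[b1 b2] := h1 s.
rewrite (ger0_norm a1) (ger0_norm b1); apply: ltrD.
  by apply: le_lt_trans k1; rewrite ler_piMr.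
by apply: le_lt_trans k2; rewrite ler_piMl.
Qed.

(** Used with z = 1 for functions of t and z = 0 for functions of the cone variable. A diagonal
    matrix over the cone already lies in M_p(B) (x) 1 at t = 0, but it is not scalar at t = 1. *)
Definition cut (z : I01 R) h := [/\ rcont h, (forall t, 0 <= h t <= 1) & h z = 0].

Lemma cut_sqrt z h : cut z h -> cut z (fun t => Num.sqrt (h t)).
Proof.
case=> ch h1 hz; split; last by rewrite hz sqrtr0.
  by apply: rcont_sqrt => // t; have /andP[] := h1 t.
move=> t; rewrite sqrtr_ge0/= -[leRHS]sqrtr1 ler_sqrt ?ler01//.
by have /andP[] := h1 t.
Qed.

Lemma cut_mul z h g : cut z h -> rcont g -> (forall t, 0 <= g t <= 1) -> cut z (fun t => h t * g t).
Proof.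
case=> ch h1 hz cg g1; split; [exact: rcont_mul| |by rewrite hz mul0r].
move=> t; have /andP[a b] := h1 t; have /andP[c d] := g1 t.
by rewrite mulr_ge0//= mulr_ile1.
Qed.

Lemma cut_subsq z h : cut z h -> cut z (fun t => h t - h t * h t).
Proof.
move=> hh; have [ch h1 hz] := hh; have [c2 h2 _] := cut_mul hh ch h1; split.
- exact: rcontB.
- by move=> t; have /andP[a b] := h1 t; apply/andP; split; nra.
- by rewrite hz mulr0 subrr.
Qed.

End RealFunctions.

Section Elements.
Variables (R : realType) (C : cstarAlg R).
Implicit Types (b : Bamb C) (J : finType) (H G : I01 R -> R).

Definition cone G (c : C) : Bamb C := (0, fun x => (G x)%:C *: c).

Lemma cone_B G c : rcont G -> G (clip 0) = 0 -> B (cone G c).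
Proof.
move=> cG G0; apply/BP; split; last by rewrite /= G0 scale0r.
move=> s e e0; have c1 : 0 < nrm c + 1 by rewrite ltr_wpDl ?nrm_ge0.
have d0 : 0 < e / (nrm c + 1) by rewrite divr_gt0.
have [d dp hd] := cG s _ d0; exists d => // t /hd h.
rewrite /= -scalerBl -[X in X *: c](rmorphB _ (G t) (G s)) nrmZ cmodR.
apply: le_lt_trans (_ : _ <= `|G t - G s| * (nrm c + 1)) _.
  by apply: ler_wpM2l => //; rewrite lerDl.
by rewrite -ltr_pdivlMr.
Qed.

Lemma cone_lin G l c c' : cone G (l *: c + c') = l *: cone G c + cone G c'.
Proof.
apply: Bext => [|x]; first by rewrite B1D B1Z /= mulr0 addr0.
by rewrite B2D B2Z /= scalerDr !scalerA mulrC.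
Qed.

Lemma cone_mul G G' c c' : smul (cone G c) (cone G' c') = cone (fun x => G x * G' x) (cs_mul c c').
Proof.
apply: Bext => [|x]; first exact: mulr0.
by rewrite smul2 /= !scale0r !add0r csZl csZr scalerA RCM.
Qed.

Lemma cone_star G c : star (cone G c) = cone G (cs_star c).
Proof.
apply: Bext => [|x]; first exact: (conjc0 R).
by rewrite -[LHS]/(cs_star ((G x)%:C *: c)) cs_starZ conjc_real.
Qed.

Definition dmx J b : MB C J := fun i j => if i == j then b else 0.
Arguments dmx J b : clear implicits.

Lemma dmx_B J b : B b -> inMB (dmx J b).
Proof. by move=> hb i j; rewrite /dmx; case: ifP => // _; exact: B0. Qed.

Lemma dmx_mul J b (c : Bamb C) : smul (dmx J b) (dmx J c) = dmx J (smul b c).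
Proof.
apply/funext => i; apply/funext => j; rewrite -[LHS]/(\sum_k smul (dmx J b i k) (dmx J c k j)).
rewrite (bigD1 i)// big1 ?Monoid.mulm1 => [|k ki].
  by rewrite /dmx eqxx; case: ifP => // _; rewrite Bsmul0r.
by rewrite {1}/dmx eq_sym (negPf ki) Bsmul0l.
Qed.

Lemma dmx_star J b : star (dmx J b) = dmx J (star b).
Proof.
apply/funext => i; apply/funext => j; rewrite -[LHS]/(star (dmx J b j i)) /dmx eq_sym.
by case: ifP => // _; exact: Bstar0.
Qed.

Lemma dmx_lin J l b (c : Bamb C) : dmx J (l *: b + c) = l *: dmx J b + dmx J c.
Proof.
apply/funext => i; apply/funext => j; rewrite -[RHS]/(l *: dmx J b i j + dmx J c i j) /dmx.
by case: ifP => // _; rewrite scaler0 addr0.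
Qed.

Definition elt J H (a : MB C J) : FB C J := fun t => (H t)%:C *: a.

Lemma elt_mul J H G (a a' : MB C J) :
  smul (elt H a) (elt G a') = elt (fun t => H t * G t) (smul a a').
Proof.
apply/funext => t; rewrite -[LHS]/(smul ((H t)%:C *: a) ((G t)%:C *: a')).
by rewrite mxmulZl mxmulZr scalerA -RCM.
Qed.

Lemma elt_star J H (a : MB C J) : star (elt H a) = elt H (star a).
Proof.
apply/funext => t; rewrite -[LHS]/(star ((H t)%:C *: a)).
have := mxstar_lin (H t)%:C a 0; rewrite addr0 => ->; rewrite conjc_real.
rewrite /elt; set z := star 0; have -> : z = 0; last by rewrite addr0.
by apply/funext => i; apply/funext => j; exact: Bstar0.
Qed.

Lemma elt_lin J H l (a a' : MB C J) : elt H (l *: a + a') = l *: elt H a + elt H a'.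
Proof.
apply/funext => t; rewrite -[RHS]/(l *: ((H t)%:C *: a) + (H t)%:C *: a').
by rewrite /elt scalerDr !scalerA mulrC.
Qed.

Lemma elt_sum J H I (r : seq I) (F : I -> MB C J) :
  elt H (\sum_(i <- r) F i) = \sum_(i <- r) elt H (F i).
Proof.
elim: r => [|i r IH]; first by rewrite !big_nil; apply/funext => t; exact: scaler0.
by rewrite !big_cons -IH -[F i]scale1r elt_lin !scale1r.
Qed.

Lemma E_elt (P Q : finType) H (a : MB C (P * Q)%type) : rcont H -> inMB a ->
  H (clip 0) = 0 \/ left_tensor a -> H (clip 1) = 0 \/ right_scalar a -> Eblock (elt H a).
Proof.
move=> cH aB h0 h1; apply/EblockP; split.
- move=> t i j; rewrite -[elt H a t i j]/((H t)%:C *: a i j); exact: B_Z.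
- move=> s e e0; have [M M0 hM] := mxle_ex aB.
  have M1 : 0 < M + 1 by rewrite ltr_wpDl.
  have d0 : 0 < e / (M + 1) by rewrite divr_gt0.
  have [d dp hd] := cH s _ d0; exists d => // t /hd h.
  have -> : elt H a t - elt H a s = (H t - H s)%:C *: a + 0.
    by rewrite addr0 -scalerBl -[X in X *: a](rmorphB _ (H t) (H s)).
  have z : inMB (0 : MB C (P * Q)%type) by move=> i j; exact: B0.
  apply: mxle_ge (mxle_lin _ aB z hM (@mxle0 R C _)) _.
  rewrite addr0 cmodR; apply: le_trans (_ : _ <= `|H t - H s| * (M + 1)) _.
    by apply: ler_wpM2l => //; rewrite lerDl.
  by apply: ltW; rewrite -ltr_pdivlMr.
- case: h0 => [h|/left_tensorP[b bB e]]; apply/left_tensorP.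
    exists 0 => [i j|]; first exact: B0.
    rewrite /elt h scale0r; apply/funext => x; apply/funext => y.
    by rewrite /ampl; case: ifP.
  exists ((H (clip 0))%:C *: b + 0).
    by apply: inMB_lin => // i j; exact: B0.
  rewrite ampl_lin -e /elt; set z := ampl 0; have -> : z = 0; last by rewrite addr0.
  by apply/funext => x; apply/funext => y; rewrite /z /ampl; case: ifP.
- case: h1 => [h|/right_scalarP[b e]]; apply/right_scalarP.
    exists (fun _ _ => 0); rewrite /elt h scale0r; apply/funext => x; apply/funext => y.
    by rewrite /ampr; case: ifP => // _; exact: Bext.
  exists (fun x y => (H (clip 1))%:C * b x y); rewrite /elt e.
  apply/funext => x; apply/funext => y; rewrite -[LHS]/(_ *: (if _ then _ else _)) /ampr.
  case: ifP => // _; last by rewrite scaler0.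
  by have := Bscal_lin C (H (clip 1))%:C (b x.2 y.2) 0; rewrite addr0 => ->; apply: Bext => [|w]; [exact/esym/addr0|rewrite B2D /= addr0].
Qed.

Lemma dmx_left (P Q : finType) b : B b -> left_tensor (dmx (P * Q)%type b).
Proof.
move=> hb; exists (dmx P b); first exact: dmx_B.
by move=> x y; rewrite /dmx -pair_eqE /= andbC; case: (x.2 == y.2) => //=; case: ifP.
Qed.

End Elements.
Arguments dmx {R C} J b.

(** * Order zero maps from C to A *)

Section Kappa.
Variables (R : realType) (C : cstarAlg R) (S : AzC_data C).
Variables (A : cstarAlg R) (mu : forall m, az_amb S m -> A).
Hypothesis lim : is_limit mu.
Variable m : nat.
Notation J := (az_idx S m).

Definition kelt (H G : I01 R -> R) (c : C) : az_amb S m := elt H (dmx J (cone G c)).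
(** A completely positive map of order zero: products of its values are given by products of the cut
    functions and of the elements of C. *)
Definition kappa H G c : A := mu (kelt H G c).

Lemma kelt_A H G c : cut (clip 1) H -> cut (clip 0) G -> az_A (kelt H G c).
Proof.
move=> [cH _ H1] [cG _ G0]; have cB : B (cone G c) by exact: cone_B.
by apply: E_elt => //; [exact: dmx_B|right; exact: dmx_left|left].
Qed.

Lemma kappa_mul H G H' G' c c' : cut (clip 1) H -> cut (clip 0) G -> cut (clip 1) H' -> cut (clip 0) G' ->
  cs_mul (kappa H G c) (kappa H' G' c') =
  kappa (fun t => H t * H' t) (fun t => G t * G' t) (cs_mul c c').
Proof.
move=> hH hG hH' hG'; rewrite -(mu_mul lim); [|exact: kelt_A..].
by rewrite /kappa /kelt elt_mul dmx_mul cone_mul.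
Qed.

Lemma kappa_star H G c : cut (clip 1) H -> cut (clip 0) G ->
  cs_star (kappa H G c) = kappa H G (cs_star c).
Proof.
move=> hH hG; rewrite -(mu_star lim); last exact: kelt_A.
by rewrite /kappa /kelt elt_star dmx_star cone_star.
Qed.

Lemma kappa_lin H G l c c' : cut (clip 1) H -> cut (clip 0) G ->
  kappa H G (l *: c + c') = l *: kappa H G c + kappa H G c'.
Proof.
move=> hH hG; rewrite -(mu_lin lim); [|exact: kelt_A..].
by rewrite /kappa /kelt cone_lin dmx_lin elt_lin.
Qed.

(** The decomposition H G = H^2 G^2 + H (G - G^2) + (H - H^2) G^2 has nonnegative terms, whence the
    map for H^2, G^2 is dominated by the one for H, G. *)
Lemma kappa_split H G c : cut (clip 1) H -> cut (clip 0) G ->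
  kappa H G c = kappa (fun t => H t * H t) (fun t => G t * G t) c
    + (kappa H (fun t => G t - G t * G t) c + kappa (fun t => H t - H t * H t) (fun t => G t * G t) c).
Proof.
move=> hH hG; have [cH H1 _] := hH; have [cG G1 _] := hG.
have hH2 := cut_mul hH cH H1; have hG2 := cut_mul hG cG G1.
have hHs := cut_subsq hH; have hGs := cut_subsq hG.
rewrite -!(mu_D lim); try apply: E_D; try exact: kelt_A.
congr mu; apply/funext => t; apply/funext => i; apply/funext => j.
rewrite -[LHS]/((H t)%:C *: dmx J (cone G c) i j).
rewrite -[RHS]/((H t * H t)%:C *: dmx J (cone (fun t => G t * G t) c) i j +
  ((H t)%:C *: dmx J (cone (fun t => G t - G t * G t) c) i j +
   (H t - H t * H t)%:C *: dmx J (cone (fun t => G t * G t) c) i j)).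
rewrite /dmx; case: ifP => _; last by rewrite !scaler0 !addr0.
apply: Bext => [|x]; first by rewrite !B1D !B1Z /= !mulr0 !addr0.
rewrite !B2D !B2Z /= !scalerA -!scalerDl -!RCM -!RCD.
by congr (_%:C *: _); ring.
Qed.

Lemma sqrtM (h : I01 R -> R) (z : I01 R) : cut z h -> (fun t => Num.sqrt (h t) * Num.sqrt (h t)) = h.
Proof.
by move=> [_ h1 _]; apply/funext => t; rewrite -expr2 sqr_sqrtr//; have /andP[] := h1 t.
Qed.

Section InRep.
Variables (H0 : hilbert R) (u : A -> H0 -> H0).
Hypothesis hu : star_rep (S := A) u.

Definition kgram H G (s : seq (C * H0)) : R[i] :=
  \sum_(a <- s) \sum_(b <- s) ip (u (kappa H G (cs_mul (cs_star b.1) a.1)) a.2) b.2.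

Lemma kgram_sq H G H' G' s : cut (clip 1) H -> cut (clip 0) G ->
  (fun t => H t * H t) = H' -> (fun t => G t * G t) = G' ->
  (nrm (\sum_(a <- s) u (kappa H G a.1) a.2) ^+ 2)%:C = kgram H' G' s.
Proof.
move=> hH hG <- <-; rewrite -ip_nrm ip_suml; apply: eq_bigr => a _.
rewrite ip_sumr; apply: eq_bigr => b _.
rewrite -(kappa_mul _ _ hH hG hH hG) -(kappa_star _ hH hG) (rep_mul hu)// [RHS](rep_star hu)//.
by rewrite -[star _]/(cs_star _) csK.
Qed.

(** [R1] is the map for the square roots of H and G. The Gram form of [R2] belongs to H^2 and G^2,
    that of [R1] to H and G, and [kappa_split] writes their difference as a sum of two Gram
    forms. *)
Lemma kappa_dilates H G : cut (clip 1) H -> cut (clip 0) G ->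
  dilates id (fun c f => u (kappa H G c) f) 1.
Proof.
move=> hH hG; have [cH H1 _] := hH; have [cG G1 _] := hG.
have hH2 := cut_mul hH cH H1; have hG2 := cut_mul hG cG G1.
have hHs := cut_subsq hH; have hGs := cut_subsq hG.
have sH := cut_sqrt hH; have sG := cut_sqrt hG.
apply: (cone_dilates (R1 := fun c f => u (kappa (fun t => Num.sqrt (H t)) (fun t => Num.sqrt (G t)) c) f)).
- by move=> l c c' f; rewrite kappa_lin// (rep_add hu).
- by move=> c; exact: (rep_lin hu).
- move=> c c' f f'.
  have -> : kappa H G (cs_mul (cs_star c') c) = cs_mul
     (cs_star (kappa (fun t => Num.sqrt (H t)) (fun t => Num.sqrt (G t)) c'))
     (kappa (fun t => Num.sqrt (H t)) (fun t => Num.sqrt (G t)) c).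
    by rewrite kappa_star// kappa_mul// (sqrtM hH) (sqrtM hG).
  by rewrite (rep_mul hu)// [RHS](rep_star hu)// -[star _]/(cs_star _) csK.
- by move=> c f f'; rewrite (rep_star hu)// -[star _]/(cs_star _) kappa_star.
- move=> s; rewrite -(ler_pXn2r (ltn0Sn 1)) ?nnegrE ?nrm_ge0// -lecR.
  rewrite (kgram_sq s hH hG erefl erefl) (kgram_sq s sH sG (sqrtM hH) (sqrtM hG)).
  have -> : kgram H G s = kgram (fun t => H t * H t) (fun t => G t * G t) s +
     (kgram H (fun t => G t - G t * G t) s + kgram (fun t => H t - H t * H t) (fun t => G t * G t) s).
    rewrite /kgram -!big_split; apply: eq_bigr => a _; rewrite -!big_split; apply: eq_bigr => b _.
    by rewrite (kappa_split _ hH hG) !(repD hu)// !ipDl.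
  rewrite lerDl addr_ge0//.
    rewrite -(kgram_sq s sH (cut_sqrt hGs) (sqrtM hH) (sqrtM hGs)).
    by rewrite lecR sqr_ge0.
  rewrite -(kgram_sq s (cut_sqrt hHs) (cut_sqrt hG2) (sqrtM hHs) (sqrtM hG2)).
  by rewrite lecR sqr_ge0.
Qed.

End InRep.

End Kappa.

(** * Nuclearity *)

Section MaxNorm.
Variables (R : realType) (A D : cstarAlg R).

Definition maxle (x : seq (A * D)) (M : R) : Prop :=
  forall (H : hilbert R) (v : A -> D -> H -> H) f, tensor_rep v ->
    nrm (\sum_(a <- x) v a.1 a.2 f) <= M * nrm f.

Lemma tensor_rep_lin (H : hilbert R) (v : A -> D -> H -> H) a d : tensor_rep v -> linear (v a d).
Proof. by case=> /(_ a d)[]. Qed.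

Lemma maxleP (x : seq (A * D)) (M : R) : 0 <= M -> (max_norm x <= M%:E)%E <-> maxle x M.
Proof.
move=> M0; split=> [h H v f hv|h]; last first.
  apply: ge_ereal_sup => _ [H [v [f [hv f1 ->]]]]; rewrite lee_fin.
  by apply: le_trans (h _ _ _ hv) _; rewrite -[leRHS]mulr1 ler_wpM2l.
have [->|/eqP f0] := eqVneq f 0.
  rewrite big1 ?nrm0 ?mulr0// => a _.
  by have [-> _ _] := linDZ (tensor_rep_lin a.1 a.2 hv).
have n0 : 0 < nrm f.
  by rewrite lt_neqAle nrm_ge0 andbT eq_sym; apply/eqP => /nrm_eq0.
pose c : R[i] := ((nrm f)^-1)%:C.
have cn : cmod c = (nrm f)^-1 by rewrite cmodR ger0_norm// invr_ge0 nrm_ge0.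
have : ((nrm (\sum_(a <- x) v a.1 a.2 (c *: f)))%:E <= M%:E)%E.
  apply: le_trans h; apply: ereal_sup_ubound; exists H, v, (c *: f); split=> //.
  by rewrite nrmZ cn mulVf ?gt_eqF.
have -> : \sum_(a <- x) v a.1 a.2 (c *: f) = c *: \sum_(a <- x) v a.1 a.2 f.
  rewrite scaler_sumr; apply: eq_bigr => a _.
  by have [_ _ ->] := linDZ (tensor_rep_lin a.1 a.2 hv).
by rewrite lee_fin nrmZ cn mulrC ler_pdivrMr.
Qed.

Lemma tensor_of_commuting (H : hilbert R) (U : A -> H -> H) (W : D -> H -> H) :
  star_rep (S := A) U -> star_rep (S := D) W -> (forall a d f, U a (W d f) = W d (U a f)) ->
  tensor_rep (fun a d f => U a (W d f)).
Proof.
move=> hU hW UW; split.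
- move=> a d; split; first by move=> c f g; rewrite (rep_lin hW)// (rep_lin hU).
  have [M M0 hM] := rep_bd hU (a := a) I; have [N N0 hN] := rep_bd hW (a := d) I.
  exists (M * N) => f; apply: le_trans (hM _) _; rewrite -mulrA; exact: ler_wpM2l.
- split=> [l a b d x|l a d e x]; first by rewrite (rep_add hU).
  by rewrite (rep_add hW)// (rep_lin hU).
- by move=> a b d e x; rewrite (rep_mul hU)// (rep_mul hW)// !UW.
- by move=> a d x y; rewrite (rep_star hU)// (rep_star hW)// UW.
Qed.

Lemma min_le_max (x : seq (A * D)) : (min_norm x <= max_norm x)%E.
Proof.
apply: ge_ereal_sup => _ [H [K [u [w [z [hu hw z1 ->]]]]]].
have [U [W [hU hW UW h]]] := commuting_reps hu hw.
apply: ereal_sup_ubound; exists (HT H K), (fun a d f => U a (W d f)), (tvec z).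
split; [exact: tensor_of_commuting|by rewrite -tvnormE|].
by rewrite -h tvnormE.
Qed.

Lemma nuclear_le : (forall (x : seq (A * D)) (M : R), 0 <= M -> minle x M -> maxle x M) ->
  forall x : seq (A * D), max_norm x = min_norm x.
Proof.
move=> h x; apply/eqP; rewrite eq_le min_le_max andbT.
have := min_norm_ge0 x; case E : (min_norm x) => [M| |] //; last by move=> _; exact: leey.
rewrite lee_fin => M0; apply/maxleP => //; apply: h => //; apply/minleP => //.
by rewrite E.
Qed.

End MaxNorm.

Lemma pt_rel (R : realType) (X : Type) (k : psdker R X) (c : R[i]) x1 x2 x3 :
  (forall z, k x1 z = c * k x2 z + k x3 z) -> pt k x1 = c *: pt k x2 + pt k x3.
Proof.
by move=> h; apply: ip_span_ext => z; rewrite ipDl ipZl !ip_pt.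
Qed.

Section Essential.
Variables (R : realType) (C D : cstarAlg R) (H : hilbert R) (v : C -> D -> H -> H).
Hypothesis hv : tensor_rep v.

Lemma tr_lin1 l a b d x : v (l *: a + b) d x = l *: v a d x + v b d x.
Proof. by have [_ [h _] _ _] := hv; exact: h. Qed.

Lemma tr_lin2 l a d e x : v a (l *: d + e) x = l *: v a d x + v a e x.
Proof. by have [_ [_ h] _ _] := hv; exact: h. Qed.

Lemma tr_mul a b d e x : v (cs_mul a b) (cs_mul d e) x = v a d (v b e x).
Proof. by have [_ _ h _] := hv; exact: h. Qed.

Lemma tr_star a d x y : ip (v a d x) y = ip x (v (cs_star a) (cs_star d) y).
Proof. by have [_ _ _ h] := hv; exact: h. Qed.

Definition ess (x : C * D * H) : H := v x.1.1 x.1.2 x.2.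

Lemma ess_psd (s : seq (R[i] * (C * D * H))) :
  0 <= \sum_(a <- s) \sum_(b <- s) a.1 * cj b.1 * ip (ess a.2) (ess b.2).
Proof.
have := ip_ge0 (\sum_(a <- s) a.1 *: ess a.2); rewrite ip_suml; congr (_ <= _).
apply: eq_bigr => a _; rewrite ip_sumr; apply: eq_bigr => b _.
by rewrite ipZl ipZr mulrA.
Qed.

(** The label (c, d, h) stands for v c d h. Left multiplication on the labels separates the actions
    of C and D without approximate units. *)
Definition ek : psdker R (C * D * H) := @Psdker R _ (fun x y => ip (ess x) (ess y)) ess_psd.

(* compressing v to its essential space splits it into commuting representations of C and D *)
Lemma essential_reps : exists (E : hilbert R) (pC : C -> E -> E) (pD : D -> E -> E) (J : E -> H),
  [/\ star_rep (S := C) pC, star_rep (S := D) pD, (forall c d f, pC c (pD d f) = pD d (pC c f)),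
      linear J /\ (forall f, nrm (J f) <= nrm f) &
      (forall c d f, J (pC c (pD d f)) = v c d (J f)) /\
      forall (x : seq (C * D)) f, exists2 e, J e = \sum_(a <- x) v a.1 a.2 f &
        nrm e = nrm (\sum_(a <- x) v a.1 a.2 f)].
Proof.
have [pC [hC pC_pt]] : exists u : C -> kolm ek -> kolm ek, star_rep (S := C) u /\
    forall c x, u c (pt ek x) = pt ek (cs_mul c x.1.1, x.1.2, x.2).
  apply: cs_action_rep => [l a b x|a b x|a x y].
  - by apply: pt_rel => z; rewrite /= /ess /= csDl csZl tr_lin1 ip_linear.
  - by rewrite csA.
  - by rewrite /= /ess /= !tr_star -!tr_mul !cs_starM -!csA.
have [pD [hD pD_pt]] : exists u : D -> kolm ek -> kolm ek, star_rep (S := D) u /\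
    forall d x, u d (pt ek x) = pt ek (x.1.1, cs_mul d x.1.2, x.2).
  apply: cs_action_rep => [l a b x|a b x|a x y].
  - by apply: pt_rel => z; rewrite /= /ess /= csDl csZl tr_lin2 ip_linear.
  - by rewrite csA.
  - by rewrite /= /ess /= !tr_star -!tr_mul !cs_starM -!csA.
have Jb s : nrm (\sum_(a <- s) a.1 *: ess a.2) <= 1 * nrm (span ek s).
  rewrite mul1r -(ler_pXn2r (ltn0Sn 1)) ?nnegrE ?nrm_ge0// -lecR -!ip_nrm /span.
  rewrite !ip_suml le_eqVlt; apply/orP; left; apply/eqP; apply: eq_bigr => a _.
  by rewrite !ip_sumr; apply: eq_bigr => b _; rewrite !ipZl !ipZr ip_pt.
have [J [J_lin J_bd J_pt]] := lift_op ler01 Jb.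
have bdC c : exists2 M : R, 0 <= M & forall f, nrm (pC c f) <= M * nrm f by exact: (rep_bd hC).
have bdD d : exists2 M : R, 0 <= M & forall f, nrm (pD d f) <= M * nrm f by exact: (rep_bd hD).
have lC c : linear (pC c) by exact: (rep_lin hC).
have lD d : linear (pD d) by exact: (rep_lin hD).
exists (kolm ek), pC, pD, J; split=> //.
- move=> c d f; have [M M0 hM] := bdC c; have [N N0 hN] := bdD d.
  apply: (kolm_op_ext (M := M * N) (M' := N * M) (U := fun f => pC c (pD d f))
    (U' := fun f => pD d (pC c f))) f => [l x y|l x y|x|x|x].
  + by rewrite lD lC.
  + by rewrite lC lD.
  + by apply: le_trans (hM _) _; rewrite -mulrA; exact: ler_wpM2l.
  + by apply: le_trans (hN _) _; rewrite -mulrA; exact: ler_wpM2l.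
  + by rewrite pD_pt pC_pt pC_pt pD_pt.
- by split=> // f; rewrite -[leRHS]mul1r.
split.
- move=> c d f; have [M M0 hM] := bdC c; have [N N0 hN] := bdD d.
  have hb : bounded_op (v c d) by have [h _ _ _] := hv; exact: h.
  have [L L0 hL] := bounded_opM hb.
  apply: (kolm_op_ext (M := M * N) (M' := L) (U := fun f => J (pC c (pD d f)))
    (U' := fun f => v c d (J f))) f => [l x y|l x y|x|x|x].
  + by rewrite lD lC J_lin.
  + by rewrite J_lin (tensor_rep_lin c d hv).
  + by apply: le_trans (J_bd _) _; rewrite mul1r; apply: le_trans (hM _) _; rewrite -mulrA; exact: ler_wpM2l.
  + apply: le_trans (hL _) _; apply: ler_wpM2l => //.
    by rewrite -[leRHS]mul1r.
  + by rewrite pD_pt pC_pt !J_pt /ess /= tr_mul.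
(* The vector f may lie outside the essential space, but its image under the tensor is a sum of
   labels. *)
- move=> x f; exists (\sum_(a <- x) pt ek (a.1, a.2, f)).
    by rewrite (lin_sum J_lin); apply: eq_bigr => a _; rewrite J_pt.
  apply/eqP; rewrite -(eqrXn2 (n := 2)) ?nrm_ge0//; apply/eqP.
  have : ((nrm (\sum_(a <- x) pt ek (a.1, a.2, f)) ^+ 2)%:C : R[i]) = (nrm (\sum_(a <- x) v a.1 a.2 f) ^+ 2)%:C.
    rewrite -!ip_nrm !ip_suml; apply: eq_bigr => a _; rewrite !ip_sumr.
    by apply: eq_bigr => b _; rewrite ip_pt.
  by move=> [].
Qed.

End Essential.

Section Nuclear.
Variables (R : realType) (C : cstarAlg R) (S : AzC_data C).
Variables (A : cstarAlg R) (mu : forall m, az_amb S m -> A).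
Hypothesis adm : AzC_admissible S.
Hypothesis lim : is_limit mu.

Definition tent (t : I01 R) : R := 1 - `|2 * sval t - 1|.

Lemma tent_cut : cut (clip 1) tent.
Proof.
split.
- apply: (rcont_lip (K := 2)) => // s t; rewrite /tent.
  have -> : 1 - `|2 * sval t - 1| - (1 - `|2 * sval s - 1|) = `|2 * sval s - 1| - `|2 * sval t - 1| by ring.
  apply: le_trans (ler_dist_dist _ _) _.
  have -> : 2 * sval s - 1 - (2 * sval t - 1) = 2 * (sval s - sval t) by ring.
  by rewrite normrM distrC ger0_norm.
- move=> t; have := I01_ge0 t; have := I01_le1 t => t1 t0; rewrite /tent.
  move: (sval t) t0 t1 => x x0 x1; rewrite subr_ge0 gerBl normr_ge0 andbT.
  by rewrite ler_norml; apply/andP; split; lra.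
- by rewrite /tent clip_val ?lexx ?ler01// mulr1 -[2]/(1 + 1) addrK normr1 subrr.
Qed.

Lemma id_cut : cut (clip 0) (fun x : I01 R => sval x).
Proof.
split; [|by move=> t; rewrite I01_ge0 I01_le1|by rewrite clip_val ?lexx ?ler01].
by apply: (rcont_lip (K := 1)) => // s t; rewrite mul1r.
Qed.

Definition cemb (c : C) : A := @kappa R C S A mu 0 tent (fun x => sval x) c.

Lemma minle_cemb (D : cstarAlg R) (x : seq (C * D)) (M : R) : 0 <= M ->
  minle x M -> minle [seq (cemb a.1, a.2) | a <- x] M.
Proof.
move=> M0 h.
have -> : [seq (cemb a.1, a.2) | a <- x] =
    [seq (a.2, a.1) | a <- [seq (a.1, cemb a.2) | a <- [seq (a.2, a.1) | a <- x]]].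
  by rewrite -!map_comp; apply: eq_map => a.
apply: minle_swap => K H w u z hw hu.
have h' : minle [seq (a.1, id a.2) | a <- [seq (a.2, a.1) | a <- x]] M.
  by rewrite -map_comp; exact: minle_swap.
have := dilates_bd z (kappa_dilates lim 0 hu tent_cut id_cut) M0 h' hw.
by rewrite mul1r /tact -map_comp /tact !allpairs_mapl.
Qed.

Lemma nuclear_quotient : cs_nuclear A -> cs_nuclear C.
Proof.
move=> nucA D; apply: nuclear_le => x M M0 hx.
have hA : maxle [seq (cemb a.1, a.2) | a <- x] M.
  by apply/maxleP => //; rewrite nucA; apply/minleP => //; exact: minle_cemb.
move=> H v f hv.
have [E [pC [pD [J [hC hD CD [J_lin J_bd] [JE Jx]]]]]] := essential_reps hv.
have hB := Bev_rep (clip 1) hC.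
(* The point t = 1/2 is where [tent] equals 1, and x = 1 in [hB] is where the cone function equals
   1. *)
have [T _] := tower_ex adm 0 (clip (1 / 2)).
have [d [d_ka d_mu d_rel]] := alpha_cp adm lim T hB.
have [U [hU U_pt]] := dker_rep d.
have lD a : linear (pD a) by exact: (rep_lin hD).
have lC a : linear (pC a) by exact: (rep_lin hC).
have lB b : B b -> linear (Bev pC (clip 1) b) by move=> hb; exact: (rep_lin hB hb).
have ka_lin c y e e' e'' z : e = c *: e' + e'' ->
    ka d (y, e) z = c * ka d (y, e') z + ka d (y, e'') z.
  move=> ->; rewrite !d_ka /=; case: ifP => _; last by rewrite mulr0 addr0.
  by rewrite (lB _ (Bscal_B C 1)) ip_linear.
have om_linx c y e e' e'' z p : e = c *: e' + e'' ->
    om d p (y, e) z = c * om d p (y, e') z + om d p (y, e'') z.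
  by move=> ->; apply: d_rel => b hb; rewrite /avec /= (lB _ (hb _ _)) ip_linear.
have BD b a e : B b -> Bev pC (clip 1) b (pD a e) = pD a (Bev pC (clip 1) b e).
  by move=> hb; rewrite /Bev lD CD.
have ka_adj a y e z e' : ka d (y, pD a e) (z, e') = ka d (y, e) (z, pD (cs_star a) e').
  by rewrite !d_ka /=; case: ifP => // _; rewrite BD ?(rep_star hD)//; exact: Bscal_B.
have om_adj a y e z e' p : om d p (y, pD a e) (z, e') = om d p (y, e) (z, pD (cs_star a) e').
  have := @d_rel 0 (y, pD a e) (z, e') (y, e) (z, e') (y, e) (z, pD (cs_star a) e').
  rewrite /avec => /(_ _ p); rewrite mul0r add0r; apply=> b hb.
  by rewrite mul0r add0r /= BD// (rep_star hD).
(* D acts on the vectors that label the dilation. Its operators commute with the representation of B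
   through [pC], hence leave the coefficients invariant and commute with [U]. *)
have [W [hW W_pt]] : exists W : D -> kolm (dker d) -> kolm (dker d), star_rep (S := D) W /\
    forall a x, W a (pt (dker d) x) = pt (dker d) (x.1, (x.2.1, pD a x.2.2)).
  apply: cs_action_rep => [l a b [[k p] [y e]]|a b [[k p] [y e]]|a [[k p] [y e]] [[k' p'] [y' e']]].
  - apply: pt_rel => -[[k' p'] z]; rewrite !dkE /=.
    have he : pD (l *: a + b) e = l *: pD a e + pD b e by rewrite (rep_add hD).
    rewrite (ka_lin _ _ _ _ _ z he) !(om_linx _ _ _ _ _ z _ he); ring.
  - by rewrite /= (rep_mul hD).
  - by rewrite !dkE /= ka_adj !om_adj.
have bdU a : exists2 M : R, 0 <= M & forall f, nrm (U a f) <= M * nrm f by exact: (rep_bd hU).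
have bdW a : exists2 M : R, 0 <= M & forall f, nrm (W a f) <= M * nrm f by exact: (rep_bd hW).
have lU a : linear (U a) by exact: (rep_lin hU).
have lW a : linear (W a) by exact: (rep_lin hW).
have UW a b g : U a (W b g) = W b (U a g).
  have [N N0 hN] := bdU a; have [N' N'0 hN'] := bdW b.
  apply: (kolm_op_ext (M := N * N') (M' := N' * N) (U := fun f => U a (W b f))
    (U' := fun f => W b (U a f))) g => [l y z|l y z|y|y|[[k p] [y e]]].
  + by rewrite lW lU.
  + by rewrite lU lW.
  + by apply: le_trans (hN _) _; rewrite -mulrA; exact: ler_wpM2l.
  + by apply: le_trans (hN' _) _; rewrite -mulrA; exact: ler_wpM2l.
  + by rewrite W_pt U_pt U_pt W_pt.
pose j0 : az_idx S 0 := (Ordinal (psize_gt0 adm 0), Ordinal (qsize_gt0 adm 0)).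
have om_cemb c e e' : om d (cemb c) (j0, e) (j0, e') = ip (pC c e) e'.
  rewrite /cemb /kappa (d_mu 0%N (@kelt R C S 0 tent (fun x => sval x) c)); last first.
    exact: (kelt_A S 0 c tent_cut id_cut).
  rewrite tau0 /avec /kelt /elt /=.
  rewrite -[((tent (clip (1 / 2)))%:C *: dmx _ _) j0 j0]/((tent (clip (1 / 2)))%:C *: dmx (az_idx S 0) (cone _ c) j0 j0).
  have -> : tent (clip (1 / 2)) = 1.
    rewrite /tent clip_val; last by apply/andP; split; lra.
    by rewrite mulrCA divff// mulr1 subrr normr0 subr0.
  rewrite scale1r /dmx eqxx -[LHS]/(ip (0 *: e + pC ((sval (clip 1))%:C *: c) e) e').
  by rewrite scale0r add0r clip_val ?lexx ?ler01// scale1r.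
have nS e : nrm (dS d (j0, e)) = nrm e.
  have : ((nrm (dS d (j0, e)) ^+ 2)%:C : R[i]) = (nrm e ^+ 2)%:C.
    rewrite -!ip_nrm ip_dS d_ka eqxx /= /Bev /= scale1r.
    by rewrite (rep0 hC)// addr0.
  by move=> [] h; apply/eqP; rewrite -(eqrXn2 (n := 2)) ?nrm_ge0//; apply/eqP.
have Wd a y e : W a (dS d (y, e)) = dS d (y, pD a e) by rewrite W_pt.
(* Compressing the pair [U], [W] to the coordinate j0 returns the pair [pC], [pD], so the maximal
   norm of the embedded tensor bounds the original one on the essential space. *)
have YE e : nrm (\sum_(a <- x) pC a.1 (pD a.2 e)) <= M * nrm e.
  set Ye := \sum_(a <- x) _.
  apply: nrm_le_ip; first by rewrite mulr_ge0// nrm_ge0.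
  have -> : ip Ye Ye = ip (\sum_(a <- x) U (cemb a.1) (W a.2 (dS d (j0, e)))) (dS d (j0, Ye)).
    rewrite ip_suml {1}/Ye ip_suml; apply: eq_bigr => a _.
    by rewrite Wd (dS_om U_pt) om_cemb.
  apply: le_trans (cauchy_schwarz _ _) _; rewrite nS; apply: ler_wpM2r; first exact: nrm_ge0.
  have := hA _ _ (dS d (j0, e)) (tensor_of_commuting hU hW UW).
  by rewrite big_map nS.
have [e0 Je0 ne0] := Jx x f.
set Y := \sum_(a <- x) v a.1 a.2 f in Je0 ne0 *.
(* As f may lie outside the range of [J], the bound is transferred to the adjoint tensor: [Y] comes
   from e0 in the essential space, and <Y, Y> = <f, J Z>. *)
pose Z := \sum_(a <- x) pC (cs_star a.1) (pD (cs_star a.2) e0).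
have Zb : nrm Z <= M * nrm e0.
  apply: nrm_le_ip; first by rewrite mulr_ge0// nrm_ge0.
  have -> : ip Z Z = ip e0 (\sum_(a <- x) pC a.1 (pD a.2 Z)).
    rewrite {1}/Z ip_suml ip_sumr; apply: eq_bigr => a _.
    by rewrite (rep_star hC)// -[star _]/(cs_star _) csK (rep_star hD)// -[star _]/(cs_star _) csK CD.
  apply: le_trans (cauchy_schwarz _ _) _; rewrite [M * _]mulrC -mulrA.
  by apply: ler_wpM2l; [exact: nrm_ge0|exact: YE].
apply: nrm_le_ip; first by rewrite mulr_ge0// nrm_ge0.
have -> : ip Y Y = ip f (J Z).
  rewrite {1}/Y ip_suml /Z (lin_sum J_lin) ip_sumr; apply: eq_bigr => a _.
  by rewrite (tr_star hv) JE Je0.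
apply: le_trans (cauchy_schwarz _ _) _; rewrite [M * _]mulrC -mulrA.
apply: ler_wpM2l; first exact: nrm_ge0.
by apply: le_trans (J_bd _) _; rewrite -ne0.
Qed.

End Nuclear.

(** * A criterion for exactness *)

Lemma sum_cat (V : nmodType) (I : Type) (x y : seq I) (F : I -> V) :
  \sum_(a <- x ++ y) F a = \sum_(a <- x) F a + \sum_(a <- y) F a.
Proof. exact: big_cat. Qed.

Section TensorLists.
Variables (R : realType) (D A : cstarAlg R).
Implicit Types (x y z : seq (D * A)).

Lemma val_tsub (H : hilbert R) (U : D -> H -> H) (W : A -> H -> H) f x y : star_rep (S := D) U ->
  \sum_(a <- tsub x y) U a.1 (W a.2 f) = \sum_(a <- x) U a.1 (W a.2 f) - \sum_(a <- y) U a.1 (W a.2 f).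
Proof.
move=> hU; rewrite /tsub big_cat big_map -sumrN; congr (_ + _); apply: eq_bigr => a _ /=.
by rewrite -scaleN1r (repZ hU)// scaleN1r.
Qed.

Lemma tact_nil (H K : hilbert R) (u : D -> H -> H) (w : A -> K -> K) zz : tvec (tact u w [::] zz) = 0.
Proof. by rewrite tvec_tact big_nil. Qed.

Lemma minle_opp x M : minle x M -> minle [seq (- a.1, a.2) | a <- x] M.
Proof.
move=> h H K u w zz hu hw; have [U [W [hU hW _ UW]]] := commuting_reps hu hw.
rewrite tvnormE UW big_map; have := h H K u w zz hu hw; rewrite tvnormE UW.
have -> // : \sum_(a <- x) U (- a.1, a.2).1 (W (- a.1, a.2).2 (tvec zz)) = - \sum_(a <- x) U a.1 (W a.2 (tvec zz)).
rewrite -sumrN; apply: eq_bigr => a _ /=.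
by rewrite -scaleN1r (repZ hU)// scaleN1r.
by rewrite nrmN.
Qed.

Lemma minle_sym x y M : minle (tsub x y) M -> minle (tsub y x) M.
Proof.
move=> /minle_opp; apply: minle_equiv => H U W f hU hW.
have := val_tsub W f x y hU; have := val_tsub W f y x hU => -> e.
rewrite -[RHS]opprB -e -sumrN big_map; apply: eq_bigr => a _ /=.
by rewrite -scaleN1r (repZ hU)// scaleN1r.
Qed.

Lemma minle_tri y x z M N : minle (tsub x y) M -> minle (tsub y z) N -> minle (tsub x z) (M + N).
Proof.
move=> h1 h2; apply: minle_equiv (minle_cat h1 h2) => H U W f hU hW.
by rewrite sum_cat !(val_tsub W f _ _ hU) addrA subrK.
Qed.

Lemma minle_tsub_cat x y x' y' M N : minle (tsub x x') M -> minle (tsub y y') N ->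
  minle (tsub (x ++ y) (x' ++ y')) (M + N).
Proof.
move=> h1 h2; apply: minle_equiv (minle_cat h1 h2) => H U W f hU hW.
by rewrite sum_cat !(val_tsub W f _ _ hU) !sum_cat opprD addrACA.
Qed.

Lemma minle_nil M : 0 <= M -> minle ([::] : seq (D * A)) M.
Proof. by move=> M0 H K u w z _ _; rewrite tvnormE tact_nil nrm0 mulr_ge0// tvnorm_ge0. Qed.

Lemma minle_lt x M e : M < e -> 0 <= M -> minle x M -> (min_norm x < e%:E)%E.
Proof. by move=> h M0 /minleP-/(_ M0) hx; apply: le_lt_trans hx _; rewrite lte_fin. Qed.

Lemma lt_minle x e : 0 < e -> (min_norm x < e%:E)%E -> minle x e.
Proof. by move=> e0 h; apply/minleP; exact: ltW. Qed.

Lemma min_cvg0 (f : nat -> seq (D * A)) :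
  (fun n => min_norm (f n)) @ \oo --> 0%E <->
  forall e : R, 0 < e -> exists N, forall n, (N <= n)%N -> minle (f n) e.
Proof.
split=> [h e e0|h].
  have [h1 h2] := (fine_cvgP _ _).1 h.
  have [N1 _ hN1] := h1; have /cvgrPdist_lt/(_ e e0)[N2 _ hN2] := h2.
  exists (maxn N1 N2) => n; rewrite geq_max => /andP[n1 n2].
  have f1 := hN1 n n1; have f2 := hN2 n n2.
  apply/minleP; first exact: ltW.
  rewrite -(fineK f1) lee_fin; rewrite /= sub0r normrN in f2.
  by apply: le_trans (ler_norm _) (ltW f2).
apply/fine_cvgP; split.
  have [N hN] := h 1 ltr01; exists N => // n /hN/minleP-/(_ ler01) hn.
  by apply/fin_numPlt; apply/andP; split; [apply: lt_le_trans (min_norm_ge0 _)|apply: le_lt_trans hn _]; rewrite ?ltNy0 ?ltey.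
apply/cvgrPdist_le => e e0; have [N hN] := h e e0; exists N => // n /hN/minleP-/(_ (ltW e0)) hn.
rewrite /= sub0r normrN ger0_norm ?fine_ge0 ?min_norm_ge0//.
rewrite -lee_fin fineK//; apply/fin_numPlt; apply/andP; split.
  by apply: lt_le_trans (min_norm_ge0 _).
by apply: le_lt_trans hn _; rewrite ltey.
Qed.

End TensorLists.

Lemma minle_q (R : realType) (D E A : cstarAlg R) (q : D -> E) (x : seq (D * A)) M :
  star_hom (S := D) (T := E) q -> minle x M -> minle [seq (q a.1, a.2) | a <- x] M.
Proof.
move=> [q1 q2 q3] h H K u w z hu hw.
have hv : star_rep (S := D) (fun a => u (q a)).
  split.
  - by move=> a _; split; [exact: (rep_lin hu)|have [N _ hN] := rep_bd hu (a := q a) I; exists N].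
  - by move=> l a b f _ _; rewrite q1// (rep_add hu).
  - by move=> a b f _ _; rewrite q2// (rep_mul hu).
  - by move=> a f g _; rewrite q3// (rep_star hu).
have := h H K _ w z hv hw; rewrite !tvnormE !tvec_tact big_map.
by [].
Qed.

Lemma mul_div1_le (R : realType) (k d : R) : 0 <= k -> 0 <= d -> k * (d / (k + 1)) <= d.
Proof.
move=> k0 d0; have k1 : 0 < k + 1 by rewrite ltr_wpDl.
by rewrite mulrCA ler_piMr// ler_pdivrMr// mul1r lerDl.
Qed.

(** Complete boundedness of p x |-> f x, expressed by minimal tensor norms. [f] is defined on
    representatives and need not be constant on the fibres of [p]. *)
Definition tbounded (R : realType) (A A' : cstarAlg R) (X : Type) (p : X -> A) (f : X -> A') (K : R) : Prop :=
  forall (D : cstarAlg R) (x : seq (D * X)) (M : R), 0 <= M ->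
    minle [seq (a.1, p a.2) | a <- x] M -> minle [seq (a.1, f a.2) | a <- x] (K * M).

Section ExactCriterion.
Variables (R : realType) (A C : cstarAlg R) (K : R).
Hypothesis K0 : 0 <= K.

Definition amap (D : cstarAlg R) (Y Z : Type) (f : Y -> Z) (x : seq (D * Y)) : seq (D * Z) :=
  [seq (a.1, f a.2) | a <- x].

Definition lsub (D : cstarAlg R) (Y : Type) (x y : seq (D * Y)) : seq (D * Y) :=
  x ++ [seq (- a.1, a.2) | a <- y].

Lemma amap_lsub (D B : cstarAlg R) (Y : Type) (f : Y -> B) (x y : seq (D * Y)) :
  amap f (lsub x y) = tsub (amap f x) (amap f y).
Proof. by rewrite /amap /lsub /tsub map_cat -!map_comp. Qed.

Hypothesis approx : forall (F : seq A) (e : R), 0 < e ->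
  exists (X : Type) (p : X -> A) (I : Type) (r : seq I) (al : I -> X -> C) (be : I -> C -> A),
  [/\ forall a (e : R), 0 < e -> exists x, nrm (a - p x) < e,
      forall i, exists2 k : R, 0 <= k & tbounded p (al i) k,
      forall i, exists2 k : R, 0 <= k & tbounded id (be i) k,
      tbounded p (fun x => \sum_(i <- r) be i (al i x)) K &
      forall a, a \in F -> exists2 x, nrm (a - p x) < e &
         repn (\sum_(i <- r) be i (al i x) - p x) e].

Lemma rep_small (D : cstarAlg R) (d : D) (a : A) (e : R) : 0 <= e -> repn a e ->
  minle [:: (d, a)] (2 * nrm d * e).
Proof.
move=> e0 h H H' u w z hu hw; have [U [W [hU hW UW UE]]] := commuting_reps hu hw.
rewrite !tvnormE UE big_seq1 /=; apply: le_trans (rep_cs_bd hU _ _) _.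
by rewrite -!mulrA; do 2! (apply: ler_wpM2l; rewrite ?nrm_ge0//); exact: h.
Qed.

Lemma lift_list (X : Type) (p : X -> A) (D : cstarAlg R) (z : seq (D * A)) (e : R) :
  (forall a (e : R), 0 < e -> exists x, nrm (a - p x) < e) -> 0 < e ->
  exists z' : seq (D * X), minle (tsub z (amap p z')) e.
Proof.
move=> pd; elim: z e => [|[d a] z IH] e e0.
  by exists [::]; apply: minle_nil; exact: ltW.
have e20 : 0 < e / 2 by rewrite divr_gt0.
have [z' hz'] := IH _ e20.
have d1 : 0 < 4 * (nrm d + 1) by rewrite mulr_gt0// ltr_wpDl ?nrm_ge0.
have c0 : 0 < e / 2 / (4 * (nrm d + 1)) by rewrite divr_gt0.
have [x hx] := pd a _ c0; exists ((d, x) :: z').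
rewrite (splitr e); apply: (minle_tsub_cat (x := [:: (d, a)]) (x' := [:: (d, p x)]) _ hz').
have : minle [:: (d, a - p x)] (e / 2).
  apply: minle_ge (minle_el _ _) _; move: hx; rewrite ltr_pdivlMr// => hx.
  apply: le_trans (ltW hx); rewrite mulrC; apply: ler_wpM2l; first exact: nrm_ge0.
  by rewrite ler_wpM2l// lerDl.
apply: minle_equiv => H U W f hU hW; rewrite (val_tsub W f _ _ hU) !big_seq1 /=.
by rewrite (repB hW)// (linB (rep_lin hU (I : setT d))).
Qed.

Lemma amap_equiv (X L : Type) (r : seq L) (g : L -> X -> A) (D : cstarAlg R) (z : seq (D * X))
  (H : hilbert R) (U : D -> H -> H) (W : A -> H -> H) (f : H) :
  star_rep (S := D) U -> star_rep (S := A) W ->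
  \sum_(a <- amap (fun x => \sum_(i <- r) g i x) z) U a.1 (W a.2 f) =
  \sum_(a <- flatten [seq amap (g i) z | i <- r]) U a.1 (W a.2 f).
Proof.
move=> hU hW; rewrite big_flatten big_map.
transitivity (\sum_(i <- r) \sum_(a <- z) U a.1 (W (g i a.2) f)); last first.
  by apply: eq_bigr => i _; rewrite big_map.
rewrite exchange_big big_map; apply: eq_bigr => a _ /=.
by rewrite (rep_sum hW)// (lin_sum (rep_lin hU (I : setT a.1))).
Qed.

Definition qnull (D E : cstarAlg R) (q : D -> E) (y : seq (D * A)) : Prop :=
  {in y, forall a, q a.1 = 0}.

Section Sequence.
Variables (D E : cstarAlg R) (q : D -> E).
Hypothesis exC : cs_exact C.
Hypothesis hq : star_hom (S := D) (T := E) q.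
Hypothesis q_surj : forall e, exists d, q d = e.
Variable x : nat -> seq (D * A).
Hypothesis x_cauchy : forall e : R, 0 < e -> exists N : nat, forall m n : nat,
  (N <= m)%N -> (N <= n)%N -> minle (tsub (x m) (x n)) e.
Hypothesis x_null : forall e : R, 0 < e -> exists N : nat, forall n : nat,
  (N <= n)%N -> minle [seq (q a.1, a.2) | a <- x n] e.

Lemma qneg d : q (- d) = - q d.
Proof. by have [h _ _] := hq; have := h (-1) d 0 I I; rewrite addr0 !scaleN1r => ->; have := h (-1) 0 0 I I; rewrite scaleN1r oppr0 addr0 scaleN1r addNr => ->; rewrite addr0. Qed.

Section Pieces.
Variables (X : Type) (p : X -> A) (x' : nat -> seq (D * X)).
Hypothesis x'_x : forall n, minle (tsub (x n) (amap p (x' n))) n.+1%:R^-1.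

Lemma x'_cauchy (e : R) : 0 < e -> exists N : nat, forall m n : nat,
  (N <= m)%N -> (N <= n)%N -> minle (amap p (lsub (x' m) (x' n))) e.
Proof.
move=> e0; have e30 : 0 < e / 3 by rewrite divr_gt0.
have [N1 h1] := x_cauchy e30; have [N2 h2] := inv_small e30.
exists (maxn N1 N2) => m n; rewrite !geq_max => /andP[m1 m2] /andP[n1 n2].
have -> : e = e / 3 + e / 3 + e / 3 by field.
rewrite amap_lsub; apply: minle_tri (_ : minle (tsub _ (x n)) _) _; last first.
  by apply: minle_ge (x'_x n) (ltW (h2 _ n2)).
apply: minle_tri (h1 _ _ m1 n1); apply: minle_sym.
by apply: minle_ge (x'_x m) (ltW (h2 _ m2)).
Qed.

Lemma x'_null (e : R) : 0 < e -> exists N : nat, forall n : nat,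
  (N <= n)%N -> minle (amap p [seq (q a.1, a.2) | a <- x' n]) e.
Proof.
move=> e0; have e20 : 0 < e / 2 by rewrite divr_gt0.
have [N1 h1] := x_null e20; have [N2 h2] := inv_small e20.
exists (maxn N1 N2) => n; rewrite !geq_max => /andP[n1 n2].
have := minle_q hq (minle_sym (minle_ge (x'_x n) (ltW (h2 _ n2)))) => h3.
have := minle_cat h3 (h1 _ n1); rewrite -splitr; apply: minle_equiv => H U W f hU hW.
rewrite sum_cat /tsub map_cat sum_cat -!map_comp !big_map /=.
rewrite [X in _ + X + _](_ : _ = - \sum_(a <- x n) U (q a.1) (W a.2 f)) ?subrK//.
rewrite -sumrN; apply: eq_bigr => a _ /=.
by rewrite qneg -scaleN1r (repZ hU)// scaleN1r.
Qed.

(** A bounded map into C keeps the sequence Cauchy and null modulo q, so exactness of C yields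
    approximants in the kernel of q; the map [be] acts on the other tensor factor and preserves this
    kernel. *)
Lemma piece_null (al : X -> C) (be : C -> A) (k k' e : R) : 0 <= k -> 0 <= k' -> 0 < e ->
  tbounded p al k -> tbounded id be k' -> exists N, forall n, (N <= n)%N ->
    exists2 y : seq (D * A), qnull q y & minle (tsub (amap (fun z => be (al z)) (x' n)) y) e.
Proof.
move=> k0 k'0 e0 hal hbe.
have k1 : 0 < k + 1 by rewrite ltr_wpDl.
have k'1 : 0 < k' + 1 by rewrite ltr_wpDl.
have [y [yq yc]] : exists y : nat -> seq (D * C), (forall n, {in y n, forall a, q a.1 = 0}) /\
    (fun n => min_norm (tsub (amap al (x' n)) (y n))) @ \oo --> 0%E.
  apply: (exC hq q_surj).
    move=> d d0; have dk : 0 < d / 2 / (k + 1) by rewrite !divr_gt0.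
    have [N hN] := x'_cauchy dk; exists N => m n mN nN.
    rewrite -amap_lsub; apply: (@minle_lt _ _ _ _ (d / 2)).
    - by rewrite ltr_pdivrMr// ltr_pMr// ltr1n.
    - by rewrite divr_ge0// ltW.
    - apply: minle_ge (hal _ _ _ (ltW dk) (hN m n mN nN)) _.
      by apply: mul_div1_le; rewrite ?divr_ge0// ltW.
  apply/min_cvg0 => d d0; have dk : 0 < d / (k + 1) by rewrite divr_gt0.
  have [N hN] := x'_null dk; exists N => n nN.
  have := hal _ _ _ (ltW dk) (hN n nN).
  have -> : [seq (q a.1, a.2) | a <- amap al (x' n)] = [seq (a.1, al a.2) | a <- [seq (q a.1, a.2) | a <- x' n]].
    by rewrite /amap -!map_comp.
  move=> h; apply: minle_ge h _.
  by apply: mul_div1_le => //; exact: ltW.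
have /min_cvg0 yc' := yc.
have ek : 0 < e / (k' + 1) by rewrite divr_gt0.
have [N hN] := yc' _ ek; exists N => n nN; exists (amap be (y n)).
  by move=> _ /mapP[a ay ->]; exact: (yq n).
have h : minle [seq (a.1, id a.2) | a <- lsub (amap al (x' n)) (y n)] (e / (k' + 1)).
  have -> : [seq (a.1, id a.2) | a <- lsub (amap al (x' n)) (y n)] = tsub (amap al (x' n)) (y n).
    by rewrite -[RHS]map_id; apply: eq_map => -[].
  exact: hN.
have := hbe _ _ _ (ltW ek) h.
rewrite -/(amap be (lsub _ _)) amap_lsub.
have -> : amap be (amap al (x' n)) = amap (fun z => be (al z)) (x' n) by rewrite /amap -map_comp.
move=> h'; apply: minle_ge h' _.
by apply: mul_div1_le => //; exact: ltW.
Qed.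

Lemma pieces_null (I : Type) (r : seq I) (al : I -> X -> C) (be : I -> C -> A) (e : R) : 0 < e ->
  (forall i, exists2 k : R, 0 <= k & tbounded p (al i) k) ->
  (forall i, exists2 k : R, 0 <= k & tbounded id (be i) k) ->
  exists N, forall n, (N <= n)%N -> exists2 y : seq (D * A), qnull q y &
    minle (tsub (flatten [seq amap (fun z => be i (al i z)) (x' n) | i <- r]) y) e.
Proof.
move=> e0 hal hbe; elim: r e e0 => [|i r IH] e e0.
  by exists 0%N => n _; exists [::] => //; apply: minle_nil; exact: ltW.
have e20 : 0 < e / 2 by rewrite divr_gt0.
have [N1 h1] := IH _ e20.
have [k k0 hk] := hal i; have [k' k'0 hk'] := hbe i.
have [N2 h2] := piece_null k0 k'0 e20 hk hk'.
exists (maxn N1 N2) => n; rewrite !geq_max => /andP[/h1[y yq hy] /h2[y' y'q hy']].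
exists (y' ++ y); last by rewrite (splitr e) /=; exact: minle_tsub_cat.
by move=> a; rewrite mem_cat => /orP[/y'q|/yq].
Qed.

End Pieces.

(** The composite T is close to p on the finitely many elements of x N0. All later terms lie near x
    N0, and the uniform bound K carries the closeness over to them. The bounds of the single factors
    enter only [pieces_null], after these have been chosen, and so may depend on e. *)
Lemma approx_null (e : R) : 0 < e -> exists N, forall n, (N <= n)%N ->
  exists2 y : seq (D * A), qnull q y & minle (tsub (x n) y) e.
Proof.
(* The chain of approximations costs 1 + 3 + 1 + 3 K + 1 times [dl]; one more [dl] is slack. *)
move=> e0; pose dl := e / (7 + 3 * K).
have c0 : 0 < 7 + 3 * K by rewrite ltr_wpDr// mulr_ge0.
have d0 : 0 < dl by rewrite divr_gt0.
have [N0 hN0] := x_cauchy d0.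
pose tot := \sum_(a <- x N0) 4 * (nrm a.1 + 1).
have tot0 : 0 <= tot by apply: sumr_ge0 => a _; rewrite mulr_ge0// addr_ge0 ?nrm_ge0.
have t1 : 0 < tot + 1 by rewrite ltr_wpDl.
have ep0 : 0 < dl / (tot + 1) by rewrite divr_gt0.
set ep := dl / (tot + 1) in ep0.
have tep : tot * ep <= dl.
  by apply: mul_div1_le => //; exact: ltW.
have [X [p [L [r [al [be [pd hal hbe hT hF]]]]]]] := approx [seq a.2 | a <- x N0] ep0.
pose T z := \sum_(i <- r) be i (al i z).
have [x' hx'] := choice (fun n => lift_list (x n) pd (invr_gt0_nat R n)).
have [z0 [hz0 hTz0]] : exists z0 : seq (D * X), minle (tsub (x N0) (amap p z0)) dl /\
    minle (tsub (amap T z0) (amap p z0)) dl.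
  have key : forall l : seq (D * A), {subset l <= x N0} -> exists z0 : seq (D * X),
     minle (tsub l (amap p z0)) (\sum_(a <- l) 4 * (nrm a.1 + 1) * ep) /\
     minle (tsub (amap T z0) (amap p z0)) (\sum_(a <- l) 4 * (nrm a.1 + 1) * ep).
    elim=> [|[d a] l IH] hl.
      by exists [::]; rewrite big_nil; split; exact: minle_nil.
    have [|z [hz hz']] := IH; first by move=> b bl; apply: hl; rewrite in_cons bl orbT.
    have [|xi h1 h2] := hF a.
      by apply/mapP; exists (d, a) => //; apply: hl; rewrite mem_head.
    exists ((d, xi) :: z); rewrite big_cons /=; split.
      apply: (minle_tsub_cat (x := [:: (d, a)]) (x' := [:: (d, p xi)]) _ hz).
      have : minle [:: (d, a - p xi)] (4 * (nrm d + 1) * ep).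
        apply: minle_ge (minle_el _ _) _.
        by apply: ler_pM; rewrite ?mulr_ge0 ?nrm_ge0// ?(ltW h1)// ler_wpM2l// lerDl.
      apply: minle_equiv => H U W f hU hW; rewrite (val_tsub W f _ _ hU) !big_seq1 /=.
      by rewrite (repB hW)// (linB (rep_lin hU (I : setT d))).
    apply: (minle_tsub_cat (x := [:: (d, T xi)]) (x' := [:: (d, p xi)]) _ hz').
    have : minle [:: (d, T xi - p xi)] (4 * (nrm d + 1) * ep).
      apply: minle_ge (rep_small d (ltW ep0) h2) _.
      by rewrite ler_wpM2r ?(ltW ep0)//; have := nrm_ge0 d; lra.
    apply: minle_equiv => H U W f hU hW; rewrite (val_tsub W f _ _ hU) !big_seq1 /=.
    by rewrite (repB hW)// (linB (rep_lin hU (I : setT d))).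
  have [z0 [h1 h2]] := key (x N0) (fun a h => h).
  by exists z0; split; [apply: minle_ge h1 _|apply: minle_ge h2 _]; rewrite -mulr_suml.
have [N1 hN1] := pieces_null hx' r d0 hal hbe.
have [N2 hN2] := inv_small d0.
exists (maxn N0 (maxn N1 N2)) => n; rewrite !geq_max => /and3P[n0 /hN1[y yq hy] n2].
exists y => //.
have s1 : minle (tsub (x n) (amap p (x' n))) dl by apply: minle_ge (hx' n) (ltW (hN2 _ n2)).
have s2 : minle (tsub (amap p (x' n)) (amap p z0)) (dl + dl + dl).
  by apply: minle_tri hz0; apply: minle_tri (minle_sym s1) (hN0 _ _ n0 (leqnn _)).
have s3 : minle (tsub (amap T z0) (amap T (x' n))) (K * (dl + dl + dl)).
  rewrite -amap_lsub; apply: hT; first by rewrite !addr_ge0 ?(ltW d0).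
  by rewrite -/(amap p (lsub _ _)) amap_lsub; exact: minle_sym.
have s4 : minle (tsub (amap T (x' n)) y) dl.
  apply: minle_equiv hy => H U W f hU hW; rewrite !(val_tsub W f _ _ hU); congr (_ - _).
  by have := amap_equiv r (fun i z => be i (al i z)) (x' n) f hU hW => ->.
have := minle_tri s1 (minle_tri s2 (minle_tri (minle_sym hTz0) (minle_tri s3 s4))).
move=> h; apply: minle_ge h _.
have -> : e = (7 + 3 * K) * dl by rewrite /dl mulrC divfK ?gt_eqF.
rewrite le_eqVlt; apply/orP; right.
have -> : (7 + 3 * K) * dl = dl + (dl + dl + dl + (dl + (K * (dl + dl + dl) + dl))) + dl by ring.
by rewrite ltrDl.
Qed.

End Sequence.

Lemma exact_criterion : cs_exact C -> cs_exact A.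
Proof.
move=> exC D E q hq q_surj x xc xn.
have xc' (e : R) : 0 < e -> exists N : nat, forall m n : nat,
    (N <= m)%N -> (N <= n)%N -> minle (tsub (x m) (x n)) e.
  move=> e0; have [N hN] := xc e e0; exists N => m n mN nN.
  by apply: lt_minle => //; exact: hN.
have xn' := (min_cvg0 _).1 xn.
have key := approx_null exC hq q_surj xc' xn'.
(* Diagonal choice: y n realises every tolerance 1/(k+1) with k <= n that is attainable for x n, and
   is empty if none is. *)
pose P n k := exists2 y : seq (D * A), qnull q y & minle (tsub (x n) y) k.+1%:R^-1.
have hy n j : exists y : seq (D * A), qnull q y /\
    forall k, (k <= j)%N -> P n k -> minle (tsub (x n) y) k.+1%:R^-1.
  elim: j => [|j [y [yq IH]]].
    case: (pselect (P n 0%N)) => [[y yq h]|h].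
      by exists y; split=> // k; rewrite leqn0 => /eqP ->.
    by exists [::]; split=> // k; rewrite leqn0 => /eqP ->.
  case: (pselect (P n j.+1)) => [[z zq h]|h].
    exists z; split=> // k kj _; apply: minle_ge h _.
    by rewrite lef_pV2 ?posrE ?ltr0n// ler_nat ltnS.
  exists y; split=> // k; rewrite leq_eqVlt => /orP[/eqP -> //|kj]; exact: IH.
have [y hy'] := choice (fun n => hy n n).
exists y; split; first by move=> n; have [h _] := hy' n.
apply/min_cvg0 => e e0; have [k hk] := inv_small e0.
have [N hN] := key _ (invr_gt0_nat R k).
exists (maxn N k) => n; rewrite geq_max => /andP[/hN[z zq hz] nk].
have [_ h] := hy' n; apply: minle_ge (h k nk _) (ltW (hk k (leqnn k))).
by exists z.
Qed.

End ExactCriterion.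

(** * Approximate factorization of A through C *)

Section Hats.
Variable R : realType.

Definition ramp (x : R) : R := Num.max 0 (Num.min x 1).

(* the piecewise linear partition of unity on the grid j/N *)
Definition hat (N j : nat) (t : I01 R) : R :=
  ramp (N%:R * sval t - j%:R + 1) - ramp (N%:R * sval t - j%:R).

Lemma ramp_mono x y : x <= y -> ramp x <= ramp y.
Proof.
rewrite /ramp => xy; rewrite ge_max !le_max lexx /=; apply/orP; right.
by rewrite le_min !ge_min xy lexx !orbT.
Qed.

Lemma ramp_le0 x : x <= 0 -> ramp x = 0.
Proof. by move=> h; apply/max_idPl; rewrite ge_min h. Qed.

Lemma ramp_ge1 x : 1 <= x -> ramp x = 1.
Proof. by move=> h; rewrite /ramp (min_idPr h); apply/max_idPr; exact: ler01. Qed.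

Lemma ramp_bd x : 0 <= ramp x <= 1.
Proof. exact: clip_subproof. Qed.

Lemma ramp_lip x y : `|ramp x - ramp y| <= `|x - y|.
Proof. exact: clip_lip. Qed.

Lemma hat_bd N j t : 0 <= hat N j t <= 1.
Proof.
rewrite /hat subr_ge0 ramp_mono ?lerDl//=.
have /andP[_ h1] := ramp_bd (N%:R * sval t - j%:R + 1).
have /andP[h2 _] := ramp_bd (N%:R * sval t - j%:R).
by rewrite lerBlDr (le_trans h1)// lerDl.
Qed.

Lemma hat_cont N j : rcont (hat N j).
Proof.
apply: (rcont_lip (K := N%:R + N%:R)) => [|s t]; first by rewrite addr_ge0.
rewrite /hat; set a := N%:R * sval t; set b := N%:R * sval s.
have -> : ramp (a - j%:R + 1) - ramp (a - j%:R) - (ramp (b - j%:R + 1) - ramp (b - j%:R)) =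
  (ramp (a - j%:R + 1) - ramp (b - j%:R + 1)) - (ramp (a - j%:R) - ramp (b - j%:R)) by ring.
apply: le_trans (ler_normB _ _) _; rewrite mulrDl.
have e : `|a - b| = N%:R * `|sval t - sval s| by rewrite -mulrBr normrM ger0_norm.
rewrite -e; apply: lerD; apply: le_trans (ramp_lip _ _) _.
  by have -> : a - j%:R + 1 - (b - j%:R + 1) = a - b by ring.
by have -> : a - j%:R - (b - j%:R) = a - b by ring.
Qed.

Lemma hat_sum N t : \sum_(j < N.+1) hat N j t = 1.
Proof.
have h n : \sum_(j < n.+1) hat N j t = ramp (N%:R * sval t + 1) - ramp (N%:R * sval t - n%:R).
  elim: n => [|n IH]; first by rewrite big_ord1 /hat subr0.
  rewrite big_ord_recr /= IH /hat -[n.+1%:R]natr1.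
  have -> : N%:R * sval t - (n%:R + 1) + 1 = N%:R * sval t - n%:R by ring.
  by ring.
rewrite h ramp_ge1 ?ramp_le0 ?subr0//.
  by rewrite subr_le0 ler_piMr// I01_le1.
by rewrite lerDr mulr_ge0// I01_ge0.
Qed.

Lemma hat_near N j t : (0 < N)%N -> (j <= N)%N -> hat N j t != 0 ->
  `|sval t - sval (clip (j%:R / N%:R : R))| <= N%:R^-1.
Proof.
move=> N0 jN; have n0 : 0 < N%:R :> R by rewrite ltr0n.
rewrite clip_val; last by rewrite divr_ge0//= ler_pdivrMr// mul1r ler_nat.
apply: contraR; rewrite -ltNge => h.
have h' : 1 < `|N%:R * sval t - j%:R|.
  have -> : N%:R * sval t - j%:R = N%:R * (sval t - j%:R / N%:R).
    by rewrite mulrBr mulrCA divff ?gt_eqF// mulr1.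
  by rewrite normrM ger0_norm// mulrC -ltr_pdivrMr// div1r.
move: h'; rewrite /hat; set x := N%:R * sval t - j%:R => h'.
have [x0|x0] := lerP 0 x.
  by rewrite (ger0_norm x0) in h'; rewrite !ramp_ge1 ?subrr//; lra.
by rewrite (ltr0_norm x0) in h'; rewrite !ramp_le0 ?subrr//; lra.
Qed.

Lemma hat_at0 N j : (0 < j)%N -> hat N j (clip 0) = 0.
Proof.
move=> j0; rewrite /hat clip_val ?lexx ?ler01// mulr0 sub0r.
have j1 : 1 <= j%:R :> R by rewrite ler1n.
by rewrite !ramp_le0 ?subrr//; lra.
Qed.

Lemma hat_at1 N j : (j < N)%N -> hat N j (clip 1) = 0.
Proof.
move=> jN; rewrite /hat clip_val ?lexx ?ler01// mulr1.
have j1 : j%:R + 1 <= N%:R :> R by rewrite natr1 ler_nat.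
by rewrite !ramp_ge1 ?subrr//; lra.
Qed.

End Hats.

(** * Spreading matrices over patches *)

Section Patches.
Variables (R : realType) (C : cstarAlg R) (J : finType) (base rr : J -> J).
Implicit Types (a : MB C J).

(* with [base, rr] jointly injective, J is a sum of pieces of copies of J *)
Definition chi (a : MB C J) : MB C J := fun x y => if base x == base y then a (rr x) (rr y) else 0.
(** A row spread over the patches. Products of such matrices with adjoints give [chi] of a rank one
    product, which makes the positivity of [chi] explicit. *)
Definition qrow (r : J -> Bamb C) : MB C J := fun z y => if z == base y then r (rr y) else 0.

Lemma chi_B a : inMB a -> inMB (chi a).
Proof. by move=> h x y; rewrite /chi; case: ifP => // _; exact: B0. Qed.

Lemma qrow_B (r : J -> Bamb C) : (forall y, B (r y)) -> inMB (qrow r).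
Proof. by move=> h x y; rewrite /qrow; case: ifP => // _; exact: B0. Qed.

Lemma qrow_mul (r r' : J -> Bamb C) : smul (star (qrow r')) (qrow r) = chi (outer r r').
Proof.
apply/funext => x; apply/funext => y.
rewrite -[LHS]/(\sum_k smul (star (qrow r' k x)) (qrow r k y)).
rewrite (bigD1 (base x))// big1 ?Monoid.mulm1 => [|k kx].
  by rewrite /qrow eqxx /chi /outer; case: ifP => // _; exact: Bsmul0r.
by rewrite {1}/qrow (negPf kx) Bstar0 Bsmul0l.
Qed.

Lemma chi_lin l a b : chi (l *: a + b) = l *: chi a + chi b.
Proof.
apply/funext => x; apply/funext => y; rewrite -[RHS]/(l *: chi a x y + chi b x y) /chi.
by case: ifP => _ //; rewrite scaler0 addr0.
Qed.

Lemma chi_sum I (r : seq I) (F : I -> MB C J) : chi (\sum_(i <- r) F i) = \sum_(i <- r) chi (F i).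
Proof.
elim: r => [|i r IH]; last by rewrite !big_cons -IH -[F i]scale1r chi_lin !scale1r.
by rewrite !big_nil; apply/funext => x; apply/funext => y; rewrite /chi; case: ifP.
Qed.

Definition smx (y y' : J) (b : Bamb C) : MB C J := fun i j => if (i == y) && (j == y') then b else 0.

Lemma smx_B y y' b : B b -> inMB (smx y y' b).
Proof. by move=> h i j; rewrite /smx; case: ifP => // _; exact: B0. Qed.

Lemma smx_sum a : a = \sum_y \sum_y' smx y y' (a y y').
Proof.
apply/funext => i; apply/funext => j.
transitivity (\sum_y \sum_y' smx y y' (a y y') i j); last first.
  rewrite fct_sumE fct_sumE; apply: eq_bigr => y _; by rewrite fct_sumE fct_sumE.
rewrite pair_bigA (bigD1 (i, j))// big1 ?Monoid.mulm1 => [|[y y'] ne].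
  by rewrite /smx !eqxx.
move: ne; rewrite xpair_eqE /smx [i == _]eq_sym [j == _]eq_sym => /negPf h.
by rewrite /= h.
Qed.

Lemma chi_smx_dmx y y' b : smul (chi (smx y y' (Bscal C 1))) (dmx J b) = chi (smx y y' b).
Proof.
apply/funext => i; apply/funext => j.
rewrite -[LHS]/(\sum_k smul (chi (smx y y' (Bscal C 1)) i k) (dmx J b k j)).
rewrite (bigD1 j)// big1 ?Monoid.mulm1 => [|k kx].
  rewrite /dmx eqxx /chi /smx; case: ifP => _; last by rewrite Bsmul0l.
  by case: ifP => _; rewrite ?Bmul1l ?Bsmul0l.
by rewrite /dmx (negPf kx) Bsmul0r.
Qed.

(** Joint injectivity is what makes [chi] unital, so that images of the unit add up to something
    computable. *)
Lemma chi_dmx b : (forall x y, base x = base y -> rr x = rr y -> x = y) -> chi (dmx J b) = dmx J b.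
Proof.
move=> inj; apply/funext => x; apply/funext => y; rewrite /chi /dmx.
case: (eqVneq x y) => [->|xy]; first by rewrite !eqxx.
case: (eqVneq (base x) (base y)) => // e1; case: (eqVneq (rr x) (rr y)) => // e2.
by rewrite (inj _ _ e1 e2) eqxx in xy.
Qed.

Lemma mxle_chi_entries a (M : R) : 0 <= M ->
  (forall i j (H : hilbert R) (v : Bamb C -> H -> H) f, star_rep_on (@B R C) v -> nrm (v (a i j) f) <= M * nrm f) ->
  mxle (chi a) (\sum_(i : J) \sum_(j : J) M).
Proof.
move=> M0 h; have -> : \sum_(i : J) \sum_(j : J) M = \sum_(i : J) \sum_(j : J) Num.max 0 M.
  by apply: eq_bigr => i _; apply: eq_bigr => j _; apply/esym/max_idPr.
apply: (mxle_entries (m := fun _ _ => M)) => i j H v f hv; rewrite /chi; case: ifP => _; first exact: h.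
by rewrite (rep0 hv) ?nrm0 ?mulr_ge0 ?nrm_ge0//; exact: B0.
Qed.

End Patches.

Section Pieces.
Variables (R : realType) (C : cstarAlg R) (S : AzC_data C).
Variables (A : cstarAlg R) (mu : forall m, az_amb S m -> A).
Hypothesis adm : AzC_admissible S.
Hypothesis lim : is_limit mu.
Variable m : nat.
Notation J := (az_idx S m).
Notation lmu := (@lmu R C S A mu m).

Section InRep.
Variables (H0 : hilbert R) (u : A -> H0 -> H0).
Hypothesis hu : star_rep (S := A) u.

(** [z] is the operator S* S of the dilation and [Th x] the compression of [lmu x]; the last clause
    makes S linear in its label. *)
Definition dil_data (z : A) (Th : lifts S m -> A) (d : cpdata A H0) : Prop :=
  [/\ forall f f', ka d f f' = ip (u z f) f',
      forall x f f', om d (lmu x) f f' = ip (u (Th x) f) f' &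
      forall p c f1 f2 f', om d p (c *: f1 + f2) f' = c * om d p f1 f' + om d p f2 f'].

(** The data are summed first and dilated once, so the bound is that of the sum of the [z i] and not
    the sum of their bounds. This makes the final estimate independent of the number of patches. *)
Lemma sum_dilates (I : Type) (r : seq I) (z : I -> A) (Th : I -> lifts S m -> A) (K : R) : 0 <= K ->
  (forall i, exists d, dil_data (z i) (Th i) d) ->
  (forall f, nrm (u (\sum_(i <- r) z i) f) <= K * nrm f) ->
  dilates lmu (fun x f => u (\sum_(i <- r) Th i x) f) K.
Proof.
move=> K0 /choice[d hd] hz; have [d' [ka' om']] := cp_sum r d.
have [U [hU U_pt]] := dker_rep d'.
have us (F : I -> A) f : u (\sum_(i <- r) F i) f = \sum_(i <- r) u (F i) f by exact: (rep_sum hu).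
have d_lin : linear (fun f => dS d' f).
  move=> c f f'; apply: dS_lin => [t|p t].
    rewrite !ka' mulr_sumr -big_split; apply: eq_bigr => i _; have [h _ _] := hd i.
    by rewrite !h (rep_lin hu)// ip_linear.
  rewrite !om' mulr_sumr -big_split; apply: eq_bigr => i _; have [_ _ h] := hd i.
  exact: h.
have d_bd f : nrm (dS d' f) <= Num.sqrt K * nrm f.
  rewrite -(ler_pXn2r (ltn0Sn 1)) ?nnegrE ?mulr_ge0 ?nrm_ge0 ?sqrtr_ge0// exprMn (sqr_sqrtr K0).
  have e : (nrm (dS d' f) ^+ 2)%:C = ip (u (\sum_(i <- r) z i) f) f.
    rewrite -ip_nrm ip_dS ka' us ip_suml; apply: eq_bigr => i _; have [h _ _] := hd i.
    exact: h.
  have := cauchy_schwarz (u (\sum_(i <- r) z i) f) f; rewrite -e cmodR ger0_norm ?sqr_ge0// => h.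
  by apply: le_trans h _; rewrite expr2 mulrA ler_wpM2r ?nrm_ge0.
exists (kolm (dker d')), U, (fun f => dS d' f), (fun f => dS d' f), (Num.sqrt K), (Num.sqrt K).
split=> //; first by split; rewrite ?sqrtr_ge0// -expr2 sqr_sqrtr.
move=> x f f'; rewrite (dS_om U_pt) om' us ip_suml; apply: eq_bigr => i _.
by have [_ h _] := hd i; rewrite h.
Qed.

Section Piece.
Variables (s : I01 R) (T : tower S m s) (base rr : J -> J) (h hs : I01 R -> R) (si r : Bamb C -> Bamb C) (Ks : R).
Hypothesis h_sq : (fun t => hs t * hs t) = h.
Hypothesis h_bd : forall t, 0 <= h t <= 1.
Hypothesis si_B : forall b, B b -> B (si b).
Hypothesis si_lin : forall c a b, B a -> B b -> si (c *: a + b) = c *: si a + si b.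
Hypothesis si_r : forall a b, B a -> B b -> si (smul (star a) b) = smul (star (r a)) (r b).
Hypothesis Ks0 : 0 <= Ks.
Hypothesis si_bd : forall b (M : R), B b -> 0 <= M ->
  (forall (H : hilbert R) (v : Bamb C -> H -> H) f, star_rep_on (@B R C) v -> nrm (v b f) <= M * nrm f) ->
  forall (H : hilbert R) (v : Bamb C -> H -> H) f, star_rep_on (@B R C) v -> nrm (v (si b) f) <= Ks * M * nrm f.

Definition sent (a : MB C J) : MB C J := fun x y => si (a x y).

Hypothesis elt_A : forall a, inMB a -> @az_A R C S m (elt h (chi base rr (sent a))).
Hypothesis row_A : forall rho : J -> Bamb C, (forall y, B (rho y)) ->
  @az_A R C S m (elt hs (qrow base rr (fun y => r (rho y)))).

Definition pmap (a : MB C J) : A := @mu m (elt h (chi base rr (sent a))).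

Lemma sent_B a : inMB a -> inMB (sent a). Proof. by move=> ha x y; exact: si_B. Qed.

Lemma pmap_lin c a b : inMB a -> inMB b -> pmap (c *: a + b) = c *: pmap a + pmap b.
Proof.
move=> ha hb; rewrite /pmap -(mu_lin lim); [|exact: elt_A..]; congr mu.
rewrite -elt_lin -chi_lin; congr (elt _ (chi _ _ _)).
by apply/funext => x; apply/funext => y; exact: si_lin.
Qed.

(** A crude entrywise bound: it is needed for the coefficients to extend to A at all and does not
    enter the constant of [sum_dilates]. *)
Lemma pmap_bd b (M : R) : inMB b -> 0 <= M -> mxle b M ->
  nrm (pmap b) <= (\sum_(i : J) \sum_(j : J) Ks) * M.
Proof.
move=> hb M0 hM.
have hc : mxle (chi base rr (sent b)) (\sum_(i : J) \sum_(j : J) Ks * M).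
  apply: mxle_chi_entries; first exact: mulr_ge0.
  move=> i j H v f hv; apply: (si_bd (hb _ _) M0) => // H' v' f' hv'; exact: (mxle_entry _ _ _ hb hv' hM).
have e : (\sum_(i : J) \sum_(j : J) Ks) * M = \sum_(i : J) \sum_(j : J) Ks * M.
  by rewrite mulr_suml; apply: eq_bigr => i _; rewrite mulr_suml.
have e0 : 0 <= (\sum_(i : J) \sum_(j : J) Ks) * M.
  by rewrite mulr_ge0//; apply: sumr_ge0 => i _; exact: sumr_ge0.
apply: (mu_le adm lim) => // [|t]; first exact: elt_A.
have zB : inMB (0 : MB C J) by move=> i j; exact: B0.
have /andP[h0 h1] := h_bd t.
have := mxle_lin (h t)%:C (chi_B base rr (sent_B hb)) zB hc (@mxle0 R C _).
rewrite !addr0 cmodR ger0_norm// => k; apply: mxle_ge k _.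
by rewrite -e ler_piMl.
Qed.

(** [si] has the form r(a)* r(b) on products and h is the square of [hs], so a rank one matrix goes
    to w_j* w_i for rows w in A; this gives the positivity. *)
Lemma piece_data : exists d, dil_data (pmap (@mx1 R C J)) (fun x => pmap (ltau T x)) d.
Proof.
pose K0 := \sum_(i : J) \sum_(j : J) Ks.
have K00 : 0 <= K0 by apply: sumr_ge0 => i _; exact: sumr_ge0.
pose l (f f' : H0) b : R[i] := ip (u (pmap b) f) f'.
pose K (f f' : H0) := 2 * K0 * nrm f * nrm f'.
have K0p f f' : 0 <= K f f' by rewrite !mulr_ge0 ?nrm_ge0.
have l_lin f f' c a b : inMB a -> inMB b -> l f f' (c *: a + b) = c * l f f' a + l f f' b.
  by move=> ha hb; rewrite /l pmap_lin// (rep_add hu)// ip_linear.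
have l_bd f f' b (M : R) : inMB b -> 0 <= M -> mxle b M -> cmod (l f f' b) <= K f f' * M.
  move=> hb M0 hM; apply: le_trans (cauchy_schwarz _ _) _.
  rewrite /K [leRHS]mulrAC ler_wpM2r ?nrm_ge0//.
  apply: le_trans (rep_cs_bd hu _ _) _; rewrite [leRHS]mulrAC ler_wpM2r ?nrm_ge0// -mulrA.
  by apply: ler_wpM2l => //; exact: pmap_bd.
have l_psd (I : Type) (q : seq I) (rho : I -> J -> Bamb C) (x : I -> H0) :
  (forall i y, B (rho i y)) ->
  0 <= \sum_(i <- q) \sum_(j <- q) l (x i) (x j) (outer (rho i) (rho j)).
  move=> hB; pose w i : A := @mu m (elt hs (qrow base rr (fun y => r (rho i y)))).
  have := ip_ge0 (\sum_(i <- q) u (w i) (x i)).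
  rewrite ip_suml; congr (_ <= _); apply: eq_bigr => i _.
  rewrite ip_sumr; apply: eq_bigr => j _; rewrite /l.
  have -> : pmap (outer (rho i) (rho j)) = cs_mul (cs_star (w j)) (w i).
    rewrite -(mu_star lim); last exact: row_A.
    rewrite -(mu_mul lim); [|apply: E_star; exact: row_A|exact: row_A].
    rewrite elt_star elt_mul h_sq qrow_mul; congr (mu (elt _ (chi _ _ _))).
    by apply/funext => y; apply/funext => y'; rewrite /sent /outer si_r.
  by rewrite (rep_mul hu)// [RHS](rep_star hu)// -[star _]/(cs_star _) csK.
have [d [h1 h2 h3]] := gen_cp adm lim T K0p l_lin l_bd l_psd.
exists d; split=> //.
  by move=> [n [g gA]] f f'; rewrite h3.
move=> p c f1 f2 f'; apply: (om_rel adm lim (T := T) (l := l) K0p h2 h3) => b hb.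
by rewrite /l (rep_lin hu)// ip_linear.
Qed.

End Piece.

End InRep.

End Pieces.

(** * Maps that factor through C *)

Section Factoring.
Variable R : realType.

Lemma dilates_conj (P : cstarAlg R) (G : Type) (m : G -> P) (H H' : hilbert R)
    (be : G -> H -> H) (be' : G -> H' -> H') (a1 a2 : H' -> H) (M N1 N2 : R) :
  dilates m be M -> linear a1 -> linear a2 -> 0 <= N1 -> 0 <= N2 ->
  (forall f, nrm (a1 f) <= N1 * nrm f) -> (forall f, nrm (a2 f) <= N2 * nrm f) ->
  (forall g f f', ip (be' g f) f' = ip (be g (a1 f)) (a2 f')) ->
  dilates m be' (N1 * N2 * M).
Proof.
move=> [HH [U [S1 [S2 [M1 [M2 [hU [l1 l2] [M10 M20 hM] [b1 b2] h]]]]]]] la1 la2 N10 N20 ha1 ha2 e.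
exists HH, U, (fun f => S1 (a1 f)), (fun f => S2 (a2 f)), (M1 * N1), (M2 * N2); split=> //.
- by split=> c f g; [rewrite la1 l1|rewrite la2 l2].
- split; [exact: mulr_ge0|exact: mulr_ge0|].
  by rewrite mulrACA mulrC; apply: ler_wpM2l => //; exact: mulr_ge0.
- by split=> f; [apply: le_trans (b1 _) _|apply: le_trans (b2 _) _]; rewrite -mulrA; exact: ler_wpM2l.
- by move=> g f f'; rewrite e h.
Qed.

Lemma tb_of_dilates (A A' : cstarAlg R) (X : Type) (p : X -> A) (f : X -> A') (K : R) :
  (forall (H : hilbert R) (u : A' -> H -> H), star_rep (S := A') u -> dilates p (fun x g => u (f x) g) K) ->
  tbounded p f K.
Proof.
move=> h D x M M0 hx H H' w u z hw hu.
have := dilates_bd z (h _ _ hu) M0 hx hw.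
by rewrite /tact allpairs_mapl.
Qed.

Lemma tbounded_add (A A' : cstarAlg R) (X : Type) (p : X -> A) (f g : X -> A') (K L : R) :
  tbounded p f K -> tbounded p g L -> tbounded p (fun x => f x + g x) (K + L).
Proof.
move=> hf hg D x M M0 hx; rewrite mulrDl.
apply: minle_equiv (minle_cat (hf _ _ _ M0 hx) (hg _ _ _ M0 hx)) => H U W v hU hW.
rewrite sum_cat !big_map -big_split; apply: eq_bigr => a _ /=.
by rewrite (repD hW)//; have [_ -> _] := linDZ (rep_lin hU (I : setT a.1)).
Qed.

Lemma tbounded_opp (A A' : cstarAlg R) (X : Type) (p : X -> A) (f : X -> A') (K : R) :
  tbounded p f K -> tbounded p (fun x => - f x) K.
Proof.
move=> hf D x M M0 hx; apply: minle_equiv (minle_opp (hf _ _ _ M0 hx)) => H U W v hU hW.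
rewrite !big_map; apply: eq_bigr => a _ /=.
rewrite -[- a.1]scaleN1r -[- f _]scaleN1r (repZ hU)// (repZ hW)//.
by have [_ _ ->] := linDZ (rep_lin hU (I : setT a.1)).
Qed.

Section Factorable.
Variables (A C : cstarAlg R) (X : Type) (p : X -> A).

(** The bounds k may depend on the index i and are not controlled; the bound of the sum is proved
    separately. *)
Definition factorable (Th : X -> A) : Prop :=
  exists (I : Type) (r : seq I) (al : I -> X -> C) (be : I -> C -> A),
  [/\ forall i, exists2 k : R, 0 <= k & tbounded p (al i) k,
      forall i, exists2 k : R, 0 <= k & tbounded id (be i) k &
      forall x, Th x = \sum_(i <- r) be i (al i x)].

Lemma factorable1 (al : X -> C) (be : C -> A) (k k' : R) : 0 <= k -> 0 <= k' ->
  tbounded p al k -> tbounded id be k' -> factorable (fun x => be (al x)).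
Proof.
move=> k0 k'0 h h'; exists unit, [:: tt], (fun=> al), (fun=> be); split.
- by move=> _; exists k.
- by move=> _; exists k'.
- by move=> x; rewrite big_seq1.
Qed.

Lemma factorable_eq (Th Th' : X -> A) : (forall x, Th x = Th' x) -> factorable Th -> factorable Th'.
Proof. by move=> e [I [r [al [be [h1 h2 h3]]]]]; exists I, r, al, be; split=> // x; rewrite -e. Qed.

Lemma factorable_add (Th Th' : X -> A) : factorable Th -> factorable Th' ->
  factorable (fun x => Th x + Th' x).
Proof.
move=> [I [r [al [be [h1 h2 h3]]]]] [I' [r' [al' [be' [h1' h2' h3']]]]].
exists (I + I')%type, ([seq inl i | i <- r] ++ [seq inr i | i <- r']),
  (fun i => match i with inl i => al i | inr i => al' i end),
  (fun i => match i with inl i => be i | inr i => be' i end); split.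
- by case.
- by case.
- by move=> x; rewrite sum_cat !big_map h3 h3'.
Qed.

Lemma factorable_opp (Th : X -> A) : factorable Th -> factorable (fun x => - Th x).
Proof.
move=> [I [r [al [be [h1 h2 h3]]]]]; exists I, r, al, (fun i c => - be i c); split=> //.
- by move=> i; have [k k0 hk] := h2 i; exists k => //; exact: tbounded_opp.
- by move=> x; rewrite h3 sumrN.
Qed.

Lemma factorable_sum (L : Type) (r : seq L) (Th : L -> X -> A) : (forall l, factorable (Th l)) ->
  factorable (fun x => \sum_(l <- r) Th l x).
Proof.
move=> h; elim: r => [|l r IH].
  exists void, [::], (fun (i : void) (_ : X) => match i return C with end),
    (fun (i : void) (_ : C) => match i return A with end).
  by split=> [[]|[]|x]; rewrite !big_nil.
by apply: factorable_eq (factorable_add (h l) IH) => x; rewrite big_cons.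
Qed.

End Factorable.

(** The representation acts on H^n through the matrices of [f]. [S1] inserts a vector at place j,
    [S2] inserts the image under the adjoint of [th] at place i. *)
Lemma coefficient_bd (A C : cstarAlg R) (n : nat) (f : C -> mx_starAlg 'I_n (scalars R)) (i j : 'I_n) (th : A) :
  star_hom (S := C) f -> tbounded id (fun c => (f c i j : R[i]) *: th) (2 * nrm th).
Proof.
move=> [f1 f2 f3]; apply: tb_of_dilates => H u hu.
pose act (c : C) (x : 'I_n -> H) : 'I_n -> H := fun k => \sum_l (f c k l : R[i]) *: x l.
have fstar c k l : (f (cs_star c) k l : R[i]) = cj (f c l k).
  by have := f3 c I => ->.
have [U [hU U_pt]] : exists U : C -> kolm (pk 'I_n H) -> kolm (pk 'I_n H), star_rep (S := C) U /\
    forall c x, U c (pt (pk 'I_n H) x) = pt (pk 'I_n H) (act c x).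
  apply: cs_action_rep => [l a b x|a b x|a x y].
  - apply: pt_rel => z; rewrite /= mulr_sumr -big_split; apply: eq_bigr => k _ /=.
    rewrite -ip_linear; congr ip; rewrite /act scaler_sumr -big_split; apply: eq_bigr => i' _ /=.
    by rewrite f1// -[(l *: f a + f b) k i']/(l * f a k i' + f b k i') scalerDl scalerA.
  - congr pt; apply/funext => k; rewrite /act f2// -[smul (f a) (f b) k]/(fun l => \sum_j (f a k j : R[i]) * f b j l).
    transitivity (\sum_l \sum_j' ((f a k j' : R[i]) * f b j' l) *: x l).
      by apply: eq_bigr => l _; rewrite scaler_suml.
    rewrite exchange_big; apply: eq_bigr => l _; rewrite scaler_sumr; apply: eq_bigr => l' _.
    by rewrite scalerA.
  - rewrite /= /act.
    transitivity (\sum_k \sum_l (f a k l : R[i]) * ip (x l) (y k)).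
      by apply: eq_bigr => k _; rewrite ip_suml; apply: eq_bigr => l _; rewrite ipZl.
    rewrite exchange_big; apply: eq_bigr => l _; rewrite ip_sumr; apply: eq_bigr => k _.
    by rewrite ipZr fstar conjcK.
pose del (k : 'I_n) (g : H) : 'I_n -> H := fun l => if l == k then g else 0.
have del_lin k : linear (fun g => vec (del k g)).
  move=> c g g'; rewrite -vec_lin; congr vec; apply/funext => l; rewrite /del.
  by case: ifP => // _; rewrite scaler0 addr0.
have del_bd k g : nrm (vec (del k g)) <= nrm g.
  apply: le_trans (vn_le_sum _) _; rewrite (bigD1 k)//= big1 ?addr0 => [|l lk].
    by rewrite /del eqxx.
  by rewrite /del (negPf lk) nrm0.
exists (hpow 'I_n H), U, (fun g => vec (del j g)), (fun g => vec (del i (u (cs_star th) g))), 1, (2 * nrm th).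
have t0 : 0 <= 2 * nrm th by rewrite mulr_ge0// nrm_ge0.
split=> //.
- split=> // c g g'; rewrite (rep_lin hu)//; exact: del_lin.
- by split; rewrite ?ler01// mul1r.
- split=> g; first by rewrite mul1r.
  by apply: le_trans (del_bd _ _) _; rewrite -(cs_nrm_star th); exact: rep_cs_bd.
move=> c g g'; rewrite /vec U_pt ip_pt /= (bigD1 i)//= big1 ?addr0 => [|k ki]; last first.
  by rewrite /del (negPf ki) ip0r.
rewrite /act (bigD1 j)//= big1 ?addr0 => [|k kj]; last by rewrite /del (negPf kj) scaler0.
rewrite /del !eqxx (repZ hu)// !ipZl (rep_star hu)//.
Qed.

End Factoring.

Section ConeReps.
Variables (R : realType) (C : cstarAlg R) (H : hilbert R) (v : Bamb C -> H -> H).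
Hypothesis hv : star_rep_on (@B R C) v.

Definition cgram G (s : seq (C * H)) : R[i] :=
  \sum_(a <- s) \sum_(b <- s) ip (v (cone G (cs_mul (cs_star b.1) a.1)) a.2) b.2.

Lemma cut_B G c : cut (clip 0) G -> B (cone G c : Bamb C).
Proof. by move=> [h _ h0]; exact: cone_B. Qed.

Lemma cgram_sq G G' s : cut (clip 0) G -> (fun t => G t * G t) = G' ->
  (nrm (\sum_(a <- s) v (cone G a.1) a.2) ^+ 2)%:C = cgram G' s.
Proof.
move=> hG <-; have cB c := cut_B c hG.
rewrite -ip_nrm ip_suml; apply: eq_bigr => a _.
rewrite ip_sumr; apply: eq_bigr => b _.
rewrite -cone_mul -cone_star (rep_mul hv)//; last exact: B_star.
by rewrite [RHS](rep_star hv) ?BstarK//; exact: B_star.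
Qed.

(** The argument of [kappa_dilates] inside a representation of B, where G = G^2 + (G - G^2) gives
    the domination. *)
Lemma cone_rep_dilates G : cut (clip 0) G -> dilates id (fun c f => v (cone G c) f) 1.
Proof.
move=> hG; have [cG G1 _] := hG.
have hG2 := cut_mul hG cG G1; have hGs := cut_subsq hG; have sG := cut_sqrt hG.
have cB G' c (h : cut (clip 0) G') := cut_B c h.
apply: (cone_dilates (R1 := fun c f => v (cone (fun t => Num.sqrt (G t)) c) f)).
- by move=> l c c' f; rewrite cone_lin (rep_add hv)//; exact: cut_B.
- by move=> c; apply: (rep_lin hv); exact: cut_B.
- move=> c c' f f'.
  have -> : cone G (cs_mul (cs_star c') c) = smul
     (star (cone (fun t => Num.sqrt (G t)) c')) (cone (fun t => Num.sqrt (G t)) c).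
    by rewrite cone_star cone_mul (sqrtM hG).
  rewrite (rep_mul hv); [|by apply: B_star; exact: cut_B|exact: cut_B].
  by rewrite [RHS](rep_star hv) ?BstarK//; apply: B_star; exact: cut_B.
- by move=> c f f'; rewrite (rep_star hv) ?cone_star//; exact: cut_B.
- move=> s; rewrite -(ler_pXn2r (ltn0Sn 1)) ?nnegrE ?nrm_ge0// -lecR.
  rewrite (cgram_sq s hG erefl) (cgram_sq s sG (sqrtM hG)).
  have -> : cgram G s = cgram (fun t => G t * G t) s + cgram (fun t => G t - G t * G t) s.
    rewrite /cgram -big_split; apply: eq_bigr => a _; rewrite -big_split; apply: eq_bigr => b _ /=.
    rewrite -ipDl -(repD hv); [|exact: cut_B..]; congr (ip (v _ _) _).
    apply: Bext => [|x]; first by rewrite B1D /= addr0.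
    by rewrite B2D /= -scalerDl -RCD addrC subrK.
  rewrite lerDl -(cgram_sq s (cut_sqrt hGs) (sqrtM hGs)).
  by rewrite lecR sqr_ge0.
Qed.

End ConeReps.

(** * Completely positive pieces on the grid *)

Section Blocks.
Variables (R : realType) (C : cstarAlg R) (S : AzC_data C).
Variables (A : cstarAlg R) (mu : forall m, az_amb S m -> A).
Hypothesis adm : AzC_admissible S.
Hypothesis lim : is_limit mu.
Variables (m N M : nat).
Hypothesis N0 : (0 < N)%N.
Notation J := (az_idx S m).
Notation lmu := (@lmu R C S A mu m).

Let p0 : 'I_(az_p S m) := Ordinal (psize_gt0 adm m).
Let q0 : 'I_(az_q S m) := Ordinal (qsize_gt0 adm m).

(* at the end points of [0,1] the patches respect M_p (x) 1 and 1 (x) M_q *)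
Definition base (j : nat) (y : J) : J :=
  if j == 0%N then (p0, y.2) else if j == N then (y.1, q0) else (p0, q0).
Definition brr (j : nat) (y : J) : J :=
  if j == 0%N then (y.1, q0) else if j == N then (p0, y.2) else y.

Lemma base_inj j x y : base j x = base j y -> brr j x = brr j y -> x = y.
Proof.
rewrite /base /brr; case: x y => [x1 x2] [y1 y2]; case: ifP => _ /=; first by move=> [->] [->].
by case: ifP => _ //= [->] [->].
Qed.

(** The cut-off vanishes at an end of [0,1] unless the grid point is that end; there the boundary
    condition is met by [base] and [brr] instead. *)
Definition ends (j : nat) (h : I01 R -> R) : Prop :=
  [/\ rcont h, (0 < j)%N -> h (clip 0) = 0 & (j < N)%N -> h (clip 1) = 0].

Lemma N_neq0 : (N == 0%N) = false. Proof. by apply/negbTE; rewrite -lt0n. Qed.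

Lemma patch_elt j h (a : MB C J) : (j <= N)%N -> ends j h -> inMB a ->
  (j = N -> forall x y, a x y = Bscal C (a x y).1) -> @az_A R C S m (elt h (chi (base j) (brr j) a)).
Proof.
move=> jN [ch h0 h1] aB aN; apply: E_elt => //; first exact: chi_B.
  have [j0|j0] := eqVneq j 0%N; last by left; apply: h0; rewrite lt0n.
  right; apply/left_tensorP; exists (fun x y => a (x, q0) (y, q0)); first by move=> x y.
  apply/funext => x; apply/funext => y; rewrite /chi /base /brr /ampl j0 /=.
  by rewrite xpair_eqE eqxx.
have [jN'|jN'] := eqVneq j N; last by left; apply: h1; rewrite ltn_neqAle jN'.
right; apply/right_scalarP; exists (fun x y => (a (p0, x) (p0, y)).1).
apply/funext => x; apply/funext => y; rewrite /chi /base /brr /ampr jN' N_neq0 eqxx xpair_eqE eqxx andbT.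
by case: ifP => // _; exact: aN.
Qed.

Lemma patch_row j h (r : J -> Bamb C) : (j <= N)%N -> ends j h -> (forall y, B (r y)) ->
  (j = N -> forall y, r y = Bscal C (r y).1) -> @az_A R C S m (elt h (qrow (base j) (brr j) r)).
Proof.
move=> jN [ch h0 h1] rB rN; apply: E_elt => //; first exact: qrow_B.
  have [j0|j0] := eqVneq j 0%N; last by left; apply: h0; rewrite lt0n.
  right; apply/left_tensorP; exists (fun x y => if x == p0 then r (y, q0) else 0).
    by move=> x y; case: ifP => // _; exact: B0.
  apply/funext => x; apply/funext => y; rewrite /qrow /base /brr /ampl j0 /=.
  by case: x => x1 x2; rewrite xpair_eqE /= andbC; case: (x2 == y.2); case: (x1 == p0).
have [jN'|jN'] := eqVneq j N; last by left; apply: h1; rewrite ltn_neqAle jN'.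
right; apply/right_scalarP; exists (fun x y => if x == q0 then (r (p0, y)).1 else 0).
apply/funext => x; apply/funext => y; rewrite /qrow /base /brr /ampr jN' N_neq0 eqxx.
case: x => x1 x2; rewrite xpair_eqE /=; case: eqVneq => //= _; case: eqVneq => _; first exact: rN.
exact: Bext.
Qed.

Lemma ends_hat j : ends j (hat N j).
Proof. by split; [exact: hat_cont|exact: hat_at0|exact: hat_at1]. Qed.

Lemma ends_sqrt j : ends j (fun t => Num.sqrt (hat N j t)).
Proof.
split; first by apply: rcont_sqrt; [move=> t; have /andP[] := hat_bd N j t|exact: hat_cont].
  by move=> j0; rewrite (hat_at0 R N j0) sqrtr0.
by move=> jN; rewrite (hat_at1 R jN) sqrtr0.
Qed.

Lemma sqrt_hat j : (fun t : I01 R => Num.sqrt (hat N j t) * Num.sqrt (hat N j t)) = hat N j.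
Proof. by apply/funext => t; rewrite -expr2 sqr_sqrtr//; have /andP[] := hat_bd N j t. Qed.

Lemma cut_hat0 (k : nat) : cut (clip 0 : I01 R) (hat M k.+1).
Proof. by split; [exact: hat_cont|exact: hat_bd|exact: hat_at0]. Qed.

Variable e : C.
Hypothesis e_sa : cs_star e = e.
Hypothesis e_bd : repn e 2.
Variable T : forall j : nat, tower S m (clip (j%:R / N%:R)).

Definition xk (k : nat) : I01 R := clip (k%:R / M%:R).
(** e (lambda + h(x_k)) e, expanded because C has no unit; its difference with [se2] is e h(x_k)
    e. *)
Definition se1 (k : nat) (b : Bamb C) : C := b.1 *: cs_mul e e + cs_mul (cs_mul e (b.2 (xk k))) e.
Definition se2 (b : Bamb C) : C := b.1 *: cs_mul e e.
(** The cone grid starts at k + 1: h vanishes at x = 0, and the hat at 0 would leave the cone. *)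
Definition si1 k (b : Bamb C) : Bamb C := cone (hat M k.+1) (se1 k.+1 b).
Definition si2 k (b : Bamb C) : Bamb C := cone (hat M k.+1) (se2 b).
Definition si3 (b : Bamb C) : Bamb C := Bscal C b.1.
Definition re1 k (b : Bamb C) : Bamb C :=
  cone (fun t => Num.sqrt (hat M k.+1 t)) (b.1 *: e + cs_mul (b.2 (xk k.+1)) e).
Definition re2 k (b : Bamb C) : Bamb C := cone (fun t => Num.sqrt (hat M k.+1 t)) (b.1 *: e).

Lemma se1_lin k c a b : se1 k (c *: a + b) = c *: se1 k a + se1 k b.
Proof.
rewrite /se1 B1lin B2lin csDr csZr csDl csZl scalerDl scalerDr scalerA.
by rewrite addrACA.
Qed.

Lemma se2_lin c a b : se2 (c *: a + b) = c *: se2 a + se2 b.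
Proof. by rewrite /se2 B1lin scalerDl scalerA. Qed.

Lemma se1_mul k a b : se1 k (smul (star a) b) =
  cs_mul (cs_star (a.1 *: e + cs_mul (a.2 (xk k)) e)) (b.1 *: e + cs_mul (b.2 (xk k)) e).
Proof.
rewrite /se1 smul2; have -> : (smul (star a) b).1 = cj a.1 * b.1 by [].
have -> : (star a).1 = cj a.1 by []; have -> : (star a).2 (xk k) = cs_star (a.2 (xk k)) by [].
rewrite cs_starD cs_starZ cs_starM e_sa !csDl !csDr !csDl !csZl !csZr !csZl !csA scalerA.
by rewrite -!addrA; congr (_ + _); rewrite addrA.
Qed.

Lemma se2_mul a b : se2 (smul (star a) b) = cs_mul (cs_star (a.1 *: e)) (b.1 *: e).
Proof. by rewrite /se2 cs_starZ e_sa csZl csZr scalerA. Qed.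

Lemma ee_bd : repn (cs_mul e e) 4.
Proof.
move=> H u f hu; rewrite (rep_mul hu)//; apply: le_trans (e_bd _ hu) _.
have := e_bd f hu; lra.
Qed.

Lemma se1_rep k b (H : hilbert R) (u : C -> H -> H) f : star_rep (S := C) u ->
  u (se1 k b) f = u e (Bev u (xk k) b (u e f)).
Proof.
move=> hu; rewrite /se1 (repD hu)// (repZ hu)// !(rep_mul hu)// /Bev (rep_lin hu)//.
Qed.

Lemma se2_rep b (H : hilbert R) (u : C -> H -> H) f : star_rep (S := C) u ->
  u (se2 b) f = u e (Bchar b (u e f)).
Proof.
move=> hu; rewrite /se2 (repZ hu)// (rep_mul hu)// /Bchar.
by have [_ _ ->] := linDZ (rep_lin hu (I : setT e)).
Qed.

(** The factor 4 comes from the two factors e, each bounded by 2 in representations; passing to the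
    cone by [cone_rep_dilates] costs nothing. *)
Lemma si_bd_of (k : nat) (g : Bamb C -> C) (w : forall H : hilbert R, (C -> H -> H) -> Bamb C -> H -> H) :
  (forall H u, star_rep (S := C) u -> star_rep_on (@B R C) (w H u)) ->
  (forall b (H : hilbert R) (u : C -> H -> H) f, star_rep (S := C) u -> u (g b) f = u e (w H u b (u e f))) ->
  forall b (L : R), B b -> 0 <= L ->
  (forall (H : hilbert R) (v : Bamb C -> H -> H) f, star_rep_on (@B R C) v -> nrm (v b f) <= L * nrm f) ->
  forall (H : hilbert R) (v : Bamb C -> H -> H) f, star_rep_on (@B R C) v ->
    nrm (v (cone (hat M k.+1) (g b)) f) <= 4 * L * nrm f.
Proof.
move=> hw hg b L bB L0 hL H v f hv.
have gb : repn (g b) (4 * L).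
  move=> H' u f' hu; rewrite hg//; apply: le_trans (e_bd _ hu) _.
  have h1 := hL _ _ (u e f') (hw _ _ hu); have h2 := e_bd f' hu.
  have h3 := ler_wpM2l L0 h2; have := le_trans h1 h3; move: (nrm _) => z.
  by rewrite mulrCA => h4; lra.
have := dilates_nrm f (cone_rep_dilates hv (cut_hat0 k)) (mulr_ge0 (ler0n R 4) L0) gb.
by rewrite mul1r.
Qed.

Lemma piece1 (j : 'I_N) (k : 'I_M) (H0 : hilbert R) (u : A -> H0 -> H0) : star_rep (S := A) u ->
  exists d, dil_data mu u (pmap mu (base j) (brr j) (hat N j) (si1 k) (@mx1 R C J))
    (fun x => pmap mu (base j) (brr j) (hat N j) (si1 k) (ltau (T j) x)) d.
Proof.
move=> hu; have jN := ltn_ord j.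
have jN' : (j = N :> nat) -> False by move=> h; rewrite h ltnn in jN.
apply: (piece_data adm lim hu (T j) (hs := fun t => Num.sqrt (hat N j t)) (r := re1 k) (Ks := 4)) => //.
- exact: sqrt_hat.
- exact: hat_bd.
- by move=> b _; apply: cut_B; exact: cut_hat0.
- by move=> c a b _ _; rewrite /si1 se1_lin cone_lin.
- by move=> a b _ _; rewrite /si1 /re1 se1_mul cone_star cone_mul (sqrtM (cut_hat0 k)).
- apply: (@si_bd_of k (se1 k.+1) (fun H u => Bev u (xk k.+1))) => [H w hw|b H w f hw].
    exact: Bev_rep.
  exact: se1_rep.
- move=> a ha; apply: patch_elt => //; [exact: ltnW|exact: ends_hat|].
  by move=> x y; apply: cut_B; exact: cut_hat0.
- move=> rho hr; apply: patch_row => //; [exact: ltnW|exact: ends_sqrt|].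
  by move=> y; apply: cut_B; apply: cut_sqrt; exact: cut_hat0.
Qed.

Lemma piece2 (j : 'I_N) (k : 'I_M) (H0 : hilbert R) (u : A -> H0 -> H0) : star_rep (S := A) u ->
  exists d, dil_data mu u (pmap mu (base j) (brr j) (hat N j) (si2 k) (@mx1 R C J))
    (fun x => pmap mu (base j) (brr j) (hat N j) (si2 k) (ltau (T j) x)) d.
Proof.
move=> hu; have jN := ltn_ord j.
have jN' : (j = N :> nat) -> False by move=> h; rewrite h ltnn in jN.
apply: (piece_data adm lim hu (T j) (hs := fun t => Num.sqrt (hat N j t)) (r := re2 k) (Ks := 4)) => //.
- exact: sqrt_hat.
- exact: hat_bd.
- by move=> b _; apply: cut_B; exact: cut_hat0.
- by move=> c a b _ _; rewrite /si2 se2_lin cone_lin.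
- by move=> a b _ _; rewrite /si2 /re2 se2_mul cone_star cone_mul (sqrtM (cut_hat0 k)).
- apply: (@si_bd_of k se2 (fun H u => @Bchar R C H)) => [H w hw|b H w f hw].
    exact: Bchar_rep.
  exact: se2_rep.
- move=> a ha; apply: patch_elt => //; [exact: ltnW|exact: ends_hat|].
  by move=> x y; apply: cut_B; exact: cut_hat0.
- move=> rho hr; apply: patch_row => //; [exact: ltnW|exact: ends_sqrt|].
  by move=> y; apply: cut_B; apply: cut_sqrt; exact: cut_hat0.
Qed.

Lemma piece3 (j : 'I_N.+1) (H0 : hilbert R) (u : A -> H0 -> H0) : star_rep (S := A) u ->
  exists d, dil_data mu u (pmap mu (base j) (brr j) (hat N j) si3 (@mx1 R C J))
    (fun x => pmap mu (base j) (brr j) (hat N j) si3 (ltau (T j) x)) d.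
Proof.
move=> hu; have jN := ltn_ord j.
apply: (piece_data adm lim hu (T j) (hs := fun t => Num.sqrt (hat N j t)) (r := si3) (Ks := 1)) => //.
- exact: sqrt_hat.
- exact: hat_bd.
- by move=> b _; exact: Bscal_B.
- by move=> c a b _ _; rewrite /si3 B1lin; exact: Bscal_lin.
- by move=> a b _ _; rewrite /si3 Bscal_star Bscal_mul.
- move=> b L bB L0 hL H v f hv; apply: le_trans (B_scal_bd hv _ _) _; rewrite mul1r.
  by have := hL _ _ f (@Bchar_rep R C H); rewrite /Bchar nrmZ.
- move=> a ha; apply: patch_elt => //; [exact: ends_hat|].
  by move=> x y; exact: Bscal_B.
- move=> rho hr; apply: patch_row => //; [exact: ends_sqrt|].
  by move=> y; exact: Bscal_B.
Qed.

End Blocks.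

(** * Bounds independent of the mesh *)

Section TotalBounds.
Variables (R : realType) (C : cstarAlg R) (S : AzC_data C).
Variables (A : cstarAlg R) (mu : forall m, az_amb S m -> A).
Hypothesis adm : AzC_admissible S.
Hypothesis lim : is_limit mu.
Variables (m N M : nat).
Hypothesis N0 : (0 < N)%N.
Notation J := (az_idx S m).
Notation lmu := (@lmu R C S A mu m).
Notation bs := (@base R C S adm m N).
Notation br := (@brr R C S adm m N).
Variable e : C.
Hypothesis e_sa : cs_star e = e.
Hypothesis e_bd : repn e 2.
Variable T : forall j : nat, tower S m (clip (j%:R / N%:R)).

Lemma cone0 G : cone G (0 : C) = 0.
Proof. by apply: Bext => // x; rewrite /= scaler0. Qed.

Lemma cone_sum I (r : seq I) (G : I -> I01 R -> R) (c : C) :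
  \sum_(i <- r) cone (G i) c = cone (fun x => \sum_(i <- r) G i x) c.
Proof.
elim: r => [|i r IH].
  by rewrite big_nil; apply: Bext => // x; rewrite /= big_nil scale0r.
rewrite big_cons IH; apply: Bext => [|x]; first by rewrite B1D /= addr0.
by rewrite B2D /= big_cons RCD scalerDl.
Qed.

Lemma sent_unit (si : Bamb C -> Bamb C) : si 0 = 0 -> sent si (@mx1 R C J) = dmx J (si (Bscal C 1)).
Proof.
by move=> s0; apply/funext => x; apply/funext => y; rewrite /sent /mx1 /dmx; case: ifP.
Qed.

Lemma pmap_unit (si : Bamb C -> Bamb C) (j : nat) (k : nat) : si 0 = 0 ->
  si (Bscal C 1) = cone (hat M k.+1) (cs_mul e e) ->
  pmap mu (bs j) (br j) (hat N j) si (@mx1 R C J) = @kappa R C S A mu m (hat N j) (hat M k.+1) (cs_mul e e).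
Proof.
move=> s0 s1; rewrite /pmap sent_unit// chi_dmx ?s1//; exact: base_inj.
Qed.

Lemma rcont_1B (h : I01 R -> R) : rcont h -> rcont (fun t => 1 - h t).
Proof.
apply: rcontB; apply: (rcont_lip (K := 0)) => // s t.
by rewrite subrr normr0 mul0r.
Qed.

Lemma cut_sumN : cut (clip 1 : I01 R) (fun t => \sum_(j < N) hat N j t).
Proof.
have e1 : (fun t : I01 R => \sum_(j < N) hat N j t) = (fun t => 1 - hat N N t).
  apply/funext => t; have := hat_sum N t; rewrite big_ord_recr /= => <-.
  by rewrite addrK.
split; last by rewrite big1// => j _; exact: hat_at1.
  by rewrite e1; apply: rcont_1B; exact: hat_cont.
move=> t; rewrite (congr1 (fun f => f t) e1); have /andP[h1 h2] := hat_bd N N t.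
by rewrite subr_ge0 h2 gerBl.
Qed.

Lemma cut_sumM : cut (clip 0 : I01 R) (fun t => \sum_(k < M) hat M k.+1 t).
Proof.
have e1 : (fun t : I01 R => \sum_(j < M) hat M j.+1 t) = (fun t => 1 - hat M 0 t).
  apply/funext => t; have := hat_sum M t; rewrite big_ord_recl /= => <-.
  by rewrite addrAC subrr add0r.
split; last by rewrite big1// => j _; exact: hat_at0.
  by rewrite e1; apply: rcont_1B; exact: hat_cont.
move=> t; rewrite (congr1 (fun f => f t) e1); have /andP[h1 h2] := hat_bd M 0 t.
by rewrite subr_ge0 h2 gerBl.
Qed.

Lemma kelt_entry H G (c : C) t i j : @kelt R C S m H G c t i j =
  if i == j then cone (fun x => H t * G x) c else 0.
Proof.
rewrite -[LHS]/((H t)%:C *: dmx J (cone G c) i j) /dmx; case: ifP => _; last by rewrite scaler0.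
by apply: Bext => [|x]; [exact: mulr0|rewrite B2Z /= scalerA RCM].
Qed.

Lemma cut_hat1 (j : 'I_N) : cut (clip 1 : I01 R) (hat N j).
Proof. by split; [exact: hat_cont|exact: hat_bd|exact: hat_at1]. Qed.

(** Products of hats sum to the product of the two sums, so the whole grid is a single order zero
    map. *)
Lemma kappa_grid (c : C) :
  \sum_(i : 'I_N * 'I_M) @kappa R C S A mu m (hat N i.1) (hat M i.2.+1) c =
  @kappa R C S A mu m (fun t => \sum_(j < N) hat N j t) (fun t => \sum_(k < M) hat M k.+1 t) c.
Proof.
rewrite /kappa -(mu_sum lim); last by move=> i; apply: kelt_A; [exact: cut_hat1|exact: cut_hat0].
congr mu; apply/funext => t; apply/funext => x; apply/funext => y.
transitivity (\sum_(i : 'I_N * 'I_M) @kelt R C S m (hat N i.1) (hat M i.2.+1) c t x y).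
  by rewrite !fct_sumE.
rewrite kelt_entry; under eq_bigr => i _ do rewrite kelt_entry.
case: ifP => _; last by rewrite big1.
rewrite cone_sum; congr cone; apply/funext => z.
by rewrite big_distrlr pair_bigA.
Qed.

Definition Th (si : 'I_M -> Bamb C -> Bamb C) (x : lifts S m) : A :=
  \sum_(i : 'I_N * 'I_M) pmap mu (bs i.1) (br i.1) (hat N i.1) (si i.2) (ltau (T i.1) x).

(** The images of the unit add up to one value of [kappa] at e e. This map is dilated with constant
    1, and e e is bounded by 4, whatever N and M are. *)
Lemma grid_bd (H0 : hilbert R) (u : A -> H0 -> H0) f (si : 'I_M -> Bamb C -> Bamb C) : star_rep (S := A) u ->
  (forall k, si k 0 = 0) -> (forall k, si k (Bscal C 1) = cone (hat M k.+1) (cs_mul e e)) ->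
  nrm (u (\sum_(i : 'I_N * 'I_M) pmap mu (bs i.1) (br i.1) (hat N i.1) (si i.2) (@mx1 R C J)) f) <= 4 * nrm f.
Proof.
move=> hu s0 s1; have -> : \sum_(i : 'I_N * 'I_M) pmap mu (bs i.1) (br i.1) (hat N i.1) (si i.2) (@mx1 R C J) =
    \sum_(i : 'I_N * 'I_M) @kappa R C S A mu m (hat N i.1) (hat M i.2.+1) (cs_mul e e).
  by apply: eq_bigr => i _; exact: pmap_unit.
rewrite kappa_grid.
have := dilates_nrm f (kappa_dilates lim m hu cut_sumN cut_sumM) (ler0n R 4) (ee_bd e_bd).
by rewrite mul1r.
Qed.

Lemma Bscal1_2 x : (Bscal C 1).2 x = 0. Proof. by []. Qed.

Lemma Th1_bd : tbounded lmu (Th (@si1 R C M e)) 4.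
Proof.
apply: tb_of_dilates => H u hu; apply: (sum_dilates hu (z := fun i : 'I_N * 'I_M => pmap mu (bs i.1) (br i.1) (hat N i.1) (@si1 R C M e i.2) (@mx1 R C J))) => //.
  by move=> [j k]; exact: (piece1 adm lim N0 e_sa e_bd T j k hu).
move=> f; apply: (@grid_bd _ u f (@si1 R C M e)) => // k; rewrite /si1 /se1.
  by rewrite scale0r cs0r cs0l addr0 cone0.
by rewrite Bscal1_2 scale1r cs0r cs0l addr0.
Qed.

Lemma Th2_bd : tbounded lmu (Th (fun k => @si2 R C M e k)) 4.
Proof.
apply: tb_of_dilates => H u hu; apply: (sum_dilates hu (z := fun i : 'I_N * 'I_M => pmap mu (bs i.1) (br i.1) (hat N i.1) (@si2 R C M e i.2) (@mx1 R C J))) => //.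
  by move=> [j k]; exact: (piece2 adm lim N0 e_sa e_bd T j k hu).
move=> f; apply: (@grid_bd _ u f (@si2 R C M e)) => // k; rewrite /si2 /se2.
  by rewrite scale0r cone0.
by rewrite scale1r.
Qed.

Definition Th3 (x : lifts S m) : A :=
  \sum_(j : 'I_N.+1) pmap mu (bs j) (br j) (hat N j) (@si3 R C) (ltau (T j) x).

Lemma mx1_dmx : @mx1 R C J = dmx J (Bscal C 1). Proof. by []. Qed.

Lemma one_A : @az_A R C S m (elt (fun=> 1) (@mx1 R C J)).
Proof.
apply: E_elt; first by apply: (rcont_lip (K := 0)) => // s t; rewrite subrr normr0 mul0r.
- exact: mx1_B.
- by right; rewrite mx1_dmx; apply: dmx_left; exact: Bscal_B.
- right; apply/right_scalarP; exists (fun x y => (x == y)%:R).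
  apply/funext => x; apply/funext => y; rewrite /mx1 /ampr; case: x y => [x1 x2] [y1 y2].
  rewrite xpair_eqE /=; by case: (x1 == y1) => //=; case: (x2 == y2).
Qed.

(** The hats sum to 1, so the images of the unit add up to the image of the unit of A_m, which is a
    projection. *)
Lemma Th3_bd : tbounded lmu Th3 1.
Proof.
apply: tb_of_dilates => H u hu; apply: (sum_dilates hu (z := fun j : 'I_N.+1 => pmap mu (bs j) (br j) (hat N j) (@si3 R C) (@mx1 R C J))) => //.
  by move=> j; exact: (piece3 adm lim N0 T j hu).
move=> f; rewrite mul1r.
pose one : A := @mu m (elt (fun=> 1) (@mx1 R C J)).
have -> : \sum_(j : 'I_N.+1) pmap mu (bs j) (br j) (hat N j) (@si3 R C) (@mx1 R C J) = one.
  have pe (j : 'I_N.+1) : chi (bs j) (br j) (sent (@si3 R C) (@mx1 R C J)) = @mx1 R C J.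
    rewrite sent_unit; last exact: Bext.
    by rewrite chi_dmx//; exact: base_inj.
  rewrite /pmap /one -(mu_sum lim); last first.
    move=> j; apply: patch_elt => //; [exact: ltn_ord j|exact: ends_hat|by move=> x y; exact: Bscal_B].
  congr mu; apply/funext => t.
  transitivity (\sum_(j : 'I_N.+1) (hat N j t)%:C *: @mx1 R C J).
    by rewrite fct_sumE; apply: eq_bigr => j _; rewrite -[LHS]/((hat N j t)%:C *: _) pe.
  by rewrite -scaler_suml -(raddf_sum (real_complex R)) hat_sum.
have one2 : cs_mul (cs_star one) one = one.
  rewrite -(mu_star lim); last exact: one_A.
  rewrite -(mu_mul lim); [|apply: E_star; exact: one_A|exact: one_A].
  rewrite elt_star elt_mul mx1_star mxmul1l; congr mu.
  by apply/funext => t; rewrite /elt mulr1.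
apply: nrm_le_ip; first exact: nrm_ge0.
have -> : ip (u one f) (u one f) = ip (u one f) f.
  by rewrite -[in RHS]one2 (rep_mul hu)// [RHS](rep_star hu)// -[star _]/(cs_star _) csK.
by apply: le_trans (cauchy_schwarz _ _) _; rewrite mulrC.
Qed.

Definition Tht (x : lifts S m) : A := Th3 x + (Th (@si1 R C M e) x - Th (fun k => @si2 R C M e k) x).

(** 1 for the scalar part and 4 for each of the two completely positive maps whose difference gives
    the cone part. *)
Lemma Tht_bd : tbounded lmu Tht 9.
Proof.
have -> : (9 : R) = 1 + (4 + 4) by ring.
by apply: tbounded_add; [exact: Th3_bd|apply: tbounded_add; [exact: Th1_bd|apply: tbounded_opp; exact: Th2_bd]].
Qed.

End TotalBounds.

Section Factorization.
Variables (R : realType) (C : cstarAlg R) (S : AzC_data C).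
Variables (A : cstarAlg R) (mu : forall m, az_amb S m -> A).
Hypothesis adm : AzC_admissible S.
Hypothesis lim : is_limit mu.
Variables (m N M : nat).
Hypothesis N0 : (0 < N)%N.
Notation J := (az_idx S m).
Notation lmu := (@lmu R C S A mu m).
Notation bs := (@base R C S adm m N).
Notation br := (@brr R C S adm m N).

(** A matrix is cut into its entries, so that each summand depends on a single element of C or a
    single scalar. *)
Lemma chi_split (j : nat) (h : I01 R -> R) (a : MB C J) : (j <= N)%N -> ends N j h -> inMB a ->
  (j = N -> forall x y, a x y = Bscal C (a x y).1) ->
  @mu m (elt h (chi (bs j) (br j) a)) =
  \sum_y \sum_y' @mu m (elt h (chi (bs j) (br j) (smx y y' (a y y')))).
Proof.
move=> jN hh aB aN.
have sA y y' : @az_A R C S m (elt h (chi (bs j) (br j) (smx y y' (a y y')))).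
  apply: patch_elt => //; first exact: smx_B.
  move=> jN' x z; rewrite /smx; case: ifP => _; first exact: aN.
  exact: Bext.
rewrite {1}(smx_sum a) chi_sum elt_sum (mu_sum lim) => [|y].
  by apply: eq_bigr => y _; rewrite chi_sum elt_sum (mu_sum lim).
rewrite chi_sum elt_sum; apply: (@E_sum R C _ _ _ _ (fun y' => elt h (chi (bs j) (br j) (smx y y' (a y y'))))) => y'; exact: sA.
Qed.

Definition th (j : nat) (y y' : J) : A :=
  @mu m (elt (fun t => Num.sqrt (hat N j t)) (chi (bs j) (br j) (smx y y' (Bscal C 1)))).
Definition bt (j k : nat) (y y' : J) (c : C) : A :=
  @mu m (elt (hat N j) (chi (bs j) (br j) (smx y y' (cone (hat M k.+1) c)))).

Lemma bt_A (j : 'I_N) k y y' c :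
  @az_A R C S m (elt (hat N j) (chi (bs j) (br j) (smx y y' (cone (hat M k.+1) c)))).
Proof.
apply: patch_elt => //; [exact: (ltnW (ltn_ord j))|exact: ends_hat|apply: smx_B; apply: cut_B; exact: cut_hat0|].
by move=> h; have := ltn_ord j; rewrite h ltnn.
Qed.

(** An off-diagonal patch is not positive, but it is an order zero map followed by left
    multiplication. One square root of the hat goes into each factor. *)
Lemma bt_eq (j : 'I_N) k y y' c : bt j k y y' c =
  cs_mul (th j y y') (@kappa R C S A mu m (fun t => Num.sqrt (hat N j t)) (hat M k.+1) c).
Proof.
rewrite /th /kappa -(mu_mul lim).
- by rewrite /kelt elt_mul chi_smx_dmx sqrt_hat.
- apply: patch_elt => //; [exact: (ltnW (ltn_ord j))|exact: ends_sqrt|apply: smx_B; exact: Bscal_B|].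
  by move=> h; have := ltn_ord j; rewrite h ltnn.
- by apply: kelt_A; [apply: cut_sqrt; exact: cut_hat1|exact: cut_hat0].
Qed.

Lemma bt_dilates (j : 'I_N) k y y' (H : hilbert R) (u : A -> H -> H) : star_rep (S := A) u ->
  dilates id (fun c f => u (bt j k y y' c) f) (2 * nrm (th j y y')).
Proof.
move=> hu; have hk := kappa_dilates lim m hu (cut_sqrt (cut_hat1 R j)) (cut_hat0 R M k).
have := dilates_conj (be' := fun c f => u (bt j k y y' c) f) (a1 := fun f => f)
  (a2 := u (cs_star (th j y y'))) (N1 := 1) (N2 := 2 * nrm (th j y y')) hk.
rewrite mul1r mulr1; apply=> //.
- exact: (rep_lin hu).
- by rewrite mulr_ge0// nrm_ge0.
- by move=> f; rewrite mul1r.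
- by move=> f; rewrite -(cs_nrm_star (th j y y')); exact: rep_cs_bd.
- move=> c f f'; rewrite bt_eq (rep_mul hu)// (rep_star hu)//.
Qed.

Lemma bt_sub (j : 'I_N) k y y' c c' : bt j k y y' (c - c') = bt j k y y' c - bt j k y y' c'.
Proof.
rewrite /bt -(mu_B lim); [|exact: bt_A..]; congr mu.
have h : smx y y' (cone (hat M k.+1) (c - c')) =
    (-1) *: smx y y' (cone (hat M k.+1) c') + smx y y' (cone (hat M k.+1) c).
  apply/funext => i; apply/funext => i'.
  rewrite -[RHS]/(-1 *: smx y y' (cone (hat M k.+1) c') i i' + smx y y' (cone (hat M k.+1) c) i i').
  rewrite /smx; case: ifP => _; last by rewrite scaler0 addr0.
  by rewrite -cone_lin scaleN1r addrC.
by rewrite h chi_lin elt_lin scaleN1r addrC.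
Qed.

Section Unit.
Variable e : C.
Hypothesis e_sa : cs_star e = e.
Hypothesis e_bd : repn e 2.
Variable T : forall j : nat, tower S m (clip (j%:R / N%:R)).

Lemma Th_bt (g : 'I_M -> Bamb C -> C) (x : lifts S m) :
  Th mu adm T (fun k b => cone (hat M k.+1) (g k b)) x =
  \sum_(i : 'I_N * 'I_M) \sum_y \sum_y' bt i.1 i.2 y y' (g i.2 (ltau (T i.1) x y y')).
Proof.
apply: eq_bigr => i _; rewrite /pmap chi_split//.
- exact: (ltnW (ltn_ord i.1)).
- exact: ends_hat.
- by move=> y y'; apply: cut_B; exact: cut_hat0.
- by move=> h; have := ltn_ord i.1; rewrite h ltnn.
Qed.

Lemma al_conj (g : Bamb C -> C) (w : forall H : hilbert R, (C -> H -> H) -> Bamb C -> H -> H) j y y' :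
  (forall H u, star_rep (S := C) u -> star_rep_on (@B R C) (w H u)) ->
  (forall b (H : hilbert R) (u : C -> H -> H) f, star_rep (S := C) u -> u (g b) f = u e (w H u b (u e f))) ->
  tbounded lmu (fun x => g (ltau (T j) x y y')) 4.
Proof.
move=> hw hg; apply: tb_of_dilates => H u hu.
have h := alpha_dilates adm lim (T j) (hw _ _ hu) y' y.
have := dilates_conj (be' := fun x f => u (g (ltau (T j) x y y')) f) (a1 := u e)
  (a2 := u e) (N1 := 2) (N2 := 2) h.
have -> : 2 * 2 * 1 = 4 :> R by ring.
apply=> //; try exact: (rep_lin hu); try by move=> f; exact: e_bd.
by move=> x f f'; rewrite hg// (rep_star hu)// -[star _]/(cs_star _) e_sa.
Qed.

Lemma bt_factorable (g : Bamb C -> C) j (i : 'I_N) k y y' :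
  tbounded lmu (fun x => g (ltau (T j) x y y')) 4 ->
  factorable C lmu (fun x => bt i k y y' (g (ltau (T j) x y y'))).
Proof.
move=> h; have h0 : 0 <= 2 * nrm (th i y y') by rewrite mulr_ge0// nrm_ge0.
apply: (factorable1 (ler0n R 4) h0 h).
by apply: tb_of_dilates => H u hu; exact: bt_dilates.
Qed.

Variables (n : nat) (phi : C -> mx_starAlg 'I_n (scalars R)) (i0 j0 : 'I_n) (c0 : C).
Hypothesis phi_hom : star_hom (S := C) phi.
Hypothesis phi_c0 : (phi c0 i0 j0 : R[i]) <> 0.

Definition th3 (j : nat) (y y' : J) : A :=
  @mu m (elt (hat N j) (chi (bs j) (br j) (smx y y' (Bscal C 1)))).

Lemma th3_A (j : 'I_N.+1) y y' : @az_A R C S m (elt (hat N j) (chi (bs j) (br j) (smx y y' (Bscal C 1)))).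
Proof.
apply: patch_elt => //; [exact: ltn_ord j|exact: ends_hat|apply: smx_B; exact: Bscal_B|].
by move=> _ x z; rewrite /smx; case: ifP => _ //; exact: Bext.
Qed.

Lemma th3Z (j : 'I_N.+1) (l : R[i]) y y' :
  @mu m (elt (hat N j) (chi (bs j) (br j) (smx y y' (Bscal C l)))) = l *: th3 j y y'.
Proof.
rewrite /th3 -(mu_Z lim); last exact: th3_A.
congr mu; apply/funext => t; apply/funext => x; apply/funext => z.
rewrite -[LHS]/((hat N j t)%:C *: chi (bs j) (br j) (smx y y' (Bscal C l)) x z).
rewrite -[RHS]/(l *: ((hat N j t)%:C *: chi (bs j) (br j) (smx y y' (Bscal C 1)) x z)).
rewrite /chi /smx; case: ifP => _; last by rewrite !scaler0.
case: ifP => _; last by rewrite !scaler0.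
rewrite !scalerA [l * _]mulrC -scalerA; congr (_ *: _).
by apply: Bext => [|w]; [rewrite B1Z /= mulr1|rewrite B2Z /= scaler0].
Qed.

Lemma Th3_sum x : Th3 mu adm T x =
  \sum_(j : 'I_N.+1) \sum_y \sum_y' (ltau (T j) x y y').1 *: th3 j y y'.
Proof.
apply: eq_bigr => j _; rewrite /pmap chi_split//.
- by apply: eq_bigr => y _; apply: eq_bigr => y' _; rewrite th3Z.
- exact: ltn_ord j.
- exact: ends_hat.
- by move=> y y'; exact: Bscal_B.
Qed.

Lemma al3_bd j y y' : tbounded lmu (fun x => (ltau (T j) x y y').1 *: c0) (2 * nrm c0).
Proof.
apply: tb_of_dilates => H u hu.
have h := alpha_dilates adm lim (T j) (@Bchar_rep R C H) y' y.
have := dilates_conj (be' := fun x f => u ((ltau (T j) x y y').1 *: c0) f) (a1 := u c0)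
  (a2 := fun f => f) (N1 := 2 * nrm c0) (N2 := 1) h.
rewrite !mulr1; apply=> //.
- exact: (rep_lin hu).
- by rewrite mulr_ge0// nrm_ge0.
- by move=> f; exact: rep_cs_bd.
- by move=> f; rewrite mul1r.
- by move=> x f f'; rewrite (repZ hu).
Qed.

(** Entry by entry: the cone part passes through C by the compressions with e, the scalar part by
    multiples of c0 and the coefficient of [phi]. *)
Lemma Tht_factorable : factorable C lmu (Tht mu adm M e T).
Proof.
apply: factorable_add.
  apply: (factorable_eq (Th := fun x => \sum_(j : 'I_N.+1) \sum_y \sum_y' (ltau (T j) x y y').1 *: th3 j y y')).
    by move=> x; rewrite Th3_sum.
  apply: factorable_sum => j; apply: factorable_sum => y; apply: factorable_sum => y'.
  (* Normalised so that reading off the coefficient of lambda c0 returns lambda. *)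
  pose z := (phi c0 i0 j0 : R[i])^-1 *: th3 j y y'.
  have k0 : 0 <= 2 * nrm c0 by rewrite mulr_ge0// nrm_ge0.
  have k1 : 0 <= 2 * nrm z by rewrite mulr_ge0// nrm_ge0.
  have := factorable1 k0 k1 (al3_bd j y y') (coefficient_bd i0 j0 z phi_hom).
  apply: factorable_eq => x; rewrite /z scalerA; congr (_ *: _).
  have [h _ _] := phi_hom; have := h (ltau (T j) x y y').1 c0 0 I I.
  have h0 : phi 0 = 0.
    have := h (-1) 0 0 I I; rewrite scaleN1r oppr0 addr0 => ->; by rewrite scaleN1r addNr.
  rewrite h0 !addr0 => ->.
  rewrite -[((ltau (T j) x y y').1 *: phi c0) i0 j0]/((ltau (T j) x y y').1 * phi c0 i0 j0).
  by rewrite mulfK//; apply/eqP.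
apply: factorable_add.
  apply: (factorable_eq (Th := fun x => \sum_(i : 'I_N * 'I_M) \sum_y \sum_y' bt i.1 i.2 y y' (se1 M e i.2.+1 (ltau (T i.1) x y y')))).
    by move=> x; rewrite -(Th_bt (fun k => se1 M e k.+1)).
  apply: factorable_sum => i; apply: factorable_sum => y; apply: factorable_sum => y'.
  apply: bt_factorable; apply: (@al_conj (se1 M e i.2.+1) (fun H u => Bev u (xk R M i.2.+1))) => [H u hu|b H u f hu].
    exact: Bev_rep.
  exact: se1_rep.
apply: factorable_opp.
apply: (factorable_eq (Th := fun x => \sum_(i : 'I_N * 'I_M) \sum_y \sum_y' bt i.1 i.2 y y' (se2 e (ltau (T i.1) x y y')))).
  by move=> x; rewrite -(Th_bt (fun k => se2 e)).
apply: factorable_sum => i; apply: factorable_sum => y; apply: factorable_sum => y'.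
apply: bt_factorable; apply: (@al_conj (se2 e) (fun H u => @Bchar R C H)) => [H u hu|b H u f hu].
  exact: Bchar_rep.
exact: se2_rep.
Qed.

End Unit.

End Factorization.

Section Estimates.
Variables (R : realType) (C : cstarAlg R).

Lemma mxleZ (J : finType) (w : R) (a : MB C J) (L : R) : 0 <= w -> 0 <= L -> inMB a ->
  (w != 0 -> mxle a L) -> mxle (w%:C *: a) (w * L).
Proof.
move=> w0 L0 aB h; have [->|wn] := eqVneq w 0; first by rewrite scale0r mul0r; exact: mxle0.
have zB : inMB (0 : MB C J) by move=> i j; exact: B0.
have := mxle_lin w%:C aB zB (h wn) (@mxle0 R C J).
by rewrite !addr0 cmodR ger0_norm.
Qed.

Lemma mxle_wsum (J : finType) (I : Type) (r : seq I) (w : I -> R) (a : I -> MB C J) (L : R) :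
  0 <= L -> (forall i, 0 <= w i) -> (forall i, inMB (a i)) -> (forall i, w i != 0 -> mxle (a i) L) ->
  mxle (\sum_(i <- r) (w i)%:C *: a i) ((\sum_(i <- r) w i) * L).
Proof.
move=> L0 w0 aB h.
have sB : forall r, inMB (\sum_(i <- r) (w i)%:C *: a i).
  elim=> [|i r' IH]; first by rewrite big_nil => i j; exact: B0.
  by rewrite big_cons; apply: inMB_lin.
elim: r => [|i r IH]; first by rewrite !big_nil mul0r; exact: mxle0.
rewrite !big_cons mulrDl -[(w i)%:C *: _]scale1r.
have wB : inMB ((w i)%:C *: a i) by move=> x y; exact: (B_Z (w i)%:C (aB i x y)).
have := mxle_lin 1 wB (sB r) (mxleZ (w0 i) L0 (aB i) (h i)) IH.
by rewrite cmod1 mul1r.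
Qed.

Lemma repn_sum (A : cstarAlg R) (I : Type) (r : seq I) (a : I -> A) (K : I -> R) :
  (forall i, repn (a i) (K i)) -> repn (\sum_(i <- r) a i) (\sum_(i <- r) K i).
Proof.
move=> h H u f hu; rewrite (rep_sum hu)// mulr_suml.
elim: r => [|i r IH]; first by rewrite !big_nil nrm0.
by rewrite !big_cons; apply: le_trans (nrmD _ _) _; apply: lerD => //; exact: h.
Qed.

Lemma entry_ucont (bs : seq (Bamb C)) (d : R) : 0 < d -> (forall b, b \in bs -> B b) ->
  exists2 M : nat, (0 < M)%N & forall b, b \in bs -> forall x x' : I01 R,
    `|sval x - sval x'| <= M%:R^-1 -> nrm (b.2 x - b.2 x') <= d.
Proof.
move=> d0; elim: bs => [|b bs IH] hB; first by exists 1%N.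
have [|M M0 hM] := IH; first by move=> b' hb'; apply: hB; rewrite in_cons hb' orbT.
have bB : B b by apply: hB; rewrite mem_head.
have [N hN] : exists N : nat, forall s t : I01 R, `|sval t - sval s| <= N.+1%:R^-1 -> nrm (b.2 s - b.2 t) <= d.
  apply: (@unif_cont R (fun s t a => nrm (b.2 s - b.2 t) <= a) d) => //.
  - by move=> s t a; rewrite nrmB.
  - by move=> s t u a c h1 h2; apply: le_trans (nrm_triangle _ (b.2 t) _) _; exact: lerD.
  - move=> s a a0; have /BP[/(_ s a a0)[r r0 hr] _] := bB; exists r => // t /hr /ltW h.
    by first [exact: h|rewrite nrmB; exact: h].
exists (maxn M N.+1) => [|b' hb' x x' hx]; first by rewrite leq_max M0.
have le k : (0 < k)%N -> (k <= maxn M N.+1)%N -> `|sval x - sval x'| <= k%:R^-1.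
  move=> k0 hk; apply: le_trans hx _; rewrite lef_pV2 ?posrE ?ltr0n ?ler_nat//.
  exact: leq_trans hk.
move: hb'; rewrite in_cons => /orP[/eqP ->|hb'].
  by apply: hN; rewrite distrC; apply: le => //; exact: leq_maxr.
by apply: hM => //; apply: le => //; exact: leq_maxl.
Qed.

Lemma block_ucont (P Q : finType) (fs : seq (FB C (P * Q)%type)) (d : R) : 0 < d ->
  (forall f, f \in fs -> Eblock f) ->
  exists2 N : nat, (0 < N)%N & forall f, f \in fs -> forall s t : I01 R,
    `|sval s - sval t| <= N%:R^-1 -> mxle (f s - f t) d.
Proof.
move=> d0; elim: fs => [|b fs IH] hB; first by exists 1%N.
have [|M M0 hM] := IH; first by move=> b' hb'; apply: hB; rewrite in_cons hb' orbT.
have bB : Eblock b by apply: hB; rewrite mem_head.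
have [N hN] := E_ucont bB d0.
exists (maxn M N.+1) => [|b' hb' x x' hx]; first by rewrite leq_max M0.
have le k : (0 < k)%N -> (k <= maxn M N.+1)%N -> `|sval x - sval x'| <= k%:R^-1.
  move=> k0 hk; apply: le_trans hx _; rewrite lef_pV2 ?posrE ?ltr0n ?ler_nat//.
  exact: leq_trans hk.
move: hb'; rewrite in_cons => /orP[/eqP ->|hb'].
  by apply: hN; rewrite distrC; apply: le => //; exact: leq_maxr.
by apply: hM => //; apply: le => //; exact: leq_maxl.
Qed.

End Estimates.

(** * Interpolation in t and in the cone variable *)

Section Interpolation.
Variables (R : realType) (C : cstarAlg R) (S : AzC_data C).
Variables (A : cstarAlg R) (mu : forall m, az_amb S m -> A).
Hypothesis adm : AzC_admissible S.
Hypothesis lim : is_limit mu.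
Variables (m N M : nat).
Hypothesis N0 : (0 < N)%N.
Hypothesis M0 : (0 < M)%N.
Notation J := (az_idx S m).
Notation bs := (@base R C S adm m N).
Notation br := (@brr R C S adm m N).
Notation sj j := (@clip R (j%:R / N%:R)).
Variable f : az_amb S m.
Hypothesis fA : az_A f.
Variables (d1 d2 : R).
Hypothesis d10 : 0 <= d1.
Hypothesis d20 : 0 <= d2.
Hypothesis f_t : forall s t : I01 R, `|sval s - sval t| <= N%:R^-1 -> mxle (f s - f t) d1.
Hypothesis f_x : forall (j : 'I_N) y y' (x x' : I01 R), `|sval x - sval x'| <= M%:R^-1 ->
  nrm ((f (sj j) y y').2 x - (f (sj j) y y').2 x') <= d2.

Lemma sj0 : sj 0%N = clip 0. Proof. by rewrite mul0r. Qed.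

Lemma sjN : sj N = clip 1. Proof. by rewrite divff// pnatr_eq0 -lt0n. Qed.

Lemma fB s : inMB (f s). Proof. exact: (E_B s fA). Qed.

(** At the two ends the boundary conditions of f say exactly that spreading leaves f unchanged; at
    interior grid points [chi] is the identity. *)
Lemma chi_fix j : chi (bs j) (br j) (f (sj j)) = f (sj j).
Proof.
have /EblockP[_ _ /left_tensorP[b bB f0] /right_scalarP[c f1]] := fA.
apply/funext => x; apply/funext => y; rewrite /chi /base /brr.
have [->|j0] := eqVneq j 0%N.
  by rewrite sj0 f0 /ampl xpair_eqE eqxx /=; case: ifP => // ->.
have [->|jN] := eqVneq j N; last by rewrite eqxx.
by rewrite sjN f1 /ampr xpair_eqE eqxx andbT /=; case: ifP => // ->.
Qed.

Definition gk (k : nat) (b : Bamb C) : C := b.2 (xk R M k.+1).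
Definition gcone (k : nat) (b : Bamb C) : Bamb C := cone (hat M k.+1) (gk k b).

(** What the total map would give at grid point j if e were a unit of C: the scalar part plus the
    interpolated cone part. *)
Definition interp (j : nat) : MB C J := sent (@si3 R C) (f (sj j)) +
  (if (j < N)%N then \sum_(k < M) sent (gcone k) (f (sj j)) else 0).

Lemma gcone_B k (a : MB C J) : inMB (sent (gcone k) a).
Proof. by move=> x y; apply: cut_B; exact: cut_hat0. Qed.

Lemma si3_B (a : MB C J) : inMB (sent (@si3 R C) a).
Proof. by move=> x y; exact: Bscal_B. Qed.

Lemma inMB_sum I (r : seq I) (F : I -> MB C J) : (forall i, inMB (F i)) -> inMB (\sum_(i <- r) F i).
Proof.
move=> h; elim: r => [|i r IH]; first by rewrite big_nil => x y; exact: B0.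
by rewrite big_cons -[F i]scale1r; exact: inMB_lin.
Qed.

Lemma interp_B j : inMB (interp j).
Proof.
rewrite /interp -[sent _ _]scale1r; apply: inMB_lin; first exact: si3_B.
case: ifP => _; last by move=> x y; exact: B0.
by apply: inMB_sum => k; exact: gcone_B.
Qed.

Lemma interp_err j (y y' : J) (H : hilbert R) (v : Bamb C -> H -> H) g : (j <= N)%N ->
  star_rep_on (@B R C) v -> nrm (v ((interp j - f (sj j)) y y') g) <= 2 * d2 * nrm g.
Proof.
move=> jN hv; rewrite -[(interp j - f (sj j)) y y']/(interp j y y' - f (sj j) y y').
rewrite -[interp j y y']/(Bscal C (f (sj j) y y').1 + (if (j < N)%N then \sum_(k < M) sent (gcone k) (f (sj j)) else 0) y y').
case: ltnP => [jN'|jN']; last first.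
  have -> : j = N by apply/eqP; rewrite eqn_leq jN jN'.
  have /EblockP[_ _ _ /right_scalarP[c f1]] := fA.
  rewrite sjN f1 -[(0 : MB C J) y y']/(0 : Bamb C) addr0 /ampr.
  set z := _ - _; have -> : z = 0.
    rewrite /z; case: ifP => _; first by rewrite subrr.
    by rewrite subr0; exact: Bext.
  by rewrite (rep0 hv) ?nrm0 ?mulr_ge0 ?nrm_ge0//; exact: B0.
set b := f (sj j) y y'.
have bB : B b by exact: fB.
have /BP[_ b0] := bB.
set z := _ - _.
(* The scalar parts cancel. The hat at k = 0 may be added because b vanishes at x = 0, and then the
   error is a convex combination of differences between nearby points. *)
have zE : z = (0, fun x => \sum_(k < M.+1) (hat M k x)%:C *: (b.2 (xk R M k) - b.2 x)).
  have hs : (\sum_(k < M) sent (gcone k) (f (sj j))) y y' = \sum_(k < M) gcone k b.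
    by rewrite !fct_sumE.
  apply: Bext => [|x]; rewrite /z.
    rewrite -[LHS]/(b.1 + ((\sum_(k < M) sent (gcone k) (f (sj j))) y y').1 - b.1) hs.
    have -> : (\sum_(k < M) gcone k b).1 = 0.
      by elim: (index_enum _) => [|k r IH]; [rewrite big_nil|rewrite big_cons B1D IH addr0].
    by rewrite addr0 subrr.
  rewrite -[LHS]/(0 + ((\sum_(k < M) sent (gcone k) (f (sj j))) y y').2 x - b.2 x) hs add0r.
  have -> : (\sum_(k < M) gcone k b).2 x = \sum_(k < M) (hat M k.+1 x)%:C *: b.2 (xk R M k.+1).
    elim: (index_enum _) => [|k r IH]; first by rewrite !big_nil.
    by rewrite !big_cons B2D IH.
  transitivity (\sum_(k < M.+1) (hat M k x)%:C *: b.2 (xk R M k) - \sum_(k < M.+1) (hat M k x)%:C *: b.2 x).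
    rewrite -scaler_suml -(raddf_sum (real_complex R)) hat_sum scale1r big_ord_recl /=.
    by rewrite /xk mul0r b0 scaler0 add0r.
  by rewrite -sumrB; apply: eq_bigr => k _; rewrite scalerBr.
have zB : B z.
  apply: B_sub => //; apply: B_D; first exact: Bscal_B.
  have := @inMB_sum _ (index_enum 'I_M) (fun k : 'I_M => sent (gcone k) (f (sj j))) (fun k => gcone_B _ _).
  exact.
rewrite zE; rewrite zE in zB; apply: B_cone_bd => // x.
apply: le_trans (nrm_sum _ _) _.
have -> : d2 = \sum_(k < M.+1) hat M k x * d2 by rewrite -mulr_suml hat_sum mul1r.
apply: ler_sum => k _; have /andP[h0 h1] := hat_bd M k x.
rewrite nrmZ cmodR ger0_norm//; have [->|hn] := eqVneq (hat M k x) 0; first by rewrite !mul0r.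
apply: ler_wpM2l => //; apply: (@f_x (Ordinal jN') y y').
by rewrite distrC; apply: hat_near => //; have := ltn_ord k.
Qed.

Definition interp_f : az_amb S m := \sum_(j : 'I_N.+1) elt (hat N j) (chi (bs j) (br j) (interp j)).

(** A convex combination over grid points near t. By [chi_fix] each term is [chi] of the cone error,
    bounded entry by entry and hence the double sum, plus the variation [d1] of f. *)
Lemma interp_le t : mxle (interp_f t - f t) (\sum_(y : J) \sum_(y' : J) 2 * d2 + d1).
Proof.
have dd0 : 0 <= 2 * d2 by rewrite mulr_ge0.
have s0 : 0 <= \sum_(y : J) \sum_(y' : J) 2 * d2 by apply: sumr_ge0 => y _; exact: sumr_ge0.
have -> : interp_f t - f t = \sum_(j : 'I_N.+1) (hat N j t)%:C *: (chi (bs j) (br j) (interp j) - f t).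
  transitivity (\sum_(j : 'I_N.+1) (hat N j t)%:C *: chi (bs j) (br j) (interp j)
     - \sum_(j : 'I_N.+1) (hat N j t)%:C *: f t).
    by rewrite -scaler_suml -(raddf_sum (real_complex R)) hat_sum scale1r /interp_f fct_sumE.
  by rewrite -sumrB; apply: eq_bigr => j _; rewrite scalerBr.
set L := _ + d1; suff : mxle (\sum_(j : 'I_N.+1) (hat N j t)%:C *: (chi (bs j) (br j) (interp j) - f t))
    ((\sum_(j : 'I_N.+1) hat N j t) * L) by rewrite hat_sum mul1r.
have sB (j : 'I_N.+1) : inMB (chi (bs j) (br j) (interp j) - f t).
  by move=> x y; apply: B_sub; [apply: chi_B; exact: interp_B|exact: fB].
apply: mxle_wsum => //; first by rewrite addr_ge0.
  by move=> j; have /andP[] := hat_bd N j t.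
move=> j hn; have jN : (j <= N)%N by have := ltn_ord j.
have -> : chi (bs j) (br j) (interp j) - f t = 1 *: chi (bs j) (br j) (interp j - f (sj j)) + (f (sj j) - f t).
  have := chi_lin (bs j) (br j) (-1) (f (sj j)) (interp j).
  rewrite !scaleN1r chi_fix (addrC (- f (sj j)) (interp j)) (addrC (- f (sj j))) => ->.
  by rewrite scale1r addrA subrK.
have eB : inMB (chi (bs j) (br j) (interp j - f (sj j))).
  by apply: chi_B => x y; apply: B_sub; [exact: interp_B|exact: fB].
have fB' : inMB (f (sj j) - f t) by move=> x y; apply: B_sub; exact: fB.
have h1 : mxle (chi (bs j) (br j) (interp j - f (sj j))) (\sum_(y : J) \sum_(y' : J) 2 * d2).
  by apply: mxle_chi_entries => // y y' H v g hv; exact: interp_err.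
have h2 : mxle (f (sj j) - f t) d1.
  by apply: f_t; rewrite distrC; exact: hat_near.
by have := mxle_lin 1 eB fB' h1 h2; rewrite cmod1 mul1r.
Qed.

End Interpolation.

(** * Choice of the parameters *)

Section Final.
Variables (R : realType) (C : cstarAlg R) (S : AzC_data C).
Variables (A : cstarAlg R) (mu : forall m, az_amb S m -> A).
Hypothesis adm : AzC_admissible S.
Hypothesis lim : is_limit mu.

Section OneElement.
Variables (m N M : nat).
Hypothesis N0 : (0 < N)%N.
Hypothesis M0 : (0 < M)%N.
Notation J := (az_idx S m).
Notation bs := (@base R C S adm m N).
Notation br := (@brr R C S adm m N).
Notation sj j := (@clip R (j%:R / N%:R)).
Variable f : az_amb S m.
Hypothesis fA : az_A f.
Variable T : forall j : nat, tower S m (sj j).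
Notation itp := (interp N M f).

Definition lift0 : lifts S m := existT (fun n => {g : az_amb S (n + m) | az_A g}) 0%N (exist _ f fA).

Lemma ltau_lift0 j : ltau (T j) lift0 = f (sj j).
Proof. exact: tau0. Qed.

Lemma interp_part_A (j : 'I_N.+1) : @az_A R C S m (elt (hat N j) (chi (bs j) (br j) (itp j))).
Proof.
apply: patch_elt => //; [exact: ltn_ord j|exact: ends_hat|exact: interp_B|].
move=> jN x y; rewrite /interp jN ltnn -[(_ + 0) x y]/(Bscal C (f (sj N) x y).1 + 0).
by rewrite addr0.
Qed.

Lemma interp_A : az_A (interp_f adm N M f).
Proof. exact: (@E_sum R C _ _ _ _ (fun j : 'I_N.+1 => elt (hat N j) (chi (bs j) (br j) (itp j)))) interp_part_A. Qed.

Lemma mu_interp : mu (interp_f adm N M f) = Th3 mu adm T lift0 + Th mu adm T (fun k : 'I_M => @gcone R C M k) lift0.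
Proof.
rewrite /interp_f (mu_sum lim); last exact: interp_part_A.
have e (j : 'I_N.+1) : @mu m (elt (hat N j) (chi (bs j) (br j) (itp j))) =
   pmap mu (bs j) (br j) (hat N j) (@si3 R C) (f (sj j)) +
   (if (j < N)%N then \sum_(k < M) pmap mu (bs j) (br j) (hat N j) (@gcone R C M k) (f (sj j)) else 0).
  have a3 : @az_A R C S m (elt (hat N j) (chi (bs j) (br j) (sent (@si3 R C) (f (sj j))))).
    apply: patch_elt => //; [exact: ltn_ord j|exact: ends_hat|exact: si3_B].
  rewrite /pmap /interp -{1}[sent (@si3 R C) _]scale1r chi_lin elt_lin scale1r.
  case: ltnP => jN; last first.
    have -> : elt (hat N j) (chi (bs j) (br j) (0 : MB C J)) = 0.
      apply/funext => t; apply/funext => x; apply/funext => y.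
      rewrite -[LHS]/((hat N j t)%:C *: chi (bs j) (br j) (0 : MB C J) x y) /chi.
      by case: ifP => _; rewrite ?scaler0// -[(0 : MB C J) _ _]/(0 : Bamb C) scaler0.
    by rewrite !addr0.
  have ak (k : 'I_M) : @az_A R C S m (elt (hat N j) (chi (bs j) (br j) (sent (@gcone R C M k) (f (sj j))))).
    apply: patch_elt => //; [exact: ltn_ord j|exact: ends_hat|exact: gcone_B|].
    by move=> h; rewrite h ltnn in jN.
  rewrite chi_sum elt_sum (mu_D lim a3); last exact: (E_sum _ ak).
  by rewrite (mu_sum lim).
rewrite (eq_bigr _ (fun j _ => e j)) big_split; congr (_ + _).
  by apply: eq_bigr => j _; rewrite ltau_lift0.
rewrite big_ord_recr /= ltnn addr0 /Th.
rewrite -(pair_bigA _ (fun (j : 'I_N) (k : 'I_M) => pmap mu (bs j) (br j) (hat N j) (@gcone R C M k) (ltau (T j) lift0))).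
by apply: eq_bigr => j _; rewrite ltn_ord ltau_lift0.
Qed.

Variables (e : C) (eta d1 d2 : R).
Hypothesis eta0 : 0 <= eta.
Hypothesis d10 : 0 <= d1.
Hypothesis d20 : 0 <= d2.
Hypothesis f_t : forall s t : I01 R, `|sval s - sval t| <= N%:R^-1 -> mxle (f s - f t) d1.
Hypothesis f_x : forall (j : 'I_N) y y' (x x' : I01 R), `|sval x - sval x'| <= M%:R^-1 ->
  nrm ((f (sj j) y y').2 x - (f (sj j) y y').2 x') <= d2.
Hypothesis f_e : forall (j : 'I_N) (k : 'I_M) y y',
  let c := (f (sj j) y y').2 (xk R M k.+1) in repn (c - cs_mul (cs_mul e c) e) eta.

Definition ksum : R := \sum_(i : 'I_N * 'I_M) \sum_(y : J) \sum_(y' : J) 2 * nrm (th mu adm N i.1 y y').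

(** Replacing h(x_k) by e h(x_k) e costs eta per entry, amplified by the bounds of [bt] collected in
    [ksum]. The interpolation error is a norm estimate in A, doubled by [rep_cs_bd]. *)
Lemma Tht_close : repn (Tht mu adm M e T lift0 - lmu mu lift0)
  (ksum * eta + 2 * (\sum_(y : J) \sum_(y' : J) 2 * d2 + d1)).
Proof.
pose L := \sum_(y : J) \sum_(y' : J) 2 * d2 + d1.
have L0 : 0 <= L by rewrite addr_ge0//; apply: sumr_ge0 => y _; apply: sumr_ge0 => y' _; rewrite mulr_ge0.
have h1 : nrm (mu (interp_f adm N M f) - mu f) <= L.
  rewrite -(mu_B lim interp_A fA); apply: (mu_le adm lim) => //; first exact: (E_sub interp_A fA).
  by move=> t; exact: interp_le.
have e1 : Tht mu adm M e T lift0 - mu (interp_f adm N M f) =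
   \sum_(i : 'I_N * 'I_M) \sum_y \sum_y' bt mu adm N M i.1 i.2 y y'
     (se1 M e i.2.+1 (f (sj i.1) y y') - se2 e (f (sj i.1) y y') - gk M i.2 (f (sj i.1) y y')).
  rewrite mu_interp /Tht opprD addrACA subrr add0r.
  have := Th_bt adm lim N0 T (fun k : 'I_M => se1 M e k.+1) lift0.
  have := Th_bt adm lim N0 T (fun k : 'I_M => se2 e) lift0.
  have := Th_bt adm lim N0 T (fun k : 'I_M => gk M k) lift0.
  rewrite -[Th mu adm T (fun k : 'I_M => [eta si1 M e k]) lift0]/(Th mu adm T (fun (k : 'I_M) b => cone (hat M k.+1) (se1 M e k.+1 b)) lift0).
  rewrite -[Th mu adm T (fun k : 'I_M => [eta si2 M e k]) lift0]/(Th mu adm T (fun (k : 'I_M) b => cone (hat M k.+1) (se2 e b)) lift0).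
  rewrite -[Th mu adm T (fun k : 'I_M => [eta gcone M k]) lift0]/(Th mu adm T (fun (k : 'I_M) b => cone (hat M k.+1) (gk M k b)) lift0).
  move=> -> -> ->; rewrite -!sumrB; apply: eq_bigr => i _; rewrite -!sumrB; apply: eq_bigr => y _.
  by rewrite -!sumrB; apply: eq_bigr => y' _; rewrite !ltau_lift0 !(bt_sub adm lim).
move=> H u g hu.
have -> : Tht mu adm M e T lift0 - lmu mu lift0 =
  (Tht mu adm M e T lift0 - mu (interp_f adm N M f)) + (mu (interp_f adm N M f) - mu f).
  by rewrite addrA subrK.
rewrite (repD hu)// mulrDl; apply: le_trans (nrmD _ _) _; apply: lerD; last first.
  apply: le_trans (rep_cs_bd hu _ _) _; apply: ler_wpM2r; first exact: nrm_ge0.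
  by apply: ler_wpM2l.
rewrite e1 /ksum mulr_suml.
have key (i : 'I_N * 'I_M) y y' : repn (bt mu adm N M i.1 i.2 y y'
     (se1 M e i.2.+1 (f (sj i.1) y y') - se2 e (f (sj i.1) y y') - gk M i.2 (f (sj i.1) y y')))
     (2 * nrm (th mu adm N i.1 y y') * eta).
  move=> H' w g' hw; set c' := _ - _ - _.
  have hb := bt_dilates adm lim M N0 i.1 i.2 y y' hw.
  have hc : repn (id c') eta.
    move=> H'' w' g'' hw'.
    have := f_e i.1 i.2 y y' g'' hw'; rewrite /=; set c := (f _ y y').2 _.
    have -> : c' = - (c - cs_mul (cs_mul e c) e).
      by rewrite /c' /se1 /se2 /gk -/c opprB [_ *: _ + _]addrC addrK.
    by rewrite -[- (c - _)]scaleN1r (repZ hw')// scaleN1r nrmN.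
  have := dilates_nrm (g := c') g' hb eta0 hc.
  exact.
have key2 (i : 'I_N * 'I_M) : repn (\sum_y \sum_y' bt mu adm N M i.1 i.2 y y'
     (se1 M e i.2.+1 (f (sj i.1) y y') - se2 e (f (sj i.1) y y') - gk M i.2 (f (sj i.1) y y')))
     ((\sum_(y : J) \sum_(y' : J) 2 * nrm (th mu adm N i.1 y y')) * eta).
  rewrite mulr_suml; apply: repn_sum => y; rewrite mulr_suml; apply: repn_sum => y'.
  exact: key.
have hsum := repn_sum (index_enum _) key2.
exact: hsum.
Qed.

End OneElement.

Lemma approximation (c0 : C) (n : nat) (phi : C -> mx_starAlg 'I_n (scalars R)) (i0 j0 : 'I_n) :
  star_hom (S := C) phi -> (phi c0 i0 j0 : R[i]) <> 0 ->
  forall (F : seq A) (e : R), 0 < e ->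
  exists (X : Type) (p : X -> A) (I : Type) (r : seq I) (al : I -> X -> C) (be : I -> C -> A),
  [/\ forall a (e : R), 0 < e -> exists x, nrm (a - p x) < e,
      forall i, exists2 k : R, 0 <= k & tbounded p (al i) k,
      forall i, exists2 k : R, 0 <= k & tbounded id (be i) k,
      tbounded p (fun x => \sum_(i <- r) be i (al i x)) 9 &
      forall a, a \in F -> exists2 x, nrm (a - p x) < e &
         repn (\sum_(i <- r) be i (al i x) - p x) e].
Proof.
move=> hphi phi0 F e e0.
have [n0 hn0] := dense_lift adm lim 0 F e0.
pose m := (n0 + 0)%N.
have hG a : exists g : az_amb S m, az_A g /\ (a \in F -> nrm (a - mu g) < e).
  have [/hn0[g [gF hg]]|aF] := boolP (a \in F); last by exists 0; split => //; exact: E0.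
  by exists g; split=> //; exact: FsetA.
have [G GP] := choice hG.
have GA a : az_A (G a) by have [] := GP a.
pose fs := [seq G a | a <- F].
have fsA f : f \in fs -> az_A f by move=> /mapP[a _ ->].
pose J := az_idx S m.
pose jj : R := \sum_(y : J) \sum_(y' : J) 2.
have jj0 : 0 <= jj by apply: sumr_ge0 => y _; exact: sumr_ge0.
(* The total error is at most ks eta + 2 (jj d2 + d1) <= e/2 + 2 (e/8 + e/8) = e. *)
pose d1 := e / 8; have d10 : 0 < d1 by rewrite divr_gt0.
have jj1 : 0 < jj + 1 by rewrite ltr_wpDl.
pose d2 := e / 8 / (jj + 1); have d20 : 0 < d2 by rewrite !divr_gt0.
have [N N0 hN] := block_ucont d10 fsA.
pose sj (j : nat) : I01 R := clip (j%:R / N%:R).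
pose bs : seq (Bamb C) := [seq f (sj i.1.1) i.1.2 i.2 | f : az_amb S m <- fs, i : 'I_N * J * J <- enum {: 'I_N * J * J}].
have bsB b : b \in bs -> B b by move=> /allpairsP[[f i] [/= /fsA fA _ ->]]; exact: (E_B _ fA).
have [M M0 hM] := entry_ucont d20 bsB.
have [T _] : exists T : forall j : nat, tower S m (sj j), True.
  by exists (fun j => sval (cid (tower_ex adm m (sj j)))).
(* It depends on the mesh but not on the approximate unit, so [eta] can be chosen relative to it. *)
pose ks := ksum m N M; have ks0 : 0 <= ks.
  apply: sumr_ge0 => i _; apply: sumr_ge0 => y _; apply: sumr_ge0 => y' _.
  by rewrite mulr_ge0// nrm_ge0.
have ks1 : 0 < ks + 1 by rewrite ltr_wpDl.
have eta0 : 0 < e / 2 / (ks + 1) by rewrite !divr_gt0.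
set eta := e / 2 / (ks + 1) in eta0.
pose cs : seq C := [seq b.2 (xk R M k.+1) | b : Bamb C <- bs, k : 'I_M <- enum 'I_M].
have [u [u_sa u_bd hu]] := approx_unit cs eta0.
have [I [r [al [be [h1 h2 h3]]]]] := Tht_factorable adm lim M N0 u_sa u_bd T hphi phi0.
exists (lifts S m), (lmu mu (m := m)), I, r, al, be; split=> //.
- move=> a d d0; have [k [g [gF hg]]] := dense_lift1 adm lim m a d0.
  by exists (existT _ k (exist _ g (FsetA adm gF))).
- have -> : (fun x => \sum_(i <- r) be i (al i x)) = Tht mu adm M u T by apply/funext => x; rewrite h3.
  exact: Tht_bd.
move=> a aF; exists (lift0 (GA a)); first by have [_ /(_ aF)] := GP a.
rewrite -h3; have fF : G a \in fs by exact: map_f.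
have bF (j : 'I_N) y y' : G a (sj j) y y' \in bs.
  by apply/allpairsP; exists (G a, (j, y, y')); rewrite fF mem_enum.
have := @Tht_close m N M N0 M0 (G a) (GA a) T u eta d1 d2 (ltW eta0) (ltW d10) (ltW d20).
move=> /(_ (hN _ fF) (fun j y y' => hM _ (bF j y y'))) h.
move=> H w g hw; apply: le_trans (h _ H w g hw) _.
  move=> j k y y' /=; apply: hu; apply/allpairsP.
  by exists (G a (sj j) y y', k); rewrite bF mem_enum.
apply: ler_wpM2r; first exact: nrm_ge0.
have e1 : ks * eta <= e / 2 by apply: mul_div1_le => //; rewrite divr_ge0// ltW.
have e2 : jj * d2 <= e / 8 by apply: mul_div1_le => //; rewrite divr_ge0// ltW.
have -> : \sum_(y : J) \sum_(y' : J) 2 * d2 = jj * d2.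
  by rewrite /jj mulr_suml; apply: eq_bigr => y _; rewrite mulr_suml.
rewrite -/ks; move: e1 e2; rewrite /d1; move: (ks * eta) (jj * d2) => p q e1 e2.
by lra.
Qed.

End Final.

Theorem proposition7p4 (R : realType) (C : cstarAlg R) (S : AzC_data C)
    (A : cstarAlg R) (mu : forall m : nat, az_amb S m -> A) :
  cs_separable C -> cs_residually_fd C -> AzC_admissible S -> is_limit mu ->
  cs_exact C -> ~ cs_nuclear C -> cs_exact A /\ ~ cs_nuclear A.
Proof.
move=> _ rfd adm lim exC nucC; split; last by move=> /(nuclear_quotient adm lim).
(* If C were zero, every tensor would act as zero and C would be nuclear. *)
have [c0 c0n] : exists c0 : C, c0 <> 0.
  apply: contrapT => h; apply: nucC => D; apply: nuclear_le => x M M0 _ H v f hv.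
  rewrite big1 ?nrm0 ?mulr_ge0 ?nrm_ge0// => a _.
  have -> : a.1 = 0 by apply: contrapT => a0; apply: h; exists a.1.
  have := tr_lin1 hv (-1) 0 0 a.2 f; rewrite scaler0 addr0 scaleN1r => e.
  by rewrite e addNr.
have [n [phi [hphi phi0]]] := rfd c0 c0n.
have [i [j hij]] : exists i j, (phi c0 i j : R[i]) <> 0.
  apply: contrapT => h; apply: phi0; apply/funext => i; apply/funext => j.
  by apply: contrapT => hn; apply: h; exists i, j.
exact: (exact_criterion (ler0n R 9) (approximation adm lim hphi hij) exC).
Qed.
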